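(* For each $x,y\in\mathbb R^N$ there exists a unique compactly supported radial (i.e. $O(N)$-invariant) probability measure $\rho_{x,y}^k$ on $\mathbb R^N$ such that \[f(x*_ky)=\int_{\mathbb R^N}f\,d\rho_{x,y}^k\quad\text{for all radial } f\in C^\infty(\mathbb R^N).\] Its support is contained in $\{\xi\in\mathbb R^N:\min_{g\in G}|x+gy|\le|\xi|\le\max_{g\in G}|x+gy|\}$. In particular, if $0\in\operatorname{supp}\rho_{x,y}^k$, then the $G$-orbits of $x$ and $-y$ coincide.
   Context: Let $R\subset\mathbb R^N$ be a reduced root system normalized by $\langle\alpha,\alpha\rangle=2$, $G$ the finite reflection group generated by the reflections $\sigma_\alpha$, $R_+$ a positive subsystem, $k:R\to[0,\infty)$ $G$-invariant. Dunkl operators: $T_\xi(k)f(x)=\partial_\xi f(x)+\sum_{\alpha\in R_+}k(\alpha)\langle\alpha,\xi\rangle\frac{f(x)-f(\sigma_\alpha x)}{\langle\alpha,x\rangle}$. The intertwining operator $V_k$ (unique degree-preserving linear isomorphism of polynomials with $T_\xi(k)V_k=V_k\partial_\xi$, $V_k1=1$) is $V_kf(x)=\int f\,d\mu_x^k$ for probability measures $\mu_x^k$ supported in the convex hull of $Gx$, and extends to a topological isomorphism of $C^\infty(\mathbb R^N)$. Generalized translation: $f(x*_ky):=V_k^xV_k^y(V_k^{-1}f)(x+y)$ for $f\in C^\infty(\mathbb R^N)$. *)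

(* Defs.v *)
From HB Require Import structures.
From mathcomp Require Import all_boot all_order all_algebra.
From mathcomp Require Import all_classical all_reals all_analysis.
Set Implicit Arguments. Unset Strict Implicit. Unset Printing Implicit Defensive.
Import Order.TTheory GRing.Theory Num.Theory.
Import numFieldNormedType.Exports.
Local Open Scope classical_set_scope.
Local Open Scope ring_scope.

Section Dunkl.
Variables (R : realType) (N : nat).
Local Notation vec := 'rV[R]_N.

Definition dotv (a b : vec) : R := (a *m b^T) ord0 ord0.
Definition enorm (a : vec) : R := Num.sqrt (dotv a a).

(* reflection sigma_a as a matrix acting on the right: x *m reflmx a = x - <a,x> a
   (valid since <a,a> = 2) *)
Definition reflmx (a : vec) : 'M[R]_N := 1%:M - a^T *m a.

Definition root_system (Rs : seq vec) : Prop :=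
  [/\ uniq Rs, 0 \notin Rs,
      (forall a, a \in Rs -> dotv a a = 2),
      (forall a b, a \in Rs -> b \in Rs -> b *m reflmx a \in Rs) &
      (forall a (c : R), a \in Rs -> c *: a \in Rs -> c = 1 \/ c = -1)].

Definition positive_subsystem (Rs Rp : seq vec) : Prop :=
  exists b : vec, (forall a, a \in Rs -> dotv a b != 0) /\
                  Rp = [seq a <- Rs | 0 < dotv a b].

Inductive refl_group (Rs : seq vec) : 'M[R]_N -> Prop :=
| rg_one : refl_group Rs 1%:M
| rg_mul a g : a \in Rs -> refl_group Rs g -> refl_group Rs (g *m reflmx a).

Definition G_orbit (Rs : seq vec) (x : vec) : set vec :=
  [set x *m g | g in refl_group Rs].

Definition multiplicity (Rs : seq vec) (k : vec -> R) : Prop :=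
  (forall a, a \in Rs -> 0 <= k a) /\
  (forall g a, refl_group Rs g -> a \in Rs -> k (a *m g) = k a).

(* Dunkl operator T_xi(k); the difference quotient is replaced on the
   hyperplane <a,x> = 0 by its continuous extension d_a f(x) *)
Definition dunkl (Rp : seq vec) (k : vec -> R) (xi : vec) (f : vec -> R)
  (x : vec) : R :=
  derive f x xi +
  \sum_(a <- Rp) k a * dotv a xi *
     (if dotv a x == 0 then derive f x a
      else (f x - f (x *m reflmx a)) / dotv a x).

Definition monom (m : {ffun 'I_N -> nat}) (x : vec) : R :=
  \prod_(i < N) x ord0 i ^+ m i.

Definition polyfun (p : vec -> R) : Prop :=
  exists s : seq (R * {ffun 'I_N -> nat}),
    forall x, p x = \sum_(c <- s) c.1 * monom c.2 x.

Definition homog (n : nat) (p : vec -> R) : Prop :=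
  exists s : seq (R * {ffun 'I_N -> nat}),
    all (fun c : R * {ffun 'I_N -> nat} => (\sum_(i < N) c.2 i == n)%N) s /\
    forall x, p x = \sum_(c <- s) c.1 * monom c.2 x.

Definition poly_intertwiner (Rp : seq vec) (k : vec -> R)
  (V : (vec -> R) -> (vec -> R)) : Prop :=
  (forall p q (c : R), polyfun p -> polyfun q ->
          V (fun x => p x + c * q x) = (fun x => V p x + c * V q x)) /\
  (forall p, polyfun p -> polyfun (V p)) /\
  [/\
      (forall n p, homog n p -> homog n (V p)),
      (forall q, polyfun q -> exists2 p, polyfun p & V p = q),
      (forall p, polyfun p -> V p = (fun => 0) -> p = (fun => 0)),
      V (fun => 1) = (fun => 1) &
      (forall xi p, polyfun p -> dunkl Rp k xi (V p) = V (fun x => derive p x xi))].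

Definition RN := g_sigma_algebraType (@open vec).

Definition supp (mu : set RN -> \bar R) : set vec :=
  [set z | forall U : set vec, open U -> U z -> (0 < mu U)%E].

Definition conv_hull (S : set vec) : set vec :=
  [set z | exists s : seq (R * vec),
     [/\ all (fun c => 0 <= c.1) s, \sum_(c <- s) c.1 = 1,
         (forall c, c \in s -> S c.2) & z = \sum_(c <- s) c.1 *: c.2]].

Definition Vop (mu : vec -> probability RN R) (f : vec -> R) (x : vec) : R :=
  fine (\int[mu x]_z (f z)%:E)%E.

Definition rosler_family (Rs : seq vec) (V : (vec -> R) -> (vec -> R))
  (mu : vec -> probability RN R) : Prop :=
  forall x, supp (mu x) `<=` conv_hull (G_orbit Rs x) /\
            (forall p, polyfun p -> Vop mu p x = V p x).

Definition Dseq (s : seq vec) (f : vec -> R) : vec -> R :=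
  foldr (fun v g => fun x => derive g x v) f s.

Definition smooth (f : vec -> R) : Prop :=
  forall (s : seq vec) (x : vec), differentiable (Dseq s f) x.

Definition Vinv (mu : vec -> probability RN R) (f : vec -> R) : vec -> R :=
  xget (fun => 0) [set g | smooth g /\ Vop mu g = f].

Definition gen_transl (mu : vec -> probability RN R) (f : vec -> R)
  (x y : vec) : R :=
  Vop mu (fun xi => Vop mu (fun eta => Vinv mu f (xi + eta)) y) x.

Definition orthogonal_mx (O : 'M[R]_N) : Prop := O *m O^T = 1%:M.

Definition radial_fun (f : vec -> R) : Prop :=
  forall O, orthogonal_mx O -> forall z, f (z *m O) = f z.

Definition radial_measure (rho : set RN -> \bar R) : Prop :=
  forall O, orthogonal_mx O -> forall A : set RN, measurable A ->
    rho ((fun z : vec => z *m O) @^-1` A) = rho A.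

End Dunkl.

(* Main.v *)
Require Import Defs.
From HB Require Import structures.
From mathcomp Require Import all_boot all_order all_algebra.
From mathcomp Require Import all_classical all_reals all_analysis.
From mathcomp Require Import measurable_realfun.
From mathcomp Require Import ring lra zify.
Set Implicit Arguments. Unset Strict Implicit. Unset Printing Implicit Defensive.
Import Order.TTheory GRing.Theory Num.Theory.
Import numFieldNormedType.Exports.
Local Open Scope classical_set_scope.
Local Open Scope ring_scope.

                                                         

(** Everything rests on one formula ([gen_translE]). For a smooth radial f and a unit vector v, f(x
    *_k y) is the integral of f(L(z) v) over z distributed by mu_x, where L(z)^2 = |x|^2 + |y|^2 +
    2<z,y>. Given this, rho is the law of L(z)u, with z distributed by mu_x and u an independent
    uniform point of the unit sphere ([radial_push]). Since mu_x lives on the convex hull of the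
    orbit of x, the linear form <z,y> lies between its extreme values over that orbit, so L(z) lies
    between two lengths |x + y g| ([gt_len_hull]). If 0 is in the support, the smaller length
    vanishes and x = -y g. For uniqueness, rotation invariance expresses the moments of <z,v>^n
    under a radial measure through integrals of radial polynomials. Powers of linear forms determine
    all polynomial integrals ([ridge_determinacy]), and a measure on a ball is determined by those
    ([moment_determinacy]).

    The formula is first proved for V^{-1}|.|^{2n}. Both sides are polynomials D(x,y) with equal
    Dunkl derivatives in x and in y and with equal values at x = 0, and such a D is unique
    ([poly2_dunkl_unique], [dunkl_Ur], [Vtransl_radial]). Passing to smooth f needs the inverse of V
    on smooth radial functions, both its existence and its uniqueness, because [Vinv] selects some
    smooth preimage.

    Existence ([radial_preimage]). Averaging phi(<x,w>) over w in the unit sphere, for the mean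
    attached to k, gives a function [ridge] phi whose image under V is radial with explicit
    coefficients. Inverting that coefficient map is a differential operator followed by a
    contraction ([Dop], [Kop]), so polynomials approximating the profile of f with its derivatives
    yield preimages that are Cauchy in the smooth topology ([smooth_limit]). The bounds require that
    the mean be dominated by the supremum on the sphere. The mean is defined algebraically by
    Pizzetti's series [Pk], and its positivity ([Pk_pos]) comes from the maximum principle for the
    Dunkl Laplacian, applied to a truncated heat flow ([iDk_pos_strict]).

    Uniqueness ([Vop_inj]). If V h = 0, all means of Y V p tend to 0 as polynomials p tend to h, for
    every polynomial Y ([Null]). Integration by parts on spheres transfers this property to partial
    derivatives of h ([null_derive]). The means of V p for k and the classical means of p differ by
    averaging operators that can be inverted ([Kop_mean], [avg_inj]). Hence the classical means
    about 0 of all iterated partial derivatives of h vanish, then those of Y h for all polynomials Y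
    ([Mz_all]), and approximating h itself by Y forces h = 0 ([Mz_zero]).

    The uniform measure on the sphere is built by induction on the dimension in polar coordinates
    and is identified by its moments of linear forms ([sphereS], [is_sphere_mean]). *)

Section PolyFun.
Variables (R : realType) (N : nat).
Local Notation vec := 'rV[R]_N.
Implicit Types (p q : vec -> R) (x v : vec).

(** * Calculus of polynomial functions on R^N *)

Lemma polyfun_ext p q : (forall x, p x = q x) -> polyfun p -> polyfun q.
Proof. by move=> /funext ->. Qed.

Lemma polyfun_cst (c : R) : polyfun (fun _ : vec => c).
Proof.
exists [:: (c, [ffun=> 0%N])] => x.
by rewrite big_seq1 /monom big1 ?mulr1// => i _; rewrite ffunE expr0.
Qed.

Lemma polyfunD p q : polyfun p -> polyfun q -> polyfun (fun x => p x + q x).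
Proof.
by move=> [s ps] [t qt]; exists (s ++ t) => x; rewrite big_cat /= ps qt.
Qed.

Lemma polyfunZ (c : R) p : polyfun p -> polyfun (fun x => c * p x).
Proof.
move=> [s ps]; exists [seq (c * m.1, m.2) | m <- s] => x.
by rewrite ps big_map mulr_sumr; apply: eq_bigr => m _; rewrite mulrA.
Qed.

Lemma monomM (m1 m2 : {ffun 'I_N -> nat}) x :
  monom m1 x * monom m2 x = monom [ffun i => (m1 i + m2 i)%N] x.
Proof.
rewrite /monom -big_split/=; apply: eq_bigr => i _; by rewrite ffunE exprD.
Qed.

Lemma polyfunM p q : polyfun p -> polyfun q -> polyfun (fun x => p x * q x).
Proof.
move=> [s ps] [t qt].
exists [seq ((a : R * {ffun 'I_N -> nat}).1 * (b : R * {ffun 'I_N -> nat}).1, [ffun i => (a.2 i + b.2 i)%N]) | a <- s, b <- t] => x.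
rewrite big_allpairs_dep/= ps qt big_distrl/=; apply: eq_bigr => a _.
rewrite big_distrr/=; apply: eq_bigr => b _.
by rewrite -monomM; ring.
Qed.

Lemma polyfun_coord (i : 'I_N) : polyfun (fun x => x ord0 i).
Proof.
exists [:: (1, [ffun j => (j == i) : nat])] => x.
rewrite big_seq1 mul1r /monom (bigD1 i)//= ffunE eqxx expr1 big1 ?mulr1// => j ji.
by rewrite ffunE (negbTE ji) expr0.
Qed.

Lemma polyfunN p : polyfun p -> polyfun (fun x => - p x).
Proof.
by move=> /(polyfunZ (-1)); apply: polyfun_ext => x; rewrite mulN1r.
Qed.

Lemma polyfunB p q : polyfun p -> polyfun q -> polyfun (fun x => p x - q x).
Proof. by move=> pp qq; apply: polyfunD => //; exact: polyfunN. Qed.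

Lemma polyfun_sum (I : Type) (r : seq I) (P : pred I) (F : I -> vec -> R) :
  (forall i, polyfun (F i)) -> polyfun (fun x => \sum_(i <- r | P i) F i x).
Proof.
move=> H; elim: r => [|a r IH].
  by apply: polyfun_ext (polyfun_cst 0) => x; rewrite big_nil.
case Pa : (P a).
  by apply: polyfun_ext (polyfunD (H a) IH) => x; rewrite big_cons Pa.
by apply: polyfun_ext IH => x; rewrite big_cons Pa.
Qed.

Lemma polyfun_sum_seq (I : eqType) (r : seq I) (F : I -> vec -> R) :
  (forall i, i \in r -> polyfun (F i)) -> polyfun (fun x => \sum_(i <- r) F i x).
Proof.
elim: r => [|a r IH] H.
  by apply: polyfun_ext (polyfun_cst 0) => x; rewrite big_nil.
apply: polyfun_ext (polyfunD (H a _) (IH _)) => [x||i ir]; rewrite ?big_cons//.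
  by rewrite mem_head.
by apply: H; rewrite inE ir orbT.
Qed.

Lemma polyfunX p n : polyfun p -> polyfun (fun x => p x ^+ n).
Proof.
move=> pp; elim: n => [|n IH]; first by apply: polyfun_ext (polyfun_cst 1).
by apply: polyfun_ext (polyfunM pp IH) => x; rewrite exprS.
Qed.

Lemma dotvE (a b : vec) : dotv a b = \sum_i a ord0 i * b ord0 i.
Proof. by rewrite /dotv mxE; apply: eq_bigr => i _; rewrite mxE. Qed.

Lemma dotvC (a b : vec) : dotv a b = dotv b a.
Proof. by rewrite !dotvE; apply: eq_bigr => i _; rewrite mulrC. Qed.

Lemma dotvDl (a b c : vec) : dotv (a + b) c = dotv a c + dotv b c.
Proof.
by rewrite !dotvE -big_split/=; apply: eq_bigr => i _; rewrite mxE mulrDl.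
Qed.

Lemma dotvZl (r : R) (a c : vec) : dotv (r *: a) c = r * dotv a c.
Proof. by rewrite !dotvE mulr_sumr; apply: eq_bigr => i _; rewrite mxE mulrA. Qed.

Lemma dotvDr (a b c : vec) : dotv a (b + c) = dotv a b + dotv a c.
Proof. by rewrite dotvC dotvDl !(dotvC _ a). Qed.

Lemma dotvZr (r : R) (a c : vec) : dotv a (r *: c) = r * dotv a c.
Proof. by rewrite dotvC dotvZl dotvC. Qed.

Lemma dotvNl (a b : vec) : dotv (- a) b = - dotv a b.
Proof. by rewrite -scaleN1r dotvZl mulN1r. Qed.

Lemma dotvNr (a b : vec) : dotv a (- b) = - dotv a b.
Proof. by rewrite dotvC dotvNl dotvC. Qed.

Lemma dotvBl (a b c : vec) : dotv (a - b) c = dotv a c - dotv b c.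
Proof. by rewrite dotvDl dotvNl. Qed.

Lemma dotv0l (b : vec) : dotv 0 b = 0.
Proof. by rewrite -(scale0r (0 : vec)) dotvZl mul0r. Qed.

Lemma dotv0r (b : vec) : dotv b 0 = 0.
Proof. by rewrite dotvC dotv0l. Qed.

Lemma dotv_ge0 (a : vec) : 0 <= dotv a a.
Proof. by rewrite dotvE sumr_ge0// => i _; rewrite -expr2 sqr_ge0. Qed.

Lemma dotv_eq0 (a : vec) : (dotv a a == 0) = (a == 0).
Proof.
apply/eqP/eqP => [|->]; last by rewrite dotv0l.
rewrite dotvE => /eqP; rewrite psumr_eq0 => [/allP H|i _]; last by rewrite -expr2 sqr_ge0.
apply/rowP => i; rewrite mxE; apply/eqP.
by have := H i; rewrite mem_index_enum => /(_ isT); rewrite -expr2 sqrf_eq0.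
Qed.

Lemma dotv_gt0 (a : vec) : a != 0 -> 0 < dotv a a.
Proof. by move=> a0; rewrite lt_neqAle dotv_ge0 eq_sym dotv_eq0 a0. Qed.

Lemma dotv_delta (x : vec) i : dotv x (delta_mx ord0 i) = x ord0 i.
Proof.
rewrite dotvE (bigD1 i)//= mxE !eqxx mulr1 big1 ?addr0// => j ji.
by rewrite mxE (negbTE ji) andbF mulr0.
Qed.

Lemma dotv_mulmx (A : 'M[R]_N) (a b : vec) : dotv (a *m A) b = dotv a (b *m A^T).
Proof. by rewrite /dotv trmx_mul trmxK mulmxA. Qed.

Lemma polyfun_dotv (a : vec) : polyfun (fun x => dotv x a).
Proof.
apply: polyfun_ext (_ : polyfun (fun x => \sum_i a ord0 i * x ord0 i)).
  by move=> x; rewrite dotvE; apply: eq_bigr => i _; rewrite mulrC.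
by apply: polyfun_sum => i; apply: polyfunZ; exact: polyfun_coord.
Qed.

Lemma polyfun_dotvl (a : vec) : polyfun (fun x => dotv a x).
Proof. by apply: polyfun_ext (polyfun_dotv a) => x; rewrite dotvC. Qed.

Lemma polyfun_dotvv : polyfun (fun x => dotv x x).
Proof.
apply: polyfun_ext (_ : polyfun (fun x => \sum_i x ord0 i * x ord0 i)).
  by move=> x; rewrite dotvE.
by apply: polyfun_sum => i; apply: polyfunM; exact: polyfun_coord.
Qed.

(** Structural induction that hides the monomial lists: constants, sums and multiplication by one
    coordinate generate everything. An identity between operators then follows once both sides
    commute with coordinates in the same way. *)
Lemma polyfun_ind (P : (vec -> R) -> Prop) :
  (forall c, P (fun=> c)) ->
  (forall p q, polyfun p -> polyfun q -> P p -> P q -> P (fun x => p x + q x)) ->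
  (forall i p, polyfun p -> P p -> P (fun x => x ord0 i * p x)) ->
  forall p, polyfun p -> P p.
Proof.
move=> Pc PD Pm.
have Q (m : {ffun 'I_N -> nat}) (c : R) : P (fun x => c * monom m x) /\
    polyfun (fun x => c * monom m x).
  rewrite /monom; elim: (index_enum _) => [|i r [IH IH']].
    split; first by have := Pc c; congr P; apply/funext => x; rewrite big_nil mulr1.
    by apply: polyfun_ext (polyfun_cst c) => x; rewrite big_nil mulr1.
  suff [Q1 Q2] : P (fun x => x ord0 i ^+ m i * (c * \prod_(i0 <- r) x ord0 i0 ^+ m i0)) /\
     polyfun (fun x => x ord0 i ^+ m i * (c * \prod_(i0 <- r) x ord0 i0 ^+ m i0)).
    split.
      by move: Q1; congr P; apply/funext => x; rewrite big_cons mulrCA.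
    by apply: polyfun_ext Q2 => x; rewrite big_cons mulrCA.
  elim: (m i) => [|n [IH1 IH2]].
    split; first by move: IH; congr P; apply/funext => x; rewrite expr0 mul1r.
    by apply: polyfun_ext IH' => x; rewrite expr0 mul1r.
  split.
    by have := Pm i _ IH2 IH1; congr P; apply/funext => x; rewrite exprS -mulrA.
  apply: polyfun_ext (polyfunM (polyfun_coord i) IH2) => x.
  by rewrite exprS -mulrA.
move=> p [s ps].
have -> : p = (fun x => \sum_(c <- s) c.1 * monom c.2 x) by apply/funext.
suff [] : P (fun x => \sum_(c <- s) c.1 * monom c.2 x) /\
  polyfun (fun x => \sum_(c <- s) c.1 * monom c.2 x) by [].
elim: s {ps} => [|a s [IH IH']].
  split; first by have := Pc 0; congr P; apply/funext => x; rewrite big_nil.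
  by apply: polyfun_ext (polyfun_cst 0) => x; rewrite big_nil.
have [Q1 Q2] := Q a.2 a.1; split.
  by have := PD _ _ Q2 IH' Q1 IH; congr P; apply/funext => x; rewrite big_cons.
by apply: polyfun_ext (polyfunD Q2 IH') => x; rewrite big_cons.
Qed.

Lemma homog_ext n p q : (forall x, p x = q x) -> homog n p -> homog n q.
Proof. by move=> /funext ->. Qed.

Lemma homog_polyfun n p : homog n p -> polyfun p.
Proof. by move=> [s [_ sE]]; exists s. Qed.

Lemma homog0 n : homog n (fun _ : vec => 0).
Proof. by exists [::]; split => // x; rewrite big_nil. Qed.

Lemma homog_cst (c : R) : homog 0 (fun _ : vec => c).
Proof.
exists [:: (c, [ffun=> 0%N])]; split => [|x] /=.
  by rewrite andbT big1// => i _; rewrite ffunE.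
by rewrite big_seq1 /monom big1 ?mulr1// => i _; rewrite ffunE expr0.
Qed.

Lemma homogD n p q : homog n p -> homog n q -> homog n (fun x => p x + q x).
Proof.
move=> [s [hs ps]] [t [ht qt]]; exists (s ++ t); split => [|x].
  by rewrite all_cat hs ht.
by rewrite big_cat /= ps qt.
Qed.

Lemma homogZ n (c : R) p : homog n p -> homog n (fun x => c * p x).
Proof.
move=> [s [hs ps]]; exists [seq (c * m.1, m.2) | m <- s]; split => [|x].
  by rewrite all_map; apply: sub_all hs => m.
by rewrite ps big_map mulr_sumr; apply: eq_bigr => m _; rewrite mulrA.
Qed.

Lemma homogM n m p q : homog n p -> homog m q -> homog (n + m) (fun x => p x * q x).
Proof.
move=> [s [hs ps]] [t [ht qt]].
exists [seq ((a : R * {ffun 'I_N -> nat}).1 * (b : R * {ffun 'I_N -> nat}).1, [ffun i => (a.2 i + b.2 i)%N]) | a <- s, b <- t]; split => [|x].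
  apply/allP => c /allpairsP[[a b] /= [sa tb ->]] /=.
  rewrite (eq_bigr (fun i => a.2 i + b.2 i)%N); last by move=> i _; rewrite ffunE.
  by rewrite big_split/= (eqP (allP hs _ sa)) (eqP (allP ht _ tb)).
rewrite big_allpairs_dep/= ps qt big_distrl/=; apply: eq_bigr => a _.
rewrite big_distrr/=; apply: eq_bigr => b _.
by rewrite -monomM; ring.
Qed.

Lemma homog_coord (i : 'I_N) : homog 1 (fun x => x ord0 i).
Proof.
exists [:: (1, [ffun j => (j == i) : nat])]; split => [|x] /=.
  rewrite andbT (bigD1 i)//= ffunE eqxx big1 ?addn0// => j ji.
  by rewrite ffunE (negbTE ji).
rewrite big_seq1 mul1r /monom (bigD1 i)//= ffunE eqxx expr1 big1 ?mulr1// => j ji.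
by rewrite ffunE (negbTE ji) expr0.
Qed.

Lemma homog_sum n (I : Type) (r : seq I) (P : pred I) (F : I -> vec -> R) :
  (forall i, homog n (F i)) -> homog n (fun x => \sum_(i <- r | P i) F i x).
Proof.
move=> H; elim: r => [|a r IH].
  by apply: homog_ext (homog0 n) => x; rewrite big_nil.
case Pa : (P a).
  by apply: homog_ext (homogD (H a) IH) => x; rewrite big_cons Pa.
by apply: homog_ext IH => x; rewrite big_cons Pa.
Qed.

Lemma homogX n p m : homog n p -> homog (n * m) (fun x => p x ^+ m).
Proof.
move=> pp; elim: m => [|m IH]; first by rewrite muln0; apply: homog_ext (homog_cst 1).
by rewrite mulnS; apply: homog_ext (homogM pp IH) => x; rewrite exprS.
Qed.

Lemma homog_dotv (a : vec) : homog 1 (fun x => dotv x a).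
Proof.
apply: homog_ext (_ : homog 1 (fun x => \sum_i a ord0 i * x ord0 i)).
  by move=> x; rewrite dotvE; apply: eq_bigr => i _; rewrite mulrC.
by apply: homog_sum => i; apply: homogZ; exact: homog_coord.
Qed.

Lemma homog_dotvv : homog 2 (fun x => dotv x x).
Proof.
apply: homog_ext (_ : homog 2 (fun x => \sum_i x ord0 i * x ord0 i)).
  by move=> x; rewrite dotvE.
apply: homog_sum => i; exact: homogM (homog_coord i) (homog_coord i).
Qed.

Lemma homog_scale n p (c : R) x : homog n p -> p (c *: x) = c ^+ n * p x.
Proof.
move=> [s [/allP hs ps]]; rewrite !ps mulr_sumr big_seq [in RHS]big_seq.
apply: eq_bigr => a /hs/eqP <-.
rewrite /monom mulrCA; congr (_ * _).
rewrite expr_sum -big_split/=; apply: eq_bigr => i _.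
by rewrite mxE exprMn.
Qed.

Lemma homog_at0 n p : homog n.+1 p -> p 0 = 0.
Proof. by move=> /(homog_scale 0 0); rewrite scale0r exprS !mul0r. Qed.

Lemma homog_decomp p : polyfun p ->
  exists d (P : nat -> vec -> R), (forall j, homog j (P j)) /\
    p = (fun x => \sum_(j < d) P j x).
Proof.
move: p; apply: polyfun_ind.
- move=> c; exists 1%N, (fun j => if j is 0 then fun=> c else fun=> 0); split.
    by case=> [|j]; [exact: homog_cst|exact: homog0].
  by apply/funext => x; rewrite big_ord1.
- move=> p q _ _ [d [P [hP ->]]] [e [Q [hQ ->]]].
  exists (d + e)%N, (fun j x => (if (j < d)%N then P j x else 0) +
                             (if (j < e)%N then Q j x else 0)); split.
    move=> j; apply: homogD; [case: (j < d)%N|case: (j < e)%N] => //; exact: homog0.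
  apply/funext => x; rewrite big_split/=; congr (_ + _).
    rewrite -(big_mkord xpredT (fun j => P j x)) -(big_mkord xpredT (fun j => if (j < d)%N then P j x else 0)).
    rewrite (big_cat_nat (leq0n d) (leq_addr e d))/= [X in _ + X]big_nat_cond [X in _ + X]big1.
      by rewrite addr0 big_nat [in RHS]big_nat; apply: eq_bigr => j /andP[_ ->].
    by move=> j; rewrite andbT => /andP[]; rewrite leqNgt => /negbTE ->.
  rewrite -(big_mkord xpredT (fun j => Q j x)) -(big_mkord xpredT (fun j => if (j < e)%N then Q j x else 0)).
  rewrite (big_cat_nat (leq0n e) (leq_addl d e))/= [X in _ + X]big_nat_cond [X in _ + X]big1.
    by rewrite addr0 big_nat [in RHS]big_nat; apply: eq_bigr => j /andP[_ ->].
  by move=> j; rewrite andbT => /andP[]; rewrite leqNgt => /negbTE ->.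
- move=> i p _ [d [P [hP ->]]].
  exists d.+1, (fun j x => if j is j'.+1 then x ord0 i * P j' x else 0); split.
    case=> [|j]; first exact: homog0.
    exact: homogM (homog_coord i) (hP j).
  by apply/funext => x; rewrite big_ord_recl/= add0r mulr_sumr.
Qed.

(** Graded version of [polyfun_ind]; the zero polynomial needs its own case because it is
    homogeneous of every degree. *)
Lemma homog_ind (P : nat -> (vec -> R) -> Prop) :
  (forall c, P 0%N (fun=> c)) -> (forall n, P n (fun=> 0)) ->
  (forall n p q, homog n p -> homog n q -> P n p -> P n q -> P n (fun x => p x + q x)) ->
  (forall n i p, homog n p -> P n p -> P n.+1 (fun x => x ord0 i * p x)) ->
  forall n p, homog n p -> P n p.
Proof.
move=> Pc P0 PD Pm.
have Q n : forall (m : {ffun 'I_N -> nat}) (c : R), (\sum_i m i = n)%N ->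
    P n (fun x => c * monom m x) /\ homog n (fun x => c * monom m x).
  elim: n => [|n IH] m c mn.
    have m0 x : monom m x = 1.
      rewrite /monom big1// => i _; move/eqP: mn; rewrite sum_nat_eq0 => /forallP /(_ i).
      by move=> /eqP ->; rewrite expr0.
    split; first by have := Pc c; congr P; apply/funext => x; rewrite m0 mulr1.
    by apply: homog_ext (homog_cst c) => x; rewrite m0 mulr1.
  have [i mi] : exists i, (0 < m i)%N.
    apply: contrapT => H; move: mn; rewrite big1// => i _; apply/eqP.
    by rewrite -leqn0 leqNgt; apply/negP => Hi; apply: H; exists i.
  pose m' := [ffun j => (m j - (j == i))%N].
  have [|Q1 Q2] := IH m' c.
    move: mn; rewrite (bigD1 i)//= => mn; rewrite (bigD1 i)//= ffunE eqxx.
    rewrite (eq_bigr m); last by move=> j ji; rewrite ffunE (negbTE ji) subn0.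
    move: mi mn; case: (m i) => // k _; rewrite addSn => -[<-] /=.
    by rewrite subSS subn0.
  have E x : c * monom m x = x ord0 i * (c * monom m' x).
    rewrite mulrCA; congr (_ * _); rewrite /monom (bigD1 i)//= [in RHS](bigD1 i)//= ffunE eqxx.
    rewrite mulrA -exprS; congr (_ ^+ _ * _); first by case: (m i) mi => // k _ /=; rewrite subSS subn0.
    by apply: eq_bigr => j ji; rewrite ffunE (negbTE ji) subn0.
  split; first by have := Pm _ i _ Q2 Q1; congr P; apply/funext => x; rewrite E.
  by apply: homog_ext (homogM (homog_coord i) Q2) => x; rewrite E.
move=> n p [s [hs ps]].
have -> : p = (fun x => \sum_(c <- s) c.1 * monom c.2 x) by apply/funext.
suff [] : P n (fun x => \sum_(c <- s) c.1 * monom c.2 x) /\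
  homog n (fun x => \sum_(c <- s) c.1 * monom c.2 x) by [].
elim: s hs {ps} => [_|a s IH].
  split; first by have := P0 n; congr P; apply/funext => x; rewrite big_nil.
  by apply: homog_ext (homog0 n) => x; rewrite big_nil.
move=> /= /andP[/eqP ha /IH[IH1 IH2]].
have [Q1 Q2] := Q n a.2 a.1 ha; split.
  by have := PD _ _ _ Q2 IH2 Q1 IH1; congr P; apply/funext => x; rewrite big_cons.
by apply: homog_ext (homogD Q2 IH2) => x; rewrite big_cons.
Qed.

Lemma polyfun_mulmx (A : 'M[R]_N) p : polyfun p -> polyfun (fun x => p (x *m A)).
Proof.
move: p; apply: polyfun_ind => [c|p q _ _|i p _ IH]; first exact: polyfun_cst.
  exact: polyfunD.
apply: polyfunM => //.
apply: polyfun_ext (polyfun_sum _ _ (fun j => polyfunZ (A j i) (polyfun_coord j))) => x.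
  by rewrite mxE; apply: eq_bigr => j _; rewrite mulrC.
Qed.

Lemma homog_mulmx (A : 'M[R]_N) n p : homog n p -> homog n (fun x => p (x *m A)).
Proof.
move: n p; apply: homog_ind => [c|n|n p q _ _|n i p _ IH].
- exact: homog_cst.
- exact: homog0.
- exact: homogD.
rewrite -add1n; apply: homogM => //.
apply: homog_ext (homog_sum _ _ (fun j => homogZ (A j i) (homog_coord j))) => x.
  by rewrite mxE; apply: eq_bigr => j _; rewrite mulrC.
Qed.

Lemma polyfun_affine (c : R) (b : vec) p : polyfun p -> polyfun (fun x => p (c *: x + b)).
Proof.
move: p; apply: polyfun_ind => [d|p q _ _|i p _ IH]; first exact: polyfun_cst.
  exact: polyfunD.
apply: polyfunM => //.
apply: polyfun_ext (polyfunD (polyfunZ c (polyfun_coord i)) (polyfun_cst (b ord0 i))) => x.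
by rewrite !mxE.
Qed.

Lemma differentiable_coordv (i : 'I_N) x : differentiable (fun y : vec => y ord0 i) x.
Proof. exact: differentiable_coord. Qed.

Lemma polyfun_differentiable p x : polyfun p -> differentiable p x.
Proof.
move=> pp; move: p pp x; apply: polyfun_ind => [c x|p q _ _ IHp IHq x|i p _ IH x].
- exact: differentiable_cst.
- exact: differentiableD.
- exact: (differentiableM (differentiable_coordv i x) (IH x)).
Qed.

Lemma polyfun_continuous p : polyfun p -> continuous p.
Proof. by move=> pp x; apply: differentiable_continuous; exact: polyfun_differentiable. Qed.

Lemma polyfun_derivable p x v : polyfun p -> derivable p x v.
Proof. by move=> pp; apply: diff_derivable; exact: polyfun_differentiable. Qed.

Lemma eq_derive p q x v : p =1 q -> derive p x v = derive q x v.
Proof. by move=> /funext ->. Qed.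

Lemma derive_cstv (c : R) x v : derive (fun _ : vec => c) x v = 0.
Proof. exact: derive_cst. Qed.

Lemma derive_coordv (i : 'I_N) x v : derive (fun y : vec => y ord0 i) x v = v ord0 i.
Proof.
rewrite deriveE; last exact: differentiable_coordv.
pose f := fun y : vec => y ord0 i : R^o.
have lf : linear f by move=> c a b; rewrite /f !mxE.
pose L : {linear vec -> R^o} := HB.pack f (GRing.isLinear.Build _ _ _ _ f lf).
change ('d (L : vec -> R^o) x v = L v); rewrite diff_lin//; exact: coord_continuous.
Qed.

Lemma derive_addv p q x v : derivable p x v -> derivable q x v ->
  derive (fun y => p y + q y) x v = derive p x v + derive q x v.
Proof. exact: deriveD. Qed.

Lemma derive_mulv p q x v : derivable p x v -> derivable q x v ->
  derive (fun y => p y * q y) x v = derive p x v * q x + p x * derive q x v.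
Proof.
by move=> dp dq; rewrite [LHS](deriveM dp dq) /GRing.scale/= addrC mulrC.
Qed.

Lemma derive_scalev (c : R) q x v : derivable q x v ->
  derive (fun y => c * q y) x v = c * derive q x v.
Proof. by move=> dq; exact: (deriveZ c dq). Qed.

Lemma derive_sumv (I : Type) (r : seq I) (P : pred I) (F : I -> vec -> R) x v :
  (forall i, polyfun (F i)) ->
  derive (fun y => \sum_(i <- r | P i) F i y) x v = \sum_(i <- r | P i) derive (F i) x v.
Proof.
move=> H; elim: r => [|a r IH].
  rewrite big_nil; apply: etrans (derive_cstv 0 x v).
  by apply: eq_derive => y; rewrite big_nil.
rewrite big_cons; case Pa : (P a); last first.
  by apply: etrans IH; apply: eq_derive => y; rewrite big_cons Pa.
have dF : derivable (F a) x v by exact: polyfun_derivable.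
have dS : derivable (fun y => \sum_(i <- r | P i) F i y) x v.
  by apply: polyfun_derivable; exact: polyfun_sum.
rewrite -IH; apply: etrans (derive_addv dF dS).
have -> : (fun y => \sum_(i <- a :: r | P i) F i y) = (fun y => F a y + \sum_(i <- r | P i) F i y) by apply/funext => y; rewrite big_cons Pa.
by [].
Qed.

Lemma derive_dotv (a x v : vec) : derive (fun y => dotv y a) x v = dotv v a.
Proof.
rewrite (_ : (fun y => _) = (fun y : vec => \sum_i a ord0 i * y ord0 i)).
  rewrite derive_sumv; last by move=> i; apply: polyfunZ; exact: polyfun_coord.
  rewrite dotvE; apply: eq_bigr => i _; rewrite derive_scalev ?derive_coordv 1?mulrC//.
  by apply: polyfun_derivable; exact: polyfun_coord.
by apply/funext => y; rewrite dotvE; apply: eq_bigr => i _; rewrite mulrC.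
Qed.

Lemma derive_dotvv (x v : vec) : derive (fun y => dotv y y) x v = 2 * dotv x v.
Proof.
rewrite (_ : (fun y => _) = (fun y : vec => \sum_i y ord0 i * y ord0 i)).
  rewrite derive_sumv; last by move=> i; apply: polyfunM; exact: polyfun_coord.
  rewrite dotvE mulr_sumr; apply: eq_bigr => i _.
  rewrite derive_mulv ?derive_coordv 1?mulrC//; first by ring.
    by apply: polyfun_derivable; exact: polyfun_coord.
  by apply: polyfun_derivable; exact: polyfun_coord.
by apply/funext => y; rewrite dotvE.
Qed.

Lemma polyfun_derive p v : polyfun p -> polyfun (fun x => derive p x v).
Proof.
move: p; apply: polyfun_ind => [c|p q pp pq IHp IHq|i p pp IH].
- by apply: polyfun_ext (polyfun_cst 0) => x; rewrite derive_cstv.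
- apply: polyfun_ext (polyfunD IHp IHq) => x; rewrite derive_addv//; exact: polyfun_derivable.
- apply: polyfun_ext (polyfunD (polyfunZ (v ord0 i) pp) (polyfunM (polyfun_coord i) IH)) => x.
  rewrite derive_mulv ?derive_coordv//; apply: polyfun_derivable => //; exact: polyfun_coord.
Qed.

Lemma homog_derive0 p v : homog 0 p -> (fun x => derive p x v) = (fun=> 0).
Proof.
move=> hp; have -> : p = fun=> p 0.
  by apply/funext => x; rewrite -[in RHS](scale0r x) (homog_scale _ _ hp) expr0 mul1r.
by apply/funext => x; rewrite derive_cstv.
Qed.

Lemma homog_derive n p v : homog n p -> homog n.-1 (fun x => derive p x v).
Proof.
move: n p; apply: homog_ind => [c|n|n p q /homog_polyfun pp /homog_polyfun pq IHp IHq|n i p hp IH].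
- by apply: homog_ext (homog0 _) => x; rewrite derive_cstv.
- by apply: homog_ext (homog0 _) => x; rewrite derive_cstv.
- apply: homog_ext (homogD IHp IHq) => x; rewrite derive_addv//; exact: polyfun_derivable.
- have pp := homog_polyfun hp.
  have E x : v ord0 i * p x + x ord0 i * derive p x v =
      derive (fun y : vec => y ord0 i * p y) x v.
    rewrite derive_mulv ?derive_coordv//; apply: polyfun_derivable => //; exact: polyfun_coord.
  apply: homog_ext E _ => /=; apply: homogD; first exact: homogZ.
  case: n hp IH => [hp _|n hp IH].
    apply: homog_ext (homog0 _) => x.
    by have := homog_derive0 v hp => /(congr1 (fun f => f x)) /= ->; rewrite mulr0.
  exact: homogM (homog_coord i) IH.
Qed.

Lemma derive_mulmx (A : 'M[R]_N) p x v :
  derive (fun y => p (y *m A)) x v = derive p (x *m A) (v *m A).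
Proof.
rewrite /derive (_ : (fun h => _) = (fun h => h^-1 *: ((p \o shift (x *m A)) (h *: (v *m A)) - p (x *m A))))//.
by apply/funext => h /=; rewrite mulmxDl -scalemxAl.
Qed.

Lemma derive_shiftv (b : vec) p x v :
  derive (fun y => p (y + b)) x v = derive p (x + b) v.
Proof.
rewrite /derive (_ : (fun h => _) = (fun h => h^-1 *: ((p \o shift (x + b)) (h *: v) - p (x + b))))//.
by apply/funext => h /=; rewrite addrA.
Qed.

Lemma derive_dirZ p x (c : R) v : differentiable p x ->
  derive p x (c *: v) = c * derive p x v.
Proof. by move=> dp; rewrite !deriveE// linearZ. Qed.

Lemma derive_dir_sum (I : Type) (r : seq I) (P : pred I) (F : I -> vec) p x :
  differentiable p x ->
  derive p x (\sum_(i <- r | P i) F i) = \sum_(i <- r | P i) derive p x (F i).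
Proof. by move=> dp; rewrite !deriveE// linear_sum; apply: eq_bigr => i _; rewrite deriveE. Qed.

Lemma row_sum_deltav x : x = \sum_i x ord0 i *: delta_mx ord0 i.
Proof. exact: row_sum_delta. Qed.

Lemma derive_coordE p x v : differentiable p x ->
  derive p x v = \sum_i v ord0 i * derive p x (delta_mx ord0 i).
Proof.
move=> dp; rewrite {1}(row_sum_deltav v) derive_dir_sum//.
by apply: eq_bigr => i _; rewrite derive_dirZ.
Qed.

Lemma derive_comm p v w : polyfun p -> forall x,
  derive (fun y => derive p y v) x w = derive (fun y => derive p y w) x v.
Proof.
move: p; apply: polyfun_ind => [c x|p q pp pq IHp IHq x|i p pp IH x].
- have E u : (fun y : vec => derive (fun=> c) y u) = fun=> 0.
    by apply/funext => y; rewrite derive_cstv.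
  by rewrite !E !derive_cstv.
- have E (u : vec) : (fun y : vec => derive (fun x => p x + q x) y u) =
     (fun y => derive p y u + derive q y u).
    by apply/funext => y; rewrite derive_addv//; exact: polyfun_derivable.
  have D (u u' : vec) r (pr : polyfun r) : derivable (fun y => derive r y u) x u'.
    by apply: polyfun_derivable; exact: polyfun_derive.
  rewrite (E v) (E w) (derive_addv (D v w p pp) (D v w q pq)).
  by rewrite (derive_addv (D w v p pp) (D w v q pq)) IHp IHq.
- have E (u : vec) : (fun y : vec => derive (fun x : vec => x ord0 i * p x) y u) =
     (fun y => u ord0 i * p y + y ord0 i * derive p y u).
    apply/funext => y; rewrite (derive_mulv (polyfun_derivable (polyfun_coord i)) (polyfun_derivable pp)).
    by rewrite derive_coordv.
  have F (u u' : vec) : derive (fun y : vec => u ord0 i * p y + y ord0 i * derive p y u) x u' =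
     u ord0 i * derive p x u' + (u' ord0 i * derive p x u +
        x ord0 i * derive (fun y => derive p y u) x u').
    have dp y : derivable p x y by exact: polyfun_derivable.
    have dc y : derivable (fun y : vec => y ord0 i) x y by apply: polyfun_derivable; exact: polyfun_coord.
    have dd : derivable (fun y => derive p y u) x u'.
      by apply: polyfun_derivable; exact: polyfun_derive.
    have d1 : derivable (fun y => u ord0 i * p y) x u'.
      by apply: polyfun_derivable; exact: polyfunZ.
    have d2 : derivable (fun y : vec => y ord0 i * derive p y u) x u'.
      apply: polyfun_derivable; apply: polyfunM; first exact: polyfun_coord.
      exact: polyfun_derive.
    by rewrite (derive_addv d1 d2) (derive_scalev _ (dp u')) (derive_mulv (dc u') dd) derive_coordv.
  rewrite (E v) (E w) (F v w) (F w v) IH.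
  by rewrite addrCA.
Qed.

Lemma polyfun_line p : polyfun p -> forall x v, exists P : {poly R},
  forall t, p (x + t *: v) = P.[t] /\ derive p (x + t *: v) v = P^`().[t].
Proof.
move: p; apply: polyfun_ind => [c x v|p q pp pq IHp IHq x v|i p pp IH x v].
- by exists c%:P => t; rewrite hornerC derivC hornerC derive_cstv.
- have [P hP] := IHp x v; have [Q hQ] := IHq x v; exists (P + Q) => t.
  rewrite derivD !hornerD; split; first by rewrite (hP t).1 (hQ t).1.
  rewrite derive_addv ?(hP t).2 ?(hQ t).2//; exact: polyfun_derivable.
- have [P hP] := IH x v; exists (((x ord0 i)%:P + (v ord0 i)%:P * 'X) * P) => t.
  rewrite derivM derivD derivC derivM derivC derivX; split.
    by rewrite !hornerE !mxE (hP t).1; ring.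
  rewrite derive_mulv; last 2 first.
  + by apply: polyfun_derivable; exact: polyfun_coord.
  + exact: polyfun_derivable.
  by rewrite derive_coordv (hP t).1 (hP t).2 !mxE !hornerE; ring.
Qed.

(** Restriction to a line turns extremum questions in R^N into questions about one univariate
    polynomial. *)
Lemma polyfun_line2 p : polyfun p -> forall x v, exists P : {poly R},
  forall t, [/\ p (x + t *: v) = P.[t], derive p (x + t *: v) v = P^`().[t] &
    derive (fun y => derive p y v) (x + t *: v) v = P^`()^`().[t]].
Proof.
move=> pp x v; have [P hP] := polyfun_line pp x v.
have [Q hQ] := polyfun_line (polyfun_derive v pp) x v.
exists P => t; rewrite (hP t).1 (hP t).2 (hQ t).2; split => //.
congr (_^`().[t]); apply/eqP; rewrite -subr_eq0; apply/eqP.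
apply: (@roots_geq_poly_eq0 _ _ [seq i%:R | i <- iota 0 (size (Q - P^`()))]).
- apply/allP => _ /mapP[i _ ->]; rewrite /root hornerD hornerN -(hP _).2 -(hQ _).1 subrr//.
- by rewrite map_inj_uniq ?iota_uniq//; exact: mulrIn.
- by rewrite size_map size_iota.
Qed.

(** Directional derivative with the direction first, so that [pd v] is an operator that can be
    iterated. It is made opaque afterwards, so that reasoning uses its algebraic rules and not the
    underlying limit. *)
Definition pd v p x : R := derive p x v.

Lemma pdE v p x : derive p x v = pd v p x. Proof. by []. Qed.

Lemma eq_pd v p q x : p =1 q -> pd v p x = pd v q x.
Proof. exact: eq_derive. Qed.

Lemma pd_cst (c : R) v x : pd v (fun=> c) x = 0.
Proof. exact: derive_cstv. Qed.

Lemma pd_coord i v x : pd v (fun y => y ord0 i) x = v ord0 i.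
Proof. exact: derive_coordv. Qed.

Lemma pdD v p q x : polyfun p -> polyfun q ->
  pd v (fun y => p y + q y) x = pd v p x + pd v q x.
Proof. by move=> pp pq; apply: derive_addv; exact: polyfun_derivable. Qed.

Lemma pdM v p q x : polyfun p -> polyfun q ->
  pd v (fun y => p y * q y) x = pd v p x * q x + p x * pd v q x.
Proof. by move=> pp pq; apply: derive_mulv; exact: polyfun_derivable. Qed.

Lemma pdZ v (c : R) q x : polyfun q -> pd v (fun y => c * q y) x = c * pd v q x.
Proof. by move=> pq; apply: derive_scalev; exact: polyfun_derivable. Qed.

Lemma pd_sum (I : Type) (r : seq I) (P : pred I) (F : I -> vec -> R) x v :
  (forall i, polyfun (F i)) ->
  pd v (fun y => \sum_(i <- r | P i) F i y) x = \sum_(i <- r | P i) pd v (F i) x.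
Proof. exact: derive_sumv. Qed.

Lemma pd_dotv (a v x : vec) : pd v (fun y => dotv y a) x = dotv v a.
Proof. exact: derive_dotv. Qed.

Lemma pd_dotvv (v x : vec) : pd v (fun y => dotv y y) x = 2 * dotv x v.
Proof. exact: derive_dotvv. Qed.

Lemma polyfun_pd v p : polyfun p -> polyfun (pd v p).
Proof. exact: polyfun_derive. Qed.

Lemma homog_pd0 v p : homog 0 p -> pd v p = fun=> 0.
Proof. exact: homog_derive0. Qed.

Lemma homog_pd n v p : homog n p -> homog n.-1 (pd v p).
Proof. exact: homog_derive. Qed.

Lemma pd_mulmx (A : 'M[R]_N) p x v :
  pd v (fun y => p (y *m A)) x = pd (v *m A) p (x *m A).
Proof. exact: derive_mulmx. Qed.

Lemma pd_shift (b : vec) p x v : pd v (fun y => p (y + b)) x = pd v p (x + b).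
Proof. exact: derive_shiftv. Qed.

Lemma pd_dirZ p x (c : R) v : polyfun p -> pd (c *: v) p x = c * pd v p x.
Proof. by move=> pp; apply: derive_dirZ; exact: polyfun_differentiable. Qed.

Lemma pd_dirN p x v : polyfun p -> pd (- v) p x = - pd v p x.
Proof. by move=> pp; rewrite -scaleN1r pd_dirZ// mulN1r. Qed.

Lemma pd_coordE p x v : polyfun p ->
  pd v p x = \sum_i v ord0 i * pd (delta_mx ord0 i) p x.
Proof. by move=> pp; apply: derive_coordE; exact: polyfun_differentiable. Qed.

Lemma pd_comm p v w : polyfun p -> forall x, pd w (pd v p) x = pd v (pd w p) x.
Proof. exact: derive_comm. Qed.

Lemma pd_line p : polyfun p -> forall x v, exists P : {poly R},
  forall t, p (x + t *: v) = P.[t] /\ pd v p (x + t *: v) = P^`().[t].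
Proof. exact: polyfun_line. Qed.

Lemma pd_line2 p : polyfun p -> forall x v, exists P : {poly R},
  forall t, [/\ p (x + t *: v) = P.[t], pd v p (x + t *: v) = P^`().[t] &
    pd v (pd v p) (x + t *: v) = P^`()^`().[t]].
Proof. exact: polyfun_line2. Qed.

Lemma Dseq_cons v s p : Dseq (v :: s) p = pd v (Dseq s p).
Proof. by []. Qed.

Lemma polyfun_Dseq s p : polyfun p -> polyfun (Dseq s p).
Proof. by move=> pp; elim: s => // v s IH; exact: polyfun_derive. Qed.

End PolyFun.

Opaque pd.

                                       

(** * Euler's identity and uniqueness of homogeneous and Taylor expansions *)

Lemma horner_eq0 (R : numDomainType) (P : {poly R}) : (forall t, P.[t] = 0) -> P = 0.
Proof.
move=> H; apply: (@roots_geq_poly_eq0 _ _ [seq i%:R | i <- iota 0 (size P)]).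
- by apply/allP => _ /mapP[i _ ->]; rewrite /root H.
- by rewrite map_inj_uniq ?iota_uniq//; exact: mulrIn.
- by rewrite size_map size_iota.
Qed.

Section Euler.
Variables (R : realType) (N : nat).
Local Notation vec := 'rV[R]_N.
Implicit Types (p q : vec -> R) (x v : vec).

Lemma homog_euler n p x : homog n p -> pd x p x = n%:R * p x.
Proof.
move=> hp; move: n p hp x; apply: homog_ind => [c|n|n p q hp hq IHp IHq|n i p hp IH] x.
- by rewrite pd_cst mul0r.
- by rewrite pd_cst mulr0.
- rewrite (pdD _ _ (homog_polyfun hp) (homog_polyfun hq)).
  by rewrite IHp IHq mulrDr.
- rewrite (pdM _ _ (polyfun_coord R i) (homog_polyfun hp)).
  by rewrite pd_coord IH -natr1; ring.
Qed.

(** At a fixed point both expressions of q(c x) are polynomials in the scalar c, so their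
    coefficients can be compared. *)
Lemma homog_unique_decomp n d (P : nat -> vec -> R) q :
  (forall j, homog j (P j)) -> (forall c x, q (c *: x) = c ^+ n * q x) ->
  (forall x, q x = \sum_(j < d) P j x) ->
  forall j x, (j < d)%N -> j <> n -> P j x = 0.
Proof.
move=> hP hq qE j x jd jn.
pose Q : {poly R} := \poly_(j < d) P j x - q x *: 'X^n.
have : Q = 0.
  apply: horner_eq0 => c; rewrite hornerD hornerN hornerZ hornerXn horner_poly.
  rewrite mulrC -hq qE; apply/eqP; rewrite subr_eq0; apply/eqP.
  by apply: eq_bigr => i _; rewrite (homog_scale _ _ (hP i)) mulrC.
move=> /(congr1 (fun r : {poly R} => r`_j)).
rewrite coefD coefN coefZ coefXn coef_poly jd coef0.
by rewrite (_ : (j == n) = false) ?mulr0 ?subr0//; apply/eqP.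
Qed.

Lemma scale_homog n q : polyfun q -> (forall c x, q (c *: x) = c ^+ n * q x) -> homog n q.
Proof.
move=> pq hq; have [d [P [hP qE]]] := homog_decomp pq.
have Z j x : (j < d)%N -> j <> n -> P j x = 0.
  by apply: (homog_unique_decomp hP hq) => y; rewrite qE.
rewrite qE; case: (ltnP n d) => nd.
  apply: homog_ext (hP n) => x; rewrite (bigD1 (Ordinal nd))//= big1 ?addr0// => i ni.
  by rewrite Z//; apply/eqP.
apply: homog_ext (@homog0 R N n) => x; rewrite big1// => i _; rewrite Z// => ni.
by move: (ltn_ord i); rewrite ni ltnNge nd.
Qed.

(** On each line through 0 the restriction is a univariate polynomial all of whose derivatives at 0
    vanish. *)
Lemma polyfun_flat0 p : polyfun p ->
  (forall s : seq vec, Dseq s p 0 = 0) -> p = fun=> 0.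
Proof.
move=> pp H; apply/funext => v.
have pD m : polyfun (Dseq (nseq m v) p).
  exact: polyfun_Dseq.
have [P hP] := pd_line pp 0 v.
have K n t : Dseq (nseq n v) p (t *: v) = P^`(n).[t].
  elim: n t => [t|n IH t]; first by rewrite derivn0 -(hP t).1 add0r.
  have [Q hQ] := pd_line (pD n) 0 v.
  have -> : Dseq (nseq n.+1 v) p (t *: v) = pd v (Dseq (nseq n v) p) (0 + t *: v) by rewrite add0r.
  rewrite (hQ t).2 derivnS; congr (_^`().[_]); apply/eqP; rewrite -subr_eq0; apply/eqP.
  by apply: horner_eq0 => s; rewrite hornerD hornerN -IH -(hQ s).1 add0r subrr.
have P0 : P = 0.
  apply/polyP => n; rewrite coef0.
  have := K n 0; rewrite scale0r H => /esym; rewrite horner_coef0 coef_derivn addn0 ffactnn.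
  by move/eqP; rewrite mulrn_eq0 -leqn0 leqNgt fact_gt0/= => /eqP.
by have := (hP 1).1; rewrite scale1r add0r P0 horner0.
Qed.

End Euler.

(** * Dunkl operators on polynomials *)

Section Dunkl.
Variables (R : realType) (N : nat).
Local Notation vec := 'rV[R]_N.
Implicit Types (p q : vec -> R) (x v : vec).

Lemma mul_reflmx (x a : vec) : x *m reflmx a = x - dotv x a *: a.
Proof.
rewrite /reflmx mulmxBr mulmx1 mulmxA; congr (_ - _).
by rewrite /dotv {1}[x *m a^T]mx11_scalar mul_scalar_mx.
Qed.

Lemma reflmxT (a : vec) : (reflmx a)^T = reflmx a.
Proof. by rewrite /reflmx linearB/= trmx1 trmx_mul trmxK. Qed.

Lemma dotv_reflmx (x y a : vec) : dotv (x *m reflmx a) y = dotv x (y *m reflmx a).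
Proof. by rewrite dotv_mulmx reflmxT. Qed.

Lemma reflmxK (a : vec) : dotv a a = 2 -> reflmx a *m reflmx a = 1%:M.
Proof.
move=> a2; apply/row_matrixP => i; rewrite !rowE mulmxA !mul_reflmx mulmx1.
rewrite dotvBl dotvZl a2 [X in _ - X *: _](_ : _ = - dotv (delta_mx 0 i) a); first by rewrite scaleNr opprK subrK.
by ring.
Qed.

Lemma mul_reflmxK (x a : vec) : dotv a a = 2 -> x *m reflmx a *m reflmx a = x.
Proof. by move=> a2; rewrite -mulmxA reflmxK// mulmx1. Qed.

Lemma refl_fix (x a : vec) : dotv a x = 0 -> x *m reflmx a = x.
Proof. by move=> ax; rewrite mul_reflmx dotvC ax scale0r subr0. Qed.

Lemma refl_self (a : vec) : dotv a a = 2 -> a *m reflmx a = - a.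
Proof. by move=> a2; rewrite mul_reflmx a2 scaler_nat mulr2n opprD addrA subrr add0r. Qed.

Variables (Rs Rp : seq vec) (k : vec -> R).
Hypotheses (hRs : root_system Rs) (hRp : positive_subsystem Rs Rp)
  (hk : multiplicity Rs k).
Local Notation T := (dunkl Rp k).
Local Notation e i := (delta_mx ord0 i : vec).

Lemma root2 a : a \in Rs -> dotv a a = 2.
Proof. by case: hRs => _ _ + _ _ => /[apply]. Qed.

Lemma Rp_sub a : a \in Rp -> a \in Rs.
Proof. by case: hRp => b [_ ->]; rewrite mem_filter => /andP[]. Qed.

Lemma Rp2 a : a \in Rp -> dotv a a = 2.
Proof. by move=> /Rp_sub/root2. Qed.

Lemma k_ge0 a : a \in Rp -> 0 <= k a.
Proof. by move=> /Rp_sub; case: hk => + _ => /[apply]. Qed.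

Definition dquot (a : vec) q x : R :=
  if dotv a x == 0 then pd a q x else (q x - q (x *m reflmx a)) / dotv a x.

Lemma dunklE xi q x : T xi q x = pd xi q x + \sum_(a <- Rp) k a * dotv a xi * dquot a q x.
Proof. by []. Qed.

Lemma dunkl_ext xi p q x : p =1 q -> T xi p x = T xi q x.
Proof. by move=> /funext ->. Qed.

Lemma dquotD a p q x : polyfun p -> polyfun q ->
  dquot a (fun x => p x + q x) x = dquot a p x + dquot a q x.
Proof.
move=> pp pq; rewrite /dquot; case: ifP => _; last by rewrite -mulrDl; congr (_ / _); ring.
by rewrite (pdD _ _ pp pq).
Qed.

Lemma dquotZ a (c : R) q x : polyfun q -> dquot a (fun x => c * q x) x = c * dquot a q x.
Proof.
move=> pq; rewrite /dquot; case: ifP => _; last by rewrite mulrA; congr (_ / _); ring.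
by rewrite (pdZ _ _ _ pq).
Qed.

Lemma dunklD xi p q x : polyfun p -> polyfun q ->
  T xi (fun x => p x + q x) x = T xi p x + T xi q x.
Proof.
move=> pp pq; rewrite !dunklE (pdD _ _ pp pq).
rewrite addrACA -big_split/=; congr (_ + _); apply: eq_bigr => a _.
by rewrite dquotD// mulrDr.
Qed.

Lemma dunklZ xi (c : R) q x : polyfun q -> T xi (fun x => c * q x) x = c * T xi q x.
Proof.
move=> pq; rewrite !dunklE (pdZ _ _ _ pq) mulrDr mulr_sumr.
congr (_ + _); apply: eq_bigr => a _; rewrite dquotZ//; ring.
Qed.

Lemma dunkl_cst xi (c : R) x : T xi (fun=> c) x = 0.
Proof.
rewrite dunklE pd_cst add0r big1// => a _; rewrite /dquot pd_cst subrr mul0r.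
by case: ifP => _; rewrite mulr0.
Qed.

Lemma dunkl_sum (I : eqType) (r : seq I) (F : I -> vec -> R) xi x :
  (forall i, i \in r -> polyfun (F i)) ->
  T xi (fun y => \sum_(i <- r) F i y) x = \sum_(i <- r) T xi (F i) x.
Proof.
elim: r => [|a r IH] H.
  rewrite big_nil; apply: etrans (dunkl_cst xi 0 x).
  by apply: dunkl_ext => y; rewrite big_nil.
have H' : forall i, i \in r -> polyfun (F i) by move=> i ir; apply: H; rewrite inE ir orbT.
rewrite big_cons -IH//.
apply: etrans (dunklD xi x (H a (mem_head _ _)) (polyfun_sum_seq H')).
by apply: dunkl_ext => y; rewrite big_cons.
Qed.

Lemma dunkl_dirE v q x : polyfun q -> T v q x = \sum_i v ord0 i * T (e i) q x.
Proof.
move=> pq; under eq_bigr do rewrite dunklE mulrDr.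
rewrite big_split/= -pd_coordE//.
rewrite dunklE; congr (_ + _); under [RHS]eq_bigr do rewrite mulr_sumr.
rewrite exchange_big/=; apply: eq_bigr => a _.
rewrite [dotv a v]dotvC dotvE mulr_sumr mulr_suml; apply: eq_bigr => i _.
by rewrite dotv_delta; ring.
Qed.

Lemma pd_invariant a f x : polyfun f -> dotv a a = 2 -> dotv a x = 0 ->
  (forall y, f (y *m reflmx a) = f y) -> pd a f x = 0.
Proof.
move=> pf a2 ax inv.
have : pd a f x = - pd a f x.
  rewrite -{1}(eq_pd a x inv) pd_mulmx (refl_fix ax) (refl_self a2).
  by rewrite pd_dirN.
lra.
Qed.

(** A reflection-invariant factor passes through the difference quotients, so the ordinary product
    rule survives. On the hyperplane <a,x> = 0 this uses that the derivative of such a factor along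
    [a] vanishes there. *)
Lemma dunkl_mul_inv xi f q x : polyfun f -> polyfun q ->
  (forall a y, a \in Rp -> f (y *m reflmx a) = f y) ->
  T xi (fun y => f y * q y) x = f x * T xi q x + pd xi f x * q x.
Proof.
move=> pf pq inv; rewrite !dunklE.
rewrite (pdM _ _ pf pq).
rewrite mulrDr mulr_sumr [RHS]addrAC [X in _ = X + _]addrC; congr (_ + _).
rewrite big_seq [RHS]big_seq; apply: eq_bigr => a aR.
rewrite /dquot; case: ifP => [/eqP ax|ax].
  rewrite (pdM _ _ pf pq).
  by rewrite (pd_invariant pf (Rp2 aR) ax (inv a ^~ aR)); ring.
by rewrite inv// -mulrBr; ring.
Qed.

(** Commutator of a Dunkl operator with a linear form: besides the classical constant it contains
    one reflected term per positive root. *)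
Lemma dunkl_mul_dotv xi (b : vec) q x : polyfun q ->
  T xi (fun y => dotv y b * q y) x = dotv x b * T xi q x + dotv xi b * q x +
   \sum_(a <- Rp) k a * dotv a xi * dotv a b * q (x *m reflmx a).
Proof.
move=> pq; rewrite !dunklE.
rewrite (pdM _ _ (polyfun_dotv b) pq) pd_dotv.
have -> : \sum_(a <- Rp) k a * dotv a xi * dquot a (fun y => dotv y b * q y) x =
  dotv x b * (\sum_(a <- Rp) k a * dotv a xi * dquot a q x) +
  \sum_(a <- Rp) k a * dotv a xi * dotv a b * q (x *m reflmx a); last by ring.
rewrite mulr_sumr -big_split/= big_seq [RHS]big_seq; apply: eq_bigr => a aR.
rewrite /dquot; case: ifP => [/eqP ax|ax].
  rewrite (pdM _ _ (polyfun_dotv b) pq) pd_dotv.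
  by rewrite refl_fix//; ring.
have -> : dotv (x *m reflmx a) b = dotv x b - dotv a x * dotv a b.
  by rewrite mul_reflmx dotvBl dotvZl [dotv x a]dotvC.
by field; rewrite ax.
Qed.

                                                                                        
(** The Dunkl Laplacian, as the sum of squares of the coordinate Dunkl operators. *)
Definition DkL q x : R := \sum_i T (e i) (T (e i) q) x.

(** The number [cc] = N + 2 [gam] takes over the role of the dimension: it is the homogeneous
    dimension of R^N with the weight given by the product of |<a,x>|^(2k(a)) over the positive
    roots. *)
Definition gam : R := \sum_(a <- Rp) k a.
Definition cc : R := N%:R + 2 * gam.

Lemma ccE : cc = N%:R + 2 * gam.
Proof. by []. Qed.

Lemma dunkl_euler q x : T x q x = pd x q x + \sum_(a <- Rp) k a * (q x - q (x *m reflmx a)).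
Proof.
rewrite dunklE; congr (_ + _); apply: eq_bigr => a _; rewrite /dquot.
case: ifPn => [/eqP ax|ax]; first by rewrite refl_fix// ax subrr !(mulr0, mul0r).
by field.
Qed.

End Dunkl.

Opaque dunkl.

(** * Second-derivative test for polynomials *)

Lemma horner_near0 (R : realType) (Q : {poly R}) (e : R) : 0 < e ->
  exists2 d, 0 < d & forall t, `|t| < d -> `|Q.[t] - Q.[0]| < e.
Proof.
move=> e0; have /cvgrPdist_lt/(_ e e0)/nbhs_ballP[d d0 hd] := @continuous_horner R Q 0.
exists d => // t td; rewrite distrC; apply: hd; by rewrite /ball/= sub0r normrN.
Qed.

Lemma mul_half_div (R : realFieldType) (u d : R) : 0 < u -> u * (d / (2 * u)) = d / 2.
Proof. by move=> u0; field; exact: lt0r_neq0. Qed.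

(** Write P(t) = P(0) + P_1 t + t^2 Q(t). A nonzero P_1, or else a negative Q(0), would make P
    smaller than P(0) at a suitable small t. *)
Lemma horner_min0 (R : realType) (P : {poly R}) : (forall t, P.[0] <= P.[t]) ->
  P^`().[0] = 0 /\ 0 <= P^`()^`().[0].
Proof.
move=> H; pose Q := drop_poly 2 P.
have PE t : P.[t] = P.[0] + P`_1 * t + t ^+ 2 * Q.[t].
  rewrite -{1}(poly_take_drop 2 P) hornerD hornerM hornerXn horner_coef0 horner_poly.
  by rewrite 2!big_ord_recl big_ord0/= expr0 mulr1 expr1 addr0 [_ * t ^+ 2]mulrC.
have H' t : 0 <= P`_1 * t + t ^+ 2 * Q.[t] by have := H t; rewrite (PE t) -addrA lerDl.
have P1 : P`_1 = 0.
  apply/eqP/negPn/negP => p0.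
  have [d d0 hd] := horner_near0 Q ltr01.
  pose M := `|Q.[0]| + 1; have M0 : 0 < M by rewrite ltr_wpDl.
  (* At t = -P_1 s the increment is P_1^2 s (s Q(t) - 1). The first bound on [s] keeps |Q(t)| below
     [M], the second gives s M <= 1/2, so the increment is negative. *)
  pose s := Num.min (d / (2 * `|P`_1|)) (1 / (2 * M)).
  have p1 : 0 < `|P`_1| by rewrite normr_gt0.
  have s0 : 0 < s by rewrite lt_min !divr_gt0// mulr_gt0.
  have s1 : s <= d / (2 * `|P`_1|) by rewrite ge_min lexx.
  have s2 : s <= 1 / (2 * M) by rewrite ge_min lexx orbT.
  have td : `|- P`_1 * s| < d.
    rewrite normrM normrN (gtr0_norm s0).
    apply: le_lt_trans (ler_wpM2l (normr_ge0 _) s1) _.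
    rewrite mul_half_div//.
    by rewrite ltr_pdivrMr// mulr_natr mulr2n ltrDl.
  have QM : Q.[- P`_1 * s] <= M.
    apply: le_trans (ler_norm _) _; rewrite /M -[X in `|X|](subrK Q.[0]) addrC.
    apply: le_trans (ler_normD _ _) _; rewrite lerD2l ltW//; exact: hd.
  have := H' (- P`_1 * s).
  rewrite (_ : _ + _ = (P`_1 ^+ 2 * s) * (s * Q.[- P`_1 * s] - 1)); last by ring.
  rewrite pmulr_rge0; last by rewrite mulr_gt0// exprn_even_gt0.
  rewrite subr_ge0 => h; have : s * M <= 1 / 2.
    apply: le_trans (ler_wpM2r (ltW M0) s2) _.
    by rewrite mulrC mul_half_div.
  have := ler_wpM2l (ltW s0) QM; lra.
split; first by rewrite horner_coef0 coef_deriv P1 mul0rn.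
rewrite horner_coef0 2!coef_deriv mulr1n mulr2n -mulr2n mulrn_wge0//.
have -> : P`_2 = Q.[0] by rewrite horner_coef0 coef_drop_poly.
rewrite leNgt; apply/negP => q0.
have [|d d0 hd] := @horner_near0 R Q (- Q.[0] / 2); first by rewrite divr_gt0// oppr_gt0.
have := H' (d / 2); rewrite P1 mul0r add0r pmulr_rge0 ?exprn_gt0 ?divr_gt0//.
have /hd : `|d / 2| < d.
  by rewrite gtr0_norm ?divr_gt0// ltr_pdivrMr// mulr_natr mulr2n ltrDl.
by rewrite ltr_norml => /andP[_]; lra.
Qed.

(** * The intertwiner on polynomials and the Dunkl Laplacian *)

Section Intertwiner.
Variables (R : realType) (N : nat).
Local Notation vec := 'rV[R]_N.
Implicit Types (p q : vec -> R) (x v xi : vec).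
Variables (Rs Rp : seq vec) (k : vec -> R) (V : (vec -> R) -> (vec -> R)).
Hypotheses (hRs : root_system Rs) (hRp : positive_subsystem Rs Rp)
  (hk : multiplicity Rs k) (hV : poly_intertwiner Rp k V).
Local Notation T := (dunkl Rp k).
Local Notation Dk := (DkL Rp k).
Local Notation cc := (cc Rp k).
Local Notation e i := (delta_mx ord0 i : vec).

Lemma V_lin p q (c : R) : polyfun p -> polyfun q ->
  V (fun x => p x + c * q x) = (fun x => V p x + c * V q x).
Proof. by case: hV => + _; apply. Qed.

Lemma Vpoly p : polyfun p -> polyfun (V p).
Proof. by case: hV => _ [+ _]; apply. Qed.

Lemma Vhomog n p : homog n p -> homog n (V p).
Proof. by case: hV => _ [_ [+ _ _ _ _]]; apply. Qed.

Lemma Vsurj q : polyfun q -> exists2 p, polyfun p & V p = q.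
Proof. by case: hV => _ [_ [_ + _ _ _]]; apply. Qed.

Lemma Vinj0 p : polyfun p -> V p = (fun => 0) -> p = (fun => 0).
Proof. by case: hV => _ [_ [_ _ + _ _]]; apply. Qed.

Lemma V_one : V (fun => 1) = (fun => 1).
Proof. by case: hV => _ [_ []]. Qed.

Lemma dunklV xi p x : polyfun p -> T xi (V p) x = V (pd xi p) x.
Proof. by case: hV => _ [_ [_ _ _ _ H]] pp; rewrite H. Qed.

Lemma V_ext p q : p =1 q -> V p = V q.
Proof. by move=> /funext ->. Qed.

Lemma VD p q x : polyfun p -> polyfun q -> V (fun x => p x + q x) x = V p x + V q x.
Proof.
move=> pp pq; rewrite -[V q x]mul1r -[RHS](congr1 (@^~ x) (V_lin 1 pp pq))/=.
by rewrite (V_ext (q := fun x => p x + 1 * q x))// => y; rewrite mul1r.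
Qed.

Lemma V_zero : V (fun => 0) = (fun=> 0).
Proof.
have pc := @polyfun_cst R N 1.
rewrite (V_ext (q := fun x => 1 + (-1) * 1)); last by move=> y; rewrite mulr1 subrr.
by rewrite (V_lin (-1) pc pc); apply/funext => x; rewrite mulN1r subrr.
Qed.

Lemma VZ (c : R) p x : polyfun p -> V (fun x => c * p x) x = c * V p x.
Proof.
move=> pp; rewrite (V_ext (q := fun x => 0 + c * p x)); last by move=> y; rewrite add0r.
by rewrite (V_lin c (@polyfun_cst R N 0) pp) V_zero add0r.
Qed.

Lemma V_cst (c : R) : V (fun => c) = fun=> c.
Proof.
apply/funext => x; rewrite (V_ext (q := fun x => c * 1)); last by move=> y; rewrite mulr1.
by rewrite VZ ?V_one ?mulr1//; exact: (@polyfun_cst R N 1).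
Qed.

Lemma VB p q x : polyfun p -> polyfun q -> V (fun x => p x - q x) x = V p x - V q x.
Proof.
move=> pp pq; rewrite -mulN1r -[RHS](congr1 (@^~ x) (V_lin (-1) pp pq))/=.
by rewrite (V_ext (q := fun x => p x + -1 * q x))// => y; rewrite mulN1r.
Qed.

Lemma V_sum (I : eqType) (r : seq I) (F : I -> vec -> R) x :
  (forall i, i \in r -> polyfun (F i)) ->
  V (fun y => \sum_(i <- r) F i y) x = \sum_(i <- r) V (F i) x.
Proof.
elim: r => [|a r IH] H.
  by rewrite big_nil (V_ext (q := fun=> 0)) ?V_zero// => y; rewrite big_nil.
have H' : forall i, i \in r -> polyfun (F i) by move=> i ir; apply: H; rewrite inE ir orbT.
rewrite big_cons -IH// -VD; last 2 first.
- by apply: H; rewrite mem_head.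
- exact: polyfun_sum_seq.
by rewrite (V_ext (q := fun x => F a x + \sum_(i <- r) F i x))// => y; rewrite big_cons.
Qed.

Lemma V_inj p q : polyfun p -> polyfun q -> V p = V q -> p = q.
Proof.
move=> pp pq pqE; have : (fun x => p x - q x) = fun=> 0.
  apply: Vinj0; first exact: polyfunB.
  by apply/funext => x; rewrite VB// pqE subrr.
by move=> /(congr1 (@^~ _)) H; apply/funext => x; apply/eqP; rewrite -subr_eq0 (H x).
Qed.

Lemma V_at0 p : polyfun p -> V p 0 = p 0.
Proof.
move=> pp; have [d [P [hP ->]]] := homog_decomp pp.
rewrite V_sum; last by move=> i _; exact: homog_polyfun.
apply: eq_bigr => i _; case: i => -[|j] jd /=.
  have -> : P 0%N = fun=> P 0%N 0.
    by apply/funext => x; rewrite -[in RHS](scale0r x) (homog_scale _ _ (hP 0%N)) expr0 mul1r.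
  by rewrite V_cst.
by rewrite (homog_at0 (hP _)) (homog_at0 (Vhomog (hP _))).
Qed.

Lemma dunkl_poly xi q : polyfun q -> polyfun (T xi q).
Proof.
move=> /Vsurj[p pp <-]; apply: polyfun_ext (Vpoly (polyfun_pd xi pp)) => x.
by rewrite dunklV.
Qed.

(** Commutativity is inherited from partial derivatives: V is onto the polynomials and turns [pd]
    into the Dunkl operator. *)
Lemma dunkl_comm xi eta q x : polyfun q -> T xi (T eta q) x = T eta (T xi q) x.
Proof.
move=> /Vsurj[p pp <-].
have E v w : T v (T w (V p)) x = V (pd v (pd w p)) x.
  rewrite -dunklV; last exact: polyfun_pd.
  by apply: dunkl_ext => y; rewrite dunklV.
rewrite (E xi eta) (E eta xi); apply: (congr1 (fun f => V f x)).
by apply/funext => y; exact: pd_comm.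
Qed.

Lemma Vhomog_pre n q : homog n q -> exists2 p, homog n p & V p = q.
Proof.
move=> hq; have [p pp Vp] := Vsurj (homog_polyfun hq).
have [d [P [hP pE]]] := homog_decomp pp.
have PP j : polyfun (P j) := homog_polyfun (hP j).
have VE x : q x = \sum_(j < d) V (P j) x.
  by rewrite -Vp pE V_sum// => i _.
have Z j : (j < d)%N -> j <> n -> P j = fun=> 0.
  move=> jd jn; apply: Vinj0 => //; apply/funext => x.
  exact: (homog_unique_decomp (fun j => Vhomog (hP j)) (fun c y => homog_scale c y hq) VE).
exists p => //; case: (ltnP n d) => nd.
  apply: homog_ext (hP n) => x; rewrite pE (bigD1 (Ordinal nd))//= big1 ?addr0// => i ni.
  by rewrite Z//; apply/eqP.
rewrite pE; apply: homog_ext (@homog0 R N n) => x; rewrite big1// => i _; rewrite Z// => ni.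
by move: (ltn_ord i); rewrite ni ltnNge nd.
Qed.

Lemma dunkl_homog n xi q : homog n q -> homog n.-1 (T xi q).
Proof.
move=> /Vhomog_pre[p hp <-]; apply: homog_ext (Vhomog (homog_pd xi hp)) => x.
by rewrite dunklV//; exact: homog_polyfun hp.
Qed.

Lemma dunkl_homog0 xi q x : homog 0 q -> T xi q x = 0.
Proof.
move=> /Vhomog_pre[p hp <-]; rewrite dunklV; last exact: homog_polyfun hp.
by rewrite homog_pd0// V_zero.
Qed.

(** Pulled back through V, the hypothesis says that all partial derivatives vanish, and Euler's
    identity concludes. This is the tool for proving identities by induction on the degree. *)
Lemma dunkl_kernel n q : homog n.+1 q -> (forall i, T (e i) q = fun=> 0) -> q = fun=> 0.
Proof.
move=> /Vhomog_pre[p hp <-] H; have pp := homog_polyfun hp.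
suff -> : p = fun=> 0 by rewrite V_zero.
apply/funext => x; have := homog_euler x hp.
rewrite pd_coordE ?big1// => [|i _].
  by move/esym/eqP; rewrite mulf_eq0 pnatr_eq0/= => /eqP.
suff -> : (pd (e i) p) = fun=> 0 by rewrite mulr0.
apply: Vinj0; first exact: polyfun_pd.
by apply/funext => y; rewrite -dunklV// H.
Qed.

Lemma Dk_ext p q x : p =1 q -> Dk p x = Dk q x.
Proof. by move=> /funext ->. Qed.

Lemma Dk_poly q : polyfun q -> polyfun (Dk q).
Proof. by move=> pq; apply: polyfun_sum => i; do 2 apply: dunkl_poly. Qed.

Lemma Dk_cst (c : R) x : Dk (fun=> c) x = 0.
Proof.
rewrite /DkL big1// => i _; apply: etrans (dunkl_cst Rp k (e i) 0 x).
by apply: dunkl_ext => y; rewrite dunkl_cst.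
Qed.

Lemma DkD p q x : polyfun p -> polyfun q -> Dk (fun x => p x + q x) x = Dk p x + Dk q x.
Proof.
move=> pp pq; rewrite /DkL -big_split/=; apply: eq_bigr => i _.
rewrite -dunklD; try exact: dunkl_poly.
by apply: dunkl_ext => y; rewrite dunklD.
Qed.

Lemma DkZ (c : R) q x : polyfun q -> Dk (fun x => c * q x) x = c * Dk q x.
Proof.
move=> pq; rewrite /DkL mulr_sumr; apply: eq_bigr => i _.
rewrite -dunklZ; last exact: dunkl_poly.
by apply: dunkl_ext => y; rewrite dunklZ.
Qed.

Lemma Dk_sum (I : eqType) (r : seq I) (F : I -> vec -> R) x :
  (forall i, i \in r -> polyfun (F i)) ->
  Dk (fun y => \sum_(i <- r) F i y) x = \sum_(i <- r) Dk (F i) x.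
Proof.
elim: r => [|a r IH] H.
  rewrite big_nil; apply: etrans (Dk_cst 0 x).
  by apply: Dk_ext => y; rewrite big_nil.
have H' : forall i, i \in r -> polyfun (F i) by move=> i ir; apply: H; rewrite inE ir orbT.
rewrite big_cons -IH//; apply: etrans (DkD x (H a (mem_head _ _)) (polyfun_sum_seq H')).
by apply: Dk_ext => y; rewrite big_cons.
Qed.

Lemma Dk_dunkl xi q x : polyfun q -> Dk (T xi q) x = T xi (Dk q) x.
Proof.
move=> pq; rewrite dunkl_sum; last by move=> i _; do 2 apply: dunkl_poly.
rewrite /DkL; apply: eq_bigr => i _; rewrite [RHS]dunkl_comm; last exact: dunkl_poly.
by apply: dunkl_ext => y; rewrite dunkl_comm.
Qed.

Lemma Dk_homog n q : homog n q -> homog n.-2 (Dk q).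
Proof. by move=> hq; apply: homog_sum => i; do 2 apply: dunkl_homog. Qed.

Lemma Dk_homog01 n q x : homog n q -> (n <= 1)%N -> Dk q x = 0.
Proof.
move=> hq n1; rewrite /DkL big1// => i _.
by apply: dunkl_homog0; move: (dunkl_homog (e i) hq); case: n n1 {hq} => [|[|]].
Qed.

Lemma dotv_refl_inv a (y : vec) : a \in Rp -> dotv (y *m reflmx a) (y *m reflmx a) = dotv y y.
Proof. by move=> aR; rewrite dotv_reflmx mul_reflmxK//; exact: (Rp2 hRs hRp). Qed.

Lemma dunkl_normsq xi q x : polyfun q ->
  T xi (fun y => dotv y y * q y) x = dotv x x * T xi q x + 2 * (dotv x xi * q x).
Proof.
move=> pq; rewrite (dunkl_mul_inv k hRs hRp)//; last 2 first.
- exact: polyfun_dotvv.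
- by move=> a y; exact: dotv_refl_inv.
by rewrite pd_dotvv mulrA.
Qed.

(** The sl(2) relation: the commutator of the Dunkl Laplacian with |x|^2 is 4 times the Euler
    operator plus 2 [cc]. The reflection terms combine because each root has squared length 2. *)
Lemma Dk_normsq q x : polyfun q ->
  Dk (fun y => dotv y y * q y) x = dotv x x * Dk q x + 4 * pd x q x + 2 * cc * q x.
Proof.
move=> pq; have pT xi := dunkl_poly xi pq.
have step i : T (e i) (T (e i) (fun y => dotv y y * q y)) x =
    dotv x x * T (e i) (T (e i) q) x + 4 * (x ord0 i * T (e i) q x) + 2 * q x +
    \sum_(a <- Rp) 2 * k a * (a ord0 i * a ord0 i) * q (x *m reflmx a).
  have -> : T (e i) (T (e i) (fun y => dotv y y * q y)) x =
      T (e i) (fun y => dotv y y * T (e i) q y + 2 * (dotv y (e i) * q y)) x.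
    by apply: dunkl_ext => y; rewrite dunkl_normsq.
  have pX : polyfun (fun y => dotv y (e i) * q y) by apply: polyfunM => //; exact: polyfun_dotv.
  rewrite dunklD; last 2 first.
  - by apply: polyfunM => //; exact: polyfun_dotvv.
  - exact: polyfunZ.
  rewrite dunkl_normsq// dunklZ// dunkl_mul_dotv// !dotv_delta.
  rewrite [(delta_mx _ _) _ _]mxE !eqxx/=.
  have -> : \sum_(a <- Rp) k a * dotv a (e i) * dotv a (e i) * q (x *m reflmx a) =
     \sum_(a <- Rp) k a * (a ord0 i * a ord0 i) * q (x *m reflmx a).
    by apply: eq_bigr => a _; rewrite dotv_delta mulrA.
  have -> : \sum_(a <- Rp) 2 * k a * (a ord0 i * a ord0 i) * q (x *m reflmx a) =
     2 * \sum_(a <- Rp) k a * (a ord0 i * a ord0 i) * q (x *m reflmx a).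
    by rewrite mulr_sumr; apply: eq_bigr => a _; rewrite !mulrA.
  move: (\sum_(a <- Rp) _) (T _ q x) (T _ (T _ q) x) => A B C; ring.
rewrite {1}/DkL (eq_bigr _ (fun i _ => step i)) !big_split/= -mulr_sumr -mulr_sumr.
rewrite -dunkl_dirE// dunkl_euler sumr_const card_ord exchange_big/=.
have -> : \sum_(a <- Rp) \sum_(i < N) 2 * k a * (a ord0 i * a ord0 i) * q (x *m reflmx a) =
   4 * \sum_(a <- Rp) k a * q (x *m reflmx a).
  rewrite mulr_sumr big_seq [RHS]big_seq; apply: eq_bigr => a aR.
  rewrite -mulr_suml -mulr_sumr -dotvE (Rp2 hRs hRp aR); ring.
under [\sum_(a <- Rp) k a * (_ - _)]eq_bigr do rewrite mulrBr.
rewrite sumrB -mulr_suml.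
rewrite ccE /gam -[_ *+ N]mulr_natr -/(DkL Rp k q x).
move: (\sum_(i <- Rp) k i * q (x *m reflmx i)) (\sum_(i <- Rp) k i) (DkL Rp k q x) => A B C.
ring.
Qed.

(** Expand the commutation of the Laplacian with T_xi on |y|^2 r using the |y|^2 rules on both
    sides. For homogeneous r, everything cancels except the claimed commutator. *)
Lemma Dk_dotv xi q x : polyfun q ->
  Dk (fun y => dotv y xi * q y) x = dotv x xi * Dk q x + 2 * T xi q x.
Proof.
have key n r : homog n r -> Dk (fun y => dotv y xi * r y) x = dotv x xi * Dk r x + 2 * T xi r x.
  move=> hr; have pr := homog_polyfun hr; have pT := dunkl_poly xi pr.
  have pX : polyfun (fun y => dotv y xi * r y) by apply: polyfunM => //; exact: polyfun_dotv.
  have pS p : polyfun p -> polyfun (fun y => dotv y y * p y).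
    by move=> pp; apply: polyfunM => //; exact: polyfun_dotvv.
  have := Dk_dunkl xi x (pS _ pr).
  have -> : Dk (T xi (fun y => dotv y y * r y)) x =
     Dk (fun y => dotv y y * T xi r y + 2 * (dotv y xi * r y)) x.
    by apply: Dk_ext => y; rewrite dunkl_normsq.
  rewrite DkD; [|exact: pS|exact: polyfunZ].
  rewrite DkZ// Dk_normsq// (homog_euler x (dunkl_homog xi hr)).
  have -> : T xi (Dk (fun y => dotv y y * r y)) x =
      T xi (fun y => dotv y y * Dk r y + (4 * n%:R + 2 * cc) * r y) x.
    by apply: dunkl_ext => y; rewrite Dk_normsq// (homog_euler y hr); ring.
  rewrite dunklD; [|by apply: pS; exact: Dk_poly|exact: polyfunZ].
  rewrite dunklZ// dunkl_normsq; last exact: Dk_poly.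
  rewrite Dk_dunkl//.
  have En : n.-1%:R * T xi r x = (n%:R - 1) * T xi r x.
    case: n hr => [hr|n hr]; first by rewrite (dunkl_homog0 xi x hr) !mulr0.
    by rewrite -[n.+1%:R]natr1 addrK.
  rewrite En; lra.
move=> pq; have [d [P [hP ->]]] := homog_decomp pq.
have PP j : polyfun (P j) := homog_polyfun (hP j).
have -> : Dk (fun y => dotv y xi * \sum_(j < d) P j y) x =
   Dk (fun y => \sum_(j < d) dotv y xi * P j y) x.
  by apply: Dk_ext => y; rewrite mulr_sumr.
rewrite Dk_sum; last by move=> j _; apply: polyfunM => //; exact: polyfun_dotv.
rewrite Dk_sum// dunkl_sum// !mulr_sumr -big_split/=; apply: eq_bigr => j _.
exact: key (hP j).
Qed.

Definition lap q x : R := \sum_(i < N) pd (e i) (pd (e i) q) x.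

(** Contribution of one root to the Dunkl Laplacian; the value on the reflecting hyperplane is the
    second derivative along the root, the limit of the other branch. *)
Definition rpart a q x : R := if dotv a x == 0 then pd a (pd a q) x else
  2 * (pd a q x / dotv a x - (q x - q (x *m reflmx a)) / dotv a x ^+ 2).

Lemma pd2D v p q x : polyfun p -> polyfun q ->
  pd v (pd v (fun x => p x + q x)) x = pd v (pd v p) x + pd v (pd v q) x.
Proof.
move=> pp pq; rewrite -(pdD _ _ (polyfun_pd v pp) (polyfun_pd v pq)).
by apply: eq_pd => y; rewrite pdD.
Qed.

Lemma pd2_dotv xi q x v : polyfun q ->
  pd v (pd v (fun z => dotv z xi * q z)) x =
  dotv x xi * pd v (pd v q) x + 2 * (dotv v xi * pd v q x).
Proof.
move=> pq; have pX := polyfun_dotv xi.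
have pdq := polyfun_pd v pq.
have -> : (pd v (fun z => dotv z xi * q z)) =
    (fun y => dotv v xi * q y + dotv y xi * pd v q y).
  apply/funext => y.
  by rewrite (pdM _ _ pX pq) pd_dotv.
rewrite (pdD _ _ (polyfunZ (dotv v xi) pq) (polyfunM pX pdq)).
rewrite (pdZ _ _ _ pq).
by rewrite (pdM _ _ pX pdq) pd_dotv; ring.
Qed.

Lemma lapD p q x : polyfun p -> polyfun q ->
  lap (fun x => p x + q x) x = lap p x + lap q x.
Proof.
by move=> pp pq; rewrite /lap -big_split/=; apply: eq_bigr => i _; exact: pd2D.
Qed.

Lemma lap_dotv xi q x : polyfun q ->
  lap (fun y => dotv y xi * q y) x = dotv x xi * lap q x + 2 * pd xi q x.
Proof.
move=> pq; rewrite [pd xi q x]pd_coordE// /lap !mulr_sumr -big_split/=; apply: eq_bigr => i _.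
by rewrite pd2_dotv// [dotv (e i) xi]dotvC dotv_delta.
Qed.

Lemma rpartD a p q x : polyfun p -> polyfun q ->
  rpart a (fun x => p x + q x) x = rpart a p x + rpart a q x.
Proof.
move=> pp pq; rewrite /rpart; case: ifPn => ax; first by rewrite pd2D.
by rewrite pdD//; field.
Qed.

Lemma rpart_dotv a xi q x : polyfun q ->
  rpart a (fun y => dotv y xi * q y) x = dotv x xi * rpart a q x + 2 * (dotv a xi * dquot a q x).
Proof.
move=> pq; rewrite /rpart /dquot; case: ifPn => ax; first by rewrite pd2_dotv.
rewrite (pdM _ _ (polyfun_dotv xi) pq) pd_dotv.
have -> : dotv (x *m reflmx a) xi = dotv x xi - dotv a x * dotv a xi.
  by rewrite mul_reflmx dotvBl dotvZl [dotv x a]dotvC.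
by field.
Qed.

(** Both sides vanish on constants, are additive, and have the same commutator with a coordinate
    ([Dk_dotv] against [lap_dotv] and [rpart_dotv]), so [polyfun_ind] applies. *)
Lemma Dk_formula q : polyfun q -> forall x,
  Dk q x = lap q x + \sum_(a <- Rp) k a * rpart a q x.
Proof.
move: q; apply: polyfun_ind => [c x|p q pp pq IHp IHq x|i p pp IH x].
- have E v : pd v (fun=> c) = fun=> 0 by apply/funext => y; rewrite pd_cst.
  rewrite Dk_cst /lap /rpart !big1 ?addr0// => [a _|i _]; last by rewrite E pd_cst.
  by rewrite E !pd_cst subrr !mul0r subrr mulr0; case: ifP; rewrite mulr0.
- rewrite DkD// IHp IHq lapD// addrACA; apply: (congr1 (fun z => _ + z)); rewrite -big_split/=.
  by apply: eq_bigr => a _; rewrite rpartD// mulrDr.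
- rewrite [LHS](_ : _ = Dk (fun x => dotv x (e i) * p x) x); last first.
    by apply: Dk_ext => y; rewrite dotv_delta.
  have -> : lap (fun x => x ord0 i * p x) x = lap (fun x => dotv x (e i) * p x) x.
    by apply: (congr1 (fun f => lap f x)); apply/funext => y; rewrite dotv_delta.
  have -> : \sum_(a <- Rp) k a * rpart a (fun x => x ord0 i * p x) x =
     \sum_(a <- Rp) (dotv x (e i) * (k a * rpart a p x) + 2 * (k a * dotv a (e i) * dquot a p x)).
    apply: eq_bigr => a _.
    have -> : (fun x => x ord0 i * p x) = (fun x => dotv x (e i) * p x).
      by apply/funext => y; rewrite dotv_delta.
    rewrite rpart_dotv//; ring.
  rewrite Dk_dotv// lap_dotv// big_split/= -!mulr_sumr IH dunklE.
  move: (\sum_(a <- Rp) _) (\sum_(a <- Rp) _) => A B; ring.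
Qed.

(** Maximum principle. At a global minimum the gradient vanishes, pure second derivatives are
    nonnegative, and q(x) minus its reflected value is nonpositive. In [Dk_formula] every root term
    is then nonnegative, as k >= 0. *)
Lemma Dk_min_ge0 q x : polyfun q -> (forall y, q x <= q y) -> 0 <= Dk q x.
Proof.
move=> pq qmin; rewrite Dk_formula//.
have H v : pd v q x = 0 /\ 0 <= pd v (pd v q) x.
  have [P hP] := pd_line2 pq x v.
  have [E0 E1 E2] := hP 0; rewrite scale0r addr0 in E0 E1 E2.
  rewrite E1 E2; apply: horner_min0 => t.
  by rewrite -E0; have [<- _ _] := hP t.
apply: addr_ge0; first by apply: sumr_ge0 => i _; exact: (H _).2.
rewrite big_seq; apply: sumr_ge0 => a aR; apply: mulr_ge0; first exact: (k_ge0 hRp hk).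
rewrite /rpart; case: ifPn => ax; first exact: (H _).2.
rewrite (H a).1 mul0r sub0r mulr_ge0// oppr_ge0 mulr_le0_ge0 ?invr_ge0 ?sqr_ge0//.
by rewrite subr_le0.
Qed.

End Intertwiner.

                                                      

(** * Compactness of Euclidean balls *)

Section Balls.
Variables (R : realType) (N : nat).
Local Notation vec := 'rV[R]_N.
Implicit Types (x : vec).

Lemma coord_sqr_le x i : x ord0 i ^+ 2 <= dotv x x.
Proof.
rewrite dotvE (bigD1 i)//= -expr2 lerDl; apply: sumr_ge0 => j _.
by rewrite -expr2 sqr_ge0.
Qed.

Lemma coord_norm_le (r : R) x i : 0 <= r -> dotv x x <= r ^+ 2 -> `|x ord0 i| <= r.
Proof.
move=> r0 xr; rewrite -(ler_pXn2r (n := 2))// ?nnegrE//.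
by rewrite real_normK ?num_real//; apply: le_trans (coord_sqr_le x i) xr.
Qed.

Lemma mx_norm_le_coord (r : R) x : 0 <= r -> (forall i, `|x ord0 i| <= r) -> `|x| <= r.
Proof.
move=> r0 H; rewrite [leLHS]/Num.norm /= mx_normrE.
by apply/bigmax_leP; split => // -[a b] _ /=; rewrite (ord1 a).
Qed.

Lemma compact_ball (r : R) : compact [set x : vec | dotv x x <= r ^+ 2].
Proof.
apply: bounded_closed_compact; last first.
  have := @preimage_closed _ _ (fun x : vec => dotv x x) [set t | t <= r ^+ 2].
  move=> /(_ _ (@closed_le R (r ^+ 2))); apply => x _.
  by apply: polyfun_continuous; exact: polyfun_dotvv.
exists `|r|; split; first exact: num_real.
move=> M rM x /= xr; apply: mx_norm_le_coord => [|i].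
  by apply: le_trans (normr_ge0 r) (ltW rM).
apply: le_trans (ltW rM); apply: coord_norm_le => //.
by rewrite real_normK ?num_real.
Qed.

Lemma ball_nonempty (r : R) : [set x : vec | dotv x x <= r ^+ 2] !=set0.
Proof. by exists 0; rewrite /= dotv0l sqr_ge0. Qed.

Lemma ball_bounded (f : vec -> R) (r : R) : continuous f ->
  exists2 C, 0 <= C & forall x, dotv x x <= r ^+ 2 -> `|f x| <= C.
Proof.
move=> cf.
have cf' : continuous (fun x => `|f x|).
  by move=> x; apply: (continuous_comp (cf x)); exact: norm_continuous.
have [c _ H] := @EVT_max_rV R N (fun x => `|f x|) _ (ball_nonempty r) (@compact_ball r) (continuous_subspaceT cf').
by exists `|f c| => // x xr; apply: H; rewrite inE.
Qed.

Lemma ball_min (f : vec -> R) (r : R) : continuous f ->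
  exists2 c, dotv c c <= r ^+ 2 & forall x, dotv x x <= r ^+ 2 -> f c <= f x.
Proof.
move=> cf.
have [c cr H] := @EVT_min_rV R N f _ (ball_nonempty r) (@compact_ball r) (continuous_subspaceT cf).
rewrite inE in cr.
by exists c => // x xr; apply: H; rewrite inE.
Qed.

Lemma dotv_scale2 (r : R) x : dotv (r *: x) (r *: x) = r ^+ 2 * dotv x x.
Proof. by rewrite dotvZl dotvZr expr2 mulrA. Qed.

Lemma polar x : x != 0 -> exists s u, [/\ 0 < s, dotv u u = 1, x = s *: u & s ^+ 2 = dotv x x].
Proof.
move=> x0; have d0 := dotv_gt0 x0.
exists (Num.sqrt (dotv x x)), ((Num.sqrt (dotv x x))^-1 *: x).
have s0 : 0 < Num.sqrt (dotv x x) by rewrite sqrtr_gt0.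
rewrite dotv_scale2 exprVn sqr_sqrtr ?(ltW d0)// mulVf ?gt_eqF// scalerA divff ?gt_eqF// scale1r.
by [].
Qed.

End Balls.

(** * Spherical means defined by Pizzetti's series *)

Section Mean.
Variables (R : realType) (N : nat).
Local Notation vec := 'rV[R]_N.
Implicit Types (p q : vec -> R) (x v xi : vec).
Variables (Rs Rp : seq vec) (k : vec -> R) (V : (vec -> R) -> (vec -> R)).
Hypotheses (hRs : root_system Rs) (hRp : positive_subsystem Rs Rp)
  (hk : multiplicity Rs k) (hV : poly_intertwiner Rp k V).
Local Notation T := (dunkl Rp k).
Local Notation Dk := (DkL Rp k).
Local Notation cc := (cc Rp k).
Local Notation e i := (delta_mx ord0 i : vec).

Lemma gam_ge0 : 0 <= gam Rp k.
Proof. by rewrite /gam big_seq sumr_ge0// => a /(k_ge0 hRp hk). Qed.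

Definition iDk n q : vec -> R := iter n Dk q.

Lemma iDkS n q : iDk n.+1 q = Dk (iDk n q). Proof. by []. Qed.
Lemma iDkSr n q : iDk n.+1 q = iDk n (Dk q). Proof. by rewrite /iDk iterSr. Qed.

Lemma iDk_poly n q : polyfun q -> polyfun (iDk n q).
Proof. by move=> pq; elim: n => // n IH; exact: (Dk_poly hV). Qed.

Lemma iDkD n p q x : polyfun p -> polyfun q ->
  iDk n (fun x => p x + q x) x = iDk n p x + iDk n q x.
Proof.
move=> pp pq; elim: n x => // n IH x; rewrite !iDkS -(DkD hV); try exact: iDk_poly.
by apply: Dk_ext => y; rewrite IH.
Qed.

Lemma iDkZ n (c : R) q x : polyfun q -> iDk n (fun x => c * q x) x = c * iDk n q x.
Proof.
move=> pq; elim: n x => // n IH x; rewrite !iDkS -(DkZ hV); try exact: iDk_poly.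
by apply: Dk_ext => y; rewrite IH.
Qed.

Lemma iDk_zero n x : iDk n (fun=> 0) x = 0.
Proof.
by elim: n x => // n IH x; rewrite iDkS -[RHS](Dk_cst Rp k 0 x); apply: Dk_ext => y; rewrite IH.
Qed.

Lemma iDk_ext n p q x : p =1 q -> iDk n p x = iDk n q x.
Proof. by move=> /funext ->. Qed.

Lemma iDk_sum n (I : eqType) (r : seq I) (F : I -> vec -> R) x :
  (forall i, i \in r -> polyfun (F i)) ->
  iDk n (fun y => \sum_(i <- r) F i y) x = \sum_(i <- r) iDk n (F i) x.
Proof.
elim: r => [|a r IH] H.
  rewrite big_nil; apply: etrans (iDk_zero n x).
  by apply: iDk_ext => y; rewrite big_nil.
have H' : forall i, i \in r -> polyfun (F i) by move=> i ir; apply: H; rewrite inE ir orbT.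
rewrite big_cons -IH//; apply: etrans (iDkD n x (H a (mem_head _ _)) (polyfun_sum_seq H')).
by apply: iDk_ext => y; rewrite big_cons.
Qed.

Lemma iDk_homog n m q : homog m q -> homog (m - n.*2) (iDk n q).
Proof.
move=> hq; elim: n => [|n IH]; first by rewrite subn0.
rewrite iDkS (_ : (m - n.+1.*2)%N = (m - n.*2).-2); last by lia.
exact: (Dk_homog hV).
Qed.

Lemma iDk_homog_high n m q x : homog m q -> (m < n.*2)%N -> iDk n q x = 0.
Proof.
elim: n m q => // n IH m q hq mn; rewrite iDkSr.
case: m hq mn => [|[|m]] hq mn; last first.
- by apply: (IH m); [exact: (Dk_homog hV hq)|move: mn; rewrite doubleS].
- rewrite -[RHS](iDk_zero n x); apply: iDk_ext => y; exact: (Dk_homog01 hV _ hq).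
- rewrite -[RHS](iDk_zero n x); apply: iDk_ext => y; exact: (Dk_homog01 hV _ hq).
Qed.

Lemma iDk_homog_at0 n m q : homog m q -> m <> n.*2 -> iDk n q 0 = 0.
Proof.
move=> hq mn; case: (ltnP m n.*2) => mn2; first exact: (iDk_homog_high 0 hq).
have := iDk_homog n hq; case E : (m - n.*2)%N => [|j]; last exact: homog_at0.
by exfalso; apply: mn; apply/eqP; rewrite eqn_leq mn2 andbT -subn_eq0 E.
Qed.

(** Pizzetti coefficients in dimension [cc]: the inverse of 4^n n! times the rising factorial of
    [cc]/2 of length n. *)
Definition bco n : R := \prod_(j < n) (2 * j.+1%:R * (cc + 2 * j%:R))^-1.

Lemma bco0 : bco 0 = 1. Proof. by rewrite /bco big_ord0. Qed.

                                                                              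
(** [Pk q], as a polynomial in r, is the mean of q over the sphere of radius r for the Dunkl weight,
    written as Pizzetti's series. The algebraic definition avoids integrating against the weight;
    every coefficient is prescribed, so the choice operator has nothing to choose. *)
Definition isPk q (P : {poly R}) := forall n,
  P`_n = if odd n then 0 else bco n./2 * iDk n./2 q 0.
Definition Pk q : {poly R} := xget 0 [set P | isPk q P].

Lemma isPk_exists q : polyfun q -> exists P, isPk q P.
Proof.
move=> /homog_decomp[d [Q [hQ ->]]].
exists (\poly_(n < d) if odd n then 0 else bco n./2 * iDk n./2 (Q n) 0) => n.
have pQ j : polyfun (Q j) := homog_polyfun (hQ j).
rewrite coef_poly; case: (boolP (odd n)) => on; first by rewrite if_same.
rewrite iDk_sum//.
have no : n = n./2.*2 by rewrite -[LHS]odd_double_half (negbTE on).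
case: ltnP => nd.
  rewrite (bigD1 (Ordinal nd))//= big1 ?addr0// => i ni.
  apply: (iDk_homog_at0 (hQ i)) => iE; move/eqP: ni; apply.
  by apply: val_inj; rewrite /= iE -no.
rewrite big1 ?mulr0// => i _; apply: (iDk_homog_at0 (hQ i)) => iE.
by move: (ltn_ord i); rewrite iE -no ltnNge nd.
Qed.

Lemma coefPk q n : polyfun q -> (Pk q)`_n = if odd n then 0 else bco n./2 * iDk n./2 q 0.
Proof. by move=> /isPk_exists[P hP]; exact: (xgetI 0 (hP : [set P | isPk q P] P)). Qed.

Lemma PkD p q : polyfun p -> polyfun q -> Pk (fun x => p x + q x) = Pk p + Pk q.
Proof.
move=> pp pq; apply/polyP => n; rewrite coefD !coefPk//; last exact: polyfunD.
by case: ifP; rewrite ?addr0// iDkD// mulrDr.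
Qed.

Lemma PkZ (c : R) q : polyfun q -> Pk (fun x => c * q x) = c *: Pk q.
Proof.
move=> pq; apply/polyP => n; rewrite coefZ !coefPk//; last exact: polyfunZ.
by case: ifP; rewrite ?mulr0// iDkZ// mulrCA.
Qed.

Lemma Pk_homog m q : homog m q ->
  Pk q = (if odd m then 0 else bco m./2 * iDk m./2 q 0) *: 'X^m.
Proof.
move=> hq; apply/polyP => n; rewrite coefPk ?coefZ ?coefXn; last exact: homog_polyfun hq.
case: (eqVneq n m) => [->|nm]; first by rewrite mulr1.
rewrite mulr0; case: ifPn => // on; rewrite (iDk_homog_at0 hq) ?mulr0// => mE.
by move/eqP: nm; apply; rewrite mE -[LHS]odd_double_half (negbTE on).
Qed.

Lemma Pk_cst (c : R) : Pk (fun=> c) = c%:P.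
Proof.
by rewrite (Pk_homog (@homog_cst R N c)) /= bco0 mul1r expr0 alg_polyC.
Qed.

Lemma Pk_sum (I : eqType) (r : seq I) (F : I -> vec -> R) :
  (forall i, i \in r -> polyfun (F i)) ->
  Pk (fun y => \sum_(i <- r) F i y) = \sum_(i <- r) Pk (F i).
Proof.
move=> H; apply/polyP => n; rewrite coef_sum coefPk; last exact: polyfun_sum_seq.
rewrite iDk_sum// big_seq [RHS]big_seq.
case: ifPn => on.
  by rewrite big1// => i ir; rewrite coefPk ?on//; exact: H.
by rewrite mulr_sumr; apply: eq_bigr => i ir; rewrite coefPk ?(negbTE on)//; exact: H.
Qed.

Hypothesis hN : (0 < N)%N.

Lemma cc_gt0 : 0 < cc.
Proof. by rewrite ltr_pwDl ?ltr0n// mulr_ge0// gam_ge0. Qed.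

Lemma bco_fact_neq0 (j : nat) : 2 * j.+1%:R * (cc + 2 * j%:R) != 0.
Proof.
by rewrite gt_eqF// mulr_gt0// ?mulr_gt0 ?ltr0n// ltr_pwDl ?cc_gt0// mulr_ge0 ?ler0n.
Qed.

Lemma bcoS n : bco n = 2 * n.+1%:R * (cc + 2 * n%:R) * bco n.+1.
Proof. by rewrite /bco big_ord_recr/= mulrCA divff ?mulr1// bco_fact_neq0. Qed.

Lemma bco_gt0 n : 0 < bco n.
Proof.
apply: prodr_gt0 => j _; rewrite invr_gt0 mulr_gt0// ?mulr_gt0 ?ltr0n// ltr_pwDl ?cc_gt0//.
Qed.

Lemma iDk_normsq n m q x : homog m q ->
  iDk n (fun y => dotv y y * q y) x = dotv x x * iDk n q x +
    2 * n%:R * (2 * m%:R - 2 * (n%:R - 1) + cc) * iDk n.-1 q x.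
Proof.
move=> hq; have pq := homog_polyfun hq.
elim: n x => [x|n IH x]; first by rewrite /= !(mulr0, mul0r) addr0.
rewrite iDkS (Dk_ext Rp k (q := fun x => dotv x x * iDk n q x +
    (2 * n%:R * (2 * m%:R - 2 * (n%:R - 1) + cc)) * iDk n.-1 q x)) //.
have pn := iDk_poly n pq.
rewrite (DkD hV); last 2 first.
- by apply: polyfunM => //; exact: polyfun_dotvv.
- by apply: polyfunZ; exact: iDk_poly.
rewrite (DkZ hV); last exact: iDk_poly.
rewrite (Dk_normsq hRs hRp hV)//.
have -> : pd x (iDk n q) x = (m%:R - 2 * n%:R) * iDk n q x.
  case: (ltnP m n.*2) => mn.
    have Z : iDk n q = fun=> 0 by apply/funext => y; exact: (iDk_homog_high _ hq mn).
    by rewrite Z pd_cst mulr0.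
  by rewrite (homog_euler _ (iDk_homog n hq)) natrB// -mul2n natrM.
have -> : 2 * n%:R * (2 * m%:R - 2 * (n%:R - 1) + cc) * Dk (iDk n.-1 q) x =
          2 * n%:R * (2 * m%:R - 2 * (n%:R - 1) + cc) * iDk n q x.
  by case: n {IH pn} => [|n]; rewrite ?mulr0 ?mul0r// iDkS.
rewrite /= -iDkS -[n.+1%:R]natr1; ring.
Qed.

(** On the sphere of radius r the factor |y|^2 is the constant r^2. For a homogeneous q this amounts
    to [iDk_normsq] at 0 and the recursion of [bco]. *)
Lemma Pk_normsq q : polyfun q -> Pk (fun y => dotv y y * q y) = 'X^2 * Pk q.
Proof.
have key m r : homog m r -> Pk (fun y => dotv y y * r y) = 'X^2 * Pk r.
  move=> hr; rewrite (Pk_homog hr) (Pk_homog (homogM (@homog_dotvv R N) hr)) -scalerAr -exprD.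
  congr (_ *: _); rewrite /= negbK; case: ifPn => // om.
  rewrite add0n -iDkS (iDk_normsq _ _ hr) dotv0l mul0r add0r /= [in RHS]bcoS.
  rewrite add0n in om.
  have mE : m%:R = 2 * m./2%:R :> R.
    by rewrite -{1}[m]odd_double_half (negbTE om) add0n -mul2n natrM.
  rewrite mE -[m./2.+1%:R]natr1; ring.
move=> /homog_decomp[d [Q [hQ ->]]].
have pQ j : polyfun (Q j) := homog_polyfun (hQ j).
have -> : (fun y => dotv y y * \sum_(j < d) Q j y) = (fun y => \sum_(j < d) dotv y y * Q j y).
  by apply/funext => y; rewrite mulr_sumr.
rewrite Pk_sum; last by move=> i _; apply: polyfunM => //; exact: polyfun_dotvv.
rewrite Pk_sum// mulr_sumr; apply: eq_bigr => j _; exact: key (hQ j).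
Qed.

Lemma iDk_dunkl n xi q x : polyfun q -> iDk n (T xi q) x = T xi (iDk n q) x.
Proof.
move=> pq; elim: n x => // n IH x; rewrite !iDkS -(Dk_dunkl hV); last exact: iDk_poly.
exact: Dk_ext.
Qed.

Lemma iDk_dotv n xi q x : polyfun q ->
  iDk n (fun y => dotv y xi * q y) x = dotv x xi * iDk n q x + 2 * n%:R * T xi (iDk n.-1 q) x.
Proof.
move=> pq; elim: n x => [x|n IH x]; first by rewrite /= mulr0 mul0r addr0.
rewrite iDkS (Dk_ext Rp k (q := fun x => dotv x xi * iDk n q x +
    (2 * n%:R) * T xi (iDk n.-1 q) x)) //.
have pn := iDk_poly n pq.
rewrite (DkD hV); last 2 first.
- by apply: polyfunM => //; exact: polyfun_dotv.
- by apply: polyfunZ; apply: (dunkl_poly hV); exact: iDk_poly.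
rewrite (DkZ hV); last by apply: (dunkl_poly hV); exact: iDk_poly.
rewrite (Dk_dotv hRs hRp hV)//.
have -> : 2 * n%:R * Dk (T xi (iDk n.-1 q)) x = 2 * n%:R * T xi (iDk n q) x.
  case: n {IH pn} => [|n]; first by rewrite mulr0 !mul0r.
  by rewrite (Dk_dunkl hV)//; exact: iDk_poly.
rewrite /= -iDkS -[n.+1%:R]natr1; ring.
Qed.

(** Integration by parts on the sphere, read off on coefficients: the mean of a linear form times q
    is a weighted antiderivative of the mean of T_xi q. *)
Lemma Pk_dotv xi q n : polyfun q ->
  (Pk (fun y => dotv y xi * q y))`_n.+2 = (Pk (T xi q))`_n / (cc + n%:R).
Proof.
move=> pq; have pX : polyfun (fun y => dotv y xi * q y) by apply: polyfunM => //; exact: polyfun_dotv.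
rewrite !coefPk//; last exact: (dunkl_poly hV).
rewrite /= negbK; case: ifPn => on; first by rewrite mul0r.
rewrite -iDkS iDk_dotv// dotv0l mul0r add0r -iDk_dunkl// [bco n./2]bcoS.
have nE : n%:R = 2 * n./2%:R :> R.
  by rewrite -{1}[n]odd_double_half (negbTE on) add0n -mul2n natrM.
rewrite nE; have c0 : cc + 2 * n./2%:R != 0.
  by rewrite gt_eqF// ltr_pwDl ?cc_gt0// mulr_ge0 ?ler0n.
by field.
Qed.

Lemma Pk_dotv01 xi q n : polyfun q -> (n <= 1)%N -> (Pk (fun y => dotv y xi * q y))`_n = 0.
Proof.
move=> pq n1; rewrite coefPk; last by apply: polyfunM => //; exact: polyfun_dotv.
case: n n1 => [|[|]]//= _; by rewrite dotv0l mul0r mulr0.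
Qed.

Lemma Pk_comp_scale (r : R) q : polyfun q -> Pk (fun x => q (r *: x)) = Pk q \Po (r *: 'X).
Proof.
move=> /homog_decomp[d [Q [hQ ->]]].
have pQ j : polyfun (Q j) := homog_polyfun (hQ j).
have -> : (fun x => \sum_(j < d) Q j (r *: x)) = (fun x => \sum_(j < d) r ^+ j * Q j x).
  by apply/funext => x; apply: eq_bigr => j _; rewrite (homog_scale _ _ (hQ j)).
rewrite Pk_sum; last by move=> i _; exact: polyfunZ.
rewrite Pk_sum// linear_sum/=; apply: eq_bigr => j _.
rewrite PkZ// (Pk_homog (hQ j)) comp_polyZ comp_Xn_poly exprZn !scalerA mulrC.
by [].
Qed.

End Mean.

(** * Positivity of the spherical means *)

Section Positivity.
Variables (R : realType) (N : nat).
Local Notation vec := 'rV[R]_N.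
Implicit Types (p q : vec -> R) (x v xi : vec).
Variables (Rs Rp : seq vec) (k : vec -> R) (V : (vec -> R) -> (vec -> R)).
Hypotheses (hRs : root_system Rs) (hRp : positive_subsystem Rs Rp)
  (hk : multiplicity Rs k) (hV : poly_intertwiner Rp k V) (hN : (0 < N)%N).
Local Notation T := (dunkl Rp k).
Local Notation Dk := (DkL Rp k).
Local Notation iDk := (iDk Rp k).
Local Notation Pk := (Pk Rp k).

Lemma pd_min0 q x v : polyfun q -> (forall y, q x <= q y) -> pd v q x = 0.
Proof.
move=> pq qmin; have [P hP] := pd_line pq x v.
have [E0 E1] := hP 0; rewrite scale0r addr0 in E0 E1.
rewrite E1; apply: (horner_min0 _).1 => t.
by rewrite -E0; have [<- _] := hP t.
Qed.

                                                                                          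
(** The heat semigroup at time 1. For q homogeneous of degree 2m the series stops at m, and its
    value at 0 is the m-th iterate at 0 divided by m!. *)
Definition heat m q x : R := \sum_(n < m.+1) (n`!%:R)^-1 * iDk n q x.

Lemma heat_poly m q : polyfun q -> polyfun (heat m q).
Proof. by move=> pq; apply: polyfun_sum => n; apply: polyfunZ; exact: (iDk_poly hV). Qed.

Lemma heat_eq m q x : homog m.*2 q ->
  Dk (heat m q) x + 2^-1 * pd x (heat m q) x = m%:R * heat m q x.
Proof.
move=> hq; have pq := homog_polyfun hq.
have pn n : polyfun (fun x => (n`!%:R)^-1 * iDk n q x).
  by apply: polyfunZ; exact: (iDk_poly hV).
rewrite (Dk_sum hV)// pd_sum// mulr_sumr /heat mulr_sumr.
have -> : \sum_(i < m.+1) Dk (fun x => i`!%:R^-1 * iDk i q x) x =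
   \sum_(i < m.+1) i%:R * (i`!%:R^-1 * iDk i q x).
  rewrite big_ord_recr big_ord_recl/= mul0r add0r.
  rewrite [X in _ + X](_ : _ = 0); last first.
    rewrite (DkZ hV); last exact: (iDk_poly hV).
    rewrite -iDkS (iDk_homog_high hV x hq) ?mulr0//.
  rewrite addr0; apply: eq_bigr => i _.
  rewrite (DkZ hV); last exact: (iDk_poly hV).
  rewrite -iDkS /bump/= add1n factS natrM mulrA; congr (_ * _).
  by rewrite invfM mulrA divff ?mul1r// pnatr_eq0.
rewrite -big_split/=; apply: eq_bigr => i _.
rewrite pdZ; last exact: (iDk_poly hV).
have im : (i.*2 <= m.*2)%N by rewrite leq_double -ltnS.
rewrite (homog_euler _ (iDk_homog hV i hq)) natrB// -!mul2n !natrM.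
by field; rewrite pnatr_eq0 -lt0n fact_gt0.
Qed.

(** The heat evolution v of q satisfies D v + (1/2) E v = m v, with D the Dunkl Laplacian and E the
    Euler operator. Since q dominates the lower-order terms far out, v has a global minimum; there E
    v = 0 and D v >= 0, so v >= 0 when m > 0. In particular v(0) >= 0, which is the claim up to
    m!. *)
Lemma iDk_pos_strict m q (eps : R) : homog m.*2 q -> 0 < eps ->
  (forall x, eps * dotv x x ^+ m <= q x) -> 0 <= iDk m q 0.
Proof.
move=> hq e0 qe; have pq := homog_polyfun hq.
case: m hq qe => [hq qe|m hq qe].
  by apply: le_trans (qe 0); rewrite expr0 mulr1 ltW.
have pn n : polyfun (iDk n q) := iDk_poly hV n pq.
pose v := heat m.+1 q; have pv : polyfun v := heat_poly _ pq.
have /choice[C hC] : forall n, exists C : R, 0 <= C /\ forall x, dotv x x <= 1 ^+ 2 -> `|iDk n q x| <= C.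
  move=> n; have [C C0 hC] := @ball_bounded R N _ 1 (polyfun_continuous (pn n)).
  by exists C.
pose Ct : R := \sum_(n < m.+1) C n.+1.
have Ct0 : 0 <= Ct by apply: sumr_ge0 => n _; exact: (hC _).1.
(* Outside the ball of radius [S] the leading term eps |x|^(2m) beats both the lower-order terms,
   bounded through [Ct], and |v(0)|. *)
pose S : R := 1 + (Ct + `|v 0|) / eps.
have S1 : 1 <= S by rewrite lerDl; apply: divr_ge0; [exact: addr_ge0|exact: ltW].
have lower x : S ^+ 2 <= dotv x x -> v 0 <= v x.
  move=> Sx; have x0 : x != 0.
    apply/eqP => xz; move: Sx; rewrite xz dotv0l leNgt exprn_gt0//.
    exact: lt_le_trans ltr01 S1.
  have [s [u [s0 u1 xE s2]]] := polar x0.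
  have s1 : 1 <= s ^+ 2.
    rewrite s2; apply: le_trans Sx; exact: exprn_ege1.
  have key : eps * (s ^+ 2) ^+ m.+1 - (s ^+ 2) ^+ m * Ct <= v x.
    rewrite /v /heat big_ord_recl [X in _ <= X + _](_ : _ = q x); last by rewrite /= fact0 invr1 mul1r.
    apply: lerD.
      by rewrite xE; apply: le_trans (qe _); rewrite dotv_scale2 u1 mulr1.
    rewrite mulr_sumr -sumrN; apply: ler_sum => n _; rewrite lift0.
    have nm : (n.+1.*2 <= m.+1.*2)%N by rewrite leq_double.
    rewrite xE (homog_scale _ _ (iDk_homog hV _ hq)).
    have -> : (m.+1.*2 - n.+1.*2)%N = (2 * (m - n))%N by lia.
    rewrite exprM; set w := iDk _ _ _.
    have wC : `|w| <= C n.+1 by apply: (hC _).2; rewrite u1 expr1n.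
    have f1 : 0 <= ((n.+1)`!%:R : R)^-1 <= 1.
      by rewrite invr_ge0 ler0n/= invf_le1 ?ltr0n ?fact_gt0// ler1n fact_gt0.
    have p1 : 0 <= (s ^+ 2) ^+ (m - n) <= (s ^+ 2) ^+ m.
      rewrite exprn_ge0 ?sqr_ge0//=; apply: ler_weXn2l => //; exact: leq_subr.
    move/andP: f1 => [f0 f1]; move/andP: p1 => [p0 p1].
    have : `|((n.+1)`!%:R : R)^-1 * ((s ^+ 2) ^+ (m - n) * w)| <= (s ^+ 2) ^+ m * C n.+1.
      rewrite normrM (ger0_norm f0) -[leRHS]mul1r; apply: ler_pM => //.
      by rewrite normrM (ger0_norm p0); apply: ler_pM.
    by rewrite ler_norml => /andP[].
  apply: le_trans key; rewrite exprS mulrA [_ ^+ m * Ct]mulrC -mulrBl.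
  have h : `|v 0| <= eps * s ^+ 2 - Ct.
    rewrite lerBrDl s2; apply: (@le_trans _ _ (eps * S ^+ 2)); last first.
      by rewrite ler_pM2l.
    apply: (@le_trans _ _ (eps * S)); last by rewrite ler_pM2l// expr2 ler_peMl// (le_trans ler01).
    rewrite mulrDr mulr1 mulrC divfK ?gt_eqF// lerDr ltW//.
  have h0 := le_trans (normr_ge0 _) h.
  apply: le_trans (ler_norm _) _; apply: le_trans h _.
  by rewrite ler_peMr// exprn_ege1.
have [x0 x0S x0min] := @ball_min R N v S (polyfun_continuous pv).
have x0gmin x : v x0 <= v x.
  case: (lerP (dotv x x) (S ^+ 2)) => [|/ltW]; first exact: x0min.
  by move=> /lower; apply: le_trans; apply: x0min; rewrite dotv0l sqr_ge0.
have v0 : v 0 = ((m.+1)`!%:R)^-1 * iDk m.+1 q 0.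
  rewrite /v /heat big_ord_recr/= big1 => [|n _]; first by rewrite add0r.
  rewrite (iDk_homog_at0 hV hq) ?mulr0//; apply/eqP.
  by rewrite gtn_eqF// ltn_double.
have := heat_eq x0 hq; rewrite -/v (pd_min0 _ pv x0gmin) mulr0 addr0 => E.
have : 0 <= v 0.
  apply: le_trans (x0gmin 0); rewrite -(pmulr_rge0 _ (_ : 0 < m.+1%:R)) ?ltr0n// -E.
  exact: (Dk_min_ge0 hRs hRp hk hV).
by rewrite v0 pmulr_rge0// invr_gt0 ltr0n fact_gt0.
Qed.

(** Add eps |x|^(2m) to reach the strict case, then let eps tend to 0. *)
Lemma iDk_pos m q : homog m.*2 q -> (forall x, 0 <= q x) -> 0 <= iDk m q 0.
Proof.
move=> hq q0; pose z (x : vec) := dotv x x ^+ m.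
have hz : homog m.*2 z by rewrite -mul2n; exact: homogX (@homog_dotvv R N).
have pz := homog_polyfun hz; have pq := homog_polyfun hq.
have H (eps : R) : 0 < eps -> 0 <= iDk m q 0 + eps * iDk m z 0.
  move=> e0; rewrite -(iDkZ hV)// -(iDkD hV)//; last exact: polyfunZ.
  apply: (@iDk_pos_strict _ _ eps) => //; first by apply: homogD => //; exact: homogZ.
  by move=> x; rewrite lerDr.
rewrite leNgt; apply/negP => neg.
pose w := `|iDk m z 0| + 1.
have w0 : 0 < w by rewrite ltr_wpDl.
have := H (- iDk m q 0 / (2 * w)); rewrite divr_gt0 ?oppr_gt0 ?mulr_gt0// => /(_ isT).
have : - iDk m q 0 / (2 * w) * iDk m z 0 <= - iDk m q 0 / 2.
  rewrite -mulrA; apply: ler_wpM2l; first by rewrite oppr_ge0 ltW.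
  rewrite ler_pdivrMl ?mulr_gt0// (_ : 2 * w * 2^-1 = w); last by field.
  by apply: le_trans (ler_norm _) _; rewrite lerDl.
lra.
Qed.

(** Drop the odd components and multiply each even one by a power of |x|^2 to reach a common degree.
    The mean at radius 1 is unchanged, and on the unit sphere the result is the even part of q,
    hence nonnegative everywhere by homogeneity; [iDk_pos] applies. *)
Lemma Pk_pos q : polyfun q -> (forall x, dotv x x = 1 -> 0 <= q x) -> 0 <= (Pk q).[1].
Proof.
move=> pq q0; have [d [Q [hQ qE]]] := homog_decomp pq.
have pQ j : polyfun (Q j) := homog_polyfun (hQ j).
pose F j (x : vec) := if odd j then 0 else dotv x x ^+ (d.+1 - j./2) * Q j x.
pose H x := \sum_(j < d) F j x.
have pS m (r : vec -> R) : polyfun r -> polyfun (fun x => dotv x x ^+ m * r x).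
  by move=> pr; apply: polyfunM => //; apply: polyfunX; exact: polyfun_dotvv.
have PkX m (r : vec -> R) : polyfun r -> (Pk (fun x => dotv x x ^+ m * r x)).[1] = (Pk r).[1].
  move=> pr; elim: m => [|m IH].
    by congr (_.[1]); congr Pk; apply/funext => x; rewrite expr0 mul1r.
  rewrite -IH; have -> : (fun x => dotv x x ^+ m.+1 * r x) =
    (fun x => dotv x x * (dotv x x ^+ m * r x)).
    by apply/funext => x; rewrite exprS mulrA.
  by rewrite (Pk_normsq hRs hRp hk hV hN (pS m r pr)) hornerM hornerXn expr1n mul1r.
have pF j : polyfun (F j).
  by rewrite /F; case: (odd j); [exact: polyfun_cst|exact: pS].
have hF (j : 'I_d) : homog (d.+1).*2 (F j).
  rewrite /F; case: (boolP (odd j)) => oj; first exact: homog0.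
  have -> : (d.+1).*2 = (2 * (d.+1 - j./2) + j)%N.
    have := ltn_ord j; have : (j = j./2.*2 :> nat) by rewrite -[LHS]odd_double_half (negbTE oj).
    lia.
  by apply: homogM (hQ j); apply: homogX; exact: homog_dotvv.
have hH : homog (d.+1).*2 H.
  rewrite /H; elim: (index_enum _) => [|j r IH].
    by apply: homog_ext (@homog0 R N _) => x; rewrite big_nil.
  by apply: homog_ext (homogD (hF j) IH) => x; rewrite big_cons.
have PkH : (Pk H).[1] = (Pk q).[1].
  rewrite qE !(Pk_sum hV)// !horner_sum; apply: eq_bigr => j _.
  rewrite /F; case: (boolP (odd j)) => oj; last by rewrite PkX.
  by rewrite (Pk_cst hV) hornerC (Pk_homog hV (hQ j)) oj scale0r horner0.
have H0 x : 0 <= H x.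
  have [->|/polar[s [u [s0 u1 -> _]]]] := eqVneq x 0.
    by have := homog_scale 0 0 hH; rewrite scale0r doubleS exprS !mul0r => ->.
  rewrite (homog_scale _ _ hH); apply: mulr_ge0; first by rewrite exprn_ge0// ltW.
  have -> : H u = (q u + q (- u)) / 2.
    rewrite qE -big_split mulr_suml; apply: eq_bigr => j _ /=; rewrite /F.
    rewrite -[- u]scaleN1r (homog_scale _ _ (hQ j)) -signr_odd u1 expr1n mul1r.
    by case: (odd j); rewrite /=; field.
  apply: divr_ge0 => //; apply: addr_ge0; apply: q0 => //.
  by rewrite dotvNl dotvNr opprK.
rewrite -PkH (Pk_homog hV hH) odd_double doubleK hornerZ hornerXn expr1n mulr1.
by rewrite mulr_ge0 ?iDk_pos// ltW// (bco_gt0 hRp hk hN).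
Qed.

Lemma Pk_bound1 q (B : R) : polyfun q -> (forall x, dotv x x = 1 -> `|q x| <= B) ->
  `|(Pk q).[1]| <= B.
Proof.
move=> pq qB; have pc := @polyfun_cst R N B.
have E1 : (Pk (fun x => q x + B)).[1] = (Pk q).[1] + B.
  by rewrite (PkD hV)// (Pk_cst hV) hornerD hornerC.
have E2 : (Pk (fun x => B + (-1) * q x)).[1] = B - (Pk q).[1].
  rewrite (PkD hV)//; last exact: polyfunZ.
  by rewrite (PkZ hV)// (Pk_cst hV) hornerD hornerC hornerZ mulN1r.
rewrite ler_norml; apply/andP; split.
  rewrite -subr_ge0 opprK -E1; apply: Pk_pos; first exact: polyfunD.
  by move=> x /qB; rewrite ler_norml => /andP[]; lra.
rewrite -subr_ge0 -E2; apply: Pk_pos; first by apply: polyfunD => //; exact: polyfunZ.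
by move=> x /qB; rewrite ler_norml => /andP[]; lra.
Qed.

(** The mean behaves as integration against a probability measure on the sphere of radius r. This
    estimate drives all convergence arguments below. *)
Lemma Pk_bound q (r B : R) : polyfun q -> (forall x, dotv x x = r ^+ 2 -> `|q x| <= B) ->
  `|(Pk q).[r]| <= B.
Proof.
move=> pq qB.
have := @Pk_bound1 (fun x => q (r *: x)) B.
rewrite (Pk_comp_scale hV)// horner_comp hornerZ hornerX mulr1; apply.
  by apply: polyfun_ext (polyfun_affine r 0 pq) => x; rewrite addr0.
by move=> x x1; apply: qB; rewrite dotv_scale2 x1 mulr1.
Qed.

End Positivity.

                                               

(** * Linear operators acting on polynomials in two vector variables *)

Section LinOp.
Variables (R : realType) (N : nat).
Local Notation vec := 'rV[R]_N.
Implicit Types (p q : vec -> R) (x y v xi : vec).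

Definition linop (A : (vec -> R) -> vec -> R) :=
  (forall p, polyfun p -> polyfun (A p)) /\
  (forall p q c x, polyfun p -> polyfun q -> A (fun y => p y + c * q y) x = A p x + c * A q x).

Lemma linop_zero A x : linop A -> A (fun=> 0) x = 0.
Proof.
move=> [_ H]; have pc := @polyfun_cst R N 0.
have E : (fun _ : vec => 0 + (-1) * 0) = (fun=> 0 : R) by apply/funext => y; rewrite mulr0 addr0.
have := H (fun=> 0) (fun=> 0) (-1) x pc pc; rewrite E mulN1r subrr//.
Qed.

Lemma linopZ A (c : R) p x : linop A -> polyfun p -> A (fun y => c * p y) x = c * A p x.
Proof.
move=> lA pp; have E : (fun y => 0 + c * p y) = (fun y => c * p y).
  by apply/funext => y; rewrite add0r.
by have := lA.2 (fun=> 0) p c x (@polyfun_cst R N 0) pp; rewrite E linop_zero// add0r.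
Qed.

Lemma linopD A p q x : linop A -> polyfun p -> polyfun q ->
  A (fun y => p y + q y) x = A p x + A q x.
Proof.
move=> lA pp pq; have E : (fun y => p y + 1 * q y) = (fun y => p y + q y).
  by apply/funext => y; rewrite mul1r.
by have := lA.2 p q 1 x pp pq; rewrite E mul1r.
Qed.

Lemma linop_sum A (I : Type) (r : seq I) (F : I -> vec -> R) x :
  linop A -> (forall i, polyfun (F i)) ->
  A (fun y => \sum_(i <- r) F i y) x = \sum_(i <- r) A (F i) x.
Proof.
move=> lA H; elim: r => [|a r IH].
  rewrite big_nil -[RHS](linop_zero x lA); apply: (congr1 (fun f => A f x)).
  by apply/funext => y; rewrite big_nil.
rewrite big_cons -IH -linopD//; last exact: polyfun_sum.
by apply: (congr1 (fun f => A f x)); apply/funext => y; rewrite big_cons.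
Qed.

Record ppair := PPair { pp1 : vec -> R; pp2 : vec -> R; ppP1 : polyfun pp1; ppP2 : polyfun pp2 }.

(** Finite sums of products p(x) q(y). On such kernels an operator in x commutes with one in y by
    linearity alone, with no continuity or Fubini argument. *)
Definition poly2 (D : vec -> vec -> R) := exists s : seq ppair,
  forall x y, D x y = \sum_(c <- s) pp1 c x * pp2 c y.

Lemma poly2_ext D E : (forall x y, D x y = E x y) -> poly2 D -> poly2 E.
Proof. by move=> DE [s H]; exists s => x y; rewrite -DE. Qed.

Lemma poly2_tensor p q : polyfun p -> polyfun q -> poly2 (fun x y => p x * q y).
Proof. by move=> pp pq; exists [:: PPair pp pq] => x y; rewrite big_seq1. Qed.

Lemma poly2_fst p : polyfun p -> poly2 (fun x y => p x).
Proof.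
move=> pp; apply: poly2_ext (poly2_tensor pp (@polyfun_cst R N 1)) => x y.
by rewrite mulr1.
Qed.

Lemma poly2_snd p : polyfun p -> poly2 (fun x y => p y).
Proof.
move=> pp; apply: poly2_ext (poly2_tensor (@polyfun_cst R N 1) pp) => x y.
by rewrite mul1r.
Qed.

Lemma poly2D D E : poly2 D -> poly2 E -> poly2 (fun x y => D x y + E x y).
Proof. by move=> [s Hs] [t Ht]; exists (s ++ t) => x y; rewrite big_cat Hs Ht. Qed.

Lemma poly2M D E : poly2 D -> poly2 E -> poly2 (fun x y => D x y * E x y).
Proof.
move=> [s Hs] [t Ht].
exists [seq PPair (polyfunM (ppP1 a) (ppP1 b)) (polyfunM (ppP2 a) (ppP2 b)) | a <- s, b <- t] => x y.
rewrite big_allpairs_dep/= Hs Ht big_distrl/=; apply: eq_bigr => a _.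
rewrite big_distrr/=; apply: eq_bigr => b _; ring.
Qed.

Lemma poly2Z (c : R) D : poly2 D -> poly2 (fun x y => c * D x y).
Proof. by move=> pD; apply: poly2M => //; apply: poly2_fst; exact: polyfun_cst. Qed.

Lemma poly2B D E : poly2 D -> poly2 E -> poly2 (fun x y => D x y - E x y).
Proof.
move=> pD pE; apply: poly2_ext (poly2D pD (poly2Z (-1) pE)) => x y; by rewrite mulN1r.
Qed.

Lemma poly2X D n : poly2 D -> poly2 (fun x y => D x y ^+ n).
Proof.
move=> pD; elim: n => [|n IH]; first by apply: poly2_fst; exact: (@polyfun_cst R N 1).
by apply: poly2_ext (poly2M pD IH) => x y; rewrite exprS.
Qed.

Lemma poly2_sum (I : Type) (r : seq I) (P : pred I) (F : I -> vec -> vec -> R) :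
  (forall i, poly2 (F i)) -> poly2 (fun x y => \sum_(i <- r | P i) F i x y).
Proof.
move=> H; elim: r => [|a r IH].
  apply: poly2_ext (poly2_fst (@polyfun_cst R N 0)) => x y; by rewrite big_nil.
case Pa : (P a).
  by apply: poly2_ext (poly2D (H a) IH) => x y; rewrite big_cons Pa.
by apply: poly2_ext IH => x y; rewrite big_cons Pa.
Qed.

Lemma poly2_dotv : poly2 (fun x y => dotv x y).
Proof.
apply: poly2_ext (_ : poly2 (fun x y => \sum_(i < N) x ord0 i * y ord0 i)) => [x y|].
  by rewrite dotvE.
by apply: poly2_sum => i; apply: poly2_tensor; exact: polyfun_coord.
Qed.

Lemma poly2_addv p : polyfun p -> poly2 (fun x y => p (x + y)).
Proof.
move: p; apply: polyfun_ind => [c|p q _ _|i p _ IH].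
- by apply: poly2_fst; exact: polyfun_cst.
- exact: poly2D.
- apply: poly2M => //.
  apply: poly2_ext (poly2D (poly2_fst (polyfun_coord R i)) (poly2_snd (polyfun_coord R i))).
  by move=> x y; rewrite mxE.
Qed.

Lemma poly2_swap D : poly2 D -> poly2 (fun x y => D y x).
Proof.
move=> [s H]; exists [seq PPair (ppP2 c) (ppP1 c) | c <- s] => x y.
by rewrite H big_map; apply: eq_bigr => c _; rewrite mulrC.
Qed.

Lemma poly2_left D y : poly2 D -> polyfun (fun x => D x y).
Proof.
move=> [s H]; apply: polyfun_ext (_ : polyfun (fun x => \sum_(c <- s) pp2 c y * pp1 c x)).
  by move=> x; rewrite H; apply: eq_bigr => c _; rewrite mulrC.
by apply: polyfun_sum => c; apply: polyfunZ; exact: ppP1.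
Qed.

Lemma poly2_right D x : poly2 D -> polyfun (D x).
Proof. by move=> /poly2_swap/poly2_left; apply. Qed.

Lemma linop_leftE A (s : seq ppair) x y : linop A ->
  A (fun z => \sum_(c <- s) pp1 c z * pp2 c y) x = \sum_(c <- s) A (pp1 c) x * pp2 c y.
Proof.
move=> lA; rewrite linop_sum//; last first.
  by move=> c; apply: polyfunM; [exact: ppP1|exact: polyfun_cst].
apply: eq_bigr => c _; rewrite mulrC -(linopZ _ _ lA (ppP1 c)).
by apply: (congr1 (fun f => A f x)); apply/funext => z; rewrite mulrC.
Qed.

Lemma linop_rightE A (s : seq ppair) x y : linop A ->
  A (fun z => \sum_(c <- s) pp1 c x * pp2 c z) y = \sum_(c <- s) pp1 c x * A (pp2 c) y.
Proof.
move=> lA; rewrite linop_sum//; last by move=> c; apply: polyfunZ; exact: ppP2.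
by apply: eq_bigr => c _; rewrite (linopZ _ _ lA (ppP2 c)).
Qed.

Lemma poly2_linop_left A D : linop A -> poly2 D -> poly2 (fun x y => A (fun z => D z y) x).
Proof.
move=> lA [s H]; exists [seq PPair (lA.1 _ (ppP1 c)) (ppP2 c) | c <- s] => x y.
rewrite big_map/= -linop_leftE//; apply: (congr1 (fun f => A f x)); apply/funext => z; exact: H.
Qed.

Lemma poly2_linop_right A D : linop A -> poly2 D -> poly2 (fun x y => A (D x) y).
Proof.
move=> lA [s H]; exists [seq PPair (ppP1 c) (lA.1 _ (ppP2 c)) | c <- s] => x y.
rewrite big_map/= -linop_rightE//; apply: (congr1 (fun f => A f y)); apply/funext => z; exact: H.
Qed.

Lemma linop_comm A B D x y : linop A -> linop B -> poly2 D ->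
  A (fun z => B (D z) y) x = B (fun w => A (fun z => D z w) x) y.
Proof.
move=> lA lB [s H].
have -> : (fun z => B (D z) y) = (fun z => \sum_(c <- s) pp1 c z * B (pp2 c) y).
  apply/funext => z; rewrite -linop_rightE//; apply: (congr1 (fun f => B f y)).
  by apply/funext => w; exact: H.
have -> : (fun w => A (fun z => D z w) x) = (fun w => \sum_(c <- s) A (pp1 c) x * pp2 c w).
  apply/funext => w; rewrite -linop_leftE//; apply: (congr1 (fun f => A f x)).
  by apply/funext => z; exact: H.
rewrite linop_sum//; last by move=> c; apply: polyfunM; [exact: ppP1|exact: polyfun_cst].
rewrite linop_sum//; last by move=> c; apply: polyfunZ; exact: ppP2.
apply: eq_bigr => c _; rewrite (linopZ _ _ lB (ppP2 c)) mulrC -(linopZ _ _ lA (ppP1 c)).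
by apply: (congr1 (fun f => A f x)); apply/funext => z; rewrite mulrC.
Qed.

Lemma linop_pd xi : linop (pd xi : (vec -> R) -> vec -> R).
Proof.
split=> [p|p q c x pp pq]; first exact: polyfun_pd.
by rewrite pdD ?pdZ//; exact: polyfunZ.
Qed.

(** Viewing a functional as an operator with constant values lets [linop_comm] also exchange means
    and integrals with V, Dunkl operators and derivatives. *)
Lemma linop_cst (L : (vec -> R) -> R) :
  (forall p q c, polyfun p -> polyfun q -> L (fun y => p y + c * q y) = L p + c * L q) ->
  linop (fun p _ => L p).
Proof. by move=> H; split=> [p _|p q c x pp pq]; [exact: polyfun_cst|exact: H]. Qed.

Lemma pdX v p n x : polyfun p -> pd v (fun y => p y ^+ n) x = n%:R * p x ^+ n.-1 * pd v p x.
Proof.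
move=> pp; elim: n => [|n IH].
  by rewrite !mul0r -[RHS](pd_cst 1 v x); apply: eq_pd.
have -> : pd v (fun y => p y ^+ n.+1) x = pd v (fun y => p y * p y ^+ n) x.
  by apply: eq_pd => y; rewrite exprS.
rewrite pdM//; last exact: polyfunX.
rewrite IH /= -[n.+1%:R]natr1; case: n {IH} => [|n] /=; last by rewrite exprS; ring.
by rewrite !expr0; ring.
Qed.

End LinOp.

(** * Equivariance of Dunkl operators under reflections *)

Section Equivariance.
Variables (R : realType) (N : nat).
Local Notation vec := 'rV[R]_N.
Implicit Types (p q : vec -> R) (x y v xi : vec).
Variables (Rs Rp : seq vec) (k : vec -> R) (V : (vec -> R) -> (vec -> R)).
Hypotheses (hRs : root_system Rs) (hRp : positive_subsystem Rs Rp)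
  (hk : multiplicity Rs k).
Local Notation T := (dunkl Rp k).
Local Notation Dk := (DkL Rp k).

Lemma root_refl a b : a \in Rs -> b \in Rs -> a *m reflmx b \in Rs.
Proof. by move=> aR bR; case: hRs => _ _ _ H _; exact: H. Qed.

Lemma root_opp a : a \in Rs -> - a \in Rs.
Proof. by move=> aR; rewrite -(refl_self (root2 hRs aR)); exact: root_refl. Qed.

Lemma k_refl a b : a \in Rs -> b \in Rs -> k (a *m reflmx b) = k a.
Proof.
move=> aR bR; case: hk => _ H; have := H (1%:M *m reflmx b) a.
rewrite mul1mx; apply => //; rewrite -[reflmx b]mul1mx; apply: rg_mul => //; exact: rg_one.
Qed.

Lemma k_opp a : a \in Rs -> k (- a) = k a.
Proof. by move=> aR; rewrite -(refl_self (root2 hRs aR)) k_refl. Qed.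

Lemma uniq_Rs : uniq Rs. Proof. by case: hRs. Qed.

Lemma sum_Rs (F : vec -> R) : (forall a, a \in Rs -> F (- a) = F a) ->
  \sum_(a <- Rs) F a = 2 * \sum_(a <- Rp) F a.
Proof.
move=> FN; case: hRp => b [bR ->].
rewrite big_filter (bigID (fun a => 0 < dotv a b))/= mulrDl mul1r; congr (_ + _).
have P : perm_eq [seq - a | a <- Rs] Rs.
  apply: uniq_perm; [by rewrite map_inj_uniq ?uniq_Rs//; exact: oppr_inj|exact: uniq_Rs|].
  move=> a; apply/mapP/idP => [[c cR ->]|aR]; first exact: root_opp.
  by exists (- a); rewrite ?opprK ?root_opp.
rewrite -(perm_big _ P)/= big_map big_seq_cond [RHS]big_seq_cond.
apply: eq_big => [a|a /andP[aR _]]; last exact: FN.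
case aR : (a \in Rs) => //=; rewrite dotvNl oppr_gt0 -leNgt le_eqVlt.
by rewrite eq_sym (negbTE (bR _ aR)).
Qed.

Lemma reflmxN (a : vec) : reflmx (- a) = reflmx a.
Proof.
rewrite /reflmx (_ : (- a)^T = - a^T) ?mulNmx ?mulmxN ?opprK//.
by apply/matrixP => i j; rewrite !mxE.
Qed.

Lemma dquot_opp a q x : polyfun q -> dquot (- a) q x = - dquot a q x.
Proof.
move=> pq; rewrite /dquot dotvNl oppr_eq0; case: ifP => _; first by rewrite pd_dirN.
by rewrite reflmxN invrN mulrN.
Qed.

(** Each summand is even in the root, so the sum can run over all of [Rs]. Unlike [Rp], that set is
    permuted by every reflection, which makes equivariance a mere reindexing. *)
Lemma dunkl_full xi q x : polyfun q ->
  2 * T xi q x = 2 * pd xi q x + \sum_(a <- Rs) k a * dotv a xi * dquot a q x.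
Proof.
move=> pq; rewrite dunklE mulrDr (sum_Rs (F := fun a => k a * dotv a xi * dquot a q x))//.
by move=> a aR; rewrite k_opp// dquot_opp// dotvNl; ring.
Qed.

Lemma refl_conj x a b : dotv b b = 2 ->
  x *m reflmx b *m reflmx (a *m reflmx b) = x *m reflmx a *m reflmx b.
Proof.
move=> b2; rewrite [_ *m reflmx (a *m reflmx b)]mul_reflmx dotv_reflmx mul_reflmxK//.
by rewrite [x *m reflmx a]mul_reflmx mulmxBl -scalemxAl.
Qed.

Lemma dunkl_refl b xi q x : b \in Rs -> polyfun q ->
  T xi (fun y => q (y *m reflmx b)) x = T (xi *m reflmx b) q (x *m reflmx b).
Proof.
move=> bR pq; have b2 := root2 hRs bR.
have pqb := polyfun_mulmx (reflmx b) pq.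
apply: (@mulfI _ 2); first by rewrite pnatr_eq0.
rewrite !dunkl_full// pd_mulmx; apply: (congr1 (fun z => _ + z)).
have P : perm_eq [seq a *m reflmx b | a <- Rs] Rs.
  apply: uniq_perm; [|exact: uniq_Rs|].
    rewrite map_inj_uniq ?uniq_Rs// => a c /(congr1 (mulmxr (reflmx b)))/=.
    by rewrite !mul_reflmxK.
  move=> a; apply/mapP/idP => [[c cR ->]|aR]; first exact: root_refl.
  by exists (a *m reflmx b); rewrite ?mul_reflmxK// root_refl.
rewrite -[in RHS](perm_big _ P)/= big_map big_seq [RHS]big_seq; apply: eq_bigr => a aR.
rewrite k_refl// [dotv (a *m _) _]dotv_reflmx mul_reflmxK//; congr (_ * _).
rewrite /dquot [dotv (a *m _) _]dotv_reflmx mul_reflmxK//.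
by rewrite pd_mulmx refl_conj.
Qed.

(** Orthogonality of the reflection collapses the double sum of T_j T_l to the diagonal. *)
Lemma Dk_refl b q x : polyfun q -> b \in Rs -> poly_intertwiner Rp k V ->
  Dk (fun y => q (y *m reflmx b)) x = Dk q (x *m reflmx b).
Proof.
move=> pq bR hV; have b2 := root2 hRs bR.
pose e i := delta_mx ord0 i : vec.
have pT xi := dunkl_poly hV xi pq.
have E i : T (e i) (T (e i) (fun y => q (y *m reflmx b))) x =
   \sum_j \sum_l reflmx b i j * reflmx b i l * T (e j) (T (e l) q) (x *m reflmx b).
  have -> : T (e i) (T (e i) (fun y => q (y *m reflmx b))) x =
     T (e i) (fun y => T (e i *m reflmx b) q (y *m reflmx b)) x.
    by apply: dunkl_ext => y; rewrite dunkl_refl.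
  rewrite (dunkl_refl (e i) x bR (pT _)).
  have -> : T (e i *m reflmx b) (T (e i *m reflmx b) q) (x *m reflmx b) =
    T (e i *m reflmx b) (fun y => \sum_l reflmx b i l * T (e l) q y) (x *m reflmx b).
    apply: dunkl_ext => y; rewrite dunkl_dirE//; apply: eq_bigr => l _.
    by rewrite -rowE mxE.
  rewrite dunkl_dirE; last by apply: polyfun_sum => l; exact: polyfunZ.
  apply: eq_bigr => j _; rewrite dunkl_sum; last by move=> l _; exact: polyfunZ.
  rewrite -rowE mxE mulr_sumr; apply: eq_bigr => l _.
  by rewrite dunklZ// mulrA.
rewrite /DkL (eq_bigr _ (fun i _ => E i)) exchange_big/=; apply: eq_bigr => j _.
rewrite exchange_big/= (bigD1 j)//= [X in _ + X]big1 ?addr0; last first.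
  move=> l lj; rewrite -mulr_suml (_ : \sum_i _ = 0) ?mul0r//.
  have := reflmxK b2; rewrite -{1}reflmxT => /matrixP/(_ j l).
  rewrite mxE [RHS]mxE eq_sym (negbTE lj) => H; apply: etrans H.
  by apply: eq_bigr => i _; rewrite [_^T _ _]mxE.
rewrite -mulr_suml (_ : \sum_i _ = 1) ?mul1r//.
have := reflmxK b2; rewrite -{1}reflmxT => /matrixP/(_ j j).
rewrite mxE [RHS]mxE eqxx => H; apply: etrans H.
by apply: eq_bigr => i _; rewrite [_^T _ _]mxE.
Qed.

End Equivariance.

(** * Dunkl kernel components, ridge functions and the translation of radial polynomials *)

Section Kernel.
Variables (R : realType) (N : nat).
Local Notation vec := 'rV[R]_N.
Implicit Types (p q : vec -> R) (x y v xi eta : vec).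
Variables (Rs Rp : seq vec) (k : vec -> R) (V : (vec -> R) -> (vec -> R)).
Hypotheses (hRs : root_system Rs) (hRp : positive_subsystem Rs Rp)
  (hk : multiplicity Rs k) (hV : poly_intertwiner Rp k V).
Local Notation T := (dunkl Rp k).
Local Notation Dk := (DkL Rp k).
Local Notation iDk := (iDk Rp k).
Local Notation Pk := (Pk Rp k).
Local Notation bco := (bco Rp k).
Local Notation e i := (delta_mx ord0 i : vec).

Lemma linop_dunkl xi : linop (T xi).
Proof.
split=> [p|p q c x pp pq]; first exact: (dunkl_poly hV).
by rewrite dunklD ?dunklZ//; exact: polyfunZ.
Qed.

Lemma linop_V : linop V.
Proof.
split=> [p|p q c x pp pq]; first exact: (Vpoly hV).
by rewrite (V_lin hV).
Qed.

Lemma dunkl_sep q : homog 0 q -> q = fun=> q 0.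
Proof.
move=> hq; apply/funext => x.
by rewrite -[in RHS](scale0r x) (homog_scale _ _ hq) expr0 mul1r.
Qed.

(** By induction on the degree: the difference of the two sides is homogeneous, and each Dunkl
    operator maps it to a difference of the same kind in lower degree, so [dunkl_kernel] kills
    it. *)
Lemma V_refl b p x : b \in Rs -> polyfun p ->
  V (fun y => p (y *m reflmx b)) x = V p (x *m reflmx b).
Proof.
move=> bR.
have key n r : homog n r -> forall x, V (fun y => r (y *m reflmx b)) x = V r (x *m reflmx b).
  elim: n r => [|n IH] r hr {}x.
    by rewrite (dunkl_sep hr) !(V_cst hV).
  have pr := homog_polyfun hr; have prb := polyfun_mulmx (reflmx b) pr.
  have pVr := Vpoly hV pr; have pVb := polyfun_mulmx (reflmx b) pVr.
  suff /(congr1 (@^~ x))/= /eqP : (fun x => V (fun y => r (y *m reflmx b)) x - V r (x *m reflmx b)) = fun=> 0.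
    by rewrite subr_eq0 => /eqP.
  apply: (dunkl_kernel hV (n := n)).
    apply: homog_ext (_ : homog n.+1 (fun x => V (fun y => r (y *m reflmx b)) x + (-1) * V r (x *m reflmx b))).
      by move=> y; rewrite mulN1r.
    apply: homogD; first by apply: (Vhomog hV); exact: homog_mulmx.
    by apply: homogZ; apply: (homog_mulmx _ (Vhomog hV hr)).
  move=> i; apply/funext => y.
  have -> : T (e i) (fun x => V (fun y => r (y *m reflmx b)) x - V r (x *m reflmx b)) y =
     T (e i) (fun x => V (fun y => r (y *m reflmx b)) x + (-1) * V r (x *m reflmx b)) y.
    by apply: dunkl_ext => z; rewrite mulN1r.
  rewrite dunklD ?dunklZ//; [|exact: (Vpoly hV)|exact: polyfunZ].
  rewrite (dunklV hV)// (dunkl_refl hRs hRp hk)// (dunklV hV)//.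
  have -> : pd (e i) (fun y => r (y *m reflmx b)) = fun y => pd (e i *m reflmx b) r (y *m reflmx b).
    by apply/funext => z; exact: pd_mulmx.
  have hd := homog_pd (e i *m reflmx b) hr; rewrite /= in hd.
  by rewrite (IH _ hd) mulN1r subrr.
move=> /homog_decomp[d [P [hP ->]]].
rewrite !(linop_sum _ _ linop_V); last 2 first.
- by move=> i; exact: homog_polyfun (hP i).
- by move=> i; apply: polyfun_mulmx; exact: homog_polyfun (hP i).
by apply: eq_bigr => i _; exact: key (hP i) x.
Qed.

                                                     
(** n! times the degree-n component of the Dunkl kernel V(exp <.,y>)(x). *)
Definition Wk n x y : R := V (fun z => dotv z y ^+ n) x.

Lemma polyfun_dotvX y n : polyfun (fun z => dotv z y ^+ n).
Proof. by apply: polyfunX; exact: polyfun_dotv. Qed.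

Lemma poly2_Wk n : poly2 (Wk n).
Proof.
apply: (poly2_linop_left (A := V) (D := fun z y => dotv z y ^+ n)) linop_V _.
by apply: poly2X; exact: poly2_dotv.
Qed.

Lemma Wk0 x y : Wk 0 x y = 1.
Proof. by rewrite /Wk (V_ext V (q := fun=> 1))// (V_one hV). Qed.

Lemma Wk_homogl n y : homog n (fun x => Wk n x y).
Proof.
apply: (Vhomog hV); rewrite -[n in homog n]mul1n; apply: homogX; exact: homog_dotv.
Qed.

Lemma Wk_scaler n (c : R) x y : Wk n x (c *: y) = c ^+ n * Wk n x y.
Proof.
rewrite /Wk -(VZ hV); last exact: polyfun_dotvX.
by apply: (congr1 (fun f => V f x)); apply/funext => z; rewrite dotvZr exprMn.
Qed.

Lemma Wk_homogr n x : homog n (Wk n x).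
Proof.
apply: scale_homog; last by move=> c y; rewrite Wk_scaler.
exact: poly2_right (poly2_Wk n).
Qed.

Lemma Wk_refl n x y b : b \in Rs -> Wk n (x *m reflmx b) y = Wk n x (y *m reflmx b).
Proof.
move=> bR; rewrite /Wk -(V_refl _ bR); last exact: polyfun_dotvX.
by apply: (congr1 (fun f => V f x)); apply/funext => z; rewrite dotv_reflmx.
Qed.

Lemma dunkl_Wkl n xi x y : T xi (fun z => Wk n z y) x = n%:R * dotv xi y * Wk n.-1 x y.
Proof.
have pn m : polyfun (fun z => dotv z y ^+ m) := polyfun_dotvX y m.
rewrite [LHS](dunklV hV xi x (pn n)) -(VZ hV)//.
apply: (congr1 (fun f => V f x)); apply/funext => z.
rewrite pdX ?pd_dotv; first by ring.
exact: polyfun_dotv.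
Qed.

(** The eigenvalue equation in the second variable, a substitute for symmetry of the kernel. As a
    function of x, the difference of both sides is homogeneous of positive degree and annihilated by
    every T in x. The reflection sums from the two variables match by [Wk_refl]. *)
Lemma dunkl_Wkr n xi x y : T xi (Wk n x) y = n%:R * dotv x xi * Wk n.-1 x y.
Proof.
elim: n x => [x|n IH x].
  rewrite !mul0r -[RHS](dunkl_cst Rp k xi 1 y); apply: dunkl_ext => z; exact: Wk0.
have p2 := poly2_Wk n; have p2S := poly2_Wk n.+1.
have pl m w := poly2_left w (poly2_Wk m).
have pr m w := poly2_right w (poly2_Wk m).
have pT m w : polyfun (fun z => T xi (Wk m z) w).
  exact: (poly2_left w (poly2_linop_right (linop_dunkl xi) (poly2_Wk m))).
have pX m w : polyfun (fun z => dotv z xi * Wk m z w).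
  by apply: polyfunM => //; exact: polyfun_dotv.
suff /(congr1 (@^~ x))/= /eqP : (fun x => T xi (Wk n.+1 x) y - n.+1%:R * (dotv x xi * Wk n x y)) = fun=> 0.
  by rewrite subr_eq0 => /eqP ->; rewrite mulrA.
have E : (fun x => T xi (Wk n.+1 x) y - n.+1%:R * (dotv x xi * Wk n x y)) =
   (fun x => T xi (Wk n.+1 x) y + (- n.+1%:R) * (dotv x xi * Wk n x y)).
  by apply/funext => z; rewrite mulNr.
rewrite E; apply: (dunkl_kernel hV (n := n)).
  apply: homogD.
    apply: scale_homog => // c z.
    have -> : T xi (Wk n.+1 (c *: z)) y = T xi (fun w => c ^+ n.+1 * Wk n.+1 z w) y.
      by apply: dunkl_ext => w; exact: (homog_scale c z (Wk_homogl n.+1 w)).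
    by rewrite dunklZ.
  apply: homogZ; rewrite -add1n; apply: homogM; [exact: homog_dotv|exact: Wk_homogl].
move=> i; apply/funext => {}x; move: (e i) => eta.
rewrite dunklD ?dunklZ//; last exact: polyfunZ.
rewrite (linop_comm x y (linop_dunkl eta) (linop_dunkl xi) p2S).
have -> : T xi (fun w => T eta (fun z => Wk n.+1 z w) x) y =
   T xi (fun w => n.+1%:R * (dotv w eta * Wk n x w)) y.
  by apply: dunkl_ext => w; rewrite dunkl_Wkl [dotv eta w]dotvC mulrA.
rewrite dunklZ; last by apply: polyfunM => //; exact: polyfun_dotv.
rewrite !dunkl_mul_dotv// dunkl_Wkl IH mulNr -mulrBr.
have -> : \sum_(a <- Rp) k a * dotv a xi * dotv a eta * Wk n x (y *m reflmx a) =
  \sum_(a <- Rp) k a * dotv a eta * dotv a xi * Wk n (x *m reflmx a) y.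
  rewrite big_seq [RHS]big_seq; apply: eq_bigr => a aR.
  by rewrite Wk_refl ?(Rp_sub hRp)//; ring.
rewrite [dotv eta y]dotvC [dotv xi eta]dotvC; ring.
Qed.

Lemma Dk_Wkr n x y : Dk (Wk n.+2 x) y = n.+2%:R * n.+1%:R * dotv x x * Wk n x y.
Proof.
rewrite /DkL dotvE mulr_sumr mulr_suml; apply: eq_bigr => i _.
have -> : T (e i) (T (e i) (Wk n.+2 x)) y = T (e i) (fun w => n.+2%:R * dotv x (e i) * Wk n.+1 x w) y.
  by apply: dunkl_ext => w; rewrite dunkl_Wkr.
rewrite dunklZ; last exact: (poly2_right x (poly2_Wk _)).
rewrite dunkl_Wkr /= dotv_delta; ring.
Qed.

Lemma iDk_Wkr n x y : iDk n (Wk n.*2 x) y = (n.*2)`!%:R * dotv x x ^+ n.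
Proof.
elim: n => [|n IH]; first by rewrite expr0 fact0 mulr1; exact: Wk0.
rewrite doubleS iDkSr (iDk_ext _ _ _ _ (q := fun y => n.*2.+2%:R * n.*2.+1%:R * dotv x x * Wk n.*2 x y)); last first.
  by move=> z; exact: Dk_Wkr.
rewrite (iDkZ hV); last exact: (poly2_right x (poly2_Wk _)).
by rewrite IH 2!factS !natrM exprS; ring.
Qed.

Lemma Pk_Wkr n x : Pk (Wk n x) =
  (if odd n then 0 else bco n./2 * n`!%:R * dotv x x ^+ n./2) *: 'X^n.
Proof.
rewrite (Pk_homog hV (Wk_homogr n x)); case: ifPn => // on.
have no : n = n./2.*2 by rewrite -[LHS]odd_double_half (negbTE on).
by have := iDk_Wkr n./2 x 0; rewrite -no => ->; rewrite mulrA.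
Qed.

                                                                                   
(** Mean over the unit sphere of plane waves phi(<x,w>). These are the polynomials whose image under
    V is radial, hence candidates for preimages of radial functions. *)
Definition ridge (phi : {poly R}) x : R := (Pk (fun w => phi.[dotv x w])).[1].

Lemma polyfun_horner (phi : {poly R}) p : polyfun p -> polyfun (fun x => phi.[p x]).
Proof.
move=> pp; apply: polyfun_ext (_ : polyfun (fun x => \sum_(i < size phi) phi`_i * p x ^+ i)) => [x|].
  by rewrite horner_coef.
by apply: polyfun_sum => i; apply: polyfunZ; exact: polyfunX.
Qed.

Lemma poly2_horner_dotv (phi : {poly R}) : poly2 (fun x w => phi.[dotv x w]).
Proof.
apply: poly2_ext (_ : poly2 (fun x w => \sum_(i < size phi) phi`_i * dotv x w ^+ i)) => [x w|].
  by rewrite horner_coef.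
by apply: poly2_sum => i; apply: poly2Z; apply: poly2X; exact: poly2_dotv.
Qed.

Lemma linop_Pk (r : R) : linop (fun p (_ : vec) => (Pk p).[r]).
Proof.
apply: linop_cst => p q c pp pq; rewrite (PkD hV) ?(PkZ hV)//; last exact: polyfunZ.
by rewrite hornerD hornerZ.
Qed.

Lemma polyfun_ridge phi : polyfun (ridge phi).
Proof. exact: (poly2_left 0 (poly2_linop_right (linop_Pk 1) (poly2_horner_dotv phi))). Qed.

(** V passes inside the mean, where it turns <z,w>^i into [Wk i]; the mean of that over w is a
    multiple of a power of |x|^2, by [Pk_Wkr]. *)
Lemma V_ridge phi x : V (ridge phi) x =
  \sum_(i < size phi) phi`_i * (if odd i then 0 else bco i./2 * i`!%:R * dotv x x ^+ i./2).
Proof.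
rewrite [LHS](linop_comm (A := V) (B := fun p _ => (Pk p).[1]) x 0 linop_V (linop_Pk 1) (poly2_horner_dotv phi)).
have -> : (fun w => V (fun z => phi.[dotv z w]) x) = (fun w => \sum_(i < size phi) phi`_i * Wk i x w).
  apply/funext => w.
  rewrite (V_ext V (q := fun z => \sum_(i < size phi) phi`_i * dotv z w ^+ i)); last first.
    by move=> z; rewrite horner_coef.
  rewrite (linop_sum _ _ linop_V); last by move=> i; apply: polyfunZ; exact: polyfun_dotvX.
  by apply: eq_bigr => i _; rewrite (VZ hV)//; exact: polyfun_dotvX.
have pW i : polyfun (Wk i x) := poly2_right x (poly2_Wk i).
rewrite (linop_sum _ 0 (linop_Pk 1)); last by move=> i; exact: polyfunZ.
apply: eq_bigr => i _; rewrite (PkZ hV)// hornerZ Pk_Wkr hornerZ hornerXn expr1n mulr1.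
by [].
Qed.

(** Cauchy problem for T in x equal to T in y. Iterated T's in x can be traded for T's in y, so all
    of them vanish at x = 0. For p with V p = D(.,y), every derivative of p at 0 is then zero. *)
Lemma poly2_dunkl_unique D : poly2 D ->
  (forall xi x y, T xi (fun z => D z y) x = T xi (D x) y) ->
  (forall y, D 0 y = 0) -> forall x y, D x y = 0.
Proof.
move=> pD TD D0 x y.
pose Tl (s : seq vec) D : vec -> vec -> R := foldr (fun xi E x y => T xi (fun z => E z y) x) D s.
have H s : [/\ poly2 (Tl s D), (forall xi x y, T xi (fun z => Tl s D z y) x = T xi (Tl s D x) y) &
   (forall y, Tl s D 0 y = 0)].
  elim: s => [//|eta s [pE TE E0]] /=.
  have pF := poly2_linop_left (linop_dunkl eta) pE.
  split => // [xi z w|w].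
    rewrite -/(Tl s D).
    rewrite -(linop_comm z w (linop_dunkl eta) (linop_dunkl xi) pE).
    rewrite (dunkl_comm hV xi eta); last exact: poly2_left.
    by apply: dunkl_ext => z'; exact: TE.
  rewrite -/(Tl s D) TE -[RHS](dunkl_cst Rp k eta 0 w); apply: dunkl_ext => w'; exact: E0.
have pl : polyfun (fun z => D z y) := poly2_left y pD.
have [p pp Vp] := Vsurj hV pl.
have E s z : Tl s D z y = V (Dseq s p) z.
  elim: s z => [z|v s IH z]; first by rewrite Vp.
  rewrite Dseq_cons -(dunklV hV); last exact: polyfun_Dseq.
  by apply: dunkl_ext => z'; exact: IH.
have p0 : p = fun=> 0.
  apply: polyfun_flat0 => // s; rewrite -(V_at0 hV); last exact: polyfun_Dseq.
  by rewrite -E; have [_ _] := H s.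
by have := congr1 (@^~ x) Vp; rewrite /= p0 (V_zero hV) => <-.
Qed.

(** The generalized translation of V p, written with p in place of its inverse image. *)
Definition Vtransl p x y : R := V (fun z => V (fun w => p (z + w)) y) x.

Lemma poly2_Vtransl p : polyfun p -> poly2 (Vtransl p).
Proof.
move=> pp; apply: (poly2_linop_left (A := V) (D := fun z y => V (fun w => p (z + w)) y)) linop_V _.
by apply: (poly2_linop_right (D := fun z w => p (z + w)) linop_V); exact: poly2_addv.
Qed.

Lemma dunkl_Vtransll p xi x y : polyfun p -> T xi (fun z => Vtransl p z y) x = Vtransl (pd xi p) x y.
Proof.
move=> pp; have pa := poly2_addv pp.
rewrite [LHS](dunklV hV); last exact: (poly2_left y (poly2_linop_right linop_V pa)).
apply: (congr1 (fun f => V f x)); apply/funext => z.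
rewrite (linop_comm z y (linop_pd xi) linop_V pa); apply: (congr1 (fun f => V f y)).
by apply/funext => w; exact: pd_shift.
Qed.

Lemma dunkl_Vtranslr p xi x y : polyfun p -> T xi (Vtransl p x) y = Vtransl (pd xi p) x y.
Proof.
move=> pp; have pa := poly2_addv pp.
rewrite -[LHS](linop_comm x y linop_V (linop_dunkl xi) (poly2_linop_right linop_V pa)).
apply: (congr1 (fun f => V f x)); apply/funext => z.
rewrite (dunklV hV); last exact: (poly2_right z pa).
apply: (congr1 (fun f => V f y)); apply/funext => w.
rewrite -(eq_pd xi w (p := fun w => p (w + z)) (q := fun w => p (z + w))); last by move=> w'; rewrite addrC.
by rewrite pd_shift addrC.
Qed.

Lemma Vtransl0 p y : polyfun p -> Vtransl p 0 y = V p y.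
Proof.
move=> pp; rewrite /Vtransl (V_at0 hV); last first.
  exact: (poly2_left y (poly2_linop_right linop_V (poly2_addv pp))).
by apply: (congr1 (fun f => V f y)); apply/funext => w; rewrite add0r.
Qed.

(** V acts on z only; this is the announced value at (x,y) of the translation of |.|^(2n). *)
Definition Ur n x y : R := V (fun z => (dotv x x + dotv y y + 2 * dotv z y) ^+ n) x.

Definition cxy x y : R := dotv x x + dotv y y.

Lemma UrE n x y : Ur n x y =
  \sum_(j < n.+1) ('C(n, j)%:R * 2 ^+ j) * (cxy x y ^+ (n - j) * Wk j x y).
Proof.
rewrite /Ur (V_ext V (q := fun z => \sum_(j < n.+1) ('C(n, j)%:R * 2 ^+ j * cxy x y ^+ (n - j)) * dotv z y ^+ j)); last first.
  move=> z; rewrite exprDn; apply: eq_bigr => j _.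
  by rewrite exprMn -mulr_natr; ring.
rewrite (linop_sum _ _ linop_V); last by move=> i; apply: polyfunZ; exact: polyfun_dotvX.
apply: eq_bigr => j _; rewrite (VZ hV); last exact: polyfun_dotvX.
by rewrite -mulrA.
Qed.

Lemma poly2_cxy : poly2 cxy.
Proof. by apply: poly2D; [apply: poly2_fst|apply: poly2_snd]; exact: polyfun_dotvv. Qed.

Lemma poly2_Ur n : poly2 (Ur n).
Proof.
apply: (poly2_ext (fun x y => esym (UrE n x y))).
apply: poly2_sum => j; apply: poly2Z; apply: poly2M; last exact: poly2_Wk.
by apply: poly2X; exact: poly2_cxy.
Qed.

Lemma Ur_recl n x y (c : R) :
  \sum_(j < n.+2) ('C(n.+1, j)%:R * 2 ^+ j) * ((n.+1 - j)%:R * cxy x y ^+ (n.+1 - j).-1 * c * Wk j x y) =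
  n.+1%:R * c * Ur n x y.
Proof.
rewrite big_ord_recr/= subnn !mul0r mulr0 addr0 UrE mulr_sumr; apply: eq_bigr => j _.
have -> : ((n.+1 - j).-1 = n - j)%N by rewrite subSn// -ltnS.
have : ((n.+1 - j) * 'C(n.+1, j) = n.+1 * 'C(n, j))%N.
  by rewrite -mul_bin_down.
move=> /(congr1 (fun m => m%:R : R)); rewrite !natrM => E.
transitivity (((n.+1 - j)%:R * 'C(n.+1, j)%:R) * (2 ^+ j * cxy x y ^+ (n - j) * c * Wk j x y)); first by ring.
by rewrite E; ring.
Qed.

Lemma Ur_recr n x y (c : R) :
  \sum_(j < n.+2) ('C(n.+1, j)%:R * 2 ^+ j) * (cxy x y ^+ (n.+1 - j) * (j%:R * c * Wk j.-1 x y)) =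
  2 * n.+1%:R * c * Ur n x y.
Proof.
rewrite big_ord_recl/= !mul0r !mulr0 add0r UrE mulr_sumr; apply: eq_bigr => j _.
rewrite /bump/= add1n subSS /=.
have : (j.+1 * 'C(n.+1, j.+1) = n.+1 * 'C(n, j))%N by rewrite mul_bin_diag.
move=> /(congr1 (fun m => m%:R : R)); rewrite !natrM => E.
transitivity ((j.+1%:R * 'C(n.+1, j.+1)%:R) * (2 * (2 ^+ j * cxy x y ^+ (n - j) * c * Wk j x y))).
  by rewrite exprS; ring.
by rewrite E; ring.
Qed.

Lemma dunkl_cX_mul m xi (d : R) q x : polyfun q ->
  T xi (fun z => (dotv z z + d) ^+ m * q z) x =
  (dotv x x + d) ^+ m * T xi q x + m%:R * (dotv x x + d) ^+ m.-1 * (2 * dotv x xi) * q x.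
Proof.
move=> pq; have pc : polyfun (fun z : vec => dotv z z + d).
  by apply: polyfunD; [exact: polyfun_dotvv|exact: polyfun_cst].
rewrite (dunkl_mul_inv k hRs hRp)//; last 2 first.
- exact: polyfunX.
- by move=> a y aR; rewrite (dotv_refl_inv hRs hRp).
rewrite pdX// pdD ?pd_dotvv ?pd_cst ?addr0//; [exact: polyfun_dotvv|exact: polyfun_cst].
Qed.

(** Both sides equal 2 (n+1) <x+y,xi> times [Ur n x y], which is symmetric in how x and y enter. The
    two binomial identities [Ur_recl] and [Ur_recr] collect the terms. *)
Lemma dunkl_Ur n xi x y : T xi (fun z => Ur n z y) x = T xi (Ur n x) y.
Proof.
have pW j w := poly2_left w (poly2_Wk j); have pW' j w := poly2_right w (poly2_Wk j).
have pcl m w j : polyfun (fun z => cxy z w ^+ m * Wk j z w).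
  by apply: polyfunM => //; apply: polyfunX; exact: (poly2_left w poly2_cxy).
have pcr m w j : polyfun (fun z => cxy w z ^+ m * Wk j w z).
  by apply: polyfunM => //; apply: polyfunX; exact: (poly2_right w poly2_cxy).
case: n => [|n].
  have -> : T xi (fun z => Ur 0 z y) x = 0.
    rewrite -[RHS](dunkl_cst Rp k xi 1 x); apply: dunkl_ext => z; exact: Wk0.
  by rewrite -[LHS](dunkl_cst Rp k xi 1 y); apply: dunkl_ext => z; rewrite /Ur (V_ext V (q := fun=> 1))// (V_one hV).
transitivity (n.+1%:R * (2 * dotv x xi) * Ur n x y + 2 * n.+1%:R * dotv xi y * Ur n x y).
  have -> : T xi (fun z => Ur n.+1 z y) x = T xi (fun z => \sum_(j < n.+2) ('C(n.+1, j)%:R * 2 ^+ j) * (cxy z y ^+ (n.+1 - j) * Wk j z y)) x.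
    by apply: dunkl_ext => z; rewrite UrE.
  rewrite (linop_sum _ _ (linop_dunkl xi)); last by move=> j; exact: polyfunZ.
  rewrite -Ur_recl -Ur_recr -big_split/=; apply: eq_bigr => j _.
  rewrite dunklZ// dunkl_cX_mul// dunkl_Wkl -mulrDr; congr (_ * _).
  by rewrite addrC -/(cxy x y).
have -> : T xi (Ur n.+1 x) y = T xi (fun z => \sum_(j < n.+2) ('C(n.+1, j)%:R * 2 ^+ j) * (cxy x z ^+ (n.+1 - j) * Wk j x z)) y.
  by apply: dunkl_ext => z; rewrite UrE.
rewrite (linop_sum _ _ (linop_dunkl xi)); last by move=> j; exact: polyfunZ.
have -> : n.+1%:R * (2 * dotv x xi) * Ur n x y + 2 * n.+1%:R * dotv xi y * Ur n x y =
  n.+1%:R * (2 * dotv y xi) * Ur n x y + 2 * n.+1%:R * dotv x xi * Ur n x y.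
  by rewrite [dotv xi y]dotvC; ring.
rewrite -Ur_recl -Ur_recr -big_split/=; apply: eq_bigr => j _.
rewrite dunklZ// -mulrDr.
have -> : T xi (fun z => cxy x z ^+ (n.+1 - j) * Wk j x z) y =
  T xi (fun z => (dotv z z + dotv x x) ^+ (n.+1 - j) * Wk j x z) y.
  by apply: dunkl_ext => z; rewrite /cxy addrC.
rewrite dunkl_cX_mul// dunkl_Wkr; congr (_ * _).
by rewrite addrC /cxy [dotv x x + _]addrC.
Qed.

(** The two sides solve the same Cauchy problem with value |y|^(2n) at x = 0, so
    [poly2_dunkl_unique] identifies them. *)
Lemma Vtransl_radial n p x y : polyfun p -> (forall z, V p z = dotv z z ^+ n) ->
  Vtransl p x y = Ur n x y.
Proof.
move=> pp Vp; apply/eqP; rewrite -subr_eq0; apply/eqP.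
have pV := poly2_Vtransl pp; have pU := poly2_Ur n.
apply: (poly2_dunkl_unique (D := fun x y => Vtransl p x y - Ur n x y)) => [|xi z w|w].
- exact: poly2B.
- have -> : T xi (fun z => Vtransl p z w - Ur n z w) z = T xi (fun z => Vtransl p z w + (-1) * Ur n z w) z.
    by apply: dunkl_ext => ?; rewrite mulN1r.
  rewrite dunklD ?dunklZ; [|exact: poly2_left|exact: poly2_left|by apply: polyfunZ; exact: poly2_left].
  have -> : T xi (fun w => Vtransl p z w - Ur n z w) w = T xi (fun w => Vtransl p z w + (-1) * Ur n z w) w.
    by apply: dunkl_ext => ?; rewrite mulN1r.
  rewrite dunklD ?dunklZ; [|exact: poly2_right|exact: poly2_right|by apply: polyfunZ; exact: poly2_right].
  by rewrite dunkl_Vtransll// dunkl_Vtranslr// dunkl_Ur.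
- rewrite Vtransl0// Vp /Ur (V_at0 hV); last first.
    apply: polyfunX; apply: polyfunD; first exact: polyfun_cst.
    by apply: polyfunZ; exact: polyfun_dotv.
  by rewrite !dotv0l mulr0 addr0 add0r subrr.
Qed.

Lemma linop_Vtransl y : linop (fun p x => Vtransl p x y).
Proof.
split=> [p pp|p q c x pp pq]; first exact: poly2_left (poly2_Vtransl pp).
rewrite /Vtransl.
have E z : V (fun w => p (z + w) + c * q (z + w)) y = V (fun w => p (z + w)) y + c * V (fun w => q (z + w)) y.
  by rewrite (V_lin hV)//; exact: poly2_right (poly2_addv _).
rewrite (V_ext V E) (V_lin hV)//.
- exact: (poly2_left y (poly2_linop_right linop_V (poly2_addv pp))).
- exact: (poly2_left y (poly2_linop_right linop_V (poly2_addv pq))).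
Qed.

End Kernel.

                           

(** * Coefficient multipliers on univariate polynomials and their sup bounds *)

Lemma cvg_rsum (R : realType) (I : Type) (r : seq I) (F : I -> nat -> R) (l : I -> R) :
  (forall i, F i n @[n --> \oo] --> l i) ->
  (\sum_(i <- r) F i n) @[n --> \oo] --> \sum_(i <- r) l i.
Proof.
move=> H; elim: r => [|a r IH].
  rewrite big_nil (_ : (fun n => _) = fun=> 0); first exact: cvg_cst.
  by apply/funext => n; rewrite big_nil.
rewrite big_cons (_ : (fun n => _) = fun n => F a n + \sum_(i <- r) F i n).
  by apply: cvgD.
by apply/funext => n; rewrite big_cons.
Qed.

Lemma cvg_norm_le (R : realType) (u : nat -> R) (l B : R) :
  u n @[n --> \oo] --> l -> (forall n, `|u n| <= B) -> `|l| <= B.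
Proof.
move=> cu uB; apply/ler_addgt0Pl => e e0.
have /cvgrPdist_lt/(_ e e0)[n _ /(_ n (leqnn n)) /= h] := cu.
rewrite -(subrK (u n) l); apply: le_trans (ler_normD _ _) _.
by apply: lerD; [exact: ltW|exact: uB].
Qed.

Section Multipliers.
Variable R : realType.
Implicit Types (P Q : {poly R}) (a b r B t : R).

Definition bnd P r B := forall t, `|t| <= r -> `|P.[t]| <= B.

Lemma horner_max1 P : (forall s, 0 <= s <= 1 -> P.[s] <= P.[1]) -> 0 <= P^`().[1].
Proof.
move=> H; pose g := P \Po (1 - 'X).
have gE u : g.[u] = P.[1 - u] by rewrite horner_comp !hornerE.
pose Q := drop_poly 1 g.
have QE u : g.[u] = g.[0] + u * Q.[u].
  rewrite -{1}(poly_take_drop 1 g) hornerD hornerM hornerXn expr1 [u * _]mulrC.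
  by rewrite horner_poly big_ord1 expr0 mulr1 horner_coef0.
have Q0 : Q.[0] = - P^`().[1].
  rewrite horner_coef0 coef_drop_poly (_ : g`_ _ = g^`().[0]); last first.
    by rewrite horner_coef0 coef_deriv mulr1n.
  rewrite deriv_comp derivB derivC derivX sub0r hornerM horner_comp !hornerE.
  by rewrite subr0 mulrN1.
rewrite leNgt; apply/negP => neg.
have q0 : 0 < Q.[0] by rewrite Q0 oppr_gt0.
have [d d0 hd] := horner_near0 Q q0.
pose u := Num.min (d / 2) 1.
have u0 : 0 < u by rewrite lt_min divr_gt0/=.
have u1 : u <= 1 by rewrite ge_min lexx orbT.
have ud : `|u| < d.
  by rewrite gtr0_norm// gt_min; apply/orP; left; rewrite ltr_pdivrMr// mulr_natr mulr2n ltrDl.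
have := hd _ ud; rewrite ltr_norml => /andP[Qu _].
have Qu0 : 0 < Q.[u] by rewrite -(subrK Q.[0] Q.[u]); lra.
have := H (1 - u); rewrite subr_ge0 u1 gerBl ltW//= => /(_ isT).
have -> : P.[1] = g.[0] by rewrite gE subr0.
by rewrite -gE QE gerDl leNgt mulr_gt0.
Qed.

(** The average of a s^(a-1) P(s t) over s in [0,1], given by its coefficients and used through the
    equation a G + t G' = a P. *)
Definition avg a P : {poly R} := \poly_(i < size P) (a / (i%:R + a) * P`_i).

Lemma coef_avg a P i : (avg a P)`_i = a / (i%:R + a) * P`_i.
Proof.
rewrite coef_poly; case: ltnP => // iP; rewrite nth_default ?mulr0//.
Qed.

Lemma avg_ode a P : 0 < a -> a *: avg a P + 'X * (avg a P)^`() = a *: P.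
Proof.
move=> a0; apply/polyP => i; rewrite coefD !coefZ coefXM coef_deriv.
have ia (j : nat) : j%:R + a != 0 by rewrite gt_eqF// ltr_wpDl.
case: i => [|i] /=; rewrite !coef_avg.
  by rewrite addr0 add0r mulrA; field; rewrite gt_eqF.
by rewrite -[_ * _ *+ _]mulr_natl; move: (ia i.+1); move: (i.+1%:R) => n nz; field.
Qed.

Lemma poly_ball_max P r : 0 <= r -> exists2 t0, `|t0| <= r & forall t, `|t| <= r -> P.[t] <= P.[t0].
Proof.
move=> r0; have rr : - r <= r by rewrite (le_trans _ r0)// oppr_le0.
have [c cr H] := EVT_max rr (continuous_subspaceT (@continuous_horner R P)).
exists c => [|t tr]; first by move: cr; rewrite in_itv /= ler_norml.
by apply: H; rewrite in_itv /= -ler_norml.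
Qed.

(** At a maximum t0 of G on the symmetric interval, shrinking t0 towards 0 cannot increase G, so t0
    G'(t0) >= 0 and the equation gives G(t0) <= P(t0). *)
Lemma avg_le a P r B : 0 < a -> 0 <= r -> (forall t, `|t| <= r -> P.[t] <= B) ->
  forall t, `|t| <= r -> (avg a P).[t] <= B.
Proof.
move=> a0 r0 PB t tr; have [t0 t0r Hm] := poly_ball_max (avg a P) r0.
apply: le_trans (Hm _ tr) _; rewrite leNgt; apply/negP => GB.
have := congr1 (horner^~ t0) (avg_ode P a0).
rewrite hornerD hornerM !hornerZ hornerX => E.
pose h := avg a P \Po (t0 *: 'X).
have hE s : h.[s] = (avg a P).[s * t0] by rewrite horner_comp hornerZ hornerX mulrC.
have : 0 <= h^`().[1].
  apply: horner_max1 => s /andP[s0 s1]; rewrite !hE mul1r; apply: Hm.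
  by rewrite normrM (ger0_norm s0); apply: le_trans t0r; apply: ler_piMl.
rewrite deriv_comp derivZ derivX hornerM horner_comp !hornerZ hornerX hornerC !mulr1.
have := PB _ t0r; nra.
Qed.

Lemma avgN a P : avg a (- P) = - avg a P.
Proof. by apply/polyP => i; rewrite coefN !coef_avg coefN mulrN. Qed.

Lemma avgD a P Q : avg a (P + Q) = avg a P + avg a Q.
Proof. by apply/polyP => i; rewrite coefD !coef_avg coefD mulrDr. Qed.

Lemma bnd_avg a P r B : 0 < a -> 0 <= r -> bnd P r B -> bnd (avg a P) r B.
Proof.
move=> a0 r0 PB t tr; rewrite ler_norml; apply/andP; split.
  rewrite lerNl -hornerN -avgN; apply: (avg_le a0 r0) tr => s sr.
  by rewrite hornerN; have := PB _ sr; rewrite ler_norml => /andP[]; lra.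
apply: (avg_le a0 r0) tr => s sr.
by have := PB _ sr; rewrite ler_norml => /andP[].
Qed.

Lemma deriv_avg a P : 0 < a -> (avg a P)^`() = (a / (a + 1)) *: avg (a + 1) P^`().
Proof.
move=> a0; apply/polyP => i; rewrite coefZ coef_deriv !coef_avg coef_deriv.
rewrite -[_ * _ *+ _]mulr_natl -[P`_i.+1 *+ _]mulr_natl -natr1.
move: (i%:R) (ler0n R i) => n n0.
have h1 : n + 1 + a != 0.
  by apply: lt0r_neq0; rewrite -addrA; apply: ltr_wpDl => //; rewrite addr_gt0.
have h2 : n + (a + 1) != 0 by rewrite [a + 1]addrC addrA.
have h3 : a + 1 != 0 by rewrite gt_eqF// addr_gt0.
rewrite (_ : n + (a + 1) = n + 1 + a); last by ring.
by move: (n + 1 + a) h1 => c h1; field; rewrite h1 h3.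
Qed.

Lemma frac_le1 a b : 0 < a -> 0 <= b -> 0 <= a / (a + b) <= 1.
Proof.
move=> a0 b0; have ab : 0 < a + b by rewrite ltr_pwDl.
by rewrite divr_ge0 ?(ltW a0) ?(ltW ab)//= ler_pdivrMr// mul1r lerDl.
Qed.

Lemma bnd_derivn_avg l a P r B : 0 < a -> 0 <= r -> bnd P^`(l) r B -> bnd (avg a P)^`(l) r B.
Proof.
elim: l a P => [|l IH] a P a0 r0; first by rewrite !derivn0; exact: bnd_avg.
rewrite !derivSn deriv_avg// linearZ/= => H.
have a1 : 0 < a + 1 by rewrite addr_gt0.
have B0 : 0 <= B by apply: le_trans (H 0 _); rewrite ?normr0.
have {}H := IH (a + 1) P^`() a1 r0 H.
move=> t tr; rewrite hornerZ normrM -[B]mul1r; apply: ler_pM => //; last exact: H.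
by have /andP[f0 f1] := frac_le1 a0 ler01; rewrite ger0_norm.
Qed.

Lemma bnd_derivn_convex l P Q r B w : 0 <= w <= 1 -> bnd P^`(l) r B -> bnd Q^`(l) r B ->
  bnd (w *: P + (1 - w) *: Q)^`(l) r B.
Proof.
move=> /andP[w0 w1] HP HQ t tr; rewrite derivnD !derivnZ hornerD !hornerZ.
apply: le_trans (ler_normD _ _) _; have w2 : 0 <= 1 - w by rewrite subr_ge0.
rewrite !normrM (ger0_norm w0) (ger0_norm w2).
have := ler_wpM2l w0 (HP _ tr); have := ler_wpM2l w2 (HQ _ tr); lra.
Qed.

Variables (a sg : R).
Hypotheses (a0 : 0 < a) (sg0 : 0 < sg).

Let an (j : nat) : R := a + 2 * j%:R.
Lemma an_gt0 j : 0 < an j.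
Proof. by rewrite /an ltr_pwDl// mulr_ge0. Qed.
Let wn (j : nat) : R := an j / (an j + sg).

                                                                              
                                                                           
(** Finite products of convex combinations of the identity and an average, hence contractions for
    sup norms of all derivatives. The weights are tuned so that the multiplier telescopes as J
    grows. *)
Fixpoint KJ J P : {poly R} := if J is j.+1 then
  wn j *: KJ j P + (1 - wn j) *: avg (an j) (KJ j P) else P.

Lemma wn01 j : 0 <= wn j <= 1.
Proof.
exact: (frac_le1 (an_gt0 j) (ltW sg0)).
Qed.

Lemma bnd_KJ J l P r B : 0 <= r -> bnd P^`(l) r B -> bnd (KJ J P)^`(l) r B.
Proof.
move=> r0 H; elim: J => //= J IH; apply: bnd_derivn_convex => //; first exact: wn01.
by apply: bnd_derivn_avg => //; exact: an_gt0.
Qed.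

Definition mJ J (n : nat) : R := \prod_(j < J) (wn j * ((n%:R + an j + sg) / (n%:R + an j))).

Lemma coef_KJ J P n : (KJ J P)`_n = mJ J n * P`_n.
Proof.
elim: J => [|J IH] /=; first by rewrite /mJ big_ord0 mul1r.
rewrite coefD !coefZ coef_avg IH /mJ big_ord_recr/=.
have := an_gt0 J; rewrite /wn; move: (an J) => c c0.
have c1 : c + sg != 0 by rewrite gt_eqF// addr_gt0.
have c2 : n%:R + c != 0 by rewrite gt_eqF// ltr_wpDl.
move: (\prod_(i < J) _) => M; field; by rewrite c1 c2.
Qed.

Lemma telescope_prod (u : nat -> R) J : (forall j, u j != 0) ->
  \prod_(j < J) (u j.+1 / u j) = u J / u 0%N.
Proof.
move=> u0; elim: J => [|J IH]; first by rewrite big_ord0 divff.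
by rewrite big_ord_recr/= IH mulrC mulrA divfK.
Qed.

Lemma mJ_even J i : mJ J i.+1.*2 = mJ J i.*2 * (an i / (an i + sg)) * ((an (i + J) + sg) / an (i + J)).
Proof.
have anD (m j : nat) : m.*2%:R + an j = an (m + j).
  by rewrite /an -mul2n natrM natrD; ring.
pose u j := (an (i + j) + sg) / an (i + j).
have p j : an j != 0 by rewrite gt_eqF// an_gt0.
have ps j : an j + sg != 0 by rewrite gt_eqF// addr_gt0// an_gt0.
have u0 j : u j != 0 by rewrite /u mulf_neq0// invr_neq0.
have -> : mJ J i.+1.*2 = mJ J i.*2 * \prod_(j < J) (u j.+1 / u j).
  rewrite /mJ -big_split/=; apply: eq_bigr => j _; rewrite !anD /u addSn addnS.
  move: (p (i + j).+1) (p (i + j)%N) (ps (i + j)%N) => h1 h2 h3; field.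
  by rewrite h1 h2 h3.
by rewrite telescope_prod// /u addn0 invf_div [RHS]mulrAC [LHS]mulrA.
Qed.

(** Limit of the multiplier at the even exponent 2i. It is the 2i-th moment of a variable whose
    square has a Beta law with parameters a/2 and sg/2, obtained here without integrals. *)
Definition rho i : R := \prod_(l < i) (an l / (an l + sg)).

Lemma mJ_cvg i : (mJ J i.*2) @[J --> \oo] --> rho i.
Proof.
elim: i => [|i IH].
  rewrite (_ : (fun J => mJ J 0.*2) = fun=> 1); first by rewrite /rho big_ord0; exact: cvg_cst.
  apply/funext => J; rewrite /mJ big1// => j _; rewrite add0r /wn.
  have h1 : an j != 0 by rewrite gt_eqF// an_gt0.
  have h2 : an j + sg != 0 by rewrite gt_eqF// addr_gt0// an_gt0.
  by field; rewrite h1 h2.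
rewrite /rho big_ord_recr/= -/(rho i) -[X in _ --> X]mulr1.
rewrite (_ : (fun J => mJ J i.+1.*2) = (fun J => mJ J i.*2 * (an i / (an i + sg)) * ((an (i + J) + sg) / an (i + J)))); last first.
  by apply/funext => J; exact: mJ_even.
apply: cvgM; first by apply: cvgM => //; exact: cvg_cst.
have -> : (fun J => (an (i + J) + sg) / an (i + J)) = (fun J => 1 + sg / an (i + J)).
  by apply/funext => J; rewrite mulrDl divff// gt_eqF// an_gt0.
rewrite -[X in _ --> X]addr0; apply: cvgD; first exact: cvg_cst.
rewrite -[X in _ --> X](mulr0 sg); apply: cvgM; first exact: cvg_cst.
apply/cvgrPdist_le => e e0; near=> J; rewrite sub0r normrN ger0_norm ?invr_ge0 ?(ltW (an_gt0 _))//.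
rewrite invf_ple ?posrE ?an_gt0//; rewrite /an natrD.
apply: (@le_trans _ _ J%:R).
  near: J; exact: nbhs_infty_ger.
have : 0 <= i%:R :> R by [].
have : 0 <= J%:R :> R by [].
have := a0; lra.
Unshelve. all: by end_near.
Qed.

Definition evenp P : {poly R} := \poly_(i < size P) (if odd i then 0 else P`_i).

Lemma coef_evenp P i : (evenp P)`_i = if odd i then 0 else P`_i.
Proof. by rewrite coef_poly; case: ltnP => // iP; rewrite nth_default// if_same. Qed.

Lemma evenpE P : evenp P = 2^-1 *: (P + (P \Po (- 'X))).
Proof.
apply/polyP => i; rewrite coef_evenp coefZ coefD.
have -> : (P \Po - 'X)`_i = (-1) ^+ i * P`_i.
  rewrite -scaleN1r coef_comp_poly.
  case: (ltnP i (size P)) => iP; last first.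
    rewrite nth_default// mulr0 big1// => j _.
    rewrite exprZn coefZ coefXn (_ : (i == j) = false) ?mulr0//.
    by rewrite gtn_eqF// (leq_trans (ltn_ord j)).
  rewrite (bigD1 (Ordinal iP))//= exprZn coefZ coefXn eqxx mulr1 big1 ?addr0 1?mulrC// => j ji.
  by rewrite exprZn coefZ coefXn eq_sym (negbTE (ji : (j : nat) != i)) !mulr0.
by rewrite -signr_odd; case: (odd i); rewrite /= ?expr1 ?expr0; field.
Qed.

Lemma derivn_compN P l : (P \Po - 'X)^`(l) = (-1) ^+ l *: (P^`(l) \Po - 'X).
Proof.
elim: l => [|l IH]; first by rewrite !derivn0 expr0 scale1r.
rewrite derivnS IH derivZ deriv_comp derivN derivX mulrN1 scalerN exprS mulN1r scaleNr.
by rewrite derivnS.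
Qed.

Lemma bnd_evenp l P r B : bnd P^`(l) r B -> bnd (evenp P)^`(l) r B.
Proof.
move=> H t tr; rewrite evenpE derivnZ derivnD derivn_compN hornerZ hornerD hornerZ horner_comp hornerN hornerX.
rewrite normrM ger0_norm ?invr_ge0// ler_pdivrMl//; apply: le_trans (ler_normD _ _) _.
rewrite normrM normrX normrN1 expr1n mul1r.
have := H t tr; have := H (- t); rewrite normrN => /(_ tr); lra.
Qed.

Definition Kop P : {poly R} := \poly_(i < size P) (if odd i then 0 else rho i./2 * P`_i).

Lemma coef_Kop P i : (Kop P)`_i = if odd i then 0 else rho i./2 * P`_i.
Proof. by rewrite coef_poly; case: ltnP => // iP; rewrite nth_default// mulr0 if_same. Qed.

Lemma size_derivn_le P l : (size P^`(l) <= size P)%N.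
Proof.
apply/leq_sizeP => j jP; rewrite coef_derivn nth_default ?mul0rn//.
exact: leq_trans jP (leq_addl _ _).
Qed.

(** On the even part, [Kop] is the coefficientwise limit of the contractions [KJ]. Degrees stay
    bounded, so values converge pointwise and the bound passes to the limit. *)
Lemma bnd_Kop l P r B : 0 <= r -> bnd P^`(l) r B -> bnd (Kop P)^`(l) r B.
Proof.
move=> r0 /bnd_evenp H t tr.
have HJ J := bnd_KJ J r0 H tr.
pose u J := ((KJ J (evenp P))^`(l)).[t].
have size_KJ J : (size (KJ J (evenp P)) <= size P)%N.
  apply/leq_sizeP => j jP; rewrite coef_KJ coef_evenp nth_default// if_same mulr0//.
have uE J : u J = \sum_(i < size P) ((if odd (i + l)%N then 0 else mJ J (i + l)%N * P`_(i + l)) *+ (i + l) ^_ l) * t ^+ i.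
  rewrite /u (horner_coef_wide _ (leq_trans (size_derivn_le _ _) (size_KJ J))).
  apply: eq_bigr => i _; rewrite coef_derivn coef_KJ coef_evenp [(l + i)%N]addnC.
  by case: ifP => _; rewrite ?mulr0.
have : u J @[J --> \oo] --> ((Kop P)^`(l)).[t].
  have -> : ((Kop P)^`(l)).[t] = \sum_(i < size P) ((if odd (i + l)%N then 0 else rho (i + l)./2 * P`_(i + l)) *+ (i + l) ^_ l) * t ^+ i.
    have sK : (size (Kop P)^`(l) <= size P)%N.
      by apply: leq_trans (size_derivn_le _ _) _; exact: size_poly.
    rewrite (horner_coef_wide _ sK); apply: eq_bigr => i _.
    by rewrite coef_derivn coef_Kop [(l + i)%N]addnC.
  rewrite (_ : u = (fun J => \sum_(i < size P) ((if odd (i + l)%N then 0 else mJ J (i + l)%N * P`_(i + l)) *+ (i + l) ^_ l) * t ^+ i)); last by apply/funext.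
  apply: cvg_rsum => i; apply: cvgM; last exact: cvg_cst.
  apply: cvgMn; case: ifPn => oi; first exact: cvg_cst.
  apply: cvgM; last exact: cvg_cst.
  rewrite (_ : (fun J => mJ J (i + l)) = (fun J => mJ J (i + l)./2.*2)); first exact: mJ_cvg.
  by apply/funext => J; rewrite -{1}[(i + l)%N]odd_double_half (negbTE oi).
by move=> cu; exact: (cvg_norm_le cu HJ).
Qed.

Definition Eop b P : {poly R} := P + b^-1 *: ('X * P^`()).

(** Differential operator of order m with multiplier the product of (n+1+2j)/(1+2j) over j < m. It
    overshoots the wanted multiplier by an integer order, and [Kop] then corrects by the remaining
    positive amount [sg]. *)
Fixpoint Dop m P := if m is j.+1 then Eop (1 + 2 * j%:R) (Dop j P) else P.

Lemma oddr_neq0 (j : nat) : 1 + 2 * j%:R != 0 :> R.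
Proof. by rewrite gt_eqF// ltr_pwDl// mulr_ge0. Qed.

Definition dm m n : R := \prod_(j < m) ((n%:R + (1 + 2 * j%:R)) / (1 + 2 * j%:R)).

Lemma coef_Dop m P n : (Dop m P)`_n = dm m n * P`_n.
Proof.
rewrite /dm; elim: m => [|m IH] /=; first by rewrite big_ord0 mul1r.
rewrite /Eop coefD coefZ coefXM coef_deriv big_ord_recr/=.
have h := oddr_neq0 m; move: (\prod_(i < m) _) IH => M IH.
case: n IH => [|n] IH /=; rewrite IH; first by field.
by rewrite -[_ * _ *+ _]mulr_natl; move: (n.+1%:R) => c; field.
Qed.

Lemma derivn_XM l Q : ('X * Q)^`(l) = 'X * Q^`(l) + Q^`(l.-1) *+ l.
Proof.
elim: l => [|l IH]; first by rewrite !derivn0 mulr0n addr0.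
rewrite derivnS IH derivD derivM derivX mul1r derivMn -!derivnS /=.
have -> : (Q^`(l.-1))^`() *+ l = Q^`(l) *+ l.
  by case: (l) => [|l']; rewrite ?mulr0n// derivnS.
by rewrite mulrS addrA [X in X + _]addrC.
Qed.

Lemma bnd_Dop m l r : 0 <= r -> exists2 C, 0 <= C & forall P B, 0 <= B ->
  (forall j, (j <= l + m)%N -> bnd P^`(j) r B) -> bnd (Dop m P)^`(l) r (C * B).
Proof.
move=> r0; elim: m l => [|m IH] l.
  by exists 1 => // P B B0 H; rewrite mul1r; apply: H; rewrite addn0.
have [C1 C10 H1] := IH l; have [C2 C20 H2] := IH l.+1.
pose b : R := 1 + 2 * m%:R.
have b0 : 0 < b by rewrite ltr_pwDl// mulr_ge0.
exists (C1 + b^-1 * (r * C2 + l%:R * C1)) => [|P B B0 H].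
  have bi : 0 <= b^-1 by rewrite invr_ge0 ltW.
  by apply: addr_ge0 => //; apply: mulr_ge0 => //; apply: addr_ge0; apply: mulr_ge0.
have h1 : bnd (Dop m P)^`(l) r (C1 * B).
  by apply: H1 => // j jl; apply: H; rewrite addnS ltnW.
have h2 : bnd (Dop m P)^`(l.+1) r (C2 * B).
  by apply: H2 => // j jl; apply: H; rewrite addnS -addSn.
move=> t tr; rewrite /= /Eop derivnD derivnZ derivn_XM -derivSn.
have -> : (Dop m P)^`()^`(l.-1) *+ l = (Dop m P)^`(l) *+ l.
  by case: (l) => [|l']; rewrite ?mulr0n//= -derivSn.
rewrite hornerD hornerZ hornerD hornerM hornerX hornerMn.
rewrite (_ : _ * B = C1 * B + b^-1 * (r * (C2 * B) + l%:R * (C1 * B))); last by ring.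
apply: le_trans (ler_normD _ _) _; apply: lerD; first exact: h1.
rewrite normrM ger0_norm ?invr_ge0 ?(ltW b0)//; apply: ler_wpM2l; first by rewrite invr_ge0 ltW.
apply: le_trans (ler_normD _ _) _; apply: lerD.
  by rewrite normrM; apply: ler_pM => //; exact: h2.
by rewrite -[_ *+ l]mulr_natl normrM normr_nat; apply: ler_wpM2l => //; exact: h1.
Qed.

End Multipliers.

(** Reorders the product from m factors to n factors by telescoping, so that it can be multiplied
    termwise with [rho]. *)
Lemma dm_even (R : realType) m n :
  dm R m n.*2 = \prod_(l < n) ((1 + 2 * m%:R + 2 * l%:R) / (1 + 2 * l%:R)).
Proof.
elim: n => [|n IH].
  rewrite big_ord0 /dm big1// => j _; by rewrite add0r divff// oddr_neq0.
rewrite big_ord_recr/= -IH.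
pose u (j : nat) : R := 1 + 2 * (n + j)%:R.
have -> : dm R m n.+1.*2 = dm R m n.*2 * \prod_(j < m) (u j.+1 / u j).
  rewrite /dm -big_split/=; apply: eq_bigr => j _; rewrite /u addnS.
  have E1 : n.+1.*2%:R + (1 + 2 * j%:R) = 1 + 2 * (n + j).+1%:R :> R.
    by rewrite -mul2n natrM -!natr1 natrD; ring.
  have E2 : n.*2%:R + (1 + 2 * j%:R) = 1 + 2 * (n + j)%:R :> R.
    by rewrite -mul2n natrM natrD; ring.
  rewrite E1 E2; move: (oddr_neq0 R j) (oddr_neq0 R (n + j)) => h1 h2.
  by move: (_ + 2 * (n + j)%:R) (_ + 2 * (n + j).+1%:R) h2 => A B h2; field; rewrite h1 h2.
rewrite telescope_prod; last by move=> j; exact: oddr_neq0.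
by rewrite /u addn0 natrD; congr (_ * (_ / _)); ring.
Qed.

                                                     

(** * Bernstein polynomials in several variables *)

Section Bernstein.
Variables (R : realType).
Implicit Types t : R.

Definition bern (n j : nat) t : R := 'C(n, j)%:R * (t ^+ j * (1 - t) ^+ (n - j)).

Lemma bern_ge0 n j t : 0 <= t <= 1 -> 0 <= bern n j t.
Proof.
move=> /andP[t0 t1]; rewrite /bern mulr_ge0// mulr_ge0 ?exprn_ge0// subr_ge0//.
Qed.

Lemma bern_sum1 n t : \sum_(j < n.+1) bern n j t = 1.
Proof.
rewrite -[RHS](expr1n _ n) -[X in _ = X ^+ n](subrK t 1) exprDn.
by apply: eq_bigr => j _; rewrite -mulr_natl /bern [t ^+ j * _]mulrC.
Qed.

Lemma bern_shift n t (f : nat -> R) :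
  \sum_(j < n.+2) (j%:R * f j) * bern n.+1 j t =
  n.+1%:R * t * \sum_(j < n.+1) f j.+1 * bern n j t.
Proof.
rewrite big_ord_recl/= !mul0r add0r mulr_sumr; apply: eq_bigr => j _.
rewrite /bump/= add1n /bern subSS exprS.
have : (j.+1 * 'C(n.+1, j.+1) = n.+1 * 'C(n, j))%N by rewrite mul_bin_diag.
move=> /(congr1 (fun m => m%:R : R)); rewrite !natrM => E.
transitivity ((j.+1%:R * 'C(n.+1, j.+1)%:R) * (f j.+1 * (t * (t ^+ j * (1 - t) ^+ (n - j))))); first by ring.
by rewrite E; ring.
Qed.

Lemma bern_mean n t : \sum_(j < n.+2) j%:R * bern n.+1 j t = n.+1%:R * t.
Proof.
transitivity (\sum_(j < n.+2) (j%:R * 1) * bern n.+1 j t).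
  by apply: eq_bigr => j _; rewrite mulr1.
rewrite (bern_shift n t (fun=> 1)) -[RHS]mulr1 -[X in _ = _ * X](bern_sum1 n t).
by congr (_ * _); apply: eq_bigr => j _; rewrite mul1r.
Qed.

Lemma bern_sq n t : \sum_(j < n.+2) (j%:R * j%:R) * bern n.+1 j t = n.+1%:R * t * (n%:R * t + 1).
Proof.
rewrite (bern_shift n t (fun j => j%:R)); congr (_ * _).
under eq_bigr do rewrite -natr1 mulrDl mul1r.
rewrite big_split/= bern_sum1; congr (_ + _).
case: n => [|n]; last exact: bern_mean.
by rewrite big_ord1/= !mul0r.
Qed.

Lemma bern_var n t : \sum_(j < n.+2) (j%:R / n.+1%:R - t) ^+ 2 * bern n.+1 j t = t * (1 - t) / n.+1%:R.
Proof.
have n0 : n.+1%:R != 0 :> R by rewrite pnatr_eq0.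
have -> : \sum_(j < n.+2) (j%:R / n.+1%:R - t) ^+ 2 * bern n.+1 j t =
  (n.+1%:R ^+ 2)^-1 * (\sum_(j < n.+2) (j%:R * j%:R) * bern n.+1 j t)
  - 2 * t / n.+1%:R * (\sum_(j < n.+2) j%:R * bern n.+1 j t)
  + t ^+ 2 * \sum_(j < n.+2) bern n.+1 j t.
  rewrite !mulr_sumr -sumrN -!big_split/=; apply: eq_bigr => j _.
  by move: (bern _ _ _) (j%:R) => b c; field.
rewrite bern_sq bern_mean bern_sum1; move: n0; rewrite -natr1; move: (n%:R) => c c0; field.
exact: c0.
Qed.

Lemma bern_var_le n t : 0 <= t <= 1 ->
  \sum_(j < n.+2) (j%:R / n.+1%:R - t) ^+ 2 * bern n.+1 j t <= n.+1%:R^-1.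
Proof.
move=> /andP[t0 t1]; rewrite bern_var ler_piMl// mulr_ile1// ?subr_ge0//.
by rewrite gerBl.
Qed.

Variable N : nat.
Local Notation vec := 'rV[R]_N.

Definition bgrid n (kap : {ffun 'I_N -> 'I_n.+2}) : vec := \row_i ((kap i)%:R / n.+1%:R).
Definition bweight n (kap : {ffun 'I_N -> 'I_n.+2}) (x : vec) : R :=
  \prod_i bern n.+1 (kap i) (x ord0 i).
Definition bernN n (g : vec -> R) (x : vec) : R :=
  \sum_(kap : {ffun 'I_N -> 'I_n.+2}) g (bgrid kap) * bweight kap x.

Lemma bweight_sum1 n x : \sum_kap @bweight n kap x = 1.
Proof.
rewrite /bweight -(bigA_distr_bigA (fun i (j : 'I_n.+2) => bern n.+1 j (x ord0 i))).
by rewrite big1// => i _; exact: bern_sum1.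
Qed.

Definition cube (x : vec) := forall i, 0 <= x ord0 i <= 1.

Lemma bweight_ge0 n kap x : cube x -> 0 <= @bweight n kap x.
Proof. by move=> xc; apply: prodr_ge0 => i _; apply: bern_ge0; exact: xc. Qed.

Lemma bgrid_cube n kap : cube (@bgrid n kap).
Proof.
move=> i; rewrite mxE divr_ge0//= ler_pdivrMr ?ltr0n// mul1r ler_nat.
by rewrite -ltnS.
Qed.

Lemma bweight_var n x : cube x ->
  \sum_kap dotv (@bgrid n kap - x) (bgrid kap - x) * bweight kap x <= N%:R / n.+1%:R.
Proof.
move=> xc.
have -> : \sum_kap dotv (@bgrid n kap - x) (bgrid kap - x) * bweight kap x =
  \sum_(i < N) \sum_kap ((@bgrid n kap - x) ord0 i ^+ 2) * bweight kap x.
  rewrite exchange_big/=; apply: eq_bigr => kap _; rewrite dotvE mulr_suml.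
  by apply: eq_bigr => i _; rewrite expr2.
apply: (@le_trans _ _ (\sum_(i < N) n.+1%:R^-1)); last first.
  by rewrite sumr_const card_ord mulr_natl.
apply: ler_sum => i _.
have -> : \sum_kap ((@bgrid n kap - x) ord0 i ^+ 2) * bweight kap x =
   \sum_(kap : {ffun 'I_N -> 'I_n.+2}) \prod_l ((if l == i then ((kap l)%:R / n.+1%:R - x ord0 l) ^+ 2 else 1) * bern n.+1 (kap l) (x ord0 l)).
  apply: eq_bigr => kap _; rewrite big_split/= -big_mkcond big_pred1_eq !mxE.
  by [].
rewrite -(bigA_distr_bigA (fun l (j : 'I_n.+2) => (if l == i then (j%:R / n.+1%:R - x ord0 l) ^+ 2 else 1) * bern n.+1 j (x ord0 l))).
rewrite [leLHS](bigD1 i)//= [X in _ * X]big1 ?mulr1; last first.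
  by move=> l li; rewrite (negbTE li); under eq_bigr do rewrite mul1r; exact: bern_sum1.
rewrite eqxx; exact/bern_var_le/xc.
Qed.

Lemma polyfun_bernN n g : polyfun (bernN n g).
Proof.
apply: polyfun_sum => kap; apply: polyfunZ; rewrite /bweight.
elim: (index_enum _) => [|i r IH].
  by apply: polyfun_ext (@polyfun_cst R N 1) => x; rewrite big_nil.
apply: polyfun_ext (polyfunM (_ : polyfun (fun x => bern n.+1 (kap i) (x ord0 i))) IH) => [x|].
  by rewrite big_cons.
apply: polyfunZ; apply: polyfunM; apply: polyfunX; first exact: polyfun_coord.
by apply: polyfunB; [exact: polyfun_cst|exact: polyfun_coord].
Qed.

(** The hypothesis is a modulus of continuity with quadratic remainder, made so that the variance
    bound of the Bernstein weights finishes at once. *)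
Lemma bernN_approx n g x (eps K : R) : 0 <= K -> cube x ->
  (forall y, cube y -> `|g y - g x| <= eps + K * dotv (y - x) (y - x)) ->
  `|bernN n g x - g x| <= eps + K * (N%:R / n.+1%:R).
Proof.
move=> K0 xc H.
rewrite -[X in _ - X]mulr1 -(bweight_sum1 n x) mulr_sumr -sumrB.
apply: le_trans (ler_norm_sum _ _ _) _.
apply: (@le_trans _ _ (\sum_kap (eps + K * dotv (@bgrid n kap - x) (bgrid kap - x)) * bweight kap x)).
  apply: ler_sum => kap _; rewrite -mulrBl normrM [X in _ * X]ger0_norm ?bweight_ge0//.
  by apply: ler_wpM2r; [exact: bweight_ge0|apply: H; exact: bgrid_cube].
under eq_bigr do rewrite mulrDl -mulrA.
rewrite big_split/= -!mulr_sumr bweight_sum1 mulr1 lerD2l.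
by apply: ler_wpM2l => //; exact: bweight_var.
Qed.

End Bernstein.

(** * Weierstrass approximation of a function, and of a function with one partial derivative *)

Section Weierstrass.
Variables (R : realType) (N : nat).
Local Notation vec := 'rV[R]_N.
Implicit Types (g : vec -> R) (x y : vec).

Lemma coord_le_mxnorm x i : `|x ord0 i| <= `|x|.
Proof.
rewrite [leRHS]/Num.norm /= mx_normrE.
by apply/bigmax_geP; right => /=; exists (ord0, i).
Qed.

Lemma mxnorm_sq_le x : `|x| ^+ 2 <= dotv x x.
Proof.
have d0 := dotv_ge0 x.
rewrite -[leRHS]sqr_sqrtr// ler_pXn2r ?nnegrE ?sqrtr_ge0//.
apply: mx_norm_le_coord => [|i]; first exact: sqrtr_ge0.
by apply: coord_norm_le; rewrite ?sqrtr_ge0// sqr_sqrtr.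
Qed.

(** Near a centre, nearby points are handled by continuity and distant ones by a large K;
    compactness of the ball makes K uniform. *)
Lemma unif_modulus g (r eps : R) : continuous g -> 0 < eps -> exists2 K, 0 <= K &
  forall x y, dotv x x <= r ^+ 2 -> dotv y y <= r ^+ 2 ->
    `|g y - g x| <= eps + K * dotv (y - x) (y - x).
Proof.
move=> cg e0; have [M M0 gM] := ball_bounded r cg.
have /compact_near_coveringP := @compact_ball R N r.
move=> /(_ R (pinfty_nbhs R) (fun K x => 0 <= K /\ forall y, dotv y y <= r ^+ 2 ->
   dotv x x <= r ^+ 2 -> `|g y - g x| <= eps + K * dotv (y - x) (y - x)) _).
case=> [c cr|K0 [_ HK]].
  have /cvgrPdist_lt/(_ (eps / 2)) := cg c.
  rewrite divr_gt0// => /(_ isT)/nbhs_ballP[d /= d0 hd].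
  (* Beyond distance d/2 the quadratic term is at least 2 [M], which bounds the oscillation of g on
     the ball. *)
  pose K1 : R := 2 * M / (d / 2) ^+ 2.
  have d2 : 0 < (d / 2) ^+ 2 by rewrite exprn_gt0// divr_gt0.
  have K10 : 0 <= K1 by rewrite divr_ge0 ?(ltW d2)// mulr_ge0.
  exists (ball c (d / 2), [set K | K1 < K]) => /=.
    split; first by apply: nbhsx_ballx; rewrite divr_gt0.
    by exists K1; split => //; rewrite num_real.
  move=> [x K] /= [xc KK]; split => [|y yr xr]; first by rewrite (le_trans K10)// ltW.
  have K0 : 0 <= K by rewrite (le_trans K10)// ltW.
  have xd : ball c d x by apply: le_ball xc; rewrite ler_pdivrMr// mulr_natr mulr2n lerDl ltW.
  case: (ltrP `|y - x| (d / 2)) => yx.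
    have yd : ball c d y.
      rewrite -ball_normE /=; rewrite -ball_normE /= in xc.
      rewrite -(subrK x c) -addrA; apply: le_lt_trans (ler_normD _ _) _.
      by rewrite [`|x - y|]distrC; lra.
    have h1 := hd _ xd; have h2 := hd _ yd.
    rewrite -(subrK (g c) (g y)) -addrA; apply: le_trans (ler_normD _ _) _.
    rewrite /= in h1 h2; rewrite distrC in h2.
    have : 0 <= K * dotv (y - x) (y - x) by rewrite mulr_ge0// dotv_ge0.
    lra.
  apply: le_trans (ler_normB _ _) _.
  have g1 := gM _ yr; have g2 := gM _ xr.
  have dy : (d / 2) ^+ 2 <= dotv (y - x) (y - x).
    apply: le_trans (mxnorm_sq_le _); rewrite ler_pXn2r ?nnegrE//.
    by rewrite divr_ge0// ltW.
  have : K1 * (d / 2) ^+ 2 <= K * dotv (y - x) (y - x).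
    by apply: ler_pM => //; [exact: ltW|exact: ltW].
  rewrite /K1 divfK ?gt_eqF//; lra.
have KK : K0 < Num.max (K0 + 1) 0 by rewrite lt_max ltrDl ltr01.
exists (Num.max (K0 + 1) 0) => [|x y xr yr]; first by rewrite le_max lexx orbT.
have [_] := HK _ KK x xr.
exact.
Qed.

Lemma cube_of_ball (r : R) x : 0 < r -> dotv x x <= r ^+ 2 ->
  cube ((2 * r)^-1 *: (x + \row_i r)).
Proof.
move=> r0 xr i; have := coord_norm_le i (ltW r0) xr; rewrite ler_norml => /andP[h1 h2].
rewrite !mxE; have r2 : 0 < 2 * r by rewrite mulr_gt0.
by rewrite mulrC divr_ge0 ?(ltW r2)//= ?ler_pdivrMr//; lra.
Qed.

Definition of_cube (r : R) x : vec := (2 * r) *: x - \row_i r.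

Lemma of_cubeK (r : R) x : 0 < r -> of_cube r ((2 * r)^-1 *: (x + \row_i r)) = x.
Proof.
move=> r0; rewrite /of_cube scalerA divff ?scale1r ?addrK//.
by rewrite mulf_neq0// gt_eqF.
Qed.

Lemma continuous_of_cube (r : R) : continuous (of_cube r).
Proof.
by move=> x; apply: differentiable_continuous; apply: differentiableB.
Qed.

Lemma weierstrass g (r eps : R) : continuous g -> 0 < eps ->
  exists2 p, polyfun p & forall x, dotv x x <= r ^+ 2 -> `|p x - g x| <= eps.
Proof.
move=> cg e0.
wlog r0 : r / 0 < r.
  move=> H; have [|p pp Hp] := H (`|r| + 1).
    by rewrite ltr_wpDl.
  exists p => // x xr; apply: Hp; apply: le_trans xr _.
  rewrite -[leLHS]real_normK ?num_real// ler_pXn2r ?nnegrE ?addr_ge0//.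
  by rewrite lerDl.
pose h x := g (of_cube r x).
have ch : continuous h.
  move=> x; apply: (continuous_comp (f := of_cube r)); [exact: continuous_of_cube|exact: cg].
have e2 : 0 < eps / 2 by rewrite divr_gt0.
have [K K0 HK] := unif_modulus (Num.sqrt N%:R) ch e2.
have [n Hn] : exists n : nat, K * N%:R / (eps / 2) <= n.+1%:R.
  have := archi_boundP (x := K * N%:R / (eps / 2)) _.
  rewrite divr_ge0 ?(ltW e2) ?mulr_ge0// => /(_ isT) H.
  exists (Num.bound (K * N%:R / (eps / 2))); apply: le_trans (ltW H) _.
  by rewrite ler_nat.
exists (fun x => bernN n h ((2 * r)^-1 *: (x + \row_i r))) => [|x xr].
  apply: polyfun_ext (polyfun_affine ((2 * r)^-1) ((2 * r)^-1 *: \row_i r) (polyfun_bernN n h)) => x.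
  by rewrite scalerDr.
have cb y : cube y -> dotv y y <= (Num.sqrt N%:R) ^+ 2.
  move=> yc; rewrite sqr_sqrtr// dotvE -[in leRHS](card_ord N) -sumr_const.
  by apply: ler_sum => i _; have /andP[? ?] := yc i; rewrite mulr_ile1.
have xc := cube_of_ball r0 xr.
have := @bernN_approx R N n h _ (eps / 2) K K0 xc (fun y yc => HK _ _ (cb _ xc) (cb _ yc)).
rewrite {2}/h of_cubeK// => /le_trans; apply.
rewrite mulrA -lerBrDl; apply: (@le_trans _ _ (eps / 2)); last by lra.
by rewrite ler_pdivrMr// -ler_pdivrMl// mulrC.
Qed.

Local Notation e i := (delta_mx ord0 i : vec).

(** Primitive in the i-th coordinate of x_i^n p, vanishing on x_i = 0. The power n is carried along
    so that the induction step multiplying by x_i itself is absorbed. *)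
Lemma antiderivative i p : polyfun p -> forall n, exists S : vec -> R,
  [/\ polyfun S, forall x, pd (e i) S x = x ord0 i ^+ n * p x & forall x, x ord0 i = 0 -> S x = 0].
Proof.
move: p; apply: polyfun_ind => [c n|p q _ _ IHp IHq n|j p pp IH n].
- exists (fun x => (c / n.+1%:R) * x ord0 i ^+ n.+1).
  have pX m : polyfun (fun x : vec => x ord0 i ^+ m) by apply: polyfunX; exact: polyfun_coord.
  split=> [|x|x ->]; first exact: polyfunZ.
    rewrite pdZ// pdX ?pd_coord; last exact: polyfun_coord.
    by rewrite mxE !eqxx/=; field; rewrite addrC natr1 pnatr_eq0.
  by rewrite expr0n mulr0.
- have [S1 [p1 d1 z1]] := IHp n; have [S2 [p2 d2 z2]] := IHq n.
  exists (fun x => S1 x + S2 x); split=> [|x|x x0]; first exact: polyfunD.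
    by rewrite pdD// d1 d2 mulrDr.
  by rewrite z1// z2// addr0.
- have [<-|ij] := eqVneq i j.
    have [S [p1 d1 z1]] := IH n.+1; exists S; split=> // x.
    by rewrite d1 exprSr mulrA.
  have [S [p1 d1 z1]] := IH n; exists (fun x => x ord0 j * S x).
  have pc := @polyfun_coord R N j.
  split=> [|x|x x0]; first exact: polyfunM.
    by rewrite pdM// pd_coord d1 mxE /= eq_sym (negbTE ij) mul0r add0r mulrCA.
  by rewrite z1// mulr0.
Qed.

Definition dropc i x : vec := x - x ord0 i *: e i.

Lemma dropc_coord i x : (dropc i x) ord0 i = 0.
Proof. by rewrite !mxE !eqxx mulr1 subrr. Qed.

Lemma dotv_coordl i x : dotv (e i) x = x ord0 i.
Proof. by rewrite dotvC dotv_delta. Qed.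

Lemma dropc_path i x (t : R) : 0 <= t <= 1 ->
  dotv (dropc i x + t *: (x ord0 i *: e i)) (dropc i x + t *: (x ord0 i *: e i)) <= dotv x x.
Proof.
move=> /andP[t0 t1]; have -> : dropc i x + t *: (x ord0 i *: e i) = x + ((t - 1) * x ord0 i) *: e i.
  by rewrite scalerA mulrBl mul1r scalerBl addrCA addrC /dropc -addrA [- _ + _]addrC.
rewrite !(dotvDl,dotvDr,dotvZl,dotvZr,dotv_delta,dotv_coordl) mxE !eqxx/=.
set a := x ord0 i; have := sqr_ge0 a; have : 0 <= (1 - t) * (1 + t) by rewrite mulr_ge0// ?subr_ge0// addr_ge0.
nra.
Qed.

Lemma is_derive_line g x v (t : R) : derivable g (x + t *: v) v ->
  is_derive t 1 (fun s : R => g (x + s *: v)) (derive g (x + t *: v) v).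
Proof.
move=> dg.
have E : (fun h : R => h^-1 *: (((fun s : R => g (x + s *: v)) \o shift t) (h *: 1) - g (x + t *: v))) =
  (fun h : R => h^-1 *: ((g \o shift (x + t *: v)) (h *: v) - g (x + t *: v))).
  by apply/funext => h /=; rewrite [h *: 1]mulr1 scalerDl [in X in g X]addrCA.
by split; [rewrite /derivable E|rewrite /derive E].
Qed.

Lemma mvt_line g x v B : (forall t : R, 0 <= t <= 1 -> derivable g (x + t *: v) v) ->
  (forall t : R, 0 <= t <= 1 -> `|derive g (x + t *: v) v| <= B) ->
  `|g (x + v) - g x| <= B.
Proof.
move=> dg HB.
have I (t : R) : t \in `[0, 1] -> 0 <= t <= 1 by rewrite in_itv.
have [c /I c01] := @MVT_segment R (fun s : R => g (x + s *: v)) (fun t => derive g (x + t *: v) v) 0 1 ler01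
  (fun t (ht : t \in `]0, 1[) => is_derive_line (dg t (I t (subset_itv_oo_cc ht))))
  (derivable_within_continuous (fun t ht => @ex_derive _ _ _ _ _ _ _ (is_derive_line (dg t (I t ht))))).
rewrite scale1r scale0r addr0 subr0 mulr1 => ->; exact: HB.
Qed.

(** Approximate the partial derivative, integrate it along the i-th coordinate, and start from an
    approximation of g on the hyperplane x_i = 0. The mean value inequality controls the total
    error. *)
Lemma weierstrass1 i g (r eps : R) : (forall x, differentiable g x) ->
  continuous (fun x => derive g x (e i)) -> 0 < eps ->
  exists p, [/\ polyfun p, forall x, dotv x x <= r ^+ 2 -> `|p x - g x| <= eps &
    forall x, dotv x x <= r ^+ 2 -> `|pd (e i) p x - derive g x (e i)| <= eps].
Proof.
move=> dg cdg e0; have cg : continuous g by move=> x; exact: differentiable_continuous.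
pose d := eps / (1 + `|r|).
have r1 : 0 < 1 + `|r| by rewrite ltr_pwDl.
have d0 : 0 < d by rewrite divr_gt0.
have [P pP HP] := weierstrass r cg d0.
have [Q pQ HQ] := weierstrass r cdg d0.
have [S [pS dS zS]] := antiderivative i pQ 0.
(* [A] projects onto the hyperplane x_i = 0; with d = eps/(1+|r|) the error there and the error
   integrated over length at most |r| add up to eps. *)
pose A : 'M[R]_N := 1%:M - (e i)^T *m e i.
have AE x : x *m A = dropc i x.
  rewrite /A mulmxBr mulmx1 mulmxA /dropc; congr (_ - _).
  rewrite [x *m _]mx11_scalar mul_scalar_mx; congr (_ *: _).
  by rewrite -/(dotv x (e i)) dotv_delta.
have pPA := polyfun_mulmx A pP.
have de : d <= eps by rewrite ler_pdivrMr// ler_peMr ?(ltW e0)// lerDl.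
exists (fun x => P (x *m A) + S x).
have dE x : pd (e i) (fun x => P (x *m A) + S x) x = Q x.
  rewrite pdD// dS expr0 mul1r pd_mulmx AE /dropc mxE !eqxx scale1r subrr.
  rewrite -(scale0r (0 : vec)) pd_dirZ// mul0r add0r //.
split=> [|x xr|x xr]; [exact: polyfunD| |by rewrite dE (le_trans (HQ _ xr))].
have pp : polyfun (fun x => P (x *m A) + S x) by exact: polyfunD.
pose h y := (P (y *m A) + S y) - g y.
have dh y v : derivable h y v.
  by apply: derivableB; [exact: polyfun_derivable|exact: diff_derivable].
have hE : h x = h (dropc i x + x ord0 i *: e i) by rewrite /dropc subrK.
rewrite -/(h x) hE -[X in `|X|](subrK (h (dropc i x))).
apply: le_trans (ler_normD _ _) _.
have -> : eps = `|r| * d + d by rewrite /d -[X in _ + X]mul1r -mulrDl addrC mulrC divfK ?gt_eqF.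
apply: lerD.
  apply: mvt_line => // t t01; have := dropc_path i x t01; set y := (_ + _ *: _) => yx.
  have yr := le_trans yx xr.
  rewrite derive_dirZ; last first.
    by apply: differentiableB => //; exact: polyfun_differentiable.
  rewrite deriveB; [|exact: polyfun_derivable|exact: diff_derivable].
  rewrite pdE dE normrM; apply: ler_pM => //; last exact: HQ.
  by apply: coord_norm_le => //; rewrite real_normK ?num_real.
have x0r : dotv (dropc i x) (dropc i x) <= r ^+ 2.
  apply: le_trans xr; have := @dropc_path i x 0; rewrite scale0r addr0; apply.
  by rewrite lexx ler01.
rewrite /h zS ?dropc_coord// addr0.
have -> : dropc i x *m A = dropc i x by rewrite AE {1}/dropc dropc_coord scale0r subr0.
exact: HP.
Qed.

End Weierstrass.

(** * Mean value bounds and simultaneous approximation of derivatives in one variable *)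

Section OneVariable.
Variable R : realType.
Implicit Types (P Q : {poly R}) (F : nat -> R -> R).

Lemma mvt_bound (f df : R -> R) (a b B : R) : a <= b -> (forall t : R, is_derive t 1 f (df t)) ->
  (forall t, a <= t <= b -> `|df t| <= B) -> `|f b - f a| <= B * (b - a).
Proof.
move=> ab fd H.
have I t : t \in `[a, b] -> a <= t <= b by rewrite in_itv.
have [c /I cab ->] := @MVT_segment R f df a b ab (fun t _ => fd t)
   (derivable_within_continuous (fun t _ => @ex_derive _ _ _ _ _ _ _ (fd t))).
by rewrite normrM [X in _ * X]ger0_norm ?subr_ge0// ler_wpM2r ?subr_ge0//; exact: H.
Qed.

Lemma mvt_bound0 (f df : R -> R) (r B : R) : 0 <= r -> (forall t : R, is_derive t 1 f (df t)) ->
  (forall t, `|t| <= r -> `|df t| <= B) -> forall t, `|t| <= r -> `|f t - f 0| <= r * B.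
Proof.
move=> r0 fd H t; have B0 : 0 <= B by apply: le_trans (H 0 _); rewrite ?normr0.
rewrite ler_norml => /andP[t1 t2].
have [t0|/ltW t0] := leP 0 t.
  apply: (@le_trans _ _ (B * (t - 0))); last by rewrite subr0 mulrC ler_wpM2r.
  apply: (mvt_bound t0 fd) => u /andP[u0 u1]; apply: H.
  by rewrite ger0_norm// (le_trans u1).
rewrite distrC; apply: (@le_trans _ _ (B * (0 - t))); last by rewrite mulrC ler_wpM2r// sub0r lerNl.
apply: (mvt_bound t0 fd) => u /andP[u0 u1]; apply: H.
by rewrite ler0_norm// lerNl (le_trans t1).
Qed.

Definition antid P : {poly R} := \poly_(i < (size P).+1) (P`_i.-1 / i%:R).

Lemma antid0 P : (antid P).[0] = 0.
Proof. by rewrite horner_coef0 coef_poly /= invr0 mulr0. Qed.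

Lemma deriv_antid P : (antid P)^`() = P.
Proof.
apply/polyP => i; rewrite coef_deriv coef_poly ltnS.
case: ltnP => [iP|/leq_sizeP -> //]; last by rewrite mul0rn.
by rewrite -[LHS]mulr_natr divfK// pnatr_eq0.
Qed.

Lemma is_derive_horner P (t : R) : is_derive t 1 (fun s => P.[s]) P^`().[t].
Proof. exact: is_derive_poly. Qed.

Lemma weierstrass_1D (f : R -> R) (r eps : R) : continuous f -> 0 < eps -> 0 <= r ->
  exists P, forall t, `|t| <= r -> `|P.[t] - f t| <= eps.
Proof.
move=> cf e0 r0.
have cg : continuous (fun x : 'rV[R]_1 => f (x ord0 ord0)).
  move=> x; apply: (@continuous_comp _ _ _ (fun x : 'rV[R]_1 => x ord0 ord0) f); last exact: cf.
  exact: coord_continuous.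
have [p pp Hp] := weierstrass r cg e0.
have [P HP] := pd_line pp 0 (delta_mx ord0 ord0).
exists P => t tr; have [<- _] := HP t; rewrite add0r.
have := Hp (t *: delta_mx ord0 ord0); rewrite dotv_scale2 mxE dotv_delta mxE !eqxx !mulr1; apply.
by rewrite -real_normK ?num_real// ler_pXn2r ?nnegrE.
Qed.

(** Approximate the highest derivative and integrate back, restoring the value at 0 each time; each
    integration costs at most the factor r. *)
Lemma poly_approx_family m : forall F (r eps : R), (forall j (t : R), is_derive t 1 (F j) (F j.+1 t)) ->
  0 < eps -> 0 <= r ->
  exists P, forall j t, (j <= m)%N -> `|t| <= r -> `|P^`(j).[t] - F j t| <= eps.
Proof.
elim: m => [|m IH] F r eps dF e0 r0.
  have cF : continuous (F 0%N).
    by move=> t; apply: differentiable_continuous; apply/derivable1_diffP; exact: ex_derive.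
  have [P HP] := weierstrass_1D cF e0 r0; exists P => j t; rewrite leqn0 => /eqP -> tr.
  by rewrite derivn0; exact: HP.
have r1 : 0 < 1 + r by rewrite ltr_pwDl.
have d0 : 0 < eps / (1 + r) by rewrite divr_gt0.
have [P HP] := IH (fun j => F j.+1) r _ (fun j t => dF j.+1 t) d0 r0.
have de : eps / (1 + r) <= eps by rewrite ler_pdivrMr// ler_peMr ?(ltW e0)// lerDl.
exists (antid P + (F 0%N 0)%:P) => -[|j] t jm tr.
  rewrite derivn0.
  have D (s : R) : is_derive s 1 (fun s => (antid P + (F 0%N 0)%:P).[s] - F 0%N s) (P.[s] - F 1%N s).
    have := is_deriveB (is_derive_horner (antid P + (F 0%N 0)%:P) s) (dF 0%N s).
    by rewrite derivD derivC addr0 deriv_antid.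
  have := mvt_bound0 r0 D (fun s hs => HP 0%N s (leq0n _) hs) tr.
  rewrite [in X in _ - X]hornerD antid0 add0r hornerC subrr subr0 => /le_trans; apply.
  rewrite mulrA ler_pdivrMr// mulrC; have := ltW e0; nra.
rewrite derivSn derivD derivC addr0 deriv_antid.
exact: le_trans (HP _ _ jm tr) de.
Qed.

Lemma poly_taylor1 P (B : R) : (forall t, 0 <= t <= 1 -> `|P^`()^`().[t]| <= B) ->
  `|P.[1] - P.[0] - P^`().[0]| <= B.
Proof.
move=> H; have B0 : 0 <= B by apply: le_trans (H 0 _); rewrite ?lexx ?ler01.
have D1 (s : R) : is_derive s 1 (fun s => (P - P^`().[0] *: 'X).[s]) (P^`().[s] - P^`().[0]).
  have := is_derive_horner (P - P^`().[0] *: 'X) s.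
  by rewrite derivB derivZ derivX !(hornerE, mulr1).
have := mvt_bound ler01 D1 (B := B).
have -> : P.[1] - P.[0] - P^`().[0] = (P - P^`().[0] *: 'X).[1] - (P - P^`().[0] *: 'X).[0].
  by rewrite !hornerE; ring.
rewrite subr0 mulr1; apply.
move=> t /andP[t0 t1].
apply: le_trans (mvt_bound t0 (is_derive_horner P^`()) (B := B) _) _ => [s /andP[s0 s1]|].
  by apply: H; rewrite s0 (le_trans s1).
by rewrite subr0 ler_piMr.
Qed.

Lemma real_cauchy_cvg (u : nat -> R) :
  (forall eps, 0 < eps -> exists n0, forall n m, (n0 <= n)%N -> (n0 <= m)%N -> `|u n - u m| <= eps) ->
  exists l : R, u n @[n --> \oo] --> l.
Proof.
move=> H; apply/cvg_ex; apply/cauchy_cvgP/cauchy_exP => eps e0.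
have e2 : 0 < eps / 2 by rewrite divr_gt0.
have [n0 Hn] := H _ e2; exists (u n0); exists n0 => // n /= nn.
rewrite -ball_normE /=; apply: le_lt_trans (Hn _ _ (leqnn _) nn) _.
by rewrite ltr_pdivrMr// mulr_natr mulr2n ltrDl.
Qed.

Lemma cvg_dist_le (u : nat -> R) (l a B : R) n0 :
  u n @[n --> \oo] --> l -> (forall n, (n0 <= n)%N -> `|a - u n| <= B) -> `|a - l| <= B.
Proof.
move=> ul H; apply: (@cvg_norm_le R (fun n => a - u (n + n0)%N)).
  apply: cvgB; first exact: cvg_cst.
  by have := ul; rewrite -(cvg_shiftn n0).
by move=> n; apply: H; rewrite leq_addl.
Qed.

End OneVariable.

(** * Limits of polynomials in the smooth topology *)

Section SmoothLimit.
Variables (R : realType) (N : nat).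
Local Notation vec := 'rV[R]_N.
Implicit Types (g : vec -> R) (x y v h : vec).
Local Notation e i := (delta_mx ord0 i : vec).

Lemma sq_littleo_differentiable g x (C : R) : 0 <= C -> g x = 0 ->
  (forall h, `|h| <= 1 -> `|g (x + h)| <= C * `|h| ^+ 2) ->
  differentiable g x /\ forall v, derive g x v = 0.
Proof.
move=> C0 gx H.
have E : g \o shift x = cst (g x) + (\0 : {linear vec -> R}) +o_ (0 : vec) id.
  apply/eqaddoP => eps e0.
  have d0 : 0 < Num.min 1 (eps / (C + 1)) by rewrite lt_min ltr01 divr_gt0// ltr_wpDl.
  apply/nbhs_ballP; exists (Num.min 1 (eps / (C + 1))) => //= h; rewrite -ball_normE /= sub0r normrN => hd.
  rewrite /= gx !fctE /= !addr0 subr0 [h + x]addrC.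
  move: hd; rewrite lt_min => /andP[/ltW h1 h2].
  apply: le_trans (H _ h1) _; rewrite expr2 mulrA ler_wpM2r//.
  apply: (@le_trans _ _ ((C + 1) * `|h|)); first by rewrite ler_wpM2r// lerDl.
  by rewrite mulrC -ler_pdivlMr ?ltW// ltr_wpDl.
have c0 : continuous (\0 : {linear vec -> R}) by exact: (@cst_continuous vec R 0).
have D := diff_unique c0 E.
have df : differentiable g x by apply/diff_locallyP; rewrite D; split.
by split=> // v; rewrite deriveE// D.
Qed.

Lemma taylor_differentiable g x (a : vec) (C : R) : 0 <= C ->
  (forall h, `|h| <= 1 -> `|g (x + h) - g x - dotv h a| <= C * `|h| ^+ 2) ->
  differentiable g x /\ forall v, derive g x v = dotv v a.
Proof.
move=> C0 H.
pose q y := dotv (y - x) a + g x.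
have pq : polyfun q.
  apply: polyfunD (@polyfun_cst R N _).
  apply: polyfun_ext (polyfunB (polyfun_dotv a) (@polyfun_cst R N (dotv x a))) => y.
  by rewrite dotvBl.
have [|h h1|d1 d2] := @sq_littleo_differentiable (fun y => g y - q y) x C C0.
- by rewrite /q subrr dotv0l add0r subrr.
- by have := H h h1; rewrite /q [x + h - x]addrC addKr opprD addrA addrAC.
have dq := polyfun_differentiable x pq.
have gE : g = (fun y => (g y - q y) + q y) by apply/funext => y; rewrite subrK.
split=> [|v]; first by rewrite gE; exact: differentiableD.
rewrite gE derive_addv; [|exact: diff_derivable|exact: diff_derivable].
rewrite d2 add0r pdE pdD ?pd_cst ?addr0; last exact: polyfun_cst; last first.
  by apply: polyfun_ext (polyfunB (polyfun_dotv a) (@polyfun_cst R N (dotv x a))) => y; rewrite dotvBl.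
by rewrite (pd_shift (- x) (fun y => dotv y a)) pd_dotv.
Qed.

Lemma dotv_le_norm x (r : R) : `|x| <= r -> dotv x x <= (N%:R * r) ^+ 2.
Proof.
move=> xr; have r0 : 0 <= r := le_trans (normr_ge0 _) xr.
apply: (@le_trans _ _ (\sum_(i < N) r ^+ 2)).
  rewrite dotvE; apply: ler_sum => i _; rewrite -expr2 -real_normK ?num_real// ler_pXn2r ?nnegrE//.
  exact: le_trans (coord_le_mxnorm _ _) xr.
rewrite sumr_const card_ord -[leLHS]mulr_natl exprMn ler_wpM2r ?sqr_ge0// -natrX ler_nat expnS expn1.
by case: (N) => // n; rewrite leq_pmulr.
Qed.

Lemma pd2_coordE p h x : polyfun p ->
  pd h (pd h p) x = \sum_i h ord0 i * \sum_j h ord0 j * pd (e i) (pd (e j) p) x.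
Proof.
move=> pp; rewrite pd_coordE; last exact: polyfun_pd.
apply: eq_bigr => i _; congr (_ * _).
rewrite -pd_comm// pd_coordE; last exact: polyfun_pd.
by apply: eq_bigr => j _; rewrite pd_comm.
Qed.

Lemma pd2_bound p h x (B : R) : polyfun p -> (forall i j, `|pd (e i) (pd (e j) p) x| <= B) ->
  `|pd h (pd h p) x| <= (N%:R * N%:R * B) * `|h| ^+ 2.
Proof.
move=> pp H; rewrite pd2_coordE//; apply: le_trans (ler_norm_sum _ _ _) _.
apply: (@le_trans _ _ (\sum_(i < N) `|h| * (N%:R * (`|h| * B)))); last first.
  rewrite sumr_const card_ord -[leLHS]mulr_natl le_eqVlt; apply/orP; left; apply/eqP; ring.
apply: ler_sum => i _; rewrite normrM; apply: ler_pM => //; first exact: coord_le_mxnorm.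
apply: le_trans (ler_norm_sum _ _ _) _.
apply: (@le_trans _ _ (\sum_(j < N) `|h| * B)); last by rewrite sumr_const card_ord mulr_natl.
apply: ler_sum => j _; rewrite normrM; apply: ler_pM => //; exact: coord_le_mxnorm.
Qed.

Lemma poly_taylor p x h (B : R) : polyfun p ->
  (forall y, `|y| <= `|x| + `|h| -> forall i j, `|pd (e i) (pd (e j) p) y| <= B) ->
  `|p (x + h) - p x - pd h p x| <= (N%:R * N%:R * B) * `|h| ^+ 2.
Proof.
move=> pp H; have [P HP] := pd_line2 pp x h.
have [E0 E1 _] := HP 0; have [E2 _ _] := HP 1.
rewrite scale0r addr0 in E0 E1; rewrite scale1r in E2; rewrite E2 E0 E1.
apply: poly_taylor1 => t /andP[t0 t1]; have [_ _ <-] := HP t.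
apply: pd2_bound => // i j; apply: H; apply: le_trans (ler_normD _ _) _.
by rewrite lerD2l normrZ ger0_norm// ler_piMl.
Qed.

Definition smooth_cauchy (p : nat -> vec -> R) := forall s (r eps : R), 0 < eps ->
  exists n0, forall n m, (n0 <= n)%N -> (n0 <= m)%N ->
  forall x, `|x| <= r -> `|Dseq s (p n) x - Dseq s (p m) x| <= eps.

Definition smooth_cvg (p : nat -> vec -> R) g := forall s (r eps : R), 0 < eps ->
  exists n0, forall n, (n0 <= n)%N ->
  forall x, `|x| <= r -> `|Dseq s (p n) x - Dseq s g x| <= eps.

(** Every iterated derivative converges locally uniformly to some G s. Second-order Taylor estimates
    for the polynomials have uniform constants, so they survive in the limit and show that G (v ::
    s) is the derivative of G s along v. *)
Lemma smooth_limit (p : nat -> vec -> R) : (forall n, polyfun (p n)) -> smooth_cauchy p ->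
  exists2 g, smooth g & smooth_cvg p g.
Proof.
move=> pp cp.
have lim_ex s x : exists l : R, Dseq s (p n) x @[n --> \oo] --> l.
  apply: real_cauchy_cvg => eps e0; have [n0 Hn] := cp s `|x| _ e0.
  by exists n0 => n m nn nm; exact: Hn.
have [G HG] : exists G : seq vec -> vec -> R, forall s x, Dseq s (p n) x @[n --> \oo] --> G s x.
  have [G HG] := choice (fun sx : seq vec * vec => lim_ex sx.1 sx.2).
  by exists (fun s x => G (s, x)) => s x; exact: (HG (s, x)).
have unif s (r eps : R) : 0 < eps -> exists n0, forall n, (n0 <= n)%N ->
    forall x, `|x| <= r -> `|Dseq s (p n) x - G s x| <= eps.
  move=> e0; have [n0 Hn] := cp s r _ e0; exists n0 => n nn x xr.
  apply: (cvg_dist_le (n0 := n0) (HG s x)) => m nm; exact: Hn.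
have bounded s (r : R) : exists2 B : R, 0 <= B &
    exists n0, forall n, (n0 <= n)%N -> forall x, `|x| <= r -> `|Dseq s (p n) x| <= B.
  have [n0 Hn] := cp s r 1 ltr01.
  have [B B0 HB] := ball_bounded (N%:R * r) (polyfun_continuous (polyfun_Dseq s (pp n0))).
  exists (1 + B); first by rewrite addr_ge0.
  exists n0 => n nn x xr; rewrite -[X in `|X|](subrK (Dseq s (p n0) x)).
  apply: le_trans (ler_normD _ _) _; apply: lerD; first exact: Hn.
  exact/HB/dotv_le_norm.
have main s x : differentiable (G s) x /\ forall v, derive (G s) x v = G (v :: s) x.
  pose a : vec := \row_i G (e i :: s) x.
  have aE v : dotv v a = G (v :: s) x.
    have H1 : (fun n => Dseq (v :: s) (p n) x) =
      (fun n => \sum_i v ord0 i * Dseq (e i :: s) (p n) x).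
      apply/funext => n; rewrite Dseq_cons pd_coordE; last exact: polyfun_Dseq.
      by apply: eq_bigr => i _; rewrite Dseq_cons.
    have := HG (v :: s) x; rewrite H1 => H2.
    have H3 : (fun n => \sum_i v ord0 i * Dseq (e i :: s) (p n) x) @ \oo --> dotv v a.
      rewrite dotvE; apply: cvg_rsum => i; rewrite mxE; apply: cvgMr; exact: HG.
    exact: (cvg_unique (@Rhausdorff R) H3 H2).
  (* One constant bounding all second partials of D_s p_n near x, for all late n: sum the bounds
     over the finitely many pairs of coordinates and take the largest threshold. *)
  have [B [B0 [n0 Hn]]] : exists B : R, 0 <= B /\ exists n0, forall n, (n0 <= n)%N ->
      forall y, `|y| <= `|x| + 1 -> forall i j, `|pd (e i) (pd (e j) (Dseq s (p n))) y| <= B.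
    have [BB HBB] := choice (fun ij : 'I_N * 'I_N => let: ex_intro2 B B0 HB := bounded [:: e ij.1, e ij.2 & s] (`|x| + 1) in
       ex_intro (fun B : R * nat => 0 <= B.1 /\ forall n, (B.2 <= n)%N -> forall y, `|y| <= `|x| + 1 ->
         `|Dseq [:: e ij.1, e ij.2 & s] (p n) y| <= B.1) (B, projT1 (cid HB)) (conj B0 (projT2 (cid HB)))).
    exists (\sum_ij (BB ij).1); split; first by apply: sumr_ge0 => ij _; have [] := HBB ij.
    exists (\max_ij (BB ij).2) => n nn y yr i j.
    have [b0 Hb] := HBB (i, j).
    have := Hb n (leq_trans (leq_bigmax (i, j)) nn) y yr; rewrite !Dseq_cons => /le_trans; apply.
    rewrite (bigD1 (i, j))//= lerDl; apply: sumr_ge0 => ij _; by have [] := HBB ij.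
  have C0 : 0 <= N%:R * N%:R * B by rewrite !mulr_ge0.
  have [|d1 d2] := @taylor_differentiable (G s) x a _ C0; last by split => // v; rewrite d2 aE.
  move=> h h1.
  have lim : (fun n => Dseq s (p n) (x + h) - Dseq s (p n) x - Dseq (h :: s) (p n) x) @ \oo -->
     G s (x + h) - G s x - dotv h a.
    by rewrite aE; apply: cvgB; [apply: cvgB|]; exact: HG.
  have := @cvg_dist_le R _ _ 0 (N%:R * N%:R * B * `|h| ^+ 2) n0 lim.
  rewrite sub0r normrN; apply => n nn; rewrite sub0r normrN Dseq_cons.
  apply: poly_taylor; first exact: polyfun_Dseq.
  move=> y yh; apply: Hn => //; apply: le_trans yh _; by rewrite lerD2l.
have DG s : Dseq s (G [::]) = G s.
  elim: s => // v s IH; apply/funext => x; rewrite Dseq_cons IH -pdE.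
  by have [_ ->] := main s x.
exists (G [::]) => [s x|s r eps e0]; first by rewrite DG; have [] := main s x.
by rewrite DG; exact: unif.
Qed.

End SmoothLimit.

                        

(** * Probability measures concentrated on a set *)

Section Concentrated.
Context {d : measure_display} {T : measurableType d} {R : realType} (P : probability T R).
Implicit Types (f g : T -> R) (A : set T).

(** Full mass on a measurable set. It replaces compact support in integrability and sup estimates,
    and passes easily to products and images. *)
Definition conc A := measurable A /\ P (~` A) = 0%E.

Lemma conc_prob1 A : conc A -> P A = 1%E.
Proof.
move=> [mA A0]; have := probability_setC P mA; rewrite A0.
move=> /eqP; rewrite eq_sym sube_eq ?fin_num_measure// ?add0e//; by move=> /eqP <-.
Qed.

Lemma concT : conc setT.
Proof. by split=> //; rewrite setCT measure0. Qed.

Variables (A : set T).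
Hypothesis cA : conc A.

Lemma conc_integrable f (B : R) : measurable_fun setT f -> (forall x, A x -> `|f x| <= B) ->
  P.-integrable setT (EFin \o f).
Proof.
move=> mf H; have [mA A0] := cA.
have mfE : measurable_fun setT (fun x => (f x)%:E) by exact/measurable_EFinP.
rewrite (negligible_integrable (measurableC mA))// setTD setCK.
apply: measurable_bounded_integrable => //; last 2 first.
- exact: measurable_funTS.
- exists B; split; rewrite ?num_real// => M BM x Ax; exact: le_trans (H x Ax) (ltW BM).
by rewrite (le_lt_trans (probability_le1 _ _))// ltry.
Qed.

Lemma conc_bound f (B : R) : measurable_fun setT f -> (forall x, A x -> `|f x| <= B) ->
  `|\int[P]_x f x| <= B.
Proof.
move=> mf H; have [mA A0] := cA.
have intf := conc_integrable mf H.
rewrite /Rintegral (negligible_integral (measurableC mA))// setTD setCK.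
have intA : P.-integrable A (EFin \o f) by exact: integrableS intf.
apply: le_trans (le_normr_Rintegral mA intA) _.
have intc : P.-integrable A (EFin \o cst B).
  by apply: finite_measure_integrable_cst.
apply: (@le_trans _ _ (\int[P]_(t in A) B)).
  by apply: le_Rintegral => //; exact: integrable_norm.
by rewrite Rintegral_cst// /= (conc_prob1 cA) mulr1.
Qed.

End Concentrated.

(** * Borel sets of R^N and supports *)

Section Borel.
Variables (R : realType) (N : nat).
Local Notation vec := 'rV[R]_N.
Local Notation RN := (RN R N).
Implicit Types (z : vec) (U : set vec).

Lemma RN_open U : open U -> measurable (U : set RN).
Proof. by move=> oU; exact: sub_sigma_algebra. Qed.

Lemma RN_continuous (f : vec -> R) : continuous f -> measurable_fun setT (f : RN -> R).
Proof.
move=> /continuousP cf; apply: (measurability _ (RGenOpens.measurableE R)).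
by move=> _ [_ [a [b ->] <-]]; rewrite setTI; apply: RN_open; apply: cf; exact: interval_open.
Qed.

Definition qvec (q : 'rV[rat]_N) : vec := \row_i ratr (q ord0 i).

Definition qball (qn : 'rV[rat]_N * nat) : set vec :=
  [set z | forall i, `|z ord0 i - qvec qn.1 ord0 i| < qn.2.+1%:R^-1].

Lemma ballP z (r : R) y : 0 < r -> ball z r y <-> forall i, `|z ord0 i - y ord0 i| < r.
Proof.
move=> r0; split=> [[_ H] i|H]; first by have := H ord0 i; rewrite -ball_normE.
split=> // i j; rewrite [i]ord1 -ball_normE; exact: H.
Qed.

Lemma qball_ball qn : qball qn = ball (qvec qn.1) qn.2.+1%:R^-1.
Proof.
have r0 : 0 < qn.2.+1%:R^-1 :> R by rewrite invr_gt0 ltr0n.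
apply/seteqP; split=> z /=.
  by move=> H; apply/ballP => // i; rewrite distrC.
by move=> /(ballP _ _ r0) H i; rewrite distrC.
Qed.

Lemma qball_open qn : open (qball qn).
Proof. by rewrite qball_ball; apply: ball_open; rewrite invr_gt0 ltr0n. Qed.

Lemma qball_base U z : open U -> U z -> exists2 qn, qball qn z & qball qn `<=` U.
Proof.
move=> oU Uz; have : nbhs z U by exact: open_nbhs_nbhs.
move=> /nbhs_ballP[e /= e0 He].
have [n Hn] : exists n : nat, n.+1%:R^-1 < e / 2.
  have e2 : 0 < e / 2 by rewrite divr_gt0.
  have := archi_boundP (ltW (_ : 0 < (e / 2)^-1)); rewrite invr_gt0 => /(_ e2) H.
  exists (Num.bound (e / 2)^-1); rewrite invf_plt ?posrE ?ltr0n//.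
  by apply: lt_le_trans H _; rewrite ler_nat.
have n0 : 0 < n.+1%:R^-1 :> R by rewrite invr_gt0 ltr0n.
have /choice[q Hq] : forall i, exists q : rat, `|z ord0 i - ratr q| < n.+1%:R^-1.
  move=> i; have [|q] := @rat_in_itvoo R (z ord0 i - n.+1%:R^-1) (z ord0 i + n.+1%:R^-1).
    by rewrite ltrBlDr -addrA ltrDl addr_gt0.
  by rewrite in_itv /= => /andP[h1 h2]; exists q; rewrite ltr_distlC h1 h2.
exists (\row_i q i, n); first by move=> i /=; rewrite !mxE; exact: Hq.
move=> y Hy; apply: He; apply/ballP => // i.
have := Hy i; rewrite /= !mxE => h1; have h2 := Hq i.
rewrite -(subrK (ratr (q i)) (z ord0 i)) -addrA; apply: le_lt_trans (ler_normD _ _) _.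
rewrite [`|ratr _ - _|]distrC [e]splitr.
by apply: ltrD; exact: lt_trans Hn.
Qed.

Lemma open_qcover U : open U ->
  U = \bigcup_n (if unpickle n is Some qn then
     if `[< qball qn `<=` U >] then qball qn else set0 else set0).
Proof.
move=> oU; apply/seteqP; split=> z.
  move=> Uz; have [qn qz qU] := qball_base oU Uz.
  by exists (pickle qn) => //; rewrite pickleK; case: asboolP.
by move=> [n _]; case: (unpickle n) => // qn; case: asboolP => // qU /qU.
Qed.

Lemma RN_measurable_map {d} {T : measurableType d} (g : T -> RN) :
  (forall i, measurable_fun setT (fun t => (g t : vec) ord0 i)) -> measurable_fun setT g.
Proof.
move=> H; apply: (@measurability _ _ T RN setT g (@open vec)) => //.
move=> _ [U oU <-]; rewrite setTI (open_qcover oU) preimage_bigcup.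
apply: bigcup_measurable => n _; case: (unpickle n) => [qn|]; last by rewrite preimage_set0.
case: asboolP => _; last by rewrite preimage_set0.
have -> : g @^-1` qball qn = \bigcap_(i in [set: 'I_N])
   ((fun t => (g t : vec) ord0 i) @^-1` ball (qvec qn.1 ord0 i) qn.2.+1%:R^-1).
  apply/seteqP; split=> t /= Ht i; last by have := Ht i I; rewrite /= -ball_normE /= distrC.
  by move=> _; rewrite /= -ball_normE /= distrC; exact: Ht.
apply: fin_bigcap_measurable => // i _.
by rewrite -[X in measurable X]setTI; apply: H => //; exact: measurable_ball.
Qed.

(** A measure gives no mass to the complement of its support, since that complement is covered by
    the countably many rational balls of measure zero. *)
Lemma supp_conc (P : probability RN R) (A : set vec) : closed A -> supp P `<=` A -> conc P (A : set RN).
Proof.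
move=> cA PA; split; first by rewrite -[A]setCK; apply: measurableC; apply: RN_open; exact: closed_openC.
have mC : measurable (~` A : set RN) by apply: RN_open; exact: closed_openC.
apply: (iffLR (@negligibleP _ RN R P _ mC)).
pose F n : set RN := if unpickle n is Some qn then
   if `[< P (qball qn : set RN) = 0%E >] then qball qn else set0 else set0.
apply: (@negligibleS _ _ _ _ (\bigcup_n F n)).
  move=> z nAz; have : ~ supp P z by move=> /PA.
  rewrite /supp /= => /existsNP[U] /not_implyP[oU] /not_implyP[Uz] /negP.
  rewrite -leNgt => PU.
  have [qn qz qU] := qball_base oU Uz; exists (pickle qn) => //.
  rewrite /F pickleK; case: asboolP => // -[]; apply/eqP.
  rewrite eq_le measure_ge0 andbT; apply: le_trans PU.
  by apply: le_measure => //; rewrite inE; apply: RN_open => //; exact: qball_open.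
apply: negligible_bigcup => n; rewrite /F; case: (unpickle n) => [qn|]; last exact: negligible_set0.
case: asboolP => [q0|_]; last exact: negligible_set0.
by apply/negligibleP => //; apply: RN_open; exact: qball_open.
Qed.

Lemma conc_supp (P : probability RN R) (A : set vec) : closed A -> conc P (A : set RN) -> supp P `<=` A.
Proof.
move=> cA [_ PA] z Pz; apply: contrapT => nAz.
by have := Pz (~` A) (closed_openC cA) nAz; rewrite PA ltxx.
Qed.

Lemma supp_closed (P : probability RN R) : closed (supp P).
Proof.
move=> z clz U oU Uz; have [y [Py Uy]] := clz U (open_nbhs_nbhs (conj oU Uz)).
exact: Py.
Qed.

End Borel.

                                                       

(** * Cauchy-Schwarz, orthogonal maps and convex hulls *)

Section Geometry.
Variables (R : realType) (N : nat).
Local Notation vec := 'rV[R]_N.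
Implicit Types (x y z v w : vec).

Lemma dotv_CS x w : dotv x w ^+ 2 <= dotv x x * dotv w w.
Proof.
have [->|w0] := eqVneq w 0; first by rewrite !dotv0r expr0n mulr0.
have wp := dotv_gt0 w0; set c := dotv x w; set d := dotv w w.
have := dotv_ge0 (d *: x - c *: w).
rewrite !(dotvDl,dotvDr,dotvNl,dotvNr,dotvZl,dotvZr) [dotv w x]dotvC -/c -/d => H.
have : 0 <= d * (d * dotv x x - c ^+ 2) by move: H; lra.
by rewrite pmulr_rge0// subr_ge0 mulrC.
Qed.

Lemma dotv_CS_le (r : R) x w : 0 <= r -> dotv x x <= r ^+ 2 -> dotv w w = 1 -> `|dotv x w| <= r.
Proof.
move=> r0 xr w1; have := dotv_CS x w; rewrite w1 mulr1 => H.
by rewrite -(ler_pXn2r (n := 2))// ?nnegrE// real_normK ?num_real// (le_trans H).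
Qed.

Lemma refl_orthogonal (a : vec) : dotv a a = 2 -> orthogonal_mx (reflmx a).
Proof. by move=> a2; rewrite /orthogonal_mx reflmxT reflmxK. Qed.

Lemma dotv_orth (O : 'M[R]_N) x y : orthogonal_mx O -> dotv (x *m O) (y *m O) = dotv x y.
Proof. by move=> oO; rewrite dotv_mulmx -mulmxA oO mulmx1. Qed.

Lemma orthogonal_tr (O : 'M[R]_N) : orthogonal_mx O -> orthogonal_mx O^T.
Proof. by rewrite /orthogonal_mx trmxK => /mulmx1C. Qed.

(** The reflection in the bisecting hyperplane of x and y does it; the normal x - y is rescaled to
    squared length 2, as [reflmx] expects. *)
Lemma orth_transitive x y : dotv x x = dotv y y -> exists2 O, orthogonal_mx O & x *m O = y.
Proof.
move=> xy; have [->|nxy] := eqVneq x y.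
  by exists 1%:M; rewrite ?mulmx1// /orthogonal_mx trmx1 mulmx1.
have d0 : 0 < dotv (x - y) (x - y) by apply: dotv_gt0; rewrite subr_eq0.
pose c := Num.sqrt (2 / dotv (x - y) (x - y)).
have c2 : c ^+ 2 = 2 / dotv (x - y) (x - y) by rewrite sqr_sqrtr// divr_ge0// ltW.
exists (reflmx (c *: (x - y))).
  by apply: refl_orthogonal; rewrite dotv_scale2 c2 divfK// gt_eqF.
rewrite mul_reflmx dotvZr scalerA mulrAC -expr2 c2.
have -> : 2 / dotv (x - y) (x - y) * dotv x (x - y) = 1.
  apply: (@mulIf _ (dotv (x - y) (x - y))); first by rewrite gt_eqF.
  rewrite mul1r mulrAC divfK ?gt_eqF//.
  by rewrite !(dotvDl,dotvDr,dotvNl,dotvNr) -xy [dotv y x]dotvC; ring.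
by rewrite scale1r opprB addrC subrK.
Qed.

Lemma orth_refl_group Rs (g : 'M[R]_N) : root_system Rs -> refl_group Rs g -> orthogonal_mx g.
Proof.
move=> hRs; elim=> [|a h aR _ IH]; first by rewrite /orthogonal_mx trmx1 mulmx1.
rewrite /orthogonal_mx trmx_mul mulmxA -[h *m _ *m _]mulmxA.
by rewrite (refl_orthogonal (root2 hRs aR)) mulmx1.
Qed.

Lemma conv_hull_dotv (S : set vec) (w : vec) (B : R) z :
  (forall v, S v -> dotv v w <= B) -> conv_hull S z -> dotv z w <= B.
Proof.
move=> H [s [c0 c1 Sv ->]].
have -> : dotv (\sum_(c <- s) c.1 *: c.2) w = \sum_(c <- s) c.1 * dotv c.2 w.
  elim: (s) => [|c t IH]; first by rewrite !big_nil dotv0l.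
  by rewrite !big_cons dotvDl dotvZl IH.
rewrite -[B]mul1r -c1 mulr_suml big_seq [leRHS]big_seq; apply: ler_sum => c cs.
by apply: ler_wpM2l; [exact: (allP c0)|apply: H; exact: Sv].
Qed.

Lemma conv_hull_ball Rs x z : root_system Rs -> conv_hull (G_orbit Rs x) z -> dotv z z <= dotv x x.
Proof.
move=> hRs cz; suff : dotv z z <= (dotv x x + dotv z z) / 2 by lra.
apply: conv_hull_dotv cz => v [g Gg <-].
have := dotv_ge0 (x *m g - z); have := dotv_orth x x (orth_refl_group hRs Gg).
by rewrite !(dotvDl,dotvDr,dotvNl,dotvNr) [dotv z (x *m g)]dotvC => ->; lra.
Qed.

End Geometry.

(** * Derivatives of ridge means and preimages of radial polynomials *)

Section RidgeBounds.
Variables (R : realType) (N : nat).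
Local Notation vec := 'rV[R]_N.
Implicit Types (p q : vec -> R) (x y z v w : vec) (phi : {poly R}).
Variables (Rs Rp : seq vec) (k : vec -> R) (V : (vec -> R) -> (vec -> R)).
Hypotheses (hRs : root_system Rs) (hRp : positive_subsystem Rs Rp)
  (hk : multiplicity Rs k) (hV : poly_intertwiner Rp k V) (hN : (0 < N)%N).
Local Notation Pk := (Pk Rp k).
Local Notation cc := (cc Rp k).
Local Notation bco := (bco Rp k).
Local Notation ridge := (ridge Rp k).

(** Ridge mean with a polynomial weight in w, the form stable under differentiation: each derivative
    along v brings down a factor <v,w>. *)
Definition ridgew q phi x : R := (Pk (fun w => q w * phi.[dotv x w])).[1].

Lemma poly2_ridgew q phi : polyfun q -> poly2 (fun x w => q w * phi.[dotv x w]).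
Proof. by move=> pq; apply: poly2M; [exact: poly2_snd|exact: poly2_horner_dotv]. Qed.

Lemma pd_horner v p phi x : polyfun p -> pd v (fun z => phi.[p z]) x = phi^`().[p x] * pd v p x.
Proof.
move=> pp; move: phi; apply: poly_ind => [|phi c IH].
  by rewrite deriv0 horner0 mul0r -[RHS](pd_cst 0 v x); apply: eq_pd => z; rewrite horner0.
rewrite derivD derivM derivX derivC !(hornerE, addr0, mulr1).
rewrite (@eq_pd R N v _ (fun z => phi.[p z] * p z + c)); last by move=> z; rewrite !hornerE.
have ph := polyfun_horner phi pp.
rewrite pdD ?pd_cst ?addr0; [|exact: polyfunM|exact: polyfun_cst].
by rewrite pdM// IH; ring.
Qed.

Lemma pd_ridgew v q phi x : polyfun q ->
  pd v (ridgew q phi) x = ridgew (fun w => dotv v w * q w) phi^`() x.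
Proof.
move=> pq; rewrite /ridgew.
have := linop_comm x 0 (linop_pd v) (linop_Pk hV 1) (poly2_ridgew phi pq).
move=> /= ->; congr (_.[1]); apply: (congr1 (fun f => Pk f)); apply/funext => w.
rewrite pdZ; last by apply: polyfun_horner; exact: polyfun_dotv.
rewrite pd_horner ?pd_dotv; last exact: polyfun_dotv.
by ring.
Qed.

Fixpoint prodv (s : seq vec) w : R := if s is v :: s' then dotv v w * prodv s' w else 1.

Lemma polyfun_prodv s : polyfun (prodv s).
Proof.
by elim: s => [|v s IH]; [exact: polyfun_cst|apply: polyfunM => //; exact: polyfun_dotvl].
Qed.

Lemma Dseq_ridge s phi x : Dseq s (ridge phi) x = ridgew (prodv s) phi^`(size s) x.
Proof.
elim: s x => [|v s IH] x.
  by rewrite /ridgew /ridge derivn0 /=; congr (_.[1]); apply: (congr1 (fun f => Pk f));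
     apply/funext => w; rewrite mul1r.
rewrite Dseq_cons (eq_pd _ _ IH) pd_ridgew; last exact: polyfun_prodv.
by rewrite derivnS.
Qed.

(** For |x| <= r and |w| = 1 the argument <x,w> stays in [-r,r], so [Pk_bound1] bounds the
    derivative by the sup of a derivative of phi of the same order. *)
Lemma Dseq_ridge_bound s : exists2 C : R, 0 <= C & forall phi (r B : R), 0 <= r -> 0 <= B ->
  bnd phi^`(size s) r B -> forall x, dotv x x <= r ^+ 2 -> `|Dseq s (ridge phi) x| <= C * B.
Proof.
have [C C0 HC] := ball_bounded 1 (polyfun_continuous (polyfun_prodv s)).
exists C => // phi r B r0 B0 H x xr; rewrite Dseq_ridge.
apply: (Pk_bound1 hRs hRp hk hV hN) => [|w w1].
  exact: (poly2_right x (poly2_ridgew _ (polyfun_prodv s))).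
rewrite normrM; apply: ler_pM => //; first by apply: HC; rewrite w1 expr1n.
by apply: H; exact: dotv_CS_le.
Qed.

Lemma ridgeB (phi psi : {poly R}) x : ridge (phi - psi) x = ridge phi x - ridge psi x.
Proof.
have pp f : polyfun (fun w => f.[dotv x w]) by apply: polyfun_horner; exact: polyfun_dotvl.
rewrite /ridge -[X in _ = _ - X]mul1r -mulNr -hornerZ -hornerD -(PkZ hV)// -(PkD hV)//; last exact: polyfunZ.
congr (_.[1]); apply: (congr1 (fun f => Pk f)); apply/funext => w.
by rewrite hornerD hornerN mulN1r.
Qed.

Lemma DseqB s p q x : polyfun p -> polyfun q ->
  Dseq s (fun y => p y - q y) x = Dseq s p x - Dseq s q x.
Proof.
move=> pp pq; elim: s x => [//|v s IH] x.
have p1 := polyfun_Dseq s pp; have p2 := polyfun_Dseq s pq.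
rewrite !Dseq_cons (eq_pd _ _ IH) pdD//; last exact: polyfunN.
congr (_ + _); rewrite -[RHS]mulN1r -pdZ//; apply: eq_pd => y; by rewrite mulN1r.
Qed.

Variable m : nat.
Local Notation sg := (1 + 2 * m%:R - cc).
Hypothesis sg0 : 0 < sg.

(** Inverts the coefficient map of [V_ridge], whose multiplier at 2n is the product of
    (1+2l)/(cc+2l). [Dop] contributes (1+2m+2l)/(1+2l), and [Kop] with [sg] = 1+2m-cc contributes
    (cc+2l)/(1+2m+2l). *)
Definition radprof (P : {poly R}) : {poly R} := Kop cc sg (Dop m P).

Lemma radprofB P Q : radprof (P - Q) = radprof P - radprof Q.
Proof.
apply/polyP => i; rewrite coefB /radprof !coef_Kop !coef_Dop coefB.
by case: ifP => _; rewrite ?subr0//; ring.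
Qed.

Lemma bco_fact n : bco n * (n.*2)`!%:R = \prod_(l < n) ((1 + 2 * l%:R) / (cc + 2 * l%:R)).
Proof.
have c0 := cc_gt0 hRp hk hN.
elim: n => [|n IH]; first by rewrite bco0 big_ord0 mul1r.
rewrite big_ord_recr/= -IH (bcoS hRp hk hN n) doubleS !factS !natrM.
have -> : (n.*2.+2%:R : R) = 2 * n.+1%:R by rewrite -doubleS -mul2n natrM.
have -> : (n.*2.+1%:R : R) = 1 + 2 * n%:R by rewrite -natr1 -mul2n natrM addrC.
have : cc + 2 * n%:R != 0 by rewrite gt_eqF// ltr_pwDl// mulr_ge0.
by move: (bco _) ((n.*2)`!%:R) (n.+1%:R) (n%:R) => b f n1 n0 h; field.
Qed.

Lemma radprof_coef (P : {poly R}) n : (radprof P)`_n.*2 * (bco n * (n.*2)`!%:R) = P`_n.*2.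
Proof.
rewrite bco_fact /radprof coef_Kop odd_double doubleK coef_Dop dm_even /rho.
have c0 := cc_gt0 hRp hk hN.
rewrite mulrA -[RHS]mul1r mulrAC -!big_split/=; congr (_ * _); apply: big1 => l _.
have l0 : (0 : R) <= 2 * l%:R by rewrite mulr_ge0.
have m0 : (0 : R) <= 2 * m%:R by rewrite mulr_ge0.
have h1 : cc + 2 * l%:R != 0 by rewrite gt_eqF// ltr_pwDl.
have h2 : 1 + 2 * l%:R != 0 :> R by rewrite gt_eqF// ltr_pwDl.
have h3 : 1 + 2 * m%:R + 2 * l%:R != 0 :> R by rewrite gt_eqF// -addrA ltr_pwDl// addr_ge0.
have -> : cc + 2 * l%:R + sg = 1 + 2 * m%:R + 2 * l%:R by ring.
by move: h1 h2 h3; move: (l%:R) (m%:R) cc => l' m' c h1 h2 h3; field; rewrite h1 h2 h3.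
Qed.

Lemma V_radprof P x (r : R) : r ^+ 2 = dotv x x -> V (ridge (radprof P)) x = (evenp P).[r].
Proof.
move=> rx; rewrite (V_ridge hRs hRp hk hV).
set phi := radprof P.
have -> : evenp P = \poly_(i < size phi) (phi`_i * (if odd i then 0 else bco i./2 * i`!%:R)).
  have E i : (evenp P)`_i = phi`_i * (if odd i then 0 else bco i./2 * i`!%:R).
    rewrite coef_evenp; case: ifPn => oi; first by rewrite mulr0.
    by rewrite -[in LHS](odd_double_half i) -[in RHS](odd_double_half i) (negbTE oi) !add0n doubleK radprof_coef.
  apply/polyP => i; rewrite coef_poly E; case: ltnP => // iP.
  by rewrite nth_default ?mul0r.
rewrite horner_poly; apply: eq_bigr => i _; case: ifPn => oi; first by rewrite !mulr0 mul0r.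
rewrite mulrA; congr (_ * _).
by rewrite -rx -exprM mul2n -[in RHS](odd_double_half i) (negbTE oi).
Qed.

End RidgeBounds.

(** * Radial profiles and their polynomial approximation *)

Section Profile.
Variables (R : realType) (N : nat).
Local Notation vec := 'rV[R]_N.
Implicit Types (f g : vec -> R) (x y z v w : vec).

Definition profile f v j (t : R) : R := Dseq (nseq j v) f (t *: v).

Lemma is_derive_profile f v : smooth f -> forall j (t : R),
  is_derive t 1 (profile f v j) (profile f v j.+1 t).
Proof.
move=> sf j t; have := @is_derive_line R N (Dseq (nseq j v) f) 0 v t.
rewrite /profile add0r => H.
have -> : (fun t0 : R => Dseq (nseq j v) f (t0 *: v)) = (fun s : R => Dseq (nseq j v) f (0 + s *: v)).
  by apply/funext => s; rewrite add0r.
by apply: H; apply: diff_derivable; exact: sf.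
Qed.

(** One sequence that works for all orders of derivative and all radii at once: the n-th polynomial
    controls orders up to n on |t| <= n, with error 1/(n+1). *)
Definition approx_profile f v (P : nat -> {poly R}) := forall n j (t : R), (j <= n)%N ->
  `|t| <= n%:R -> `|(P n)^`(j).[t] - profile f v j t| <= n.+1%:R^-1.

Lemma approx_profile_exists f v : smooth f -> exists P, approx_profile f v P.
Proof.
move=> sf; have /choice[P HP] : forall n, exists P : {poly R}, forall j (t : R), (j <= n)%N ->
  `|t| <= n%:R -> `|P^`(j).[t] - profile f v j t| <= n.+1%:R^-1.
  move=> n; apply: poly_approx_family => //; first exact: is_derive_profile.
by exists P.
Qed.

Lemma radial_profile f v x (t : R) : radial_fun f -> dotv v v = 1 -> t ^+ 2 = dotv x x -> f x = f (t *: v).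
Proof.
move=> rf v1 tx; have [|O oO <-] := @orth_transitive R N (t *: v) x; last exact: rf.
by rewrite dotv_scale2 v1 mulr1.
Qed.

Lemma smooth_continuous f : smooth f -> continuous f.
Proof. by move=> sf x; apply: differentiable_continuous; exact: (sf [::]). Qed.

Lemma inv_small (eps : R) : 0 < eps -> exists n0 : nat, forall n, (n0 <= n)%N -> n.+1%:R^-1 <= eps.
Proof.
move=> e0; exists (Num.bound eps^-1) => n nn.
have := archi_boundP (ltW (_ : 0 < eps^-1)); rewrite invr_gt0 => /(_ e0) H.
rewrite invf_ple ?posrE ?ltr0n//; apply: le_trans (ltW H) _.
by rewrite ler_nat; exact: leq_trans nn _.
Qed.

End Profile.

(** * Smooth preimages of radial functions and the translation formula *)

Section Existence.
Variables (R : realType) (N : nat).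
Local Notation vec := 'rV[R]_N.
Implicit Types (p q f g : vec -> R) (x y z v w : vec).
Variables (Rs Rp : seq vec) (k : vec -> R) (V : (vec -> R) -> (vec -> R)).
Hypotheses (hRs : root_system Rs) (hRp : positive_subsystem Rs Rp)
  (hk : multiplicity Rs k) (hV : poly_intertwiner Rp k V) (hN : (0 < N)%N).
Local Notation cc := (cc Rp k).
Local Notation ridge := (ridge Rp k).

Definition cball (r : R) : set vec := [set x | dotv x x <= r ^+ 2].

Lemma closed_cball r : closed (cball r).
Proof. exact: (compact_closed (@norm_hausdorff R vec) (@compact_ball R N r)). Qed.

Lemma bndB P Q r (B C : R) j (F : R -> R) : (forall t, `|t| <= r -> `|P^`(j).[t] - F t| <= B) ->
  (forall t, `|t| <= r -> `|Q^`(j).[t] - F t| <= C) -> bnd (P - Q)^`(j) r (B + C).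
Proof.
move=> H1 H2 t tr; rewrite derivnB hornerD hornerN -[P^`(j).[t]](subrK (F t)) -addrA.
by apply: le_trans (ler_normD _ _) _; apply: lerD; [exact: H1|rewrite distrC; exact: H2].
Qed.

(** A derivative of order l of the ridge preimage needs only the derivatives of the profile
    polynomials up to order l + m, because [Dop] loses m derivatives and [Kop] none. *)
Lemma smooth_cauchy_ridge f v m P : smooth f -> 0 < 1 + 2 * m%:R - cc -> approx_profile f v P ->
  smooth_cauchy (fun n => ridge (radprof Rp k m (P n))).
Proof.
move=> sf sg0 HP s r eps e0.
pose r1 : R := N%:R * `|r|; have r10 : 0 <= r1 by rewrite mulr_ge0.
have [C1 C10 H1] := Dseq_ridge_bound hRs hRp hk hV hN s.
have [C2 C20 H2] := @bnd_Dop R m (size s) r1 r10.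
have c0 := cc_gt0 hRp hk hN.
(* Two errors of this size, multiplied by the constants [C1] of the ridge bound and [C2] of [Dop],
   stay below eps; the added 1 keeps the denominator positive. *)
have e1 : 0 < eps / (2 * (C1 * C2) + 1) by rewrite divr_gt0// ltr_wpDl// !mulr_ge0.
have [n1 Hn1] := inv_small e1.
have [n2 Hn2] : exists n2 : nat, r1 <= n2%:R.
  by exists (Num.bound r1); apply: ltW; exact: archi_boundP.
exists (maxn (size s + m) (maxn n1 n2)) => a b; rewrite !geq_max => /and3P[a1 a2 a3] /and3P[b1 b2 b3] x xr.
have pr n : polyfun (ridge (radprof Rp k m (P n))) by exact: (polyfun_ridge hV).
rewrite -DseqB//.
have -> : (fun y => ridge (radprof Rp k m (P a)) y - ridge (radprof Rp k m (P b)) y) =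
  ridge (radprof Rp k m (P a - P b)).
  by apply/funext => y; rewrite radprofB (ridgeB hV).
pose B : R := a.+1%:R^-1 + b.+1%:R^-1; have B0 : 0 <= B by rewrite addr_ge0// invr_ge0.
have bP j : (j <= size s + m)%N -> bnd (P a - P b)^`(j) r1 B.
  move=> js; apply: (bndB (F := profile f v j)) => t tr; apply: HP.
  - exact: leq_trans js a1.
  - by apply: le_trans tr (le_trans Hn2 _); rewrite ler_nat.
  - exact: leq_trans js b1.
  - by apply: le_trans tr (le_trans Hn2 _); rewrite ler_nat.
have := H1 (radprof Rp k m (P a - P b)) r1 (C2 * B) r10 (mulr_ge0 C20 B0).
move=> /(_ (bnd_Kop c0 sg0 r10 (H2 _ _ B0 bP)) x) H.
apply: le_trans (H _) _.
  by apply: dotv_le_norm; apply: le_trans xr _; exact: ler_norm.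
have BB : B <= 2 * (eps / (2 * (C1 * C2) + 1)).
  by rewrite mulr_natl mulr2n; apply: lerD; [exact: Hn1|exact: Hn1].
apply: (@le_trans _ _ (C1 * C2 * (2 * (eps / (2 * (C1 * C2) + 1))))).
  by rewrite [leLHS]mulrA ler_wpM2l// mulr_ge0.
have C12 : 0 <= C1 * C2 by rewrite mulr_ge0.
have D0 : 0 < 2 * (C1 * C2) + 1 by rewrite ltr_wpDl// mulr_ge0.
rewrite (_ : _ * _ = (2 * (C1 * C2) * eps) / (2 * (C1 * C2) + 1)); last by ring.
by rewrite ler_pdivrMr// mulrDr mulr1 mulrC lerDl ltW.
Qed.

Variable mu : vec -> probability (RN R N) R.
Hypothesis hmu : rosler_family Rs V mu.

Lemma mu_conc x (r : R) : dotv x x <= r ^+ 2 -> conc (mu x) (cball r : set (RN R N)).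
Proof.
move=> xr; apply: supp_conc; first exact: closed_cball.
have [H _] := hmu x; apply: subset_trans H _ => z cz.
exact: le_trans (conv_hull_ball hRs cz) xr.
Qed.

Lemma Vop_poly p x : polyfun p -> Vop mu p x = V p x.
Proof. by have [_] := hmu x; apply. Qed.

Lemma VopE g x : Vop mu g x = \int[mu x]_z g z.
Proof. by []. Qed.

Lemma bounded_near_poly p g r (eps : R) : polyfun p ->
  (forall z, dotv z z <= r ^+ 2 -> `|p z - g z| <= eps) ->
  exists B : R, forall z, cball r z -> `|g z| <= B.
Proof.
move=> pp H; have [B B0 HB] := ball_bounded r (polyfun_continuous pp).
exists (eps + B) => z zr; rewrite -[g z](subrK (p z)); apply: le_trans (ler_normD _ _) _.
by rewrite distrC; apply: lerD; [exact: H|exact: HB].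
Qed.

(** The measure mu_x lives in the ball of radius |x|, so a uniform error there is not amplified by
    V. *)
Lemma Vop_near p g x (r eps : R) : polyfun p -> measurable_fun setT (g : RN R N -> R) ->
  dotv x x <= r ^+ 2 -> (forall z, dotv z z <= r ^+ 2 -> `|p z - g z| <= eps) ->
  `|V p x - Vop mu g x| <= eps.
Proof.
move=> pp mg xr H; have cm := mu_conc xr.
have mp : measurable_fun setT (p : RN R N -> R) by apply: RN_continuous; exact: polyfun_continuous.
have [B _ HB] := ball_bounded r (polyfun_continuous pp).
have [C HC] := bounded_near_poly pp H.
rewrite -Vop_poly// !VopE -RintegralB//; last 2 first.
- exact: (conc_integrable cm mp HB).
- exact: (conc_integrable cm mg HC).
by apply: (conc_bound cm) => //; exact: measurable_funB.
Qed.

Lemma smooth_cvg_unif (p : nat -> vec -> R) g : smooth_cvg p g -> forall (r eps : R), 0 < eps ->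
  exists n0, forall n, (n0 <= n)%N -> forall x, dotv x x <= r ^+ 2 -> `|p n x - g x| <= eps.
Proof.
move=> H r eps e0; have [n0 Hn] := H [::] `|r| eps e0; exists n0 => n nn x xr.
apply: (Hn n nn); apply: mx_norm_le_coord => // i; apply: coord_norm_le => //.
by rewrite real_normK ?num_real.
Qed.

Lemma limit_unique_eps (a b : R) : (forall eps : R, 0 < eps -> `|a - b| <= eps) -> a = b.
Proof.
move=> H; apply/eqP; rewrite -subr_eq0 -normr_le0; apply/ler_addgt0Pl => e e0.
by rewrite addr0; exact: H.
Qed.

Lemma evenp_near P f v n (r t : R) : approx_profile f v P -> dotv v v = 1 -> radial_fun f ->
  0 <= r -> `|t| <= r -> r <= n%:R -> `|(evenp (P n)).[t] - f (t *: v)| <= n.+1%:R^-1.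
Proof.
move=> HP v1 rf r0 tr rn; rewrite evenpE hornerZ hornerD horner_comp hornerN hornerX.
have fN : f (t *: v) = f ((- t) *: v).
  rewrite -(@radial_profile R N f v (t *: v) (- t))// sqrrN dotv_scale2 v1 mulr1//.
have -> : 2^-1 * ((P n).[t] + (P n).[- t]) - f (t *: v) =
   2^-1 * (((P n).[t] - f (t *: v)) + ((P n).[- t] - f ((- t) *: v))) by rewrite -fN; field.
have h s : `|s| <= r -> `|(P n).[s] - f (s *: v)| <= n.+1%:R^-1.
  by move=> sr; have := HP n 0%N s (leq0n _) (le_trans sr rn); rewrite derivn0.
rewrite normrM ger0_norm ?invr_ge0// ler_pdivrMl// mulr_natl mulr2n.
apply: le_trans (ler_normD _ _) _; apply: lerD; apply: h => //; by rewrite normrN.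
Qed.

Lemma nat_above (r : R) : exists n0 : nat, forall n, (n0 <= n)%N -> r <= n%:R.
Proof.
exists (Num.bound `|r|) => n nn; apply: le_trans (ler_norm _) _.
by apply: le_trans (ltW (archi_boundP (normr_ge0 r))) _; rewrite ler_nat.
Qed.

(** Besides the preimage g, the approximating polynomials are returned, since the translation
    formula is obtained as their limit. *)
Lemma radial_preimage f v : smooth f -> radial_fun f -> dotv v v = 1 ->
  exists g (p : nat -> vec -> R) (P : nat -> {poly R}), [/\ smooth g, Vop mu g = f &
    [/\ forall n, polyfun (p n), smooth_cvg p g, approx_profile f v P &
     forall n x (r : R), r ^+ 2 = dotv x x -> V (p n) x = (evenp (P n)).[r]]].
Proof.
move=> sf rf v1.
have [P HP] := approx_profile_exists v sf.
(* Enough derivatives in [Dop] for the remaining order of [Kop] to be positive. *)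
have [m sg0] : exists m : nat, 0 < 1 + 2 * m%:R - cc.
  have [m Hm] := nat_above cc; exists m; have := Hm m (leqnn m).
  by have : (0 : R) <= m%:R by []; lra.
pose p n := ridge (radprof Rp k m (P n)).
have pp n : polyfun (p n) by exact: (polyfun_ridge hV).
have [g sg gp] := smooth_limit pp (smooth_cauchy_ridge sf sg0 HP).
have Vp n x (r : R) : r ^+ 2 = dotv x x -> V (p n) x = (evenp (P n)).[r].
  exact: (V_radprof hRs hRp hk hV hN m).
exists g, p, P; split=> //; apply/funext => x; apply: limit_unique_eps => eps e0.
pose r := Num.sqrt (dotv x x); have r2 : r ^+ 2 = dotv x x by rewrite sqr_sqrtr// dotv_ge0.
have xr : dotv x x <= r ^+ 2 by rewrite r2.
have e2 : 0 < eps / 2 by rewrite divr_gt0.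
have [n0 Hn0] := smooth_cvg_unif gp r e2.
have [n1 Hn1] := inv_small e2; have [n2 Hn2] := nat_above r.
pose n := maxn n0 (maxn n1 n2).
have h0 : (n0 <= n)%N by rewrite leq_max leqnn.
have h1 : (n1 <= n)%N by rewrite !leq_max leqnn orbT.
have h2 : (n2 <= n)%N by rewrite !leq_max leqnn !orbT.
have mg : measurable_fun setT (g : RN R N -> R) by apply: RN_continuous; exact: smooth_continuous.
have A := Vop_near (pp n) mg xr (Hn0 n h0).
have r0 : 0 <= r by exact: sqrtr_ge0.
have B := @evenp_near P f v n r r HP v1 rf r0 _ (Hn2 n h2).
rewrite (Vp n x r r2) in A.
rewrite (radial_profile rf v1 r2) -[Vop mu g x](subrK (evenp (P n)).[r]) -addrA [eps]splitr.
apply: le_trans (ler_normD _ _) _; apply: lerD; first by rewrite distrC.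
by apply: le_trans (B _) (Hn1 _ h1); rewrite ger0_norm.
Qed.

Lemma Vop_translate_cvg (p : nat -> vec -> R) g y : (forall n, polyfun (p n)) -> continuous g ->
  (forall r eps : R, 0 < eps -> exists n0, forall n, (n0 <= n)%N -> forall x, dotv x x <= r ^+ 2 ->
     `|p n x - g x| <= eps) ->
  forall r eps : R, 0 < eps -> exists n0, forall n, (n0 <= n)%N -> forall z, dotv z z <= r ^+ 2 ->
   `|V (fun w => p n (z + w)) y - Vop mu (fun w => g (z + w)) y| <= eps.
Proof.
move=> pp cg H r eps e0; pose s := Num.sqrt (dotv y y).
have s2 : s ^+ 2 = dotv y y by rewrite sqr_sqrtr// dotv_ge0.
have s0 : 0 <= s by exact: sqrtr_ge0.
have [n0 Hn0] := H (`|r| + s) eps e0; exists n0 => n nn z zr.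
apply: (@Vop_near _ _ y s).
- by apply: polyfun_ext (polyfun_affine 1 z (pp n)) => w; rewrite scale1r addrC.
- apply: RN_continuous => w; apply: continuous_comp; last exact: cg.
  by apply: differentiable_continuous; apply: differentiableD.
- by rewrite s2.
move=> w ws; apply: Hn0 => //.
have := dotv_CS z w; rewrite !(dotvDl,dotvDr) [dotv w z]dotvC => h.
have zr' : dotv z z <= `|r| ^+ 2 by rewrite real_normK ?num_real.
have : dotv z w <= `|r| * s.
  apply: le_trans (ler_norm _) _; rewrite -(ler_pXn2r (n := 2))// ?nnegrE ?mulr_ge0//.
  rewrite real_normK ?num_real// (le_trans h)// exprMn; apply: ler_pM => //; exact: dotv_ge0.
by rewrite sqrrD; lra.
Qed.

Lemma linop_shift y : linop (fun q z => V (fun w => q (z + w)) y).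
Proof.
have pz q z : polyfun q -> polyfun (fun w => q (z + w)).
  by move=> pq; apply: polyfun_ext (polyfun_affine 1 z pq) => w; rewrite scale1r addrC.
split=> [q pq|q q' c z pq pq'].
  exact: (poly2_left y (poly2_linop_right (linop_V hV) (poly2_addv pq))).
by rewrite (V_lin hV)//; exact: pz.
Qed.

                                                                                                
                                      
(** The length in the translation formula. For |z| <= |x| the radicand is at least |z+y|^2, so the
    square root is genuine on the ball carrying mu_x. *)
Definition gt_len x y z : R := Num.sqrt (dotv x x + dotv y y + 2 * dotv z y).

Lemma gt_len_sq x y z : dotv z z <= dotv x x -> gt_len x y z ^+ 2 = dotv x x + dotv y y + 2 * dotv z y.
Proof.
move=> zx; rewrite sqr_sqrtr//; apply: le_trans (_ : 0 <= dotv (z + y) (z + y)) _; first exact: dotv_ge0.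
by rewrite !(dotvDl,dotvDr) [dotv y z]dotvC; lra.
Qed.

Lemma continuous_gt_len x y : continuous (gt_len x y).
Proof.
move=> z; apply: (@continuous_comp vec R R (fun z => dotv x x + dotv y y + 2 * dotv z y) Num.sqrt).
  apply: (polyfun_continuous (p := fun z => dotv x x + dotv y y + 2 * dotv z y)).
  by apply: polyfunD; [exact: polyfun_cst|apply: polyfunZ; exact: polyfun_dotv].
exact: sqrt_continuous.
Qed.

Lemma gt_len_le x y z : dotv z z <= dotv x x -> gt_len x y z <= Num.sqrt (dotv x x) + Num.sqrt (dotv y y).
Proof.
move=> zx; have h1 := sqrtr_ge0 (dotv x x); have h2 := sqrtr_ge0 (dotv y y).
rewrite -(ler_pXn2r (n := 2))// ?nnegrE ?sqrtr_ge0 ?addr_ge0// gt_len_sq//.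
rewrite sqrrD !sqr_sqrtr ?dotv_ge0//.
suff : dotv z y <= Num.sqrt (dotv x x) * Num.sqrt (dotv y y) by lra.
apply: le_trans (ler_norm _) _; rewrite -(ler_pXn2r (n := 2))// ?nnegrE ?mulr_ge0//.
rewrite real_normK ?num_real// (le_trans (dotv_CS _ _))// exprMn !sqr_sqrtr ?dotv_ge0//.
by rewrite ler_wpM2r ?dotv_ge0.
Qed.

(** An even polynomial in the length is a polynomial in its square, hence a polynomial in z;
    linearity then reduces to [Vtransl_radial]. *)
Lemma Vtransl_evenp (p : vec -> R) (P : {poly R}) x y : polyfun p ->
  (forall x (r : R), r ^+ 2 = dotv x x -> V p x = (evenp P).[r]) ->
  exists2 q, polyfun q & V q x = Vtransl V p x y /\
    forall z, dotv z z <= dotv x x -> q z = (evenp P).[gt_len x y z].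
Proof.
move=> pp Hp.
pose Q z := dotv x x + dotv y y + 2 * dotv z y.
have pQ : polyfun Q.
  by apply: polyfunD; [exact: polyfun_cst|apply: polyfunZ; exact: polyfun_dotv].
have evE (t : R) : (evenp P).[t] = \sum_(i < size P) P`_i.*2 * (t ^+ 2) ^+ i.
  have sE : (size (evenp P) <= (size P).*2)%N.
    by apply: leq_trans (size_poly _ _) _; rewrite -addnn leq_addr.
  rewrite (horner_coef_wide _ sE).
  have key n : \sum_(i < n.*2) (evenp P)`_i * t ^+ i = \sum_(i < n) P`_i.*2 * (t ^+ 2) ^+ i.
    elim: n => [|n IH]; first by rewrite !big_ord0.
    rewrite doubleS !big_ord_recr/= IH !coef_evenp /= odd_double /= mul0r addr0.
    by rewrite -exprM mul2n.
  exact: key.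
have /choice[q Hq] : forall i, exists q, polyfun q /\ V q = (fun z => dotv z z ^+ i).
  by move=> i; have [q pq Vq] := Vsurj hV (polyfunX i (@polyfun_dotvv R N)); exists q.
have pq i : polyfun (q i) by have [] := Hq i.
have pE : p = (fun z => \sum_(i < size P) P`_i.*2 * q i z).
  apply: (V_inj hV) => //; first by apply: polyfun_sum => i; exact: polyfunZ.
  apply/funext => z; rewrite (Hp z (Num.sqrt (dotv z z))) ?sqr_sqrtr ?dotv_ge0// evE.
  rewrite (V_sum hV) => [|i _]; last exact: polyfunZ.
  apply: eq_bigr => i _; rewrite (VZ hV)//; have [_ ->] := Hq i.
  by rewrite sqr_sqrtr// dotv_ge0.
exists (fun z => \sum_(i < size P) P`_i.*2 * Q z ^+ i).
  by apply: polyfun_sum => i; apply: polyfunZ; exact: polyfunX.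
split=> [|z zx]; last by rewrite evE gt_len_sq.
rewrite (V_sum hV) => [|i _]; last by apply: polyfunZ; exact: polyfunX.
rewrite pE (linop_sum (A := fun p x => Vtransl V p x y)); last 2 first.
- exact: (linop_Vtransl hV).
- by move=> i; exact: polyfunZ.
apply: eq_bigr => i _; rewrite (VZ hV); last exact: polyfunX.
rewrite (linopZ (A := fun p x => Vtransl V p x y))//; last exact: (linop_Vtransl hV).
congr (_ * _); rewrite (Vtransl_radial hRs hRp hk hV (n := i))// => z.
by have [_ ->] := Hq i.
Qed.

(** Both sides are compared with the same number, the polynomial identity [Vtransl_evenp] at a late
    index n; each comparison costs eps/2. *)
Lemma translate_value f g v (p : nat -> vec -> R) (P : nat -> {poly R}) x y :
  smooth f -> radial_fun f -> dotv v v = 1 -> smooth g ->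
  (forall n, polyfun (p n)) -> smooth_cvg p g -> approx_profile f v P ->
  (forall n x (r : R), r ^+ 2 = dotv x x -> V (p n) x = (evenp (P n)).[r]) ->
  Vop mu (fun xi => Vop mu (fun eta => g (xi + eta)) y) x = \int[mu x]_z f (gt_len x y z *: v).
Proof.
move=> sf rf v1 sg pp gp HP Vp; apply: limit_unique_eps => eps e0.
pose r := Num.sqrt (dotv x x); have r2 : r ^+ 2 = dotv x x by rewrite sqr_sqrtr// dotv_ge0.
have xr : dotv x x <= r ^+ 2 by rewrite r2.
pose s := r + Num.sqrt (dotv y y); have r0 : 0 <= r by exact: sqrtr_ge0.
have s0 : 0 <= s by rewrite addr_ge0 ?sqrtr_ge0.
have e2 : 0 < eps / 2 by rewrite divr_gt0.
have cvg1 := Vop_translate_cvg y pp (smooth_continuous sg) (smooth_cvg_unif gp).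
have [n0 Hn0] := cvg1 r _ e2.
have [n1 Hn1] := inv_small e2; have [n2 Hn2] := nat_above s.
pose n := maxn n0 (maxn n1 n2).
have h0 : (n0 <= n)%N by rewrite leq_max leqnn.
have h1 : (n1 <= n)%N by rewrite !leq_max leqnn orbT.
have h2 : (n2 <= n)%N by rewrite !leq_max leqnn !orbT.
have pV m : polyfun (fun z => V (fun w => p m (z + w)) y).
  by have [H _] := linop_shift y; exact: H.
(* The inner integral is measurable in z as a pointwise limit of polynomials in z. *)
have mh : measurable_fun setT ((fun z => Vop mu (fun eta => g (z + eta)) y) : RN R N -> R).
  apply: (@measurable_fun_cvg _ _ _ _ (fun m (z : RN R N) => V (fun w => p m (z + w)) y)) => [m|z _].
    by apply: RN_continuous; exact: polyfun_continuous.
  apply/cvgrPdist_le => e e_gt0; have [m0 Hm0] := cvg1 (Num.sqrt (dotv z z)) e e_gt0.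
  exists m0 => // m /= mm; rewrite distrC; apply: Hm0 => //.
  by rewrite sqr_sqrtr// dotv_ge0.
have A := Vop_near (pV n) mh xr (Hn0 n h0).
have [q pq [Vq qE]] := Vtransl_evenp x y (pp n) (Vp n).
have mF : measurable_fun setT ((fun z => f (gt_len x y z *: v)) : RN R N -> R).
  apply: RN_continuous => z; apply: (@continuous_comp _ _ _ (fun z => gt_len x y z *: v) f).
    apply: (@continuous_comp vec R vec (gt_len x y) (fun t => t *: v)); first exact: continuous_gt_len.
    exact: scalel_continuous.
  exact: smooth_continuous.
have B : `|V q x - Vop mu (fun z => f (gt_len x y z *: v)) x| <= n.+1%:R^-1.
  apply: (@Vop_near _ _ x r) => //.
  move=> z; rewrite r2 => zx; rewrite qE//.
  apply: (evenp_near HP v1 rf s0 _ (Hn2 _ h2)).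
  by rewrite ger0_norm ?sqrtr_ge0//; exact: gt_len_le.
rewrite -[X in `|X - _|](subrK (V q x)) -addrA [eps]splitr.
apply: le_trans (ler_normD _ _) _; apply: lerD; last exact: le_trans B (Hn1 _ h1).
by rewrite distrC Vq.
Qed.

End Existence.

                                               

(** * Quantitative injectivity of the averaging operators *)

Section AvgInjectivity.
Variable R : realType.
Implicit Types (F G : {poly R}) (t : R).

Lemma poly_bounded F (r : R) : 0 <= r -> exists2 L : R, 0 < L & bnd F r L.
Proof.
move=> r0; have [c cr Hc] := poly_ball_max (F ^+ 2) r0.
exists ((F ^+ 2).[c] + 1) => [|t tr].
  by rewrite ltr_wpDl// horner_exp sqr_ge0.
have := Hc t tr; rewrite !horner_exp => h.
rewrite ler_norml; apply/andP; split; nra.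
Qed.

Lemma mvt_ge (f df : R -> R) (a b c : R) : a <= b -> (forall t : R, is_derive t 1 f (df t)) ->
  (forall t, a <= t <= b -> c <= df t) -> c * (b - a) <= f b - f a.
Proof.
move=> ab fd H.
have I t : t \in `[a, b] -> a <= t <= b by rewrite in_itv.
have [s /I sab ->] := @MVT_segment R f df a b ab (fun t _ => fd t)
   (derivable_within_continuous (fun t _ => @ex_derive _ _ _ _ _ _ _ (fd t))).
by rewrite ler_wpM2r ?subr_ge0//; exact: H.
Qed.

                                                                                              
                                                                                               
(** Inverting an average loses a derivative, so smallness is recovered only for F close to a fixed
    F0. If F(t0) > 6 eps, the Lipschitz bound of F0 keeps F >= 3 eps on an interval of length l/2
    inside [l/2,r]. There G = [avg a F] is at most d, so the equation forces G' >= 2 a eps/r and G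
    would vary by more than 2d. *)
Lemma avg_inj_pos a (r eps : R) F0 : 0 < a -> 0 < r -> 0 < eps -> exists2 eta : R, 0 < eta &
  forall F, bnd (F - F0) r eps -> bnd ('X^2 * avg a F) r eta ->
  forall t, 0 <= t <= r -> F.[t] <= 6 * eps.
Proof.
move=> a0 r0 e0; have [L L0 HL] := poly_bounded F0^`() (ltW r0).
pose l := Num.min (eps / L) (r / 2).
have l0 : 0 < l by rewrite lt_min !divr_gt0.
have lL : L * l <= eps by rewrite mulrC -ler_pdivlMr// ge_min lexx.
have lr : l <= r / 2 by rewrite ge_min lexx orbT.
pose d := Num.min eps (a * eps * l / (4 * r)).
have d0 : 0 < d by rewrite lt_min e0 divr_gt0 ?mulr_gt0.
have de : d <= eps by rewrite ge_min lexx.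
have da : d * (4 * r) <= a * eps * l by rewrite -ler_pdivlMr ?mulr_gt0// ge_min lexx orbT.
exists ((l / 2) ^+ 2 * d) => [|F HF HG t0 /andP[t00 t0r]]; first by rewrite mulr_gt0// exprn_gt0// divr_gt0.
rewrite leNgt; apply/negP => FB.
(* The interval lies to the right of t0 or to its left, according to which half of [0,r] contains
   t0, so that it avoids both 0 and the exterior. *)
have [t1 [t2 [h1 h2 h12 H]]] : exists t1 t2 : R, [/\ l / 2 <= t1, t2 <= r, t2 - t1 = l / 2 &
    forall t, t1 <= t <= t2 -> `|t - t0| <= l].
  have [tr|tr] := leP t0 (r / 2).
    exists (t0 + l / 2), (t0 + l); split; try lra.
    by move=> t /andP[ta tb]; rewrite ler_norml; apply/andP; split; lra.
  exists (t0 - l / 2), t0; split; try lra.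
  by move=> t /andP[ta tb]; rewrite ler_norml; apply/andP; split; lra.
have F0t t : t1 <= t <= t2 -> F0.[t0] - eps <= F0.[t].
  move=> tt; have /andP[ta tb] := tt; have := H t tt.
  have lip (u v : R) : - r <= u -> v <= r -> u <= v -> `|F0.[v] - F0.[u]| <= L * (v - u).
    move=> ur vr uv; apply: (mvt_bound uv (is_derive_horner F0)) => s /andP[su sv]; apply: HL.
    by rewrite ler_norml; apply/andP; split; lra.
  rewrite ler_norml => /andP[tl1 tl2].
  have [tt0|/ltW tt0] := leP t t0.
    have := lip t t0; rewrite ler_norml => /(_ _ _ _)/andP-/(_ _ _ tt0)[||_ hh]; try lra.
    have : L * (t0 - t) <= L * l by rewrite ler_wpM2l ?(ltW L0)//; lra.
    lra.
  have := lip t0 t; rewrite ler_norml => /(_ _ _ _)/andP-/(_ _ _ tt0)[||hh _]; try lra.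
  have : L * (t - t0) <= L * l by rewrite ler_wpM2l ?(ltW L0)//; lra.
  lra.
have tr t : t1 <= t <= t2 -> `|t| <= r.
  by move=> /andP[ta tb]; rewrite ler_norml; apply/andP; split; lra.
have Ft t : t1 <= t <= t2 -> 3 * eps <= F.[t].
  move=> tt; have := HF t (tr t tt); have := HF t0; rewrite (ger0_norm t00) => /(_ t0r).
  rewrite !hornerD !hornerN !ler_norml => /andP[_ x2] /andP[x3 _].
  by have := F0t t tt; lra.
have Gt t : t1 <= t <= t2 -> `|(avg a F).[t]| <= d.
  move=> tt; have := HG t (tr t tt); have /andP[ta tb] := tt.
  rewrite hornerM hornerXn normrM normrX (ger0_norm (_ : 0 <= t)); last by lra.
  have l2 : 0 < l / 2 by rewrite divr_gt0.
  have lt2 : (l / 2) ^+ 2 <= t ^+ 2 by rewrite ler_pXn2r ?nnegrE ?(ltW l2)//; lra.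
  have p2 : 0 < t ^+ 2 by apply: lt_le_trans lt2; rewrite exprn_gt0.
  move=> hh; rewrite -(ler_pM2l p2); apply: le_trans hh _.
  by rewrite ler_wpM2r// ltW.
have dG t : t1 <= t <= t2 -> 2 * a * eps / r <= (avg a F)^`().[t].
  move=> tt; have := congr1 (fun Q => Q.[t]) (avg_ode F a0).
  rewrite hornerD hornerM !hornerZ hornerX.
  have := Ft t tt; have := Gt t tt; rewrite ler_norml => /andP[_ g2] f3.
  have /andP[ta tb] := tt; move=> E.
  rewrite ler_pdivrMr//; set D := (avg a F)^`().[t] in E *.
  have tp : 0 < t by apply: lt_le_trans (le_trans h1 ta); rewrite divr_gt0.
  have h3 : a * (2 * eps) <= t * D.
    have : a * (2 * eps) <= a * (F.[t] - (avg a F).[t]) by rewrite ler_wpM2l ?(ltW L0)//; lra.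
    by move: E; lra.
  have D0 : 0 <= D by rewrite -(pmulr_rge0 _ tp); apply: le_trans h3; rewrite !mulr_ge0 ?(ltW a0) ?(ltW e0).
  have : t * D <= r * D by rewrite ler_wpM2r//; lra.
  lra.
have t12 : t1 <= t2 by lra.
have := mvt_ge t12 (is_derive_horner (avg a F)) dG; rewrite h12 => K.
have := Gt t2; rewrite t12 lexx ler_norml => /(_ isT)/andP[_ k2].
have := Gt t1; rewrite t12 lexx ler_norml => /(_ isT)/andP[k1 _].
have X0 : 0 < a * eps * l by rewrite !mulr_gt0.
have : a * eps * l / r <= 2 * d.
  by rewrite (_ : a * eps * l / r = 2 * a * eps / r * (l / 2)); [lra|field; rewrite gt_eqF].
rewrite ler_pdivrMr// => K2; lra.
Qed.

Lemma avg_inj a (r eps : R) F0 : 0 < a -> 0 < r -> 0 < eps -> exists2 eta : R, 0 < eta &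
  forall F, (forall t, F.[- t] = F.[t]) -> bnd (F - F0) r eps -> bnd ('X^2 * avg a F) r eta ->
  bnd F r (6 * eps).
Proof.
move=> a0 r0 e0; have [d1 d10 H1] := avg_inj_pos F0 a0 r0 e0.
have [d2 d20 H2] := avg_inj_pos (- F0) a0 r0 e0.
exists (Num.min d1 d2) => [|F Fe HF HG]; first by rewrite lt_min d10.
have key t : 0 <= t <= r -> `|F.[t]| <= 6 * eps.
  move=> tr; rewrite ler_norml; apply/andP; split.
    rewrite lerNl -hornerN; apply: (H2 (- F)) => //.
      by move=> s sr; rewrite -opprB opprK addrC hornerN normrN; exact: HF.
    move=> s sr; rewrite avgN mulrN hornerN normrN; apply: le_trans (HG _ sr) _.
    by rewrite ge_min lexx orbT.
  apply: (H1 F) => // s sr; apply: le_trans (HG _ sr) _; by rewrite ge_min lexx.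
move=> t; have [t0|/ltW t0] := leP 0 t.
  by rewrite ger0_norm// => tr; apply: key; rewrite t0.
by rewrite ler0_norm// -Fe => tr; apply: key; rewrite tr oppr_ge0 t0.
Qed.

End AvgInjectivity.

                                                                                            
(** * Families of polynomials that are small along approximations *)

Section SmallFamilies.
Variables (R : realType) (X : Type) (A : R -> X -> Prop).
Hypothesis (A_mono : forall d d' x, d <= d' -> A d x -> A d' x)
  (A_ne : forall d, 0 < d -> exists x, A d x).
Variable r : R.
Hypothesis r0 : 0 < r.
Implicit Types (L : X -> {poly R}).

(** [A d] collects the indices that are d-close to some target. Smallness means uniform convergence
    to 0 on |t| <= r as d tends to 0; [fcauchy] is the corresponding Cauchy condition. *)
Definition small L := forall eps : R, 0 < eps -> exists2 d, 0 < d & forall x, A d x -> bnd (L x) r eps.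

Definition fcauchy L := forall eps : R, 0 < eps -> exists2 d, 0 < d &
  forall x y, A d x -> A d y -> bnd (L x - L y) r eps.

Lemma bndD P Q (B C : R) : bnd P r B -> bnd Q r C -> bnd (P + Q) r (B + C).
Proof.
by move=> HP HQ t tr; rewrite hornerD (le_trans (ler_normD _ _))// lerD ?HP ?HQ.
Qed.

Lemma bndZ (c : R) P (B : R) : bnd P r B -> bnd (c *: P) r (`|c| * B).
Proof. by move=> HP t tr; rewrite hornerZ normrM ler_wpM2l// HP. Qed.

Lemma bnd_le P (B C : R) : B <= C -> bnd P r B -> bnd P r C.
Proof. by move=> BC HP t tr; exact: le_trans (HP t tr) BC. Qed.

Lemma small_ext L L' : (forall d x, A d x -> L x = L' x) -> small L -> small L'.
Proof.
by move=> E HL eps e0; have [d d0 H] := HL eps e0; exists d => // x Ax; rewrite -(E d)//; exact: H.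
Qed.

Lemma smallD L L' : small L -> small L' -> small (fun x => L x + L' x).
Proof.
move=> H1 H2 eps e0; have e2 : 0 < eps / 2 by rewrite divr_gt0.
have [d1 d10 K1] := H1 _ e2; have [d2 d20 K2] := H2 _ e2.
exists (Num.min d1 d2) => [|x Ax]; first by rewrite lt_min d10.
rewrite [eps]splitr; apply: bndD; [apply: K1|apply: K2]; apply: A_mono Ax.
  by rewrite ge_min lexx.
by rewrite ge_min lexx orbT.
Qed.

Lemma smallZ (c : R) L : small L -> small (fun x => c *: L x).
Proof.
move=> HL eps e0; have c0 : 0 < `|c| + 1 by rewrite ltr_wpDl.
have [d d0 K] := HL (eps / (`|c| + 1)) (divr_gt0 e0 c0); exists d => // x Ax.
apply: bnd_le (bndZ c (K x Ax)).
by rewrite mulrA ler_pdivrMr// mulrC mulrDr mulr1 lerDl ltW.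
Qed.

Lemma small_sum (I : Type) (s : seq I) (L : I -> X -> {poly R}) :
  (forall i, small (L i)) -> small (fun x => \sum_(i <- s) L i x).
Proof.
move=> H; elim: s => [|i s IH].
  by move=> eps e0; exists 1 => // x _ t _; rewrite big_nil horner0 normr0 ltW.
apply: small_ext (smallD (H i) IH) => d x _; by rewrite big_cons.
Qed.

(** The Cauchy condition supplies the fixed comparison polynomial that [avg_inj] requires: any one
    member of the family at a fine enough scale. *)
Lemma small_avg_inj a L : 0 < a -> (forall x t, (L x).[- t] = (L x).[t]) -> fcauchy L ->
  small (fun x => 'X^2 * avg a (L x)) -> small L.
Proof.
move=> a0 Le CL HL eps e0; have e6 : 0 < eps / 6 by rewrite divr_gt0.
have [d d0 Hd] := CL _ e6; have [x0 Ax0] := A_ne d0.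
have [eta eta0 Heta] := avg_inj (L x0) a0 r0 e6.
have [d' d'0 Hd'] := HL _ eta0.
exists (Num.min d d') => [|x Ax]; first by rewrite lt_min d0.
apply: bnd_le (_ : 6 * (eps / 6) <= eps) _; first by rewrite mulrC divfK.
apply: Heta; [exact: Le| |].
  by apply: Hd => //; apply: A_mono Ax; rewrite ge_min lexx.
by apply: Hd'; apply: A_mono Ax; rewrite ge_min lexx orbT.
Qed.

End SmallFamilies.

(** * Even polynomials and iterated averages *)

Section EvenPoly.
Variable R : realType.
Implicit Types (P : {poly R}).

Lemma even_horner P : (forall i, odd i -> P`_i = 0) -> forall t, P.[- t] = P.[t].
Proof.
move=> H t; rewrite !horner_coef; apply: eq_bigr => i _.
case oi : (odd i); first by rewrite H// !mul0r.
by rewrite exprNn -signr_odd oi expr0 mul1r.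
Qed.

Fixpoint mavg (b : R) m P := if m is j.+1 then avg (b + 2 * j%:R) (mavg b j P) else P.

Lemma coef_mavg b m P i : (mavg b m P)`_i = (\prod_(j < m) ((b + 2 * j%:R) / (i%:R + (b + 2 * j%:R)))) * P`_i.
Proof.
elim: m => [|m IH]; first by rewrite big_ord0 mul1r.
by rewrite /= coef_avg IH big_ord_recr/=; ring.
Qed.

(** Exchanges the m factors of the iterated average for n factors, by telescoping, to match the
    Pizzetti coefficients. *)
Lemma mavg_even_prod (b : R) m n : 0 < b -> \prod_(j < m) ((b + 2 * j%:R) / (n.*2%:R + (b + 2 * j%:R))) =
  \prod_(l < n) ((b + 2 * l%:R) / (b + 2 * m%:R + 2 * l%:R)).
Proof.
move=> b0; have pos (x : R) : 0 <= x -> b + x != 0 by move=> x0; rewrite gt_eqF// ltr_pwDl.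
elim: m => [|m IH].
  rewrite big_ord0 big1// => l _; rewrite mulr0 addr0 divff// pos// mulr_ge0//.
rewrite big_ord_recr/= IH.
pose u (l : nat) : R := b + 2 * m%:R + 2 * l%:R.
have u0 l : u l != 0 by rewrite /u -addrA pos// addr_ge0// mulr_ge0.
have -> : (b + 2 * m%:R) / (n.*2%:R + (b + 2 * m%:R)) = (\prod_(l < n) (u l.+1 / u l))^-1.
  by rewrite telescope_prod// invf_div /u mulr0 addr0 -mul2n natrM [2 * n%:R + _]addrC.
rewrite -prodfV -big_split/=; apply: eq_bigr => l _; rewrite invf_div.
have -> : b + 2 * m.+1%:R + 2 * l%:R = u l.+1 by rewrite /u -!natr1; ring.
by rewrite -/(u l); have h1 := u0 l; have h2 := u0 l.+1; field; rewrite h1 h2.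
Qed.

Lemma Pk_odd N (Rp : seq 'rV[R]_N) k q i : odd i -> (Pk Rp k q)`_i = 0.
Proof.
by rewrite /Pk; case: xgetP => [P _ HP|_] oi; rewrite ?coef0// HP oi.
Qed.

Lemma Pk_even N (Rp : seq 'rV[R]_N) k q t : (Pk Rp k q).[- t] = (Pk Rp k q).[t].
Proof. by apply: even_horner => i; exact: Pk_odd. Qed.

End EvenPoly.

(** * Integration by parts and the stability of the null space of V under derivatives *)

Section MeanTools.
Variables (R : realType) (N : nat).
Local Notation vec := 'rV[R]_N.
Implicit Types (p q f g h Y : vec -> R) (x y z v w : vec).
Variables (Rs Rp : seq vec) (k : vec -> R) (V : (vec -> R) -> (vec -> R)).
Hypotheses (hRs : root_system Rs) (hRp : positive_subsystem Rs Rp)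
  (hk : multiplicity Rs k) (hV : poly_intertwiner Rp k V) (hN : (0 < N)%N).
Local Notation T := (dunkl Rp k).
Local Notation Dk := (DkL Rp k).
Local Notation iDk := (iDk Rp k).
Local Notation Pk := (Pk Rp k).
Local Notation cc := (cc Rp k).
Local Notation bco := (bco Rp k).
Local Notation e i := (delta_mx ord0 i : vec).

Lemma Pk_refl b q : b \in Rs -> polyfun q -> Pk (fun x => q (x *m reflmx b)) = Pk q.
Proof.
move=> bR pq; have pqb := polyfun_mulmx (reflmx b) pq.
apply/polyP => i; rewrite !(coefPk hV)//; case: ifP => // _; congr (_ * _).
have H n x : iDk n (fun y => q (y *m reflmx b)) x = iDk n q (x *m reflmx b).
  elim: n x => [//|n IH] x; rewrite !iDkS (Dk_ext _ _ _ IH) (Dk_refl hRs hRp hk _ _ bR hV)//.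
  exact: (iDk_poly hV).
by rewrite H mul0mx.
Qed.

Lemma Pk_dotv_avg xi q : polyfun q ->
  Pk (fun y => dotv y xi * q y) = cc^-1 *: ('X^2 * avg cc (Pk (T xi q))).
Proof.
move=> pq; apply/polyP => -[|[|n]]; rewrite coefZ coefXnM /=.
- by rewrite mulr0 (Pk_dotv01 hV xi pq).
- by rewrite mulr0 (Pk_dotv01 hV xi pq).
rewrite (Pk_dotv hRs hRp hk hV hN)// subn2 /= coef_avg.
have c0 := cc_gt0 hRp hk hN.
have h1 : cc + n%:R != 0 by rewrite gt_eqF// ltr_pwDl.
have h2 : n%:R + cc != 0 by rewrite addrC.
by rewrite [n%:R + _]addrC; field; rewrite h1 gt_eqF.
Qed.

(** Product rule with an arbitrary polynomial factor: the error terms involve q and its reflections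
    but no derivative of q. *)
Lemma leibniz xi Y : polyfun Y -> exists Z0 (Z : vec -> vec -> R),
  [/\ polyfun Z0, forall a, polyfun (Z a) & forall q x, polyfun q ->
   T xi (fun y => Y y * q y) x = Y x * T xi q x + Z0 x * q x +
     \sum_(a <- Rp) Z a x * q (x *m reflmx a)].
Proof.
move: Y; apply: polyfun_ind => [c|Y1 Y2 p1 p2 [Z1 [S1 [pZ1 pS1 H1]]] [Z2 [S2 [pZ2 pS2 H2]]]|j Y pY [Z [S [pZ pS H]]]].
- exists (fun=> 0), (fun _ _ => 0); split=> [|a|q x pq]; [exact: polyfun_cst|exact: polyfun_cst|].
  by rewrite dunklZ// mul0r addr0 big1 ?addr0// => a _; rewrite mul0r.
- exists (fun x => Z1 x + Z2 x), (fun a x => S1 a x + S2 a x); split=> [|a|q x pq]; [exact: polyfunD|exact: polyfunD|].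
  rewrite (@dunkl_ext _ _ _ _ _ _ (fun y => Y1 y * q y + Y2 y * q y)); last by move=> y; rewrite mulrDl.
  rewrite dunklD; [|exact: polyfunM|exact: polyfunM]; rewrite H1// H2//.
  rewrite [in RHS](eq_bigr (fun a => S1 a x * q (x *m reflmx a) + S2 a x * q (x *m reflmx a))); last by move=> a _; rewrite mulrDl.
  by rewrite big_split/=; ring.
exists (fun x => x ord0 j * Z x + dotv xi (e j) * Y x),
  (fun a x => x ord0 j * S a x + (k a * dotv a xi * dotv a (e j)) * Y (x *m reflmx a)).
have pc := @polyfun_coord R N j.
split=> [|a|q x pq].
- by apply: polyfunD; [exact: polyfunM|exact: polyfunZ].
- by apply: polyfunD; [exact: polyfunM|apply: polyfunZ; exact: polyfun_mulmx].
rewrite (@dunkl_ext _ _ _ _ _ _ (fun y => dotv y (e j) * (Y y * q y))); last by move=> y; rewrite dotv_delta mulrA.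
rewrite dunkl_mul_dotv; last exact: polyfunM.
rewrite H// dotv_delta.
rewrite [in RHS](eq_bigr (fun a => x ord0 j * (S a x * q (x *m reflmx a)) +
  k a * dotv a xi * dotv a (e j) * (Y (x *m reflmx a) * q (x *m reflmx a)))); last by move=> a _; ring.
by rewrite big_split/= -mulr_sumr; ring.
Qed.

(** Means are invariant under reflections, so the reflections in the error terms of [leibniz] can be
    moved from q to the coefficients. *)
Lemma leibniz_mean xi Y : polyfun Y -> exists2 Z, polyfun Z & forall q, polyfun q ->
  Pk (T xi (fun y => Y y * q y)) = Pk (fun y => Y y * T xi q y) + Pk (fun y => Z y * q y).
Proof.
move=> pY; have [Z0 [Z [pZ0 pZ H]]] := leibniz xi pY.
exists (fun x => Z0 x + \sum_(a <- Rp) Z a (x *m reflmx a)).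
  by apply: polyfunD => //; apply: polyfun_sum => a; exact: polyfun_mulmx.
move=> q pq; have pT := dunkl_poly hV xi pq.
have -> : T xi (fun y => Y y * q y) = fun x => Y x * T xi q x + (Z0 x * q x +
     \sum_(a <- Rp) Z a x * q (x *m reflmx a)) by apply/funext => x; rewrite H// addrA.
have pS a : polyfun (fun x => Z a x * q (x *m reflmx a)) by apply: polyfunM => //; exact: polyfun_mulmx.
have pS' a : polyfun (fun x => Z a (x *m reflmx a) * q x) by apply: polyfunM => //; exact: polyfun_mulmx.
have pYT : polyfun (fun x => Y x * T xi q x) by exact: polyfunM.
have pZq : polyfun (fun x => Z0 x * q x) by exact: polyfunM.
rewrite (PkD hV) //; last by apply: polyfunD => //; exact: polyfun_sum.
congr (_ + _); rewrite (PkD hV)//; last exact: polyfun_sum.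
have -> : (fun y => (Z0 y + \sum_(a <- Rp) Z a (y *m reflmx a)) * q y) =
  (fun y => Z0 y * q y + \sum_(a <- Rp) Z a (y *m reflmx a) * q y).
  by apply/funext => y; rewrite mulrDl mulr_suml.
rewrite (PkD hV)//; last exact: polyfun_sum.
congr (_ + _); rewrite !(Pk_sum hV)//; apply: eq_big_seq => a aR.
have aRs := Rp_sub hRp aR.
rewrite -(Pk_refl aRs (pS' a)); congr (Pk _); apply/funext => x.
by rewrite mul_reflmxK// (root2 hRs aRs).
Qed.

Hypothesis Vcontr : forall p r (B : R), polyfun p -> (forall x, dotv x x <= r ^+ 2 -> `|p x| <= B) ->
  forall x, dotv x x <= r ^+ 2 -> `|V p x| <= B.

Definition mY Y p := Pk (fun x => Y x * V p x).

Lemma mY_bounded Y r : polyfun Y -> exists2 C : R, 0 <= C & forall p q B, polyfun p -> polyfun q ->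
  (forall x, dotv x x <= r ^+ 2 -> `|p x - q x| <= B) -> bnd (mY Y p - mY Y q) r (C * B).
Proof.
move=> pY; have [C C0 HC] := ball_bounded r (polyfun_continuous pY).
exists C => // p q B pp pq H t tr.
have pVp := Vpoly hV pp; have pVq := Vpoly hV pq.
have -> : mY Y p - mY Y q = Pk (fun x => Y x * V (fun y => p y - q y) x).
  have -> : (fun x => Y x * V (fun y => p y - q y) x) = (fun x => Y x * V p x + (-1) * (Y x * V q x)).
    by apply/funext => x; rewrite (VB hV)//; ring.
  rewrite (PkD hV); [|exact: polyfunM|by apply: polyfunZ; exact: polyfunM].
  by rewrite (PkZ hV) ?scaleN1r//; exact: polyfunM.
have pB : polyfun (fun y => p y - q y) by exact: polyfunB.
apply: (Pk_bound hRs hRp hk hV hN) => [|x xt]; first by apply: polyfunM => //; exact: (Vpoly hV).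
have xr : dotv x x <= r ^+ 2.
  by rewrite xt -real_normK ?num_real// ler_pXn2r ?nnegrE// (le_trans _ tr).
by rewrite normrM; apply: ler_pM => //; [exact: HC|exact: Vcontr xr].
Qed.

(** Polynomials approximating h on a ball; [A1] asks the same of one partial derivative with the
    same tolerance. *)
Definition A0 h r (d : R) p := polyfun p /\ forall x, dotv x x <= r ^+ 2 -> `|p x - h x| <= d.

Definition A1 i h r (d : R) p := A0 h r d p /\ A0 (fun x => derive h x (e i)) r d (pd (e i) p).

Lemma A0_mono h r d d' p : d <= d' -> A0 h r d p -> A0 h r d' p.
Proof. by move=> dd [pp H]; split=> // x xr; exact: le_trans (H x xr) dd. Qed.

Lemma A1_mono i h r d d' p : d <= d' -> A1 i h r d p -> A1 i h r d' p.
Proof. by move=> dd [H1 H2]; split; exact: A0_mono dd _. Qed.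

Lemma A1_ne i h r d : smooth h -> 0 < d -> exists p, A1 i h r d p.
Proof.
move=> sh d0.
have [||p [pp H1 H2]] := @weierstrass1 R N i h r d _ _ d0.
- by move=> x; exact: (sh [::]).
- by move=> x; apply: differentiable_continuous; exact: (sh [:: e i]).
by exists p; split; split=> //; exact: polyfun_pd.
Qed.

(** A Lipschitz L is small along all approximations of h' once it is small along one particular
    kind, here those of the form F p with p approximating h and its derivative. *)
Lemma small_transfer i h h' r L (F : (vec -> R) -> vec -> R) : smooth h ->
  (exists2 C : R, 0 <= C & forall p q B, polyfun p -> polyfun q ->
     (forall x, dotv x x <= r ^+ 2 -> `|p x - q x| <= B) -> bnd (L p - L q) r (C * B)) ->
  (forall d p, A1 i h r d p -> A0 h' r d (F p)) ->
  small (A1 i h r) r (fun p => L (F p)) -> small (A0 h' r) r L.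
Proof.
move=> sh [C C0 HC] HF HL eps e0; have e2 : 0 < eps / 2 by rewrite divr_gt0.
have [d1 d10 Hd1] := HL _ e2.
have C1 : 0 < C + 1 by rewrite ltr_wpDl.
pose d2 := eps / (4 * (C + 1)).
have d20 : 0 < d2 by rewrite divr_gt0// mulr_gt0.
have [p1 Ap1] : exists p, A1 i h r (Num.min d1 d2) p by apply: A1_ne => //; rewrite lt_min d10.
have [m1 m2] : Num.min d1 d2 <= d1 /\ Num.min d1 d2 <= d2 by rewrite !ge_min !lexx orbT.
have b1 := Hd1 p1 (A1_mono m1 Ap1).
have [pF HF1] := HF _ _ (A1_mono m2 Ap1).
exists d2 => // p [pp Hp]; rewrite -[L p](subrK (L (F p1))) [eps]splitr.
apply: bndD => //; apply: (bnd_le (_ : C * (d2 + d2) <= eps / 2)).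
  rewrite /d2 (_ : _ * _ = C * eps / (2 * (C + 1))); last by field; rewrite gt_eqF.
  rewrite ler_pdivrMr ?mulr_gt0// (_ : eps / 2 * (2 * (C + 1)) = (C + 1) * eps); last by field.
  by rewrite mulrDl mul1r lerDl ltW.
apply: HC => // x xr; rewrite -[p x](subrK (h' x)) -addrA.
by apply: le_trans (ler_normD _ _) _; apply: lerD; [exact: Hp|rewrite distrC; exact: HF1].
Qed.

                                                                                                  
                                                                 
(** Weak form of V h = 0, tested against every polynomial Y and expressed through polynomial
    approximations p of h, so that only V and means of polynomials occur. *)
Definition Null h := forall Y, polyfun Y -> forall r : R, 0 < r -> small (A0 h r) r (mY Y).

Lemma fcauchy_bounded h r L : (exists2 C : R, 0 <= C & forall p q B, polyfun p -> polyfun q ->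
     (forall x, dotv x x <= r ^+ 2 -> `|p x - q x| <= B) -> bnd (L p - L q) r (C * B)) ->
  fcauchy (A0 h r) r L.
Proof.
move=> [C C0 HC] eps e0; have C1 : 0 < C + 1 by rewrite ltr_wpDl.
exists (eps / (2 * (C + 1))) => [|p q [pp Hp] [pq Hq]]; first by rewrite divr_gt0// mulr_gt0.
apply: (bnd_le (_ : C * (eps / (2 * (C + 1)) + eps / (2 * (C + 1))) <= eps)).
  rewrite (_ : _ * _ = C * eps / (C + 1)); last by field; rewrite gt_eqF.
  by rewrite ler_pdivrMr// mulrDr mulr1 mulrC lerDl ltW.
apply: HC => // x xr; rewrite -[p x](subrK (h x)) -addrA.
by apply: le_trans (ler_normD _ _) _; apply: lerD; [exact: Hp|rewrite distrC; exact: Hq].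
Qed.

Lemma small_sub (X : Type) (A B : R -> X -> Prop) r L : (forall (d : R) (x : X), A d x -> B d x) -> small B r L -> small A r L.
Proof.
by move=> AB HL eps e0; have [d d0 H] := HL eps e0; exists d => // u Au; apply: H; exact: AB.
Qed.

Lemma fcauchyD (X : Type) (A : R -> X -> Prop) r L L' : (forall (d d' : R) (x : X), d <= d' -> A d x -> A d' x) ->
  fcauchy A r L -> fcauchy A r L' -> fcauchy A r (fun u : X => L u + L' u).
Proof.
move=> mo H1 H2 eps e0; have e2 : 0 < eps / 2 by rewrite divr_gt0.
have [d1 d10 K1] := H1 _ e2; have [d2 d20 K2] := H2 _ e2.
have [m1 m2] : Num.min d1 d2 <= d1 /\ Num.min d1 d2 <= d2 by rewrite !ge_min !lexx orbT.
exists (Num.min d1 d2) => [|x y Ax Ay]; first by rewrite lt_min d10.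
rewrite opprD addrACA [eps]splitr; apply: bndD; [apply: K1|apply: K2].
- exact: mo m1 Ax.
- exact: mo m1 Ay.
- exact: mo m2 Ax.
- exact: mo m2 Ay.
Qed.

                                                                                                        
                                                                           
(** By parts, the mean of x_i Y V p, which is small, is X^2/cc times an average of the mean of T_i(Y
    V p). That average is inverted by [small_avg_inj], and [leibniz_mean] splits off the mean of Y
    V(d_i p), the other term being small by hypothesis. *)
Lemma null_derive i h : smooth h -> Null h -> Null (fun x => derive h x (e i)).
Proof.
move=> sh Nh Y pY r r0.
apply: (@small_transfer i h _ r (mY Y) (pd (e i)) sh (mY_bounded r pY)); first by move=> d p [_].
have [Z pZ HZ] := leibniz_mean (e i) pY.
have A10 (d : R) p : A1 i h r d p -> A0 h r d p by case.
have mA : forall (d d' : R) p, d <= d' -> A1 i h r d p -> A1 i h r d' p by move=> d d' p; exact: A1_mono.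
pose L p := mY Y (pd (e i) p) + mY Z p.
have LE p : polyfun p -> L p = Pk (T (e i) (fun y => Y y * V p y)).
  move=> pp; rewrite HZ; last exact: (Vpoly hV).
  congr (_ + _); rewrite /mY; apply: (congr1 Pk); apply/funext => x; by rewrite (dunklV hV).
have sZ : small (A1 i h r) r (mY Z) by apply: small_sub (Nh Z pZ r r0) => d p; exact: A10.
have sL : small (A1 i h r) r L.
  apply: (@small_avg_inj _ _ (A1 i h r) mA _ r r0 cc).
  - by move=> d; exact: A1_ne.
  - exact: (cc_gt0 hRp hk hN).
  - by move=> p t; rewrite /L /mY !hornerD !Pk_even.
  - apply: fcauchyD => //; last first.
      move=> eps e0; have [d d0 H] := fcauchy_bounded h (mY_bounded r pZ) e0.
      by exists d => // p q /A10 Ap /A10 Aq; exact: H.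
    move=> eps e0; have [d d0 H] := fcauchy_bounded (fun x => derive h x (e i)) (mY_bounded r pY) e0.
    by exists d => // p q [_ Ap] [_ Aq]; exact: H.
  have c0 := cc_gt0 hRp hk hN.
  have pxY : polyfun (fun x => dotv x (e i) * Y x) by apply: polyfunM => //; exact: polyfun_dotv.
  have := smallZ cc (small_sub A10 (Nh _ pxY r r0)); apply: small_ext => d p [[pp _] _].
  rewrite LE// /mY; have pV := Vpoly hV pp.
  have -> : (fun x => dotv x (e i) * Y x * V p x) = (fun x => dotv x (e i) * (Y x * V p x)).
    by apply/funext => x; rewrite mulrA.
  by rewrite Pk_dotv_avg ?scalerA ?divff ?scale1r ?gt_eqF//; exact: polyfunM.
have := smallD mA sL (smallZ (-1) sZ); apply: small_ext => d p _.
by rewrite /L scaleN1r addrK.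
Qed.

End MeanTools.

(** * Continuity of vector-valued maps *)

Section ContinuousRow.
Variables (R : realType) (N : nat).
Local Notation vec := 'rV[R]_N.

Lemma continuous_row (T : topologicalType) (f : T -> vec) :
  (forall i, continuous (fun x => f x ord0 i)) -> continuous f.
Proof.
move=> H x; apply/cvg_ballP => e e0.
have : \forall y \near x, forall i, ball (f x ord0 i) e (f y ord0 i).
  by apply: filter_forall => i; have /cvg_ballP/(_ e e0) := H i x.
apply: filterS => y Hy; apply/ballP => // i; have := Hy i; by rewrite -ball_normE.
Qed.

Lemma continuous_mulmx (O : 'M[R]_N) : continuous (fun x : vec => x *m O).
Proof.
apply: continuous_row => i; apply: (polyfun_continuous (p := fun x : vec => (x *m O) ord0 i)).
exact: (polyfun_mulmx O (@polyfun_coord R N i)).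
Qed.

End ContinuousRow.

(** * Classical spherical means, as the case of the empty root system *)

Section Classical.
Variables (R : realType) (N : nat).
Local Notation vec := 'rV[R]_N.
Implicit Types (p q f g h Y : vec -> R) (x y z v w : vec).
Variable k : vec -> R.
Local Notation e i := (delta_mx ord0 i : vec).

Lemma root_system_nil : root_system ([::] : seq vec).
Proof. by split. Qed.

Lemma positive_nil : positive_subsystem ([::] : seq vec) [::].
Proof. by exists 0; split. Qed.

Lemma multiplicity_nil : multiplicity [::] k.
Proof. by split. Qed.

Lemma dunkl_nil xi p : dunkl [::] k xi p = pd xi p.
Proof. by apply/funext => x; rewrite dunklE big_nil addr0. Qed.

Lemma intertwiner_nil : poly_intertwiner [::] k id.
Proof.
split; first by move=> p q c _ _.
split=> //; split=> //; first by move=> q pq; exists q.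
by move=> xi p pp; rewrite dunkl_nil.
Qed.

Lemma cc_nil : cc [::] k = N%:R.
Proof. by rewrite /cc /gam big_nil mulr0 addr0. Qed.

Lemma DkL_nil p x : DkL [::] k p x = lap p x.
Proof. by rewrite /DkL /lap; apply: eq_bigr => i _; rewrite !dunkl_nil. Qed.

(** With no roots the Dunkl operators are partial derivatives and V is the identity, so every result
    on [Pk] specializes to ordinary spherical means. *)
Definition Pk0 := Pk [::] k.

Lemma lap_orth (O : 'M[R]_N) p x : orthogonal_mx O -> polyfun p ->
  lap (fun y => p (y *m O)) x = lap p (x *m O).
Proof.
move=> oO pp.
have E i : pd (e i) (pd (e i) (fun y => p (y *m O))) x =
   \sum_j \sum_l O i j * O i l * pd (e j) (pd (e l) p) (x *m O).
  rewrite (eq_pd _ _ (fun y => pd_mulmx O p y (e i))) pd_mulmx pd2_coordE//.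
  apply: eq_bigr => j _; rewrite mulr_sumr; apply: eq_bigr => l _.
  by rewrite -rowE !mxE mulrA.
have -> : lap (fun y => p (y *m O)) x = \sum_(i < N) \sum_(j < N) \sum_(l < N)
   O i j * O i l * pd (e j) (pd (e l) p) (x *m O) by apply: eq_bigr => i _; exact: E.
rewrite exchange_big/=; apply: eq_bigr => j _; rewrite exchange_big/=.
have OO l : \sum_i O i j * O i l = (j == l)%:R.
  have := orthogonal_tr oO; rewrite /orthogonal_mx trmxK => /matrixP/(_ j l).
  by rewrite !mxE => <-; apply: eq_bigr => i _; rewrite mxE.
rewrite (bigD1 j)//= [X in _ + X]big1 ?addr0 => [|l lj].
  by rewrite -mulr_suml OO eqxx mul1r.
by rewrite -mulr_suml OO eq_sym (negbTE lj) mul0r.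
Qed.

Lemma Pk0_orth (O : 'M[R]_N) p : orthogonal_mx O -> polyfun p -> Pk0 (fun x => p (x *m O)) = Pk0 p.
Proof.
move=> oO pp; have hV0 := intertwiner_nil; have ppO := polyfun_mulmx O pp.
apply/polyP => i; rewrite /Pk0 !(coefPk hV0)//; case: ifP => // _; congr (_ * _).
have H n x : iDk [::] k n (fun y => p (y *m O)) x = iDk [::] k n p (x *m O).
  elim: n x => [//|n IH] x; rewrite !iDkS (Dk_ext _ _ _ IH) !DkL_nil lap_orth//.
  exact: (iDk_poly hV0).
by rewrite H mul0mx.
Qed.

Hypothesis hN : (0 < N)%N.

Let N0 : 0 < N%:R :> R. Proof. by rewrite ltr0n. Qed.

Lemma Pk0_pos p (r : R) : polyfun p -> (forall x, dotv x x = r ^+ 2 -> 0 <= p x) -> 0 <= (Pk0 p).[r].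
Proof.
move=> pp H; have hV0 := intertwiner_nil.
have [B B0 HB] := ball_bounded r (polyfun_continuous pp).
have h : `|(Pk0 (fun x => p x - B / 2)).[r]| <= B / 2.
  apply: (Pk_bound root_system_nil positive_nil multiplicity_nil hV0 hN).
    by apply: polyfunB => //; exact: polyfun_cst.
  move=> x xr; have := H x xr; have := HB x; rewrite xr lexx => /(_ isT).
  by rewrite !ler_norml => /andP[_ h1] h2; apply/andP; split; lra.
move: h; have -> : Pk0 (fun x => p x - B / 2) = Pk0 p - (B / 2)%:P.
  rewrite /Pk0 (PkD hV0)//; last exact: polyfun_cst.
  by rewrite (Pk_cst hV0) polyCN.
by rewrite hornerD hornerN hornerC ler_norml => /andP[h1 _]; lra.
Qed.

Lemma Pk0_coord i q : polyfun q ->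
  Pk0 (fun y => y ord0 i * q y) = N%:R^-1 *: ('X^2 * avg N%:R (Pk0 (pd (e i) q))).
Proof.
move=> pq; have := Pk_dotv_avg root_system_nil positive_nil multiplicity_nil intertwiner_nil hN (e i) pq.
rewrite cc_nil dunkl_nil -/(Pk0 _) => <-; apply: (congr1 (Pk [::] k)); apply/funext => y.
by rewrite dotv_delta.
Qed.

Definition m0 Y p := Pk0 (fun x => Y x * p x).

Lemma m0_bounded Y r : polyfun Y -> exists2 C : R, 0 <= C & forall p q B, polyfun p -> polyfun q ->
  (forall x, dotv x x <= r ^+ 2 -> `|p x - q x| <= B) -> bnd (m0 Y p - m0 Y q) r (C * B).
Proof.
exact: (mY_bounded root_system_nil positive_nil multiplicity_nil intertwiner_nil hN
  (fun p r B _ H => H) r).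
Qed.

(** The classical means of Y h vanish on all spheres centred at 0, again stated along polynomial
    approximations of h. *)
Definition Mz Y h := forall r : R, 0 < r -> small (A0 h r) r (m0 Y).

Lemma small_X2avg (X : Type) (A : R -> X -> Prop) (r a : R) (L : X -> {poly R}) : 0 < r -> 0 < a ->
  small A r L -> small A r (fun u => 'X^2 * avg a (L u)).
Proof.
move=> r0 a0 HL eps e0; have [d d0 H] := HL _ (divr_gt0 e0 (exprn_gt0 2 r0)).
exists d => // u Au t tr; rewrite hornerM hornerXn normrM normrX.
have := bnd_avg a0 (ltW r0) (H u Au) tr; rewrite ler_pdivlMr ?exprn_gt0// mulrC; apply: le_trans.
by rewrite ler_wpM2r// ler_pXn2r ?nnegrE ?(ltW r0).
Qed.

(** Integration by parts: the mean of x_i Y p is an average of the mean of (d_i Y) p + Y (d_i p), up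
    to a factor X^2/N. *)
Lemma m0_coord_small i Y h : smooth h -> polyfun Y -> Mz (pd (e i) Y) h ->
  Mz Y (fun x => derive h x (e i)) -> Mz (fun x => x ord0 i * Y x) h.
Proof.
move=> sh pY H1 H2 r r0.
have pX : polyfun (fun x => x ord0 i * Y x) by apply: polyfunM => //; exact: polyfun_coord.
apply: (@small_transfer R N i h _ r _ id sh (m0_bounded r pX)); first by move=> d p [].
have K1 : small (A1 i h r) r (m0 (pd (e i) Y)) by apply: small_sub (H1 r r0) => d p [].
have K2 : small (A1 i h r) r (fun p => m0 Y (pd (e i) p)).
  by move=> eps e0; have [d d0 H] := H2 r r0 eps e0; exists d => // p [_ Ap]; exact: H.
have mA : forall (d d' : R) p, d <= d' -> A1 i h r d p -> A1 i h r d' p by move=> d d' p; exact: A1_mono.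
have := smallZ N%:R^-1 (small_X2avg r0 N0 (smallD mA K1 K2)).
apply: small_ext => d p [[pp _] _].
rewrite /m0; have hV0 := intertwiner_nil; have pdY := polyfun_pd (e i) pY.
rewrite (_ : (fun x => x ord0 i * Y x * p x) = (fun x => x ord0 i * (Y x * p x))); last first.
  by apply/funext => x; rewrite mulrA.
rewrite Pk0_coord; last exact: polyfunM.
rewrite (_ : pd (e i) (fun x => Y x * p x) = (fun x => pd (e i) Y x * p x + Y x * pd (e i) p x)).
  rewrite [in RHS]/Pk0 (PkD hV0)//; apply: polyfunM => //; exact: polyfun_pd.
by apply/funext => x; rewrite pdM.
Qed.

Lemma Mz_sum (I : eqType) (s : seq I) (F : I -> vec -> R) h : (forall i, polyfun (F i)) ->
  (forall i, Mz (F i) h) -> Mz (fun x => \sum_(i <- s) F i x) h.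
Proof.
move=> pF HF r r0.
have := small_sum (fun d d' p => @A0_mono R N h r d d' p) s (fun i => HF i r r0).
apply: small_ext => d p [pp _]; rewrite /m0 -(Pk_sum intertwiner_nil) => [|i _]; last exact: polyfunM.
by apply: (congr1 (Pk [::] k)); apply/funext => x; rewrite mulr_suml.
Qed.

Lemma Dseq_smooth s h : smooth h -> smooth (Dseq s h).
Proof. by move=> sh t x; have := sh (t ++ s) x; rewrite /Dseq foldr_cat. Qed.

(** Induction on the degree of Y, simultaneously for all derivatives of h: Euler's identity writes Y
    as a combination of x_i d_i Y, and [m0_coord_small] lowers the degree at the price of one
    derivative on h. *)
Lemma Mz_all h : smooth h -> (forall s : seq 'I_N, Mz (fun=> 1) (Dseq [seq e i | i <- s] h)) -> forall Y, polyfun Y -> Mz Y h.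
Proof.
move=> sh H.
have Hc c (s : seq 'I_N) : Mz (fun=> c) (Dseq [seq e i | i <- s] h).
  move=> r r0; have := smallZ c (H s r r0); apply: small_ext => d p [pp _].
  rewrite /m0 /Pk0 -(PkZ intertwiner_nil); last by apply: polyfunM => //; exact: polyfun_cst.
  by apply: (congr1 (Pk [::] k)); apply/funext => x; rewrite mul1r.
have key n : forall m Y (s : seq 'I_N), (m <= n)%N -> homog m Y -> Mz Y (Dseq [seq e i | i <- s] h).
  elim: n => [|n IH] [|m] Y s // mn hY.
  - by rewrite (dunkl_sep hY); exact: Hc.
  - by rewrite (dunkl_sep hY); exact: Hc.
  have pY := homog_polyfun hY.
  pose Z i x := m.+1%:R^-1 * pd (e i) Y x.
  have hZ i : homog m (Z i) by apply: homogZ; exact: (homog_pd (e i) hY).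
  have pZ i := homog_polyfun (hZ i).
  have YE : Y = (fun x => \sum_(i <- index_enum 'I_N) x ord0 i * Z i x).
    apply/funext => x; have := homog_euler x hY; rewrite pd_coordE// => E.
    have m1 : m.+1%:R != 0 :> R by rewrite pnatr_eq0.
    apply: (mulfI m1); rewrite -E mulr_sumr; apply: eq_bigr => i _.
    by rewrite /Z mulrCA (mulrA m.+1%:R) divff// mul1r.
  rewrite YE; apply: Mz_sum => i; first by apply: polyfunM => //; exact: polyfun_coord.
  apply: m0_coord_small => //; first exact: Dseq_smooth.
    by apply: (IH m.-1); [rewrite ltnS in mn; exact: leq_trans (leq_pred _) mn|exact: homog_pd].
  exact: (IH m (Z i) (i :: s)).
move=> Y pY; have [d [P [hP ->]]] := homog_decomp pY.
have := @Mz_sum _ (index_enum 'I_d) (fun j => P j) h; apply => j; first exact: homog_polyfun.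
exact: (key j j (P j) [::]).
Qed.

(** Testing with Y close to h makes the mean of h^2 arbitrarily small on the sphere through x0. If
    h(x0) were nonzero, finitely many rotated copies of h^2 would have a sum bounded below on that
    sphere, while each copy has the same mean. *)
Lemma Mz_zero h : continuous h -> (forall Y, polyfun Y -> Mz Y h) -> h = fun=> 0.
Proof.
move=> ch H; apply/funext => x0; apply/eqP/negPn/negP => hx0.
pose eta := h x0 ^+ 2 / 2.
have eta0 : 0 < eta by rewrite divr_gt0// exprn_even_gt0.
pose s := Num.sqrt (dotv x0 x0); have s2 : s ^+ 2 = dotv x0 x0 by rewrite sqr_sqrtr// dotv_ge0.
have s0 : 0 <= s by exact: sqrtr_ge0.
pose r := s + 1; have r0 : 0 < r by rewrite ltr_wpDl.
have sr : s ^+ 2 <= r ^+ 2 by rewrite ler_pXn2r ?nnegrE ?(ltW r0)// lerDl.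
have [Os oO HO] : exists2 Os : seq 'M[R]_N, (forall O, O \in Os -> orthogonal_mx O) &
   forall x, dotv x x = s ^+ 2 -> exists2 O, O \in Os & eta < h (x *m O) ^+ 2.
  have cS : compact [set x : vec | dotv x x = s ^+ 2].
    apply: (subclosed_compact _ (@compact_ball R N s)); last by move=> x /= ->.
    have := @preimage_closed _ _ (fun x : vec => dotv x x) [set s ^+ 2].
    by apply; [move=> x _; apply: polyfun_continuous; exact: polyfun_dotvv|exact: closed_eq].
  move: cS; rewrite compact_cover => /(_ 'M[R]_N [set O | orthogonal_mx O] (fun O => [set x | eta < h (x *m O) ^+ 2])).
  case=> [ O oO| |Os oO HO].
  - apply: (@open_comp _ _ (fun x => h (x *m O) ^+ 2) [set t | eta < t]); last exact: open_gt.
    move=> x _; apply: (@continuous_comp vec R R (fun x => h (x *m O)) (fun t => t ^+ 2)).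
      2: exact: exprn_continuous.
    apply: (@continuous_comp vec vec R (fun x : vec => x *m O) h); last exact: ch.
    exact: continuous_mulmx.
  - move=> x /= xs; have [|O oO xO] := @orth_transitive R N x x0; first by rewrite xs s2.
    exists O => //=; rewrite xO /eta ltr_pdivrMr// mulr_natr mulr2n ltrDl.
    by rewrite exprn_even_gt0.
  exists (finmap.enum_fset Os) => [ O OO|x xs]; first by have := oO O OO; rewrite inE.
  by have [ O OO xO] := HO x xs; exists O.
(* [e1] is chosen so that J rotated copies, each of mean at most 2 [e1], total at most eta/4, below
   the lower bound eta/2. *)
pose J := size Os; pose e1 : R := eta / (8 * (J%:R + 1)).
have J1 : (0 : R) < J%:R + 1 by rewrite ltr_wpDl.
have e10 : 0 < e1 by rewrite divr_gt0// mulr_gt0.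
have [C C0 HC] := ball_bounded r ch.
have [d [d0 d1 d2 d3]] : exists d : R, [/\ 0 < d, d <= 1, d * (2 * C + 1) <= eta / 2 & (C + 1) * (2 * d) <= e1].
  have c1 : 0 < 2 * C + 1 by rewrite ltr_wpDl// mulr_ge0.
  have c2 : 0 < (C + 1) * 2 by rewrite mulr_gt0// ltr_wpDl.
  exists (Num.min 1 (Num.min (eta / 2 / (2 * C + 1)) (e1 / ((C + 1) * 2)))).
  split.
  - rewrite lt_min ltr01 /= lt_min; apply/andP; split; apply: divr_gt0 => //; exact: divr_gt0.
  - by rewrite ge_min lexx.
  - by rewrite -ler_pdivlMr// !ge_min lexx !orbT.
  - by rewrite mulrA mulrC -ler_pdivlMr// !ge_min lexx !orbT.
(* [p1] is fixed first, as the test polynomial Y; only then is the finer approximation [p2] chosen,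
   within the tolerance [d'] that depends on [p1]. *)
have [p1 pp1 Hp1] := weierstrass r ch d0.
have [d' d'0 Hd'] := H p1 pp1 r r0 e1 e10.
have dm0 : 0 < Num.min d d' by rewrite lt_min d0.
have [p2 pp2 Hp2] := weierstrass r ch dm0.
have b12 : `|(m0 p1 p2).[s]| <= e1.
  apply: Hd'; last by rewrite ger0_norm// lerDl.
  by split=> // x xr; apply: le_trans (Hp2 x xr) _; rewrite ge_min lexx orbT.
have hV0 := intertwiner_nil.
have p1C x : dotv x x <= r ^+ 2 -> `|p1 x| <= C + 1.
  move=> xr; rewrite -[p1 x](subrK (h x)) addrC; apply: le_trans (ler_normD _ _) _.
  by apply: lerD; [exact: HC|exact: le_trans (Hp1 x xr) d1].
have b11 : `|(m0 p1 p1).[s] - (m0 p1 p2).[s]| <= e1.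
  have -> : (m0 p1 p1).[s] - (m0 p1 p2).[s] = (Pk0 (fun x => p1 x * (p1 x + (-1) * p2 x))).[s].
    rewrite /m0 /Pk0 (_ : (fun x => p1 x * (p1 x + -1 * p2 x)) = (fun x => p1 x * p1 x + (-1) * (p1 x * p2 x))).
      rewrite (PkD hV0); [|exact: polyfunM|by apply: polyfunZ; exact: polyfunM].
      by rewrite (PkZ hV0) ?hornerD ?hornerZ ?mulN1r//; exact: polyfunM.
    by apply/funext => x; ring.
  apply: (Pk_bound root_system_nil positive_nil multiplicity_nil hV0 hN) => [|x xs].
    by apply: polyfunM => //; apply: polyfunD => //; exact: polyfunZ.
  have xr : dotv x x <= r ^+ 2 by rewrite xs.
  rewrite normrM; apply: le_trans d3; apply: ler_pM => //; first exact: p1C.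
  rewrite mulN1r -[p1 x](subrK (h x)) -addrA (_ : 2 * d = d + d); last by ring.
  apply: le_trans (ler_normD _ _) _; apply: lerD; first exact: Hp1.
  by rewrite distrC; apply: le_trans (Hp2 x xr) _; rewrite ge_min lexx.
have pO O : polyfun (fun x => p1 (x *m O) * p1 (x *m O)).
  by apply: polyfunM; exact: polyfun_mulmx.
have low : 0 <= (Pk0 (fun x => \sum_(O <- Os) p1 (x *m O) * p1 (x *m O) - eta / 2)).[s].
  apply: Pk0_pos => [|x xs].
    by apply: polyfunB; [exact: polyfun_sum|exact: polyfun_cst].
  have [ O OO xO] := HO x xs; rewrite (big_rem O)//= -addrA addrC -addrA.
  have oxr : dotv (x *m O) (x *m O) <= r ^+ 2 by rewrite (dotv_orth _ _ (oO O OO)) xs.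
  have := Hp1 _ oxr; have := HC _ oxr; move: xO; set a := h _; set b := p1 _ => xO aC ab.
  apply: addr_ge0; first by apply: sumr_ge0 => O' _; rewrite -expr2 sqr_ge0.
  have -> : b * b = a ^+ 2 + (b - a) * (2 * a + (b - a)) by ring.
  have : `|(b - a) * (2 * a + (b - a))| <= d * (2 * C + 1).
    rewrite normrM; apply: ler_pM => //; apply: le_trans (ler_normD _ _) _.
    apply: lerD; last exact: le_trans ab d1.
    by rewrite normrM ger0_norm// ler_wpM2l.
  by rewrite ler_norml => /andP[q1 _]; lra.
move: low; rewrite /Pk0 (PkD hV0) => [|| ]; [|exact: polyfun_sum|exact: polyfun_cst].
rewrite (Pk_cst hV0) (Pk_sum hV0) => [|O _]; last exact: pO.
rewrite (eq_big_seq (fun _ => m0 p1 p1)) => [|O OO]; last first.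
  exact: (Pk0_orth (oO O OO) (polyfunM pp1 pp1)).
rewrite big_const_seq count_predT iter_addr addr0 hornerD hornerC hornerMn -/J.
move: b11 b12; rewrite !ler_norml => /andP[_ q1] /andP[_ q2] q3.
have q4 : (m0 p1 p1).[s] *+ J <= J%:R * (2 * e1).
  by rewrite -[leLHS]mulr_natl ler_wpM2l//; lra.
have q5 : J%:R * (2 * e1) <= eta / 4.
  rewrite /e1 (_ : _ * _ = J%:R * eta / (4 * (J%:R + 1))); last by field; rewrite gt_eqF.
  rewrite ler_pdivrMr ?mulr_gt0// (_ : eta / 4 * (4 * (J%:R + 1)) = J%:R * eta + eta); last by field.
  by rewrite lerDl ltW.
by lra.
Qed.

End Classical.

(** * Injectivity of V on smooth functions and the translation formula *)

Section Injectivity.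
Variables (R : realType) (N : nat).
Local Notation vec := 'rV[R]_N.
Implicit Types (p q f g h Y : vec -> R) (x y z v w : vec).
Variables (Rs Rp : seq vec) (k : vec -> R) (V : (vec -> R) -> (vec -> R)).
Hypotheses (hRs : root_system Rs) (hRp : positive_subsystem Rs Rp)
  (hk : multiplicity Rs k) (hV : poly_intertwiner Rp k V) (hN : (0 < N)%N).
Variable mu : vec -> probability (RN R N) R.
Hypothesis hmu : rosler_family Rs V mu.
Local Notation cc := (cc Rp k).
Local Notation e i := (delta_mx ord0 i : vec).

Lemma V_contraction p r (B : R) : polyfun p -> (forall x, dotv x x <= r ^+ 2 -> `|p x| <= B) ->
  forall x, dotv x x <= r ^+ 2 -> `|V p x| <= B.
Proof.
move=> pp H x xr; rewrite -(Vop_poly hmu)// VopE.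
apply: (conc_bound (mu_conc hRs hmu xr)) => //.
by apply: RN_continuous; exact: polyfun_continuous.
Qed.

Lemma null_base h : continuous h -> Vop mu h = (fun=> 0) -> Null Rp k V h.
Proof.
move=> ch h0 Y pY r r0 eps e0.
have [C C0 HC] := ball_bounded r (polyfun_continuous pY).
have C1 : 0 < C + 1 by rewrite ltr_wpDl.
exists (eps / (C + 1)) => [|p [pp Hp]]; first by rewrite divr_gt0.
move=> t tr; apply: (Pk_bound hRs hRp hk hV hN) => [|x xt].
  by apply: polyfunM => //; exact: (Vpoly hV).
have xr : dotv x x <= r ^+ 2 by rewrite xt -real_normK ?num_real// ler_pXn2r ?nnegrE// ltW.
have := Vop_near hRs hmu pp (RN_continuous ch) xr Hp; rewrite h0 subr0 => Vx.
rewrite normrM; apply: (@le_trans _ _ (C * (eps / (C + 1)))).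
  by apply: ler_pM => //; exact: HC.
by rewrite mulrA ler_pdivrMr// mulrC mulrDr mulr1 lerDl ltW.
Qed.

Lemma iDk_V n p x : polyfun p -> iDk Rp k n (V p) x = V (iDk [::] k n p) x.
Proof.
move=> pp; have pD m : polyfun (iDk [::] k m p) := iDk_poly (intertwiner_nil k) m pp.
elim: n x => [//|n IH] x; rewrite !iDkS (Dk_ext _ _ _ IH) /DkL.
rewrite (V_sum hV) => [|i _]; last by rewrite !dunkl_nil; apply: polyfun_pd; exact: polyfun_pd.
apply: eq_bigr => i _.
have -> : dunkl Rp k (e i) (V (iDk [::] k n p)) = V (pd (e i) (iDk [::] k n p)).
  by apply/funext => y; exact: (dunklV hV).
by rewrite (dunklV hV) ?dunkl_nil//; exact: polyfun_pd.
Qed.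

(** V carries the Laplacian to the Dunkl Laplacian and keeps values at 0, so both means have the
    same iterates and differ only in Pizzetti coefficients. [Kop] replaces dimension [cc] by N + 2m,
    and m averages do the same starting from N. *)
Lemma Kop_mean m p : polyfun p -> Kop cc (N%:R + 2 * m%:R - cc) (Pk Rp k (V p)) = mavg N%:R m (Pk0 k p).
Proof.
move=> pp; apply/polyP => i; rewrite coef_Kop coef_mavg.
case: ifPn => oi; first by rewrite (Pk_odd _ _ _ oi) mulr0.
rewrite (coefPk hV); last exact: (Vpoly hV).
rewrite /Pk0 (coefPk (intertwiner_nil k))// (negbTE oi) iDk_V//.
have ppD := iDk_poly (intertwiner_nil k) i./2 pp.
rewrite (V_at0 hV)// !mulrA; congr (_ * _).
have N0 : 0 < N%:R :> R by rewrite ltr0n.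
have -> : i%:R = i./2.*2%:R :> R by rewrite -{1}[i]odd_double_half (negbTE oi).
rewrite mavg_even_prod// /rho /bco -!big_split/=; apply: eq_bigr => l _.
have c0 := cc_gt0 hRp hk hN; rewrite cc_nil.
have l0 : (0 : R) <= 2 * l%:R by rewrite mulr_ge0.
have h1 : cc + 2 * l%:R != 0 by rewrite gt_eqF// ltr_pwDl.
have h2 : N%:R + 2 * l%:R != 0 :> R by rewrite gt_eqF// ltr_pwDl.
have h3 : N%:R + 2 * m%:R + 2 * l%:R != 0 :> R by rewrite gt_eqF// -addrA ltr_pwDl// addr_ge0// mulr_ge0.
have h4 : l.+1%:R != 0 :> R by rewrite pnatr_eq0.
have -> : cc + 2 * l%:R + (N%:R + 2 * m%:R - cc) = N%:R + 2 * m%:R + 2 * l%:R by ring.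
move: h1 h2 h3 h4; move: (l%:R) (m%:R) cc (N%:R) (l.+1%:R) => l' m' c n' l1 h1 h2 h3 h4; field.
by rewrite h1 h2 h3 h4.
Qed.

Lemma mavgB b m (P Q : {poly R}) : mavg b m (P - Q) = mavg b m P - mavg b m Q.
Proof. by elim: m => [//|m IH] /=; rewrite IH avgD avgN. Qed.

Lemma bnd_mavg b m P r (B : R) : 0 < b -> 0 <= r -> bnd P r B -> bnd (mavg b m P) r B.
Proof.
move=> b0 r0; elim: m => [//|m IH] H /=; apply: bnd_avg => //; last exact: IH.
by rewrite ltr_pwDl// mulr_ge0.
Qed.

Lemma small_X2 (X : Type) (A : R -> X -> Prop) (r : R) (L : X -> {poly R}) : 0 < r ->
  small A r L -> small A r (fun u => 'X^2 * L u).
Proof.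
move=> r0 HL eps e0; have [d d0 H] := HL _ (divr_gt0 e0 (exprn_gt0 2 r0)).
exists d => // u Au t tr; rewrite hornerM hornerXn normrM normrX.
have := H u Au t tr; rewrite ler_pdivlMr ?exprn_gt0// mulrC; apply: le_trans.
by rewrite ler_wpM2r// ler_pXn2r ?nnegrE ?(ltW r0).
Qed.

(** Smallness of the Dunkl means passes through the contraction [Kop] to the m-fold average of the
    classical means; the averages are then removed one at a time. *)
Lemma null_mean h : continuous h -> Null Rp k V h -> Mz k (fun=> 1) h.
Proof.
move=> ch Nh r r0; have p1 := @polyfun_cst R N 1.
have N0 : 0 < N%:R :> R by rewrite ltr0n.
have m01 p : m0 k (fun=> 1) p = Pk0 k p by apply: (congr1 (Pk [::] k)); apply/funext => x; rewrite mul1r.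
have [m Hm] := nat_above cc.
have sg0 : 0 < N%:R + 2 * m%:R - cc.
  by have := Hm m (leqnn m); have : (0 : R) <= m%:R by []; lra.
have top : small (A0 h r) r (fun p => mavg N%:R m (m0 k (fun=> 1) p)).
  move=> eps e0; have [d d0 H] := Nh _ p1 r r0 eps e0; exists d => // p Ap.
  have pp : polyfun p by case: Ap.
  rewrite m01 -Kop_mean// -[Kop _ _ _]derivn0; apply: bnd_Kop; [exact: (cc_gt0 hRp hk hN)|exact: sg0|exact: ltW|].
  rewrite derivn0; have := H p Ap; rewrite /mY.
  by rewrite (_ : (fun x => 1 * V p x) = V p)//; apply/funext => x; rewrite mul1r.
have mA : forall (d d' : R) p, d <= d' -> A0 h r d p -> A0 h r d' p by move=> d d' p; exact: A0_mono.
elim: m {Hm sg0} top => [//|m IH] top; apply: IH.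
apply: (@small_avg_inj _ _ (A0 h r) mA _ r r0 (N%:R + 2 * m%:R)).
- by move=> d d0; have [p pp Hp] := weierstrass r ch d0; exists p.
- by rewrite ltr_pwDl// mulr_ge0.
- move=> p t; apply: even_horner => i oi; by rewrite coef_mavg /m0 /Pk0 Pk_odd ?mulr0.
- move=> eps e0; have [d d0 H] := fcauchy_bounded h (m0_bounded k hN r p1) e0.
  exists d => // p q Ap Aq; rewrite -mavgB; apply: bnd_mavg => //; [exact: ltW|exact: H].
exact: small_X2.
Qed.

Lemma DseqBs s f g : smooth f -> smooth g ->
  Dseq s (fun x => f x - g x) = (fun x => Dseq s f x - Dseq s g x).
Proof.
move=> sf sg; elim: s => [//|v s IH]; apply/funext => x; rewrite Dseq_cons IH -pdE.
by rewrite deriveB//; apply: diff_derivable; [exact: sf|exact: sg].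
Qed.

Lemma smoothB f g : smooth f -> smooth g -> smooth (fun x => f x - g x).
Proof.
by move=> sf sg s x; rewrite DseqBs//; apply: differentiableB; [exact: sf|exact: sg].
Qed.

Lemma null_Dseq h (s : seq 'I_N) : smooth h -> Null Rp k V h -> Null Rp k V (Dseq [seq e i | i <- s] h).
Proof.
move=> sh Nh; elim: s => [//|i s IH].
by apply: (null_derive hRs hRp hk hV hN V_contraction i) => //; exact: Dseq_smooth.
Qed.

Lemma Vop_inj0 h : smooth h -> Vop mu h = (fun=> 0) -> h = fun=> 0.
Proof.
move=> sh h0; have ch := smooth_continuous sh.
apply: (Mz_zero (k := k) hN ch); apply: (Mz_all hN sh) => s.
apply: null_mean; first by apply: smooth_continuous; exact: Dseq_smooth.
by apply: null_Dseq => //; exact: null_base.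
Qed.

Lemma Vop_inj f g : smooth f -> smooth g -> Vop mu f = Vop mu g -> f = g.
Proof.
move=> sf sg E; suff : (fun x => f x - g x) = fun=> 0.
  by move=> H; apply/funext => x; apply/eqP; rewrite -subr_eq0; apply/eqP; exact: (congr1 (fun F => F x) H).
apply: Vop_inj0; first exact: smoothB.
apply/funext => x; pose r := Num.sqrt (dotv x x).
have xr : dotv x x <= r ^+ 2 by rewrite sqr_sqrtr// dotv_ge0.
have intc F : smooth F -> (mu x).-integrable setT (EFin \o (F : RN R N -> R)).
  move=> sF; have [B _ HB] := ball_bounded r (smooth_continuous sF).
  by apply: (conc_integrable (mu_conc hRs hmu xr) (RN_continuous (smooth_continuous sF))); exact: HB.
rewrite VopE RintegralB//; [|exact: intc|exact: intc].
by rewrite -!VopE E subrr.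
Qed.

(** Injectivity makes the preimage selected by [Vinv] coincide with any smooth preimage that has
    been constructed. *)
Lemma Vinv_eq f g : smooth g -> Vop mu g = f -> Vinv mu f = g.
Proof.
move=> sg gf; have [sv vf] := @xgetI _ (fun=> 0) [set g | smooth g /\ Vop mu g = f] g (conj sg gf).
by apply: Vop_inj => //; rewrite gf.
Qed.

Lemma gen_translE f v x y : smooth f -> radial_fun f -> dotv v v = 1 ->
  gen_transl mu f x y = \int[mu x]_z f (gt_len x y z *: v).
Proof.
move=> sf rf v1.
have [g [p [P [sg gf [pp gp HP Vp]]]]] := radial_preimage hRs hRp hk hV hN hmu sf rf v1.
rewrite /gen_transl (Vinv_eq sg gf).
exact: (translate_value hRs hRp hk hV hmu x y sf rf v1 sg pp gp HP Vp).
Qed.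

End Injectivity.

                                          

(** * Wallis integrals *)

Section TrigMoments.
Variable R : realType.
Local Notation leb := (@lebesgue_measure R).
Implicit Types (f g F : R -> R) (t : R).

Lemma is_derive_mulR f g df dg t : is_derive t 1 f df -> is_derive t 1 g dg ->
  is_derive t 1 (fun s => f s * g s) (f t * dg + df * g t).
Proof.
move=> hf hg; have := is_deriveM hf hg => H.
by apply: is_derive_eq H _; rewrite /GRing.scale /= [g t * df]mulrC.
Qed.

Lemma is_derive_powR f df t n : is_derive t 1 f df ->
  is_derive t 1 (fun s => f s ^+ n) (n%:R * f t ^+ n.-1 * df).
Proof.
move=> hf; elim: n => [|n IH].
  by rewrite !mul0r; exact: is_derive_cst.
have -> : (fun s => f s ^+ n.+1) = (fun s => f s * f s ^+ n) by apply/funext => s; rewrite exprS.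
apply: is_derive_eq (is_derive_mulR hf IH) _; rewrite /= -natr1.
case: n {IH} => [|n] /=; first by rewrite expr0; ring.
by rewrite exprS; ring.
Qed.

Definition J f : R := \int[leb]_(t in `[0, pi]) f t.

Lemma J_integrable f : continuous f -> leb.-integrable `[0, pi] (EFin \o f).
Proof.
move=> cf; apply: continuous_compact_integrable; first exact: segment_compact.
exact: continuous_subspaceT.
Qed.

Lemma JD f g : continuous f -> continuous g -> J (fun t => f t + g t) = J f + J g.
Proof. by move=> cf cg; apply: RintegralD => //; exact: J_integrable. Qed.

Lemma JZ (c : R) f : continuous f -> J (fun t => c * f t) = c * J f.
Proof. by move=> cf; apply: RintegralZl => //; exact: J_integrable. Qed.

Lemma J_FTC F f : (forall t, is_derive t 1 F (f t)) -> continuous f -> J f = F pi - F 0.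
Proof.
move=> dF cf; rewrite /J /Rintegral (@continuous_FTC2 _ f F 0 pi) ?pi_gt0//.
- exact: continuous_subspaceT.
- have cF t : {for t, continuous F}.
    by apply: differentiable_continuous; apply/derivable1_diffP; exact: ex_derive.
  split=> [t _| |]; first exact: ex_derive.
  + by apply: cvg_at_right_filter; exact: cF.
  + by apply: cvg_at_left_filter; exact: cF.
- by move=> t _; rewrite derive1E; exact: derive_val.
Qed.

(** Its recursions come from integrating the derivative of cos^(a+1) sin^(c+1) over [0,pi] and from
    cos^2 + sin^2 = 1. *)
Definition W a c : R := J (fun t => cos t ^+ a * sin t ^+ c).

Lemma continuous_trig a c : continuous (fun t : R => cos t ^+ a * sin t ^+ c).
Proof.
move=> t; apply: differentiable_continuous; apply/derivable1_diffP.
exact: (@ex_derive _ _ _ _ _ _ _ (is_derive_mulR (is_derive_powR a (is_derive_cos t)) (is_derive_powR c (is_derive_sin t)))).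
Qed.

Lemma W_parts a c : c.+1%:R * W a.+2 c = a.+1%:R * W a c.+2.
Proof.
pose F t : R := cos t ^+ a.+1 * sin t ^+ c.+1.
pose f t : R := c.+1%:R * (cos t ^+ a.+2 * sin t ^+ c) + (- a.+1%:R) * (cos t ^+ a * sin t ^+ c.+2).
have dF t : is_derive t 1 F (f t).
  apply: is_derive_eq (is_derive_mulR (is_derive_powR a.+1 (is_derive_cos t)) (is_derive_powR c.+1 (is_derive_sin t))) _.
  by rewrite /f /= !exprS; ring.
have cf : continuous f.
  by move=> t; apply: cvgD; apply: cvgMr; exact: continuous_trig.
have := J_FTC dF cf; rewrite /F sinpi sin0 !expr0n /= !mulr0 subrr /f.
rewrite JD; [|by move=> t; apply: cvgMr; exact: continuous_trig..].
rewrite !JZ; [|exact: continuous_trig..].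
by rewrite -!/(W _ _) => /eqP; rewrite mulNr subr_eq0 => /eqP.
Qed.

Lemma W_pyth a c : W a c.+2 = W a c - W a.+2 c.
Proof.
rewrite -[X in _ = _ + X]mulN1r -JZ; last exact: continuous_trig.
rewrite -JD; [|exact: continuous_trig|by move=> t; apply: cvgMr; exact: continuous_trig].
congr J; apply/funext => t; have E : sin t ^+ 2 = 1 - cos t ^+ 2 by rewrite -(cos2Dsin2 t) addrC addKr.
by rewrite -[c.+2]addn2 -[a.+2]addn2 !exprD E; ring.
Qed.

Lemma W_recl a c : (a + c + 2)%:R * W a.+2 c = a.+1%:R * W a c.
Proof.
have := W_parts a c; rewrite W_pyth mulrBr => /eqP; rewrite eq_sym subr_eq => /eqP ->.
by rewrite -mulrDl -natrD; congr (_%:R * _); lia.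
Qed.

Lemma W_recr a c : (a + c + 2)%:R * W a c.+2 = c.+1%:R * W a c.
Proof.
rewrite W_pyth mulrBr W_recl -mulrBl; congr (_ * _).
by rewrite -natrB; [congr (_%:R); lia|lia].
Qed.

Lemma W_odd a c : odd a -> W a c = 0.
Proof.
move=> oa; rewrite -[a]odd_double_half oa; elim: (a./2) => [|n IH].
  have dF (t : R) : is_derive t 1 (fun s : R => sin s ^+ c.+1) (c.+1%:R * (cos t ^+ 1 * sin t ^+ c)).
    by apply: is_derive_eq (is_derive_powR c.+1 (is_derive_sin t)) _; rewrite /= expr1; ring.
  have := J_FTC dF; rewrite JZ; last exact: continuous_trig.
  rewrite sinpi sin0 !expr0n subrr => H.
  have cf : continuous (fun t : R => c.+1%:R * (cos t ^+ 1 * sin t ^+ c)).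
    by move=> t; apply: cvgMr; exact: continuous_trig.
  by move: (H cf) => /eqP; rewrite mulf_eq0 pnatr_eq0 /= => /eqP.
have := W_recl (true + n.*2) c; rewrite IH mulr0 => /eqP; rewrite mulf_eq0 pnatr_eq0 addn2 /=.
by rewrite doubleS !addnS => /eqP.
Qed.

Lemma W0_gt0 c : 0 < W 0 c.
Proof.
have H : 0 < W 0 c /\ 0 < W 0 c.+1.
  elim: c => [|c [IH1 IH2]].
    split.
      have dF (t : R) : is_derive t 1 (id : R -> R) (cos t ^+ 0 * sin t ^+ 0).
        by rewrite !expr0 mulr1; exact: is_derive_id.
      by rewrite /W (J_FTC dF (@continuous_trig 0 0)) subr0 pi_gt0.
    have dF (t : R) : is_derive t 1 (fun s : R => - cos s) (cos t ^+ 0 * sin t ^+ 1).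
      have := is_deriveN (is_derive_cos t); rewrite opprK expr0 expr1 mul1r; exact.
    by rewrite /W (J_FTC dF (@continuous_trig 0 1)) cospi cos0 !opprK; lra.
  split=> //; have := W_recr 0 c => E.
  by rewrite -(pmulr_rgt0 (W 0 c.+2) (_ : 0 < (0 + c + 2)%:R :> R)) ?E ?mulr_gt0// ltr0n addn2.
by case: H.
Qed.

End TrigMoments.

(** * The law of the polar angle *)

Section AngleMeasure.
Variables (R : realType) (c : nat).
Local Notation leb := (@lebesgue_measure R).

(** Density of the angle between a uniform point of the unit sphere of R^(c+2) and a fixed axis,
    extended by 0 outside [0,pi]. *)
Definition angw : R -> R := (fun t : R => sin t ^+ c / W R 0 c) \_ `[0, pi].

Lemma measurable_angw : measurable_fun setT angw.
Proof.
apply/(@measurable_restrictT _ _ _ _ `[0, pi]%classic) => //.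
apply: measurable_funTS; apply: continuous_measurable_fun => t; apply: cvgMl.
have := @continuous_trig R 0 c t; rewrite (_ : (fun t => _) = (fun t => sin t ^+ c))//.
by apply/funext => s; rewrite expr0 mul1r.
Qed.

Lemma angw_ge0 t : 0 <= angw t.
Proof.
rewrite /angw patchE; case: ifPn => //; rewrite inE /= in_itv /= => tp.
by rewrite divr_ge0 ?exprn_ge0 ?sin_ge0_pi// ltW// W0_gt0.
Qed.

Definition ang (A : set (measurableTypeR R)) : \bar R := \int[leb]_(t in A) (angw t)%:E.

Let ang0 : ang set0 = 0%E.
Proof. by rewrite /ang integral_set0. Qed.

Let ang_ge0 A : (0 <= ang A)%E.
Proof. by apply: integral_ge0 => t _; rewrite lee_fin angw_ge0. Qed.

Let mangw : measurable_fun setT (fun t => (angw t)%:E).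
Proof. by apply/measurable_EFinP; exact: measurable_angw. Qed.

Let ang_sigma_additive : semi_sigma_additive ang.
Proof.
move=> /= F mF tF mUF; rewrite /ang; apply: cvg_toP.
  apply: ereal_nondecreasing_is_cvgn => m n mn.
  apply: lee_sum_nneg_natr => // k _ _.
  by apply: integral_ge0 => /= x Fkx; rewrite lee_fin angw_ge0.
rewrite ge0_integral_bigcup//=.
- exact: measurable_funTS.
- by move=> x _; rewrite lee_fin angw_ge0.
Qed.

HB.instance Definition _ := isMeasure.Build _ _ _ ang ang0 ang_ge0 ang_sigma_additive.

Lemma integral_angw (f : R -> R) : continuous f ->
  \int[leb]_t (f t * angw t) = J (fun t => f t * (cos t ^+ 0 * sin t ^+ c)) / W R 0 c.
Proof.
move=> cf; rewrite [RHS]mulrC -JZ; last first.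
  move=> t; apply: cvgM; [exact: cf|exact: continuous_trig].
rewrite /J [RHS]Rintegral_mkcond; congr fine; apply: eq_integral => t _; rewrite /= /angw !patchE.
by case: ifPn => _; rewrite ?mulr0// expr0 mul1r mulrA mulrC.
Qed.

Lemma ang_setT : ang setT = 1%E.
Proof.
have := integral_angw (@cst_continuous R R 1).
rewrite (_ : J _ = W R 0 c); last by congr J; apply/funext => t; rewrite mul1r.
rewrite divff ?gt_eqF ?W0_gt0// => H.
have i1 : leb.-integrable setT (EFin \o angw).
  rewrite /angw -restrict_EFin; apply/(integrable_mkcond _ _).1 => //.
  apply: J_integrable => t; apply: cvgMl.
  have := @continuous_trig R 0 c t; rewrite (_ : (fun t => _) = (fun t => sin t ^+ c))//.
  by apply/funext => s; rewrite expr0 mul1r.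
rewrite /ang -[LHS]fineK; last exact: integrable_fin_num.
congr (_%:E); rewrite -[RHS]H; congr fine; apply: eq_integral => t _; by rewrite mul1r.
Qed.

HB.instance Definition _ := @Measure_isProbability.Build _ _ R ang ang_setT.

Lemma ang_dominated : ang `<< leb.
Proof.
apply/null_content_dominatesP => A mA A0; rewrite /ang.
by apply: null_set_integral => //; exact: measurable_funTS.
Qed.

Lemma integral_ang (f : R -> R) (B : R) : continuous f -> (forall t, `|f t| <= B) ->
  \int[ang]_t f t = J (fun t => f t * (cos t ^+ 0 * sin t ^+ c)) / W R 0 c.
Proof.
move=> cf fB; rewrite -integral_angw//.
have mf : measurable_fun setT f by exact: continuous_measurable_fun.
have intf : ang.-integrable setT (EFin \o f).
  by apply: (conc_integrable (concT (ang : probability _ R)) mf) => t _; exact: fB.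
rewrite /Rintegral; congr fine.
have RN := @Radon_Nikodym_change_of_variables _ _ _ ang leb ang_dominated.
rewrite -RN//=.
apply: ae_eq_integral => //.
- apply: emeasurable_funM; first exact/measurable_EFinP.
  apply: (measurable_int leb).
  by apply: Radon_Nikodym_integrable; exact: ang_dominated.
- by apply/measurable_EFinP; apply: measurable_funM => //; exact: measurable_angw.
rewrite (_ : (fun t => (f t * angw t)%:E) = (fun t => (f t)%:E * (angw t)%:E)%E); last first.
  by apply/funext => t; rewrite EFinM.
apply: ae_eqe_mul2l; rewrite Radon_NikodymE//=; first exact: ang_dominated.
move=> adom; case: cid => /= h [h1 h2 h3].
apply: integral_ae_eq => //= E _ mE.
by rewrite -h3.
Qed.

End AngleMeasure.

(** * Linear functionals determined by powers of linear forms *)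

Section RidgeDeterminacy.
Variables (R : realType) (N : nat).
Local Notation vec := 'rV[R]_N.
Implicit Types (p q : vec -> R) (x v : vec).

                                                                              
(** Differentiating L(q <.,v>^(l+1)) = 0 in v along a coordinate gives L(x_i q <.,v>^l) = 0.
    Starting from q constant, coordinates are thus multiplied in one at a time, and v = 0, l = 0
    ends the proof. *)
Lemma ridge_determinacy (L : (vec -> R) -> R) :
  (forall p q c, polyfun p -> polyfun q -> L (fun y => p y + c * q y) = L p + c * L q) ->
  (forall v n, L (fun x => dotv x v ^+ n) = 0) -> forall p, polyfun p -> L p = 0.
Proof.
move=> Llin L0 p pp.
have lL := @linop_cst R N L Llin.
have pX v l : polyfun (fun x => dotv x v ^+ l) by apply: polyfunX; exact: polyfun_dotv.
suff key : forall q, polyfun q -> forall l v, L (fun x => q x * dotv x v ^+ l) = 0.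
  rewrite -(key p pp 0%N 0); congr (L _); apply/funext => x; by rewrite expr0 mulr1.
apply: polyfun_ind => [c l v|q1 q2 p1 p2 IH1 IH2 l v|i q pq IH l v].
- by have := linopZ c 0 lL (pX v l); rewrite /= L0 mulr0.
- have := linopD 0 lL (polyfunM p1 (pX v l)) (polyfunM p2 (pX v l)); rewrite /= IH1 IH2 addr0 => <-.
  by congr (L _); apply/funext => x; rewrite mulrDl.
pose D v x := q x * dotv x v ^+ l.+1.
have pD : poly2 D.
  apply: poly2M; first exact: poly2_snd.
  exact: (poly2X l.+1 (poly2_swap (@poly2_dotv R N))).
have := linop_comm v 0 (linop_pd (delta_mx ord0 i)) lL pD.
rewrite (eq_pd _ _ (q := fun=> 0)); last by move=> w; exact: IH.
rewrite pd_cst /= => /esym.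
have -> : (fun x => pd (delta_mx ord0 i : vec) (fun w => D w x) v) =
  (fun x => l.+1%:R * (x ord0 i * q x * dotv x v ^+ l)).
  apply/funext => x; rewrite /D pdZ; last by apply: polyfunX; exact: polyfun_dotvl.
  rewrite pdX; last exact: polyfun_dotvl.
  rewrite (eq_pd _ _ (q := fun w => dotv w x)); last by move=> w; exact: dotvC.
  by rewrite pd_dotv dotv_coordl /=; ring.
have pq' : polyfun (fun x => x ord0 i * q x * dotv x v ^+ l).
  by apply: polyfunM => //; apply: polyfunM => //; exact: polyfun_coord.
have := linopZ l.+1%:R 0 lL pq'; rewrite /= => -> /eqP.
by rewrite mulf_eq0 pnatr_eq0 => /eqP.
Qed.

End RidgeDeterminacy.

(** * Product measures and image measures *)

Section RealFubini.
Context {d1 d2 : measure_display} {T1 : measurableType d1} {T2 : measurableType d2} {R : realType}.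
Variables (P1 : probability T1 R) (P2 : probability T2 R).

Lemma conc_prod A1 A2 : conc P1 A1 -> conc P2 A2 -> conc (P1 \x P2)%E (A1 `*` A2).
Proof.
move=> [m1 c1] [m2 c2]; split; first exact: measurableX.
have mm : measurable (~` (A1 `*` A2)) by apply: measurableC; exact: measurableX.
apply: (iffLR (@negligibleP _ _ R (P1 \x P2)%E _ mm)).
apply: (@negligibleS _ _ _ _ ((~` A1 `*` setT) `|` (setT `*` ~` A2))).
  move=> [x y] /= /not_andP[] h; [by left|by right].
apply: negligibleU; apply/negligibleP.
- by apply: measurableX => //; exact: measurableC.
- have := product_measure1E P1 P2 (measurableC m1) measurableT; rewrite /= => ->.
  by rewrite c1 mul0e.
- by apply: measurableX => //; exact: measurableC.
- have := product_measure1E P1 P2 measurableT (measurableC m2); rewrite /= => ->.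
  by rewrite c2 mule0.
Qed.

Lemma real_fubini A1 A2 (F : T1 -> T2 -> R) (B : R) : conc P1 A1 -> conc P2 A2 ->
  measurable_fun setT (fun xy : T1 * T2 => F xy.1 xy.2) ->
  (forall x y, A1 x -> A2 y -> `|F x y| <= B) ->
  \int[(P1 \x P2)%E]_xy F xy.1 xy.2 = \int[P1]_x \int[P2]_y F x y.
Proof.
move=> c1 c2 mF HB.
have intF : (P1 \x P2)%E.-integrable setT (EFin \o (fun xy : T1 * T2 => F xy.1 xy.2)).
  by apply: (conc_integrable (conc_prod c1 c2) mF (B := B)) => -[x y] /= [xA yA]; exact: HB.
rewrite /Rintegral; congr fine; rewrite -integral12_prod_meas1//.
have mG := measurable_fubini_F intF.
apply: ae_eq_integral => //.
- by apply/measurable_EFinP; apply: (measurableT_comp _ mG); exact: fine_measurable.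
exists (~` A1); case: (c1) => mA1 cA1; split=> //; first exact: measurableC.
move=> x /= H Ax; apply: H => _.
have mFx : measurable_fun setT (F x) by exact: (measurableT_comp mF (measurable_pair1 x)).
by rewrite /fubini_F fineK//; apply: integrable_fin_num => //; apply: (conc_integrable c2 mFx) => y; exact: HB.
Qed.

End RealFubini.

Section Push.
Context {d : measure_display} {T : measurableType d} {R : realType} {N : nat}.
Variable P : probability T R.

Lemma push_exists (g : T -> RN R N) : measurable_fun setT g -> exists Q : probability (RN R N) R,
  (forall A, Q A = P (g @^-1` A)) /\
  forall f : RN R N -> R, measurable_fun setT f -> P.-integrable setT (EFin \o (f \o g)) ->
    \int[Q]_z f z = \int[P]_t f (g t).
Proof.
move=> mg; pose X : {mfun T >-> RN R N} := HB.pack g (isMeasurableFun.Build _ _ _ _ g mg).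
exists (distribution P X); split=> // f mf intf.
rewrite /Rintegral integral_distribution//; exact/measurable_EFinP.
Qed.

End Push.

(** * Moments of linear forms on spheres *)

Section SphereMoments.
Variable R : realType.

                                                                                    
Definition bc (M : R) n : R := \prod_(j < n) (2 * j.+1%:R * (M + 2 * j%:R))^-1.

Lemma bc0 M : bc M 0 = 1.
Proof. by rewrite /bc big_ord0. Qed.

Lemma bcS M n : bc M n.+1 = bc M n * (2 * n.+1%:R * (M + 2 * n%:R))^-1.
Proof. by rewrite /bc big_ord_recr. Qed.

Lemma bco_nil N k n : bco ([::] : seq 'rV[R]_N) k n = bc N%:R n.
Proof. by rewrite /bco /bc; apply: eq_bigr => j _; rewrite cc_nil. Qed.

Definition wr c a b : R := W R a (b + c) / W R 0 c.

Lemma wr_recl c a b : (a + b + c + 2)%:R * wr c a.+2 b = a.+1%:R * wr c a b.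
Proof. by rewrite /wr !mulrA -W_recl addnA. Qed.

Lemma wr_recr c a b : (a + b + c + 2)%:R * wr c a b.+2 = (b + c).+1%:R * wr c a b.
Proof. by rewrite /wr !mulrA -W_recr addnA. Qed.

Lemma wr00 c : wr c 0 0 = 1.
Proof. by rewrite /wr add0n divff// gt_eqF// W0_gt0. Qed.

Lemma wr_odd c a b : odd a -> wr c a b = 0.
Proof. by move=> oa; rewrite /wr W_odd// mul0r. Qed.

(** Normalized Wallis ratios link the Pizzetti coefficients of dimensions c+1 and c+2; the binomial
    coefficient is what the expansion of (v0^2 + s)^(i+j) needs. *)
Lemma wr_bc c i j : wr c i.*2 j.*2 * bc c.+1%:R j = (i.*2)`!%:R * bc c.+2%:R (i + j) * 'C(i + j, i)%:R.
Proof.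
have nz n : n.+1%:R != 0 :> R by rewrite pnatr_eq0.
have dbl n : n.*2%:R = 2 * n%:R :> R by rewrite -mul2n natrM.
elim: j => [|j IHj].
  rewrite addn0 binn mulr1 bc0 mulr1.
  elim: i => [|i IHi]; first by rewrite wr00 fact0 bc0 mulr1.
  have := wr_recl c i.*2 0; rewrite addn0 -doubleS IHi !doubleS !factS !natrM bcS.
  have -> : (i.*2.+2%:R : R) = 2 * i.+1%:R by rewrite -doubleS dbl.
  have -> : ((i.*2 + c + 2)%:R : R) = c.+2%:R + 2 * i%:R by rewrite !natrD dbl -!natr1; ring.
  have h1 : c.+2%:R + 2 * i%:R != 0 :> R by rewrite gt_eqF// ltr_pwDl// mulr_ge0.
  move=> E; apply: (mulfI h1); rewrite E; have h2 := nz i.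
  by move: h1 h2; move: (c.+2%:R) (i.+1%:R) (i%:R) (bc _ _) (_`!%:R) (i.*2.+1%:R) => C i1 i0 b f g h1 h2; field; rewrite h1 h2.
have E := wr_recr c i.*2 j.*2.
have h1 : c.+2%:R + 2 * (i + j)%:R != 0 :> R by rewrite gt_eqF// ltr_pwDl// mulr_ge0.
have e1 : ((i.*2 + j.*2 + c + 2)%:R : R) = c.+2%:R + 2 * (i + j)%:R.
  by rewrite !natrD !dbl -!natr1; ring.
have e2 : ((j.*2 + c).+1%:R : R) = c.+1%:R + 2 * j%:R by rewrite -addnS natrD dbl addrC.
have B : (j.+1%:R * 'C(i + j.+1, i)%:R : R) = (i + j).+1%:R * 'C(i + j, i)%:R.
  have := mul_bin_down (i + j).+1 i; rewrite /= addnS subSn ?leq_addr// addKn => H.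
  by rewrite -!natrM; congr (_%:R); rewrite H.
rewrite doubleS bcS addnS bcS; rewrite e1 e2 in E.
have h2 : c.+1%:R + 2 * j%:R != 0 :> R by rewrite gt_eqF// ltr_pwDl// mulr_ge0.
have h3 := nz j; have h4 := nz (i + j)%N.
have -> : ('C((i + j).+1, i)%:R : R) = (i + j).+1%:R * 'C(i + j, i)%:R / j.+1%:R.
  by rewrite -B addnS mulrC mulKf.
have -> : wr c i.*2 j.*2.+2 = (c.+1%:R + 2 * j%:R) * wr c i.*2 j.*2 / (c.+2%:R + 2 * (i + j)%:R).
  by rewrite -E mulrC mulKf.
have -> : (c.+1%:R + 2 * j%:R) * wr c i.*2 j.*2 / (c.+2%:R + 2 * (i + j)%:R) *
  (bc c.+1%:R j * (2 * j.+1%:R * (c.+1%:R + 2 * j%:R))^-1) =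
  (wr c i.*2 j.*2 * bc c.+1%:R j) / (2 * j.+1%:R * (c.+2%:R + 2 * (i + j)%:R)).
  move: h1 h2 h3; move: (c.+1%:R + 2 * j%:R) (c.+2%:R + _) (j.+1%:R) => x1 x2 x3 h1 h2 h3.
  by field; rewrite h1 h2 h3.
rewrite IHj; move: h1 h3 h4; move: (c.+2%:R + _) (j.+1%:R) ((i + j).+1%:R) => x1 x2 x3 h1 h3 h4.
by field; rewrite h1 h3 h4.
Qed.

Lemma sum_even n (F : nat -> R) : (forall j, odd j -> F j = 0) ->
  \sum_(j < n.*2.+1) F j = \sum_(q < n.+1) F q.*2.
Proof.
move=> F0; elim: n => [|n IH]; first by rewrite !big_ord1.
rewrite doubleS big_ord_recr big_ord_recr/= IH [in RHS]big_ord_recr/=.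
by rewrite F0 /= ?addr0// odd_double.
Qed.

(** The n-th moment of <u,v> for u uniform on the unit sphere of R^M and |v|^2 = s. *)
Definition mom (M : R) (s : R) n : R := n`!%:R * (if odd n then 0 else bc M n./2 * s ^+ n./2).

(** Expanding (cos t v0 + sin t <u,w>)^n and averaging over angle and lower sphere: only even powers
    remain, and [wr_bc] turns the sum into the binomial formula for (v0^2 + s)^(n/2). *)
Lemma mom_step c n (v0 s : R) :
  \sum_(j < n.+1) 'C(n, j)%:R * v0 ^+ (n - j) * mom c.+1%:R s j * wr c (n - j) j =
  mom c.+2%:R (v0 ^+ 2 + s) n.
Proof.
rewrite {2}/mom; case: ifPn => on.
  rewrite mulr0 big1// => j _; case oj : (odd j); first by rewrite /mom oj !mulr0 mul0r.
  by rewrite wr_odd ?mulr0// oddB ?on ?oj// -ltnS.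
rewrite -[n]odd_double_half (negbTE on) add0n; move: (n./2) => m; rewrite doubleK.
rewrite (@sum_even m (fun j => 'C(m.*2, j)%:R * v0 ^+ (m.*2 - j) * mom c.+1%:R s j * wr c (m.*2 - j) j)); last first.
  by move=> j oj; rewrite /mom oj mulr0 mulr0 mul0r.
rewrite exprDn !mulr_sumr; apply: eq_bigr => q _.
have qm : (q <= m)%N by rewrite -ltnS.
rewrite /mom odd_double doubleK -doubleB.
have := wr_bc c (m - q) q; rewrite subnK// => E.
have -> : 'C(m.*2, q.*2)%:R * v0 ^+ (m - q).*2 * ((q.*2)`!%:R * (bc c.+1%:R q * s ^+ q)) * wr c (m - q).*2 q.*2 =
  ('C(m.*2, q.*2)%:R * (q.*2)`!%:R) * v0 ^+ (m - q).*2 * s ^+ q * (wr c (m - q).*2 q.*2 * bc c.+1%:R q) by ring.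
rewrite E.
have F : ('C(m.*2, q.*2)%:R * (q.*2)`!%:R * ((m - q).*2)`!%:R = (m.*2)`!%:R :> R).
  by rewrite -!natrM; congr (_%:R); rewrite -mulnA doubleB bin_fact// leq_double.
rewrite -F bin_sub// -[_ *+ 'C(m, q)]mulr_natr -exprM mul2n.
by ring.
Qed.

End SphereMoments.

(** * Characterization of the uniform measure on the sphere *)

Section SphereMeasure.
Variable R : realType.

Definition sphere N : set 'rV[R]_N := [set u | dotv u u = 1].

(** Uniformity expressed by the moments of linear forms, which is what the induction on dimension
    propagates; rotation invariance is recovered from [is_sphere_mean] and [Pk0_orth]. *)
Definition is_sphere N (sg : probability (RN R N) R) :=
  conc sg (@sphere N : set (RN R N)) /\
  forall v n, \int[sg]_u (dotv u v ^+ n) = mom N%:R (dotv v v) n.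

Lemma closed_sphere N : closed (@sphere N).
Proof.
have := @preimage_closed _ _ (fun x : 'rV[R]_N => dotv x x) [set 1].
apply; [move=> x _; apply: polyfun_continuous; exact: polyfun_dotvv|exact: closed_eq].
Qed.

Lemma sphere_integrable N (sg : probability (RN R N) R) p : conc sg (@sphere N : set (RN R N)) -> polyfun p ->
  sg.-integrable setT (EFin \o (p : RN R N -> R)).
Proof.
move=> cs pp; have [B B0 HB] := ball_bounded 1 (polyfun_continuous pp).
apply: (conc_integrable cs (RN_continuous (polyfun_continuous pp)) (B := B)) => u u1.
by apply: HB; rewrite u1 expr1n.
Qed.

Lemma sphere_linear N (sg : probability (RN R N) R) p q (c : R) : conc sg (@sphere N : set (RN R N)) ->
  polyfun p -> polyfun q -> \int[sg]_u (p u + c * q u) = \int[sg]_u p u + c * \int[sg]_u q u.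
Proof.
move=> cs pp pq; rewrite RintegralD//; last 2 first.
- exact: sphere_integrable.
- by apply: (sphere_integrable cs (p := fun u => c * q u)); exact: polyfunZ.
by rewrite RintegralZl//; exact: sphere_integrable.
Qed.

(** The integral over the sphere and the algebraic mean agree on powers of linear forms, hence on
    all polynomials by [ridge_determinacy]. *)
Lemma is_sphere_mean N k (sg : probability (RN R N) R) p (r : R) : is_sphere sg -> polyfun p ->
  \int[sg]_u p (r *: u) = (Pk0 k p).[r].
Proof.
move=> [cs ms] pp; have hV0 := intertwiner_nil k.
have key q : polyfun q -> \int[sg]_u q u = (Pk0 k q).[1].
  move=> pq; apply/eqP; rewrite -subr_eq0; apply/eqP.
  apply: (ridge_determinacy (L := fun q => \int[sg]_u q u - (Pk0 k q).[1])) pq => [p1 p2 c pp1 pp2|v n].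
    rewrite sphere_linear// /Pk0 (PkD hV0)//; last exact: polyfunZ.
    by rewrite (PkZ hV0)// hornerD hornerZ; ring.
  have := Pk_Wkr (@root_system_nil R N) (@positive_nil R N) (multiplicity_nil k) hV0 n v.
  rewrite /Wk /= ms /Pk0 /mom.
  rewrite (_ : (fun x => dotv x v ^+ n) = (fun y => dotv v y ^+ n)); last by apply/funext => x; rewrite dotvC.
  move=> ->; rewrite hornerZ hornerXn expr1n mulr1 bco_nil.
  by case: ifP => _; rewrite ?mulr0 ?subrr//; ring.
rewrite (key (fun u => p (r *: u))); last first.
  by apply: polyfun_ext (polyfun_affine r 0 pp) => u; rewrite addr0.
by rewrite /Pk0 (Pk_comp_scale hV0)// horner_comp hornerZ hornerX mulr1.
Qed.

End SphereMeasure.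

(** * Construction of the uniform measure by induction on the dimension *)

Section SphereExists.
Variable R : realType.

Lemma bernoulli_half (f : bool -> R) : \int[bernoulli_prob (2^-1 : R)]_b f b = (f true + f false) / 2.
Proof.
have lr (I a b c : R) : 2^-1 * (a + c) + (1 - 2^-1) * (b + c) = I + c -> I = (a + b) / 2 by lra.
have mf (g : bool -> R) : measurable_fun setT g by [].
(* The shift by [c] makes the integrand nonnegative, as the Bernoulli integral formula requires; it
   is subtracted again at the end. *)
pose c := `|f true| + `|f false|.
have fc b : 0 <= f b + c.
  have h1 := normr_ge0 (f true); have h2 := normr_ge0 (f false); rewrite /c.
  have h3 := ler_norm (- f true); have h4 := ler_norm (- f false); rewrite !normrN in h3 h4.
  by case: b; lra.
have int (g : bool -> R) : (bernoulli_prob (2^-1 : R)).-integrable setT (EFin \o g).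
  apply: (@conc_integrable _ _ _ (bernoulli_prob (2^-1 : R)) setT (concT _) g (`|g true| + `|g false|)) => // b _.
  by case: b; rewrite ?lerDl ?lerDr.
have p01 : 0 <= (2^-1 : R) <= 1 by apply/andP; split; lra.
have := @integral_bernoulli_prob R (2^-1) p01 (fun b => (f b + c)%:E).
have fc' b : (0 <= (f b + c)%:E)%E by rewrite lee_fin.
move=> /(_ fc') H.
have E : \int[bernoulli_prob (2^-1 : R)]_b (f b + c) = 2^-1 * (f true + c) + (1 - 2^-1) * (f false + c).
  by rewrite /Rintegral H.
have E2 : \int[bernoulli_prob (2^-1 : R)]_b (f b + c) = \int[bernoulli_prob (2^-1 : R)]_b f b + c.
  rewrite RintegralD// ?(int (fun => c))//.
  by rewrite Rintegral_cst//= probability_setT /= mulr1.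
by apply: (lr _ _ _ c); rewrite -E.
Qed.

Lemma bc1_fact m : bc (1 : R) m * (m.*2)`!%:R = 1.
Proof.
elim: m => [|m IH]; first by rewrite bc0 mul1r.
rewrite bcS doubleS !factS !natrM -!muln2.
have h1 : (2 * m.+1%:R : R) != 0 by rewrite mulf_neq0// pnatr_eq0.
have e1 : ((m * 2).+2%:R : R) = 2 * m.+1%:R by rewrite -!natr1 natrM; ring.
have e2 : ((m * 2).+1%:R : R) = 1 + 2 * m%:R by rewrite -!natr1 natrM; ring.
have h2 : (1 + 2 * m%:R : R) != 0 by rewrite -e2 pnatr_eq0.
rewrite -muln2 in IH; rewrite e1 e2 -[RHS]IH.
by move: h1 h2; move: (2 * m.+1%:R) (1 + _) => a b h1 h2; field; rewrite h1 h2.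
Qed.

Lemma RN_closed N (A : set 'rV[R]_N) : closed A -> measurable (A : set (RN R N)).
Proof. by move=> cA; rewrite -[A]setCK; apply: measurableC; apply: RN_open; exact: closed_openC. Qed.

Lemma sphere1 : exists sg : probability (RN R 1) R, is_sphere sg.
Proof.
pose g (b : bool) : RN R 1 := (if b then const_mx 1 else const_mx (-1) : 'rV[R]_1).
have mg : measurable_fun setT g by [].
have [Q [QA Qf]] := push_exists (bernoulli_prob (2^-1 : R)) mg.
have dg b v : dotv (g b : 'rV[R]_1) v = (if b then 1 else -1) * v ord0 ord0.
  by rewrite dotvE big_ord1 /g; case: b; rewrite mxE.
have cQ : conc Q (@sphere R 1 : set (RN R 1)).
  split; first exact: (RN_closed (@closed_sphere R 1)).
  rewrite QA (_ : _ @^-1` _ = set0) ?measure0// -subset0 => b /=; apply.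
  by rewrite /sphere /= (dg b (g b)) /g; case: b; rewrite mxE ?mulr1 ?mulrNN ?mulr1.
exists Q; split=> // v n.
rewrite Qf; last 2 first.
- exact: RN_continuous (polyfun_continuous (polyfunX n (polyfun_dotv v))).
- apply: (@conc_integrable _ _ _ _ setT (concT _) _ (`|v ord0 ord0| ^+ n)) => // b _.
  by rewrite /= normrX dg normrM; case: b; rewrite ?normrN normr1 mul1r.
rewrite (bernoulli_half (fun b => dotv (g b : 'rV[R]_1) v ^+ n)) !dg dotvE big_ord1 mul1r mulN1r -expr2.
rewrite /mom; case: ifPn => on.
  by rewrite exprNn -signr_odd on /= expr1 mulN1r subrr mul0r mulr0.
rewrite exprNn -signr_odd (negbTE on) /= expr0 mul1r.
rewrite -[n in n`!]odd_double_half (negbTE on) add0n mulrA [_%:R * _]mulrC bc1_fact mul1r -exprM mul2n.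
have -> : n./2.*2 = n by rewrite -[RHS]odd_double_half (negbTE on).
by rewrite -mulr2n -[_ *+ 2]mulr_natr mulfK// pnatr_eq0.
Qed.

Lemma J_sum n (F : nat -> R -> R) : (forall j, continuous (F j)) ->
  continuous (fun t => \sum_(j < n) F j t) /\ J (fun t => \sum_(j < n) F j t) = \sum_(j < n) J (F j).
Proof.
move=> cF; elim: n => [|n [cS IH]].
  have E : (fun t : R => \sum_(j < 0) F j t) = (fun=> 0) by apply/funext => t; rewrite big_ord0.
  rewrite E big_ord0; split; first exact: cst_continuous.
  by have := JZ 0 (@cst_continuous R R 0); rewrite !mul0r => ->.
have E : (fun t : R => \sum_(j < n.+1) F j t) = (fun t => \sum_(j < n) F j t + F n t).
  by apply/funext => t; rewrite big_ord_recr.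
rewrite E big_ord_recr /= -IH; split; last exact: JD.
by move=> t; apply: cvgD; [exact: cS|exact: cF].
Qed.

Lemma dotv_row_mx n (a : R) (u : 'rV[R]_n) (v : 'rV[R]_(1 + n)) :
  dotv (row_mx a%:M u) v = a * v ord0 (lshift n ord0) + dotv u (rsubmx v).
Proof.
rewrite dotvE big_split_ord big_ord1 /= row_mxEl mxE eqxx mulr1n; congr (_ + _).
by rewrite dotvE; apply: eq_bigr => i _; rewrite row_mxEr mxE.
Qed.

Lemma dotv_split n (v : 'rV[R]_(1 + n)) :
  dotv v v = v ord0 (lshift n ord0) ^+ 2 + dotv (rsubmx v) (rsubmx v).
Proof.
rewrite dotvE big_split_ord big_ord1 /= -expr2; congr (_ + _).
by rewrite dotvE; apply: eq_bigr => i _; rewrite !mxE.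
Qed.

Lemma sphere_angle_integral N (sg : probability (RN R N) R) n (a b : R) w : is_sphere sg ->
  \int[sg]_u (a + b * dotv u w) ^+ n =
  \sum_(j < n.+1) 'C(n, j)%:R * a ^+ (n - j) * b ^+ j * mom N%:R (dotv w w) j.
Proof.
move=> [cs ms]; have lL := linop_cst (fun p q c => sphere_linear (p := p) (q := q) c cs).
have pw j : polyfun (fun u : 'rV[R]_N => dotv u w ^+ j) by apply: polyfunX; exact: polyfun_dotv.
pose F (j : 'I_n.+1) (u : 'rV[R]_N) := 'C(n, j)%:R * a ^+ (n - j) * b ^+ j * dotv u w ^+ j.
have pF j : polyfun (F j) by apply: polyfunZ.
have E := @linop_sum R N _ _ (index_enum 'I_n.+1) F 0 lL pF.
rewrite [LHS](_ : _ = \int[sg]_u \sum_(j < n.+1) F j u); last first.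
  apply: eq_Rintegral => u _; rewrite exprDn; apply: eq_bigr => j _.
  by rewrite /F exprMn -[_ *+ 'C(n, j)]mulr_natr; ring.
rewrite {}E; apply: eq_bigr => j _.
by rewrite -ms; exact: (linopZ (A := fun p _ => \int[sg]_u p u) _ 0 lL (pw j)).
Qed.

(** Polar coordinates (t,u) to (cos t, sin t u), which build the next sphere from an angle and a
    point of the previous one. *)
Definition polar_map N (t : measurableTypeR R * RN R N) : RN R (1 + N) :=
  row_mx (cos t.1)%:M (sin t.1 *: (t.2 : 'rV[R]_N)).

Lemma polar_map_measurable N : measurable_fun setT (@polar_map N).
Proof.
apply: RN_measurable_map => i; rewrite /polar_map.
have mc : measurable_fun setT (fun t : measurableTypeR R * RN R N => cos t.1 : R).
  by apply: (measurableT_comp _ measurable_fst); apply: continuous_measurable_fun; exact: continuous_cos.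
have ms : measurable_fun setT (fun t : measurableTypeR R * RN R N => sin t.1 : R).
  by apply: (measurableT_comp _ measurable_fst); apply: continuous_measurable_fun; exact: continuous_sin.
rewrite -[i]splitK; case: (fintype.split i) => j /=.
  rewrite (_ : (fun t => _) = (fun t : measurableTypeR R * RN R N => cos t.1)) //.
  by apply/funext => t; rewrite row_mxEl [j]ord1 mxE eqxx mulr1n.
rewrite (_ : (fun t => _) = (fun t : measurableTypeR R * RN R N => sin t.1 * (t.2 : 'rV[R]_N) ord0 j)).
  apply: measurable_funM => //; 
  have mj := RN_continuous (polyfun_continuous (@polyfun_coord R N j)).
  exact: (measurableT_comp mj measurable_snd).
by apply/funext => t; rewrite row_mxEr mxE.
Qed.

Lemma dotv_polar_map N t v : dotv (@polar_map N t : 'rV[R]_(1 + N)) v =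
  cos t.1 * v ord0 (lshift N ord0) + sin t.1 * dotv (t.2 : 'rV[R]_N) (rsubmx v).
Proof. by rewrite dotv_row_mx dotvZl. Qed.

Lemma polar_map_sphere N t : sphere (t.2 : 'rV[R]_N) -> sphere (@polar_map N t : 'rV[R]_(1 + N)).
Proof.
rewrite /sphere /= dotv_polar_map /polar_map row_mxEl mxE eqxx mulr1n row_mxKr dotvZr => ->.
by rewrite mulr1 -!expr2 cos2Dsin2.
Qed.

(** Image of the product of the angle law and the lower sphere under polar coordinates. Fubini and
    the Wallis integrals reduce its moments to [mom_step]. *)
Lemma sphereS c (sg : probability (RN R c.+1) R) : is_sphere sg ->
  exists sg' : probability (RN R (1 + c.+1)) R, is_sphere sg'.
Proof.
move=> hs; have [cs ms] := hs; pose P := (ang c \x sg)%E.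
have cP : conc P (setT `*` (@sphere R c.+1 : set (RN R c.+1))) by apply: conc_prod => //; exact: concT.
have [Q [QA Qf]] := push_exists P (@polar_map_measurable c.+1).
have mS : measurable (@sphere R (1 + c.+1) : set (RN R (1 + c.+1))).
  exact: (RN_closed (@closed_sphere R _)).
exists Q; split.
  split=> //; rewrite QA; apply/eqP; rewrite -measure_le0; have [mS2 <-] := cP.
  apply: le_measure; rewrite ?inE.
  - by rewrite -[X in measurable X]setTI; apply: (@polar_map_measurable c.+1) => //; exact: measurableC.
  - exact: measurableC.
  - by move=> t /= nt [_ ts]; apply: nt; exact: polar_map_sphere.
move=> v n; set v0 := v ord0 (lshift c.+1 ord0); set w : 'rV[R]_c.+1 := rsubmx v.
have [B B0 HB] := ball_bounded 1 (polyfun_continuous (polyfun_dotv w)).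
have HB' t u : sphere u -> `|(cos t * v0 + sin t * dotv u w) ^+ n| <= (`|v0| + B) ^+ n.
  move=> su; rewrite normrX lerXn2r ?nnegrE ?addr_ge0//.
  apply: le_trans (ler_normD _ _) _; rewrite !normrM; apply: lerD.
    by rewrite ler_piMl// cos_max.
  apply: le_trans (HB u _); last by rewrite su expr1n.
  by rewrite ler_piMl// sin_max.
have pz : polyfun (fun z : 'rV[R]_(1 + c.+1) => dotv z v ^+ n) by apply: polyfunX; exact: polyfun_dotv.
have mz := RN_continuous (polyfun_continuous pz).
rewrite Qf//; last first.
  apply: (conc_integrable cP _ (B := (`|v0| + B) ^+ n)).
    exact: (measurableT_comp mz (@polar_map_measurable c.+1)).
  by move=> [t u] /= [_ su]; rewrite dotv_polar_map; exact: HB'.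
have := @real_fubini _ _ _ _ _ (ang c) sg setT _ (fun t u => dotv (polar_map (t, u) : 'rV[R]_(1 + c.+1)) v ^+ n) ((`|v0| + B) ^+ n) (concT _) cs.
move=> H; rewrite [LHS](_ : _ = \int[P]_xy dotv (polar_map (xy.1, xy.2) : 'rV[R]_(1 + c.+1)) v ^+ n); last first.
  by apply: eq_Rintegral => -[].
rewrite H; last 2 first.
- rewrite (_ : (fun xy => _) = (fun xy => dotv (@polar_map c.+1 xy : 'rV[R]_(1 + c.+1)) v ^+ n)); last by apply/funext => -[].
  exact: (measurableT_comp mz (@polar_map_measurable c.+1)).
- by move=> t u _ su; rewrite dotv_polar_map; exact: HB'.
pose cf j := 'C(n, j)%:R * v0 ^+ (n - j) * mom c.+1%:R (dotv w w) j.
pose G j (t : R) := cf j * (cos t ^+ (n - j) * sin t ^+ j).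
rewrite (_ : \int[ang c]_x _ = \int[ang c]_t \sum_(j < n.+1) G j t); last first.
  apply: eq_Rintegral => t _; rewrite -/w.
  under eq_Rintegral do rewrite dotv_polar_map -/v0 -/w /=.
  rewrite sphere_angle_integral//; apply: eq_bigr => j _; rewrite /G /cf exprMn; ring.
have cG j : continuous (G j) by move=> t; apply: cvgMr; exact: continuous_trig.
have [cS _] := J_sum n.+1 cG.
rewrite (integral_ang c (B := \sum_(j < n.+1) `|cf j|) cS); last first.
  move=> t; apply: le_trans (ler_norm_sum _ _ _) _; apply: ler_sum => j _; rewrite normrM.
  by rewrite ler_piMr// normrM !normrX mulr_ile1 ?exprn_ge0// exprn_ile1 ?cos_max ?sin_max.
rewrite (_ : (fun t => _) = (fun t => \sum_(j < n.+1) cf j * (cos t ^+ (n - j) * sin t ^+ (j + c)))); last first.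
  apply/funext => t; rewrite mulr_suml; apply: eq_bigr => j _; rewrite /G exprD expr0 mul1r; ring.
have cG' j : continuous (fun t : R => cf j * (cos t ^+ (n - j) * sin t ^+ (j + c))).
  by move=> t; apply: cvgMr; exact: continuous_trig.
have [_ ->] := J_sum n.+1 cG'.
rewrite dotv_split -/v0 -/w -mom_step mulr_suml; apply: eq_bigr => j _.
by rewrite JZ; [rewrite -mulrA|exact: continuous_trig].
Qed.

Theorem sphere_exists N : (0 < N)%N -> exists sg : probability (RN R N) R, is_sphere sg.
Proof.
case: N => // N _; elim: N => [|N [sg hs]]; first exact: sphere1.
exact: sphereS hs.
Qed.

End SphereExists.

                                    

(** * Measures on a ball are determined by polynomial integrals *)

Section MomentDeterminacy.
Variables (R : realType) (N : nat).
Local Notation vec := 'rV[R]_N.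
Local Notation RN := (RN R N).

Lemma conc_dist (P : probability RN R) (A : set RN) (f g : vec -> R) (eps C : R) : conc P A ->
  continuous f -> continuous g -> (forall x, A x -> `|g x| <= C) ->
  (forall x, A x -> `|f x - g x| <= eps) ->
  `|\int[P]_x f x - \int[P]_x g x| <= eps.
Proof.
move=> cA cf cg HC He.
have mf := RN_continuous cf; have mg := RN_continuous cg.
have ig : P.-integrable setT (EFin \o (g : RN -> R)) by exact: conc_integrable HC.
have if_ : P.-integrable setT (EFin \o (f : RN -> R)).
  apply: (conc_integrable cA mf (B := eps + C)) => x Ax.
  by rewrite -[f x](subrK (g x)); apply: le_trans (ler_normD _ _) _; rewrite lerD ?He ?HC.
rewrite -RintegralB//; apply: (conc_bound cA _ He).
by apply: measurable_funB.
Qed.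

Lemma moments_continuous (P1 P2 : probability RN R) r : conc P1 (cball r : set RN) -> conc P2 (cball r : set RN) ->
  (forall p : vec -> R, polyfun p -> \int[P1]_x p x = \int[P2]_x p x) ->
  forall f : vec -> R, continuous f -> \int[P1]_x f x = \int[P2]_x f x.
Proof.
move=> c1 c2 H f cf; apply: limit_unique_eps => eps e0.
have [p pp Hp] := weierstrass r cf (divr_gt0 e0 (ltr0n R 2)).
have cp := polyfun_continuous pp.
have [C C0 HC] := ball_bounded r cf.
have h1 := conc_dist c1 cp cf HC Hp; have h2 := conc_dist c2 cp cf HC Hp.
rewrite -[X in `|X|](subrKA (\int[P1]_x p x)).
apply: le_trans (ler_normD _ _) _; rewrite [eps]splitr; apply: lerD; first by rewrite distrC.
by rewrite H.
Qed.

(** A generating class stable under finite intersection (via the minimum of two functions), whose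
    indicators are limits of min(1, n max(0,f)). *)
Definition positivity_sets : set (set vec) := [set U | exists2 f : vec -> R, continuous f & U = [set x | 0 < f x]].

Lemma positivity_open U : positivity_sets U -> open U.
Proof.
move=> [f cf ->]; rewrite (_ : mkset _ = f @^-1` `]0, +oo[); last first.
  by apply/seteqP; split=> x; rewrite /= in_itv /= andbT.
by move/continuousP : cf; apply; exact: interval_open.
Qed.

Lemma positivity_setI : setI_closed positivity_sets.
Proof.
move=> _ _ [f cf ->] [g cg ->]; exists (fun x => Num.min (f x) (g x)).
  by move=> x; apply: continuous_min; [exact: cf|exact: cg].
by apply/seteqP; split=> x /=; rewrite lt_min => /andP.
Qed.

Lemma continuous_max0 (T : topologicalType) (f : T -> R) : continuous f -> continuous (fun x => Num.max 0 (f x)).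
Proof. by move=> cf x; exact: (@continuous_max R T (fun=> 0) f x (@cst_continuous T R 0 x) (cf x)). Qed.

Lemma continuous_min1 (T : topologicalType) (f : T -> R) : continuous f -> continuous (fun x => Num.min 1 (f x)).
Proof. by move=> cf x; exact: (@continuous_min R T (fun=> 1) f x (@cst_continuous T R 1 x) (cf x)). Qed.

Lemma continuous_scale_max0 (c : R) : continuous (fun t : R => c * Num.max 0 t).
Proof.
have h : continuous (fun t : R => Num.max 0 t) by apply: continuous_max0 => t; exact: cvg_id.
by move=> t; apply: cvgMr; exact: h.
Qed.

Lemma continuous_tent (c d : R) : continuous (fun t : R => Num.max 0 (c - `|t - d|)).
Proof.
apply: continuous_max0 => t; apply: cvgB; first exact: cst_continuous.
by apply: cvg_norm; apply: cvgB; [exact: cvg_id|exact: cst_continuous].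
Qed.

Lemma continuous_prod (T : topologicalType) (I : Type) (l : seq I) (F : I -> T -> R) :
  (forall i, continuous (F i)) -> continuous (fun z => \prod_(i <- l) F i z).
Proof.
move=> cF; elim: l => [|a l IH].
  by rewrite (_ : (fun z => _) = (fun=> 1)); [exact: cst_continuous|apply/funext => z; rewrite big_nil].
rewrite (_ : (fun z => _) = (fun z => F a z * \prod_(i <- l) F i z)).
  by move=> z; apply: cvgM; [exact: cF|exact: IH].
by apply/funext => z; rewrite big_cons.
Qed.

Lemma positivity_generates : @measurable _ RN = <<s positivity_sets >>.
Proof.
apply/seteqP; split; last first.
  apply: smallest_sub; first exact: sigma_algebra_measurable.
  by move=> U /positivity_open; exact: RN_open.
apply: smallest_sub; first exact: smallest_sigma_algebra.
move=> U oU; rewrite (open_qcover oU).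
apply: sigma_algebra_bigcup => n; case: (unpickle n) => [qn|]; last exact: sigma_algebra0.
case: ifP => _; last exact: sigma_algebra0.
apply: sub_sigma_algebra; exists (fun z => \prod_i Num.max 0 (qn.2.+1%:R^-1 - `|z ord0 i - qvec R qn.1 ord0 i|)).
  have cF i : continuous (fun z : vec => Num.max 0 (qn.2.+1%:R^-1 - `|z ord0 i - qvec R qn.1 ord0 i|)).
    move=> z; apply: (@continuous_comp vec R R (fun z : vec => z ord0 i) (fun t => Num.max 0 (qn.2.+1%:R^-1 - `|t - qvec R qn.1 ord0 i|))).
      exact: (polyfun_continuous (@polyfun_coord R N i)).
    exact: continuous_tent.
  exact: continuous_prod.
apply/seteqP; split=> z /= H.
  by apply: prodr_gt0 => i _; rewrite lt_max subr_gt0 H orbT.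
move=> i; rewrite ltNge; apply/negP => h; move: H.
by rewrite (bigD1 i)//= max_l ?mul0r ?ltxx// subr_le0.
Qed.

Lemma positivity_cvg (t : R) : Num.min 1 (n%:R * Num.max 0 t) @[n --> \oo] --> ((0 < t)%R%:R : R).
Proof.
case: (ltP 0 t) => t0; last first.
  rewrite (_ : (fun n : nat => _) = (fun=> 0)); first exact: cvg_cst.
  by apply/funext => n; rewrite mulr0 min_r.
have [n0 Hn] := nat_above t^-1.
apply: cvg_near_cst; exists n0 => // n /= nn.
by rewrite min_l// -ler_pdivrMr// mul1r Hn.
Qed.

(** Weierstrass extends the equality to continuous functions, dominated convergence to the sets {f >
    0}, and uniqueness of measures on an intersection-stable class to all Borel sets. *)
Lemma moment_determinacy (P1 P2 : probability RN R) r : conc P1 (cball r : set RN) -> conc P2 (cball r : set RN) ->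
  (forall p : vec -> R, polyfun p -> \int[P1]_x p x = \int[P2]_x p x) ->
  forall A, measurable A -> P1 A = P2 A.
Proof.
move=> c1 c2 H.
apply: (@measure_unique _ R RN positivity_sets (fun=> setT)).
- exact: positivity_generates.
- exact: positivity_setI.
- move=> _; exists (fun=> 1); first exact: cst_continuous.
  by apply/seteqP; split=> x //= _; exact: ltr01.
- by apply/seteqP; split=> // x _; exists 0%N.
- move=> U pU; have mU := RN_open (positivity_open pU); case: pU => f cf UE.
  pose F (n : nat) (x : vec) : R := Num.min 1 (n%:R * Num.max 0 (f x)).
  have cF n : continuous (F n).
    apply: continuous_min1 => x; apply: (@continuous_comp vec R R f (fun t => n%:R * Num.max 0 t)); first exact: cf.
    exact: continuous_scale_max0.
  have F01 n x : 0 <= F n x <= 1.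
    by rewrite /F le_min ler01 mulr_ge0 ?le_max ?lexx// ge_min lexx.
  have lim (P : probability RN R) : (\int[P]_x F n x)%:E @[n --> \oo] --> P U.
    have iF n : P.-integrable setT (EFin \o (F n : RN -> R)).
      apply: (conc_integrable (concT P) (RN_continuous (cF n)) (B := 1)) => x _.
      by have /andP[h0 h1] := F01 n x; rewrite ger0_norm.
    have E n : (\int[P]_x F n x)%:E = (\int[P]_x (F n x)%:E)%E by rewrite fineK//; exact: integrable_fin_num (iF n).
    under eq_fun do rewrite E.
    have -> : P U = (\int[P]_x (\1_U x)%:E)%E by rewrite integral_indic// setIT.
    apply: (@dominated_cvg _ RN R P setT measurableT (fun n x => (F n x)%:E) (fun x => (\1_U x)%:E) (fun=> 1%:E)).
    - by move=> n; apply/measurable_EFinP; exact: RN_continuous (cF n).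
    - move=> x _; apply: cvg_EFin; first by near=> n.
      have h := @positivity_cvg (f x); rewrite indicE (_ : (x \in U) = (0 < f x)) //.
      by rewrite UE; apply/idP/idP; rewrite ?inE// => ?; exact: mem_set.
    - by [].
    - exact: finite_measure_integrable_cst.
    - move=> n x _; have /andP[h0 h1] := F01 n x.
      by rewrite lee_fin ger0_norm.
  have := lim P1; under eq_fun do rewrite (moments_continuous c1 c2 H (cF _)).
  move=> h; exact: (@cvg_unique _ (@ereal_hausdorff R) _ _ _ _ h (lim P2)).
- by move=> n; apply: (le_lt_trans (probability_le1 P1 measurableT) (ltry _)).
Unshelve. all: by end_near. Qed.

End MomentDeterminacy.

(** * Radial measures: uniqueness and construction *)

Section RadialMeasures.
Variables (R : realType) (N : nat).
Local Notation vec := 'rV[R]_N.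
Local Notation RN := (RN R N).

Lemma polyfun_smooth p : polyfun p -> smooth (p : vec -> R).
Proof. by move=> pp s x; apply: polyfun_differentiable; exact: polyfun_Dseq. Qed.

Lemma polyfun_mom n : polyfun (fun z : vec => mom N%:R (dotv z z) n).
Proof.
rewrite /mom; case: (odd n); first exact: polyfun_cst.
by apply: polyfunZ; apply: polyfunZ; apply: polyfunX; exact: polyfun_dotvv.
Qed.

Lemma radial_measure_integral (rho : probability RN R) (O : 'M[R]_N) (f : vec -> R) (A : set vec) (B : R) :
  radial_measure rho -> orthogonal_mx O -> continuous f -> conc rho (A : set RN) ->
  (forall z, A z -> `|f (z *m O)| <= B) ->
  \int[rho]_z f (z *m O) = \int[rho]_z f z.
Proof.
move=> rr oO cf cA HB.
have cg : continuous (fun z : vec => f (z *m O)).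
  by move=> z; apply: (@continuous_comp vec vec R (fun z => z *m O) f); [exact: continuous_mulmx|exact: cf].
have mg : measurable_fun setT ((fun z : vec => z *m O) : RN -> RN).
  apply: RN_measurable_map => i; apply: (RN_continuous (f := fun z : vec => (z *m O) ord0 i)).
  exact: (polyfun_continuous (polyfun_mulmx O (@polyfun_coord R N i))).
have [Q [QA Qf]] := push_exists rho mg.
rewrite -(Qf f (RN_continuous cf)); last exact: (conc_integrable cA (RN_continuous cg) HB).
rewrite /Rintegral; congr fine; apply: eq_measure_integral => C mC _.
by apply: (etrans (QA C)); exact: rr.
Qed.

Lemma conc_subset (P : probability RN R) (A B : set vec) : closed A -> closed B -> A `<=` B ->
  conc P (A : set RN) -> conc P (B : set RN).
Proof. by move=> cA cB AB cP; apply: supp_conc => //; exact: subset_trans (conc_supp cA cP) AB. Qed.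

Lemma compact_supp_conc (P : probability RN R) : compact (supp P) -> exists r : R, conc P (cball r : set RN).
Proof.
move=> /compact_bounded[M [Mr HM]]; exists (N%:R * (M + 1)).
apply: supp_conc; first exact: closed_cball.
move=> z Pz; apply: dotv_le_norm; apply: HM => //; by rewrite ltrDl.
Qed.

Lemma integral_conc_poly (P : probability RN R) r p : conc P (cball r : set RN) -> polyfun p ->
  P.-integrable setT (EFin \o (p : RN -> R)).
Proof.
move=> cP pp; have [B _ HB] := ball_bounded r (polyfun_continuous pp).
exact: (conc_integrable cP (RN_continuous (polyfun_continuous pp)) HB).
Qed.

Variable sg : probability RN R.
Hypothesis hsg : is_sphere sg.

                                                                                  
(** By invariance the integral of <z,w>^n is the same for all unit w, hence equals its average over
    w in the sphere. Exchanging the two integrals leaves a radial polynomial in z. *)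
Lemma radial_ridge_integral (rho : probability RN R) r (v : vec) n :
  radial_measure rho -> conc rho (cball r : set RN) ->
  \int[rho]_z dotv z v ^+ n = Num.sqrt (dotv v v) ^+ n * \int[rho]_z mom N%:R (dotv z z) n.
Proof.
move=> rr cr; have [cs ms] := hsg.
have pX (w : vec) : polyfun (fun z : vec => dotv z w ^+ n) by apply: polyfunX; exact: polyfun_dotv.
have inv (w w' : vec) : dotv w w = dotv w' w' -> \int[rho]_z dotv z w ^+ n = \int[rho]_z dotv z w' ^+ n.
  move=> /orth_transitive[ O oO ww'].
  have oT := orthogonal_tr oO.
  have [B _ HB] := ball_bounded r (polyfun_continuous (polyfun_mulmx O^T (pX w))).
  rewrite -(radial_measure_integral (f := fun z : vec => dotv z w ^+ n) rr oT (polyfun_continuous (pX w)) cr HB).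
  by apply: eq_Rintegral => z _; rewrite dotv_mulmx trmxK ww'.
have [w w1 vw] : exists2 w : vec, dotv w w = 1 & v = Num.sqrt (dotv v v) *: w.
  have [->|v0] := eqVneq v 0.
    (* For v = 0 some unit vector is still required; one exists because a probability measure sits
       on the sphere. *)
    have [[w w1]|nw] := pselect (exists w : vec, dotv w w = 1).
      by exists w => //; rewrite dotv0l sqrtr0 scale0r.
    have := conc_prob1 cs; rewrite (_ : @sphere R N = set0) ?measure0 => [/eqP|].
      by rewrite eq_sym onee_eq0.
    by rewrite -subset0 => w w1; apply: nw; exists w.
  have d0 := dotv_gt0 v0; exists ((Num.sqrt (dotv v v))^-1 *: v).
    by rewrite dotv_scale2 exprVn sqr_sqrtr ?(ltW d0)// mulVf ?gt_eqF.
  by rewrite scalerA divff ?scale1r// gt_eqF// sqrtr_gt0.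
rewrite [LHS](_ : _ = \int[rho]_z (Num.sqrt (dotv v v) ^+ n * dotv z w ^+ n)); last first.
  by apply: eq_Rintegral => z _; rewrite {1}vw dotvZr exprMn.
rewrite RintegralZl//; last exact: integral_conc_poly cr (pX w).
congr (_ * _).
have lS := linop_cst (fun p q c => sphere_linear (p := p) (q := q) c cs).
have lR : linop (fun (p : vec -> R) (_ : vec) => \int[rho]_z p z).
  apply: linop_cst => p q c pp pq; rewrite RintegralD//; last 2 first.
  - exact: integral_conc_poly cr pp.
  - by apply: (integral_conc_poly (p := fun z => c * q z) cr); exact: polyfunZ.
  by rewrite RintegralZl//; exact: integral_conc_poly cr pq.
have pD : poly2 (fun u z : vec => dotv u z ^+ n) by apply: (poly2X n); exact: poly2_dotv.
have := linop_comm 0 0 lS lR pD => /= E.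
rewrite (_ : \int[rho]_z mom _ _ _ = \int[rho]_z \int[sg]_u dotv u z ^+ n); last first.
  by apply: eq_Rintegral => z _; rewrite ms.
rewrite -E.
pose h (u : vec) := \int[rho]_z dotv u z ^+ n.
have ph : polyfun h by exact: (poly2_left 0 (poly2_linop_right lR pD)).
have hw u : sphere u -> h u = \int[rho]_z dotv z w ^+ n.
  move=> u1; rewrite (inv w u) ?w1 ?u1//.
  by apply: eq_Rintegral => z _; rewrite dotvC.
have [B _ HB] := ball_bounded 1 (polyfun_continuous ph).
have := @conc_dist _ _ sg (@sphere R N) (fun=> \int[rho]_z dotv z w ^+ n) h 0 B cs
  (@cst_continuous vec R _) (polyfun_continuous ph).
rewrite Rintegral_cst//= probability_setT /= mulr1 => H.
apply/eqP; rewrite -subr_eq0 -normr_le0; apply: H => u u1; first by apply: HB; rewrite u1 expr1n.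
by rewrite hw// subrr normr0.
Qed.

Lemma radial_measure_unique (rho1 rho2 : probability RN R) r : radial_measure rho1 -> radial_measure rho2 ->
  conc rho1 (cball r : set RN) -> conc rho2 (cball r : set RN) ->
  (forall f, smooth f -> radial_fun f -> \int[rho1]_z f z = \int[rho2]_z f z) ->
  forall A, measurable A -> rho1 A = rho2 A.
Proof.
move=> r1 r2 c1 c2 H; apply: (moment_determinacy c1 c2) => p pp.
apply/eqP; rewrite -subr_eq0; apply/eqP.
apply: (ridge_determinacy (L := fun p => \int[rho1]_z p z - \int[rho2]_z p z)) pp => [p1 p2 c pp1 pp2|v n].
  have i1 q := @integral_conc_poly rho1 r q c1; have i2 q := @integral_conc_poly rho2 r q c2.
  have pc2 := polyfunZ c pp2.
  rewrite !RintegralD//; [|exact: i2|exact: i2|exact: i1|exact: i1].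
  rewrite !RintegralZl//; [ring|exact: i2|exact: i1].
rewrite (radial_ridge_integral v n r1 c1) (radial_ridge_integral v n r2 c2) H ?subrr//.
  exact: polyfun_smooth (polyfun_mom n).
by move=> O oO z; rewrite dotv_orth.
Qed.

Variables (P : probability RN R) (x y : vec).
Hypothesis cP : conc P (cball (Num.sqrt (dotv x x)) : set RN).
Let M := Num.sqrt (dotv x x) + Num.sqrt (dotv y y).

(** The image of the product measure under (z,u) to L(z) u. The last clause, on the sets that carry
    the image, later yields both the compact support and the shell containing it. *)
Lemma radial_push : exists Q : probability RN R,
  [/\ forall A, Q A = (P \x sg)%E ((fun zu => gt_len x y zu.1 *: zu.2) @^-1` A),
      forall f : vec -> R, continuous f -> \int[Q]_z f z = \int[P]_z \int[sg]_u f (gt_len x y z *: u) &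
      forall A C : set vec, conc P (A : set RN) -> closed C ->
        (forall z u, A z -> sphere u -> C (gt_len x y z *: u)) -> conc Q (C : set RN)].
Proof.
have [cs ms] := hsg.
pose g (t : RN * RN) : RN := gt_len x y t.1 *: (t.2 : vec).
have mg : measurable_fun setT g.
  apply: RN_measurable_map => i.
  rewrite (_ : (fun t => _) = (fun t : RN * RN => gt_len x y t.1 * (t.2 : vec) ord0 i)); last first.
    by apply/funext => t; rewrite mxE.
  apply: measurable_funM.
    exact: (measurableT_comp (RN_continuous (@continuous_gt_len R N x y)) measurable_fst).
  exact: (measurableT_comp (RN_continuous (polyfun_continuous (@polyfun_coord R N i))) measurable_snd).
have [Q [QA Qf]] := push_exists (P \x sg)%E mg.
have x2 : Num.sqrt (dotv x x) ^+ 2 = dotv x x by rewrite sqr_sqrtr ?dotv_ge0.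
have M0 : 0 <= M by rewrite addr_ge0 ?sqrtr_ge0.
have gM (z u : vec) : cball (Num.sqrt (dotv x x)) z -> sphere u -> cball M (gt_len x y z *: u).
  rewrite /cball /sphere /= x2 dotv_scale2 => zx ->; rewrite mulr1 lerXn2r ?nnegrE ?sqrtr_ge0//.
  exact: gt_len_le.
exists Q; split=> //.
  move=> f cf; have [B _ HB] := ball_bounded M cf.
  rewrite (Qf f (RN_continuous cf)); last first.
    apply: (conc_integrable (conc_prod cP cs) (B := B)); first exact: (measurableT_comp (RN_continuous cf) mg).
    by move=> [z u] /= [zx us]; apply: HB; exact: gM.
  pose F (z u : RN) : R := f (gt_len x y z *: (u : vec)).
  apply: (@real_fubini _ _ _ _ _ P sg _ _ F B cP cs).
    exact: (measurableT_comp (RN_continuous cf) mg).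
  by move=> z u zx us; apply: HB; exact: gM.
move=> A C cA clC gC; have mC : measurable (C : set RN) by exact: RN_closed.
split=> //; rewrite QA; apply/eqP; rewrite -measure_le0; have [mS2 <-] := conc_prod cA cs.
apply: le_measure; rewrite ?inE.
- by rewrite -[X in measurable X]setTI; apply: mg => //; exact: measurableC.
- exact: measurableC.
- by move=> t /= nt [ts1 ts2]; apply: nt; exact: gC.
Qed.

Variable k : vec -> R.

(** It suffices to compare polynomial integrals, and there the inner integral is a classical
    spherical mean, which is invariant under orthogonal maps. *)
Lemma radial_push_radial (Q : probability RN R) (r : R) :
  conc Q (cball r : set RN) ->
  (forall f : vec -> R, continuous f -> \int[Q]_z f z = \int[P]_z \int[sg]_u f (gt_len x y z *: u)) ->
  radial_measure Q.
Proof.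
move=> cQ HQ O oO A mA.
have mg : measurable_fun setT ((fun z : vec => z *m O) : RN -> RN).
  apply: RN_measurable_map => i; apply: (RN_continuous (f := fun z : vec => (z *m O) ord0 i)).
  exact: (polyfun_continuous (polyfun_mulmx O (@polyfun_coord R N i))).
have [Q' [QA Qf]] := push_exists Q mg.
have iO z : cball r (z *m O) = cball r z by rewrite /cball /= dotv_orth.
have cQ' : conc Q' (cball r : set RN).
  have [mC c0] := cQ; split=> //; apply: (etrans (QA _)).
  by rewrite (_ : _ @^-1` _ = ~` cball r)//; apply/seteqP; split=> z; rewrite /= iO.
apply: (etrans (esym (QA A))).
apply: (moment_determinacy cQ' cQ) => // p pp.
have pO := polyfun_mulmx O pp.
rewrite (Qf p (RN_continuous (polyfun_continuous pp))); last exact: integral_conc_poly cQ pO.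
rewrite (HQ _ (polyfun_continuous pO)) (HQ _ (polyfun_continuous pp)).
apply: eq_Rintegral => z _.
by rewrite (is_sphere_mean k _ hsg pO) (is_sphere_mean k _ hsg pp) Pk0_orth.
Qed.

Lemma radial_push_value (Q : probability RN R) (f : vec -> R) v :
  (forall f : vec -> R, continuous f -> \int[Q]_z f z = \int[P]_z \int[sg]_u f (gt_len x y z *: u)) ->
  continuous f -> radial_fun f -> dotv v v = 1 ->
  \int[Q]_z f z = \int[P]_z f (gt_len x y z *: v).
Proof.
move=> HQ cf rf v1; have [cs _] := hsg; rewrite HQ//; apply: eq_Rintegral => z _.
move: (gt_len x y z) => a.
have fE u : sphere u -> f (a *: u) = f (a *: v).
  move=> u1; have [ O oO <-] := @orth_transitive R N u v (etrans u1 (esym v1)).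
  by rewrite scalemxAl rf.
have cfa : continuous (fun u : vec => f (a *: u)).
  move=> u; apply: (@continuous_comp vec vec R (fun u => a *: u) f); [exact: scaler_continuous|exact: cf].
have := @conc_dist _ _ sg (@sphere R N) (fun u => f (a *: u)) (fun=> f (a *: v)) 0 `|f (a *: v)| cs cfa
  (@cst_continuous vec R _).
rewrite Rintegral_cst//= probability_setT /= mulr1 => H.
apply/eqP; rewrite -subr_eq0 -normr_le0; apply: H => u u1 //.
by rewrite fE// subrr normr0.
Qed.

End RadialMeasures.

                                             

(** * Orbits of the reflection group and the spherical shell *)

Section ReflectionGroup.
Variables (R : realType) (N : nat).
Local Notation vec := 'rV[R]_N.
Variable Rs : seq vec.
Hypothesis hRs : root_system Rs.

Lemma refl_groupM (g h : 'M[R]_N) : refl_group Rs g -> refl_group Rs h -> refl_group Rs (g *m h).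
Proof. by move=> Gg; elim=> [|a h' aR _ IH]; rewrite ?mulmx1// mulmxA; exact: rg_mul. Qed.

Lemma refl_group_tr (g : 'M[R]_N) : refl_group Rs g -> refl_group Rs g^T.
Proof.
elim=> [|a h aR _ IH]; first by rewrite trmx1; exact: rg_one.
rewrite trmx_mul reflmxT; apply: refl_groupM => //.
by rewrite -[reflmx a]mul1mx; apply: rg_mul => //; exact: rg_one.
Qed.

Lemma refl_group_root (g : 'M[R]_N) a : refl_group Rs g -> a \in Rs -> a *m g \in Rs.
Proof.
move=> Gg aR; elim: Gg => [|b h bR _ IH]; first by rewrite mulmx1.
by rewrite mulmxA; have [_ _ _ + _] := hRs; apply.
Qed.

Lemma refl_group_fix (g : 'M[R]_N) z : (forall a, a \in Rs -> dotv a z = 0) -> refl_group Rs g -> z *m g = z.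
Proof.
move=> za; elim=> [|a h aR _ IH]; first by rewrite mulmx1.
by rewrite mulmxA IH refl_fix// za.
Qed.

(** The difference x g - x h is orthogonal to every root, hence fixed by the group; pairing it with
    itself then gives zero. So x g depends only on how the transpose of g permutes the roots. *)
Lemma refl_group_eq (g h : 'M[R]_N) (x : vec) : refl_group Rs g -> refl_group Rs h ->
  (forall a, a \in Rs -> a *m g^T = a *m h^T) -> x *m g = x *m h.
Proof.
move=> Gg Gh E; apply/eqP; rewrite -subr_eq0 -dotv_eq0; apply/eqP.
set d := _ - _.
have da a : a \in Rs -> dotv a d = 0.
  by move=> aR; rewrite dotvC dotvBl !dotv_mulmx E// subrr.
by rewrite {1}/d dotvBl !dotv_mulmx !(refl_group_fix da) ?subrr//; exact: refl_group_tr.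
Qed.

Lemma orbit_max (x w : vec) : exists2 g, refl_group Rs g &
  forall h, refl_group Rs h -> dotv (x *m h) w <= dotv (x *m g) w.
Proof.
pose m := size Rs.
(* Records the permutation of the roots in a finite type, which reduces the maximum over the group
   to a maximum over finitely many representatives. *)
pose table (g : 'M[R]_N) : {ffun 'I_m -> 'I_m.+1} := [ffun i : 'I_m => inord (index (Rs`_i *m g^T) Rs)].
have tE g h : refl_group Rs g -> refl_group Rs h -> table g = table h -> x *m g = x *m h.
  move=> Gg Gh gh; apply: refl_group_eq => // a aR.
  have im : (index a Rs < m)%N by rewrite index_mem.
  have := congr1 (fun t : {ffun 'I_m -> 'I_m.+1} => nat_of_ord (t (Ordinal im))) gh.
  have gR := refl_group_root (refl_group_tr Gg) aR; have hR := refl_group_root (refl_group_tr Gh) aR.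
  rewrite !ffunE /= nth_index// !inordK ?ltnS ?index_size// => E.
  by rewrite -(nth_index 0 gR) E nth_index.
pose rep t := xget 1%:M [set g | refl_group Rs g /\ table g = t].
have repG t : refl_group Rs (rep t) by rewrite /rep; case: xgetP => [g _ []//|_]; exact: rg_one.
pose F t := dotv (x *m rep t) w.
exists (rep [arg max_(t > table 1%:M) F t]%O) => // h Gh.
case: arg_maxP => // t _ /(_ (table h) isT); apply: le_trans; rewrite /F.
have [G1 G2] : [set g | refl_group Rs g /\ table g = table h] (rep (table h)).
  by apply: (@xgetPex _ 1%:M [set g | refl_group Rs g /\ table g = table h]); exists h.
by rewrite (tE _ _ G1 Gh G2).
Qed.

Lemma enorm_addv (x y : vec) (g : 'M[R]_N) : refl_group Rs g ->
  enorm (x + y *m g) = Num.sqrt (dotv x x + dotv y y + 2 * dotv (x *m g^T) y).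
Proof.
move=> Gg; congr Num.sqrt.
rewrite !(dotvDl, dotvDr) (dotv_orth _ _ (orth_refl_group hRs Gg)) [dotv (y *m g) x]dotvC.
by rewrite dotv_mulmx trmxK; ring.
Qed.

(** The form <z,y> on the hull is bounded by its extreme values on the orbit, attained at x h;
    moving h to the other side by transposition gives the two lengths |x + y g|. *)
Lemma gt_len_hull (x y : vec) : exists g1 g2 : 'M[R]_N, [/\ refl_group Rs g1, refl_group Rs g2 &
  forall z, conv_hull (G_orbit Rs x) z -> enorm (x + y *m g1) <= gt_len x y z <= enorm (x + y *m g2)].
Proof.
have [h1 G1 H1] := orbit_max x (- y); have [h2 G2 H2] := orbit_max x y.
have T1 := refl_group_tr G1; have T2 := refl_group_tr G2.
exists h1^T, h2^T; split=> // z cz; rewrite !enorm_addv// !trmxK /gt_len.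
have B1 : dotv z (- y) <= dotv (x *m h1) (- y).
  by apply: conv_hull_dotv cz => v [g Gg <-]; exact: H1.
have B2 : dotv z y <= dotv (x *m h2) y.
  by apply: conv_hull_dotv cz => v [g Gg <-]; exact: H2.
rewrite !dotvNr lerN2 in B1.
by apply/andP; split; apply: ler_wsqrtr; rewrite lerD2l ler_pM2l.
Qed.

Lemma G_orbit_opp (x y : vec) (g : 'M[R]_N) : refl_group Rs g -> enorm (x + y *m g) <= 0 ->
  G_orbit Rs x = G_orbit Rs (- y).
Proof.
move=> Gg; rewrite /enorm => h; have d0 : dotv (x + y *m g) (x + y *m g) == 0.
  rewrite eq_le dotv_ge0 andbT -sqrtr_eq0 eq_le h sqrtr_ge0 //.
have xy : x = - y *m g by move: d0; rewrite dotv_eq0 addr_eq0 mulNmx => /eqP.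
apply/seteqP; split=> _ [h1 G1 <-].
  by exists (g *m h1); [exact: refl_groupM|rewrite xy mulmxA].
exists (g^T *m h1); first by apply: refl_groupM => //; exact: refl_group_tr.
by rewrite xy mulmxA -[_ *m g *m _]mulmxA (orth_refl_group hRs Gg) mulmx1.
Qed.

Lemma continuous_enorm : continuous (@enorm R N).
Proof.
move=> z; apply: (@continuous_comp vec R R (fun z => dotv z z) Num.sqrt).
  exact: (polyfun_continuous (@polyfun_dotvv R N)).
exact: sqrt_continuous.
Qed.

Lemma closed_shell (a b : R) (F : vec -> R) : continuous F -> closed [set z | a <= F z <= b].
Proof.
move=> cF; rewrite (_ : mkset _ = F @^-1` `[a, b]); last by apply/seteqP; split=> z; rewrite /= in_itv.
by apply: preimage_closed => [z _|]; [exact: cF|exact: interval_closed].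
Qed.

End ReflectionGroup.

(** * Assembly, in positive dimension and in dimension zero *)

Definition translation_measure (R : realType) (N : nat) (Rs : seq 'rV[R]_N)
  (mu : 'rV[R]_N -> probability (RN R N) R) (x y : 'rV[R]_N) (rho : probability (RN R N) R) : Prop :=
    [/\ compact (supp rho), radial_measure rho,
        (forall f, smooth f -> radial_fun f ->
           (gen_transl mu f x y)%:E = (\int[rho]_z (f z)%:E)%E),
        (forall rho' : probability (RN R N) R,
           compact (supp rho') -> radial_measure rho' ->
           (forall f, smooth f -> radial_fun f ->
              (gen_transl mu f x y)%:E = (\int[rho']_z (f z)%:E)%E) ->
           forall A : set (RN R N), measurable A -> rho' A = rho A) &
        supp rho `<=` [set xi | exists g1 g2, [/\ refl_group Rs g1, refl_group Rs g2,
              enorm (x + y *m g1) <= enorm xi & enorm xi <= enorm (x + y *m g2)]]] /\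
        (supp rho 0 -> G_orbit Rs x = G_orbit Rs (- y)).

Section MainPositive.
Variables (R : realType) (N : nat).
Local Notation vec := 'rV[R]_N.
Local Notation RN := (RN R N).
Variables (Rs Rp : seq vec) (k : vec -> R) (V : (vec -> R) -> vec -> R).
Hypotheses (hRs : root_system Rs) (hRp : positive_subsystem Rs Rp) (hk : multiplicity Rs k)
  (hV : poly_intertwiner Rp k V).
Variable mu : vec -> probability RN R.
Hypothesis hmu : rosler_family Rs V mu.
Variables x y : vec.

Lemma translation_measure_pos : (0 < N)%N -> exists rho, translation_measure Rs mu x y rho.
Proof.
move=> hN; have [sg hsg] := @sphere_exists R N hN.
have x2 : Num.sqrt (dotv x x) ^+ 2 = dotv x x by rewrite sqr_sqrtr ?dotv_ge0.
have cmu : conc (mu x) (cball (Num.sqrt (dotv x x)) : set RN) by apply: (mu_conc hRs hmu); rewrite x2.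
have [Q [_ Qf Qc]] := radial_push hsg y cmu.
have cQ : conc Q (cball (Num.sqrt (dotv x x) + Num.sqrt (dotv y y)) : set RN).
  apply: (Qc _ _ cmu); first exact: closed_cball.
  move=> z u; rewrite /cball /sphere /= x2 dotv_scale2 => zx ->; rewrite mulr1.
  by rewrite lerXn2r ?nnegrE ?addr_ge0 ?sqrtr_ge0//; exact: gt_len_le.
have rQ : radial_measure Q by exact: (radial_push_radial hsg k cQ Qf).
have Qv f : smooth f -> radial_fun f -> (gen_transl mu f x y)%:E = (\int[Q]_z (f z)%:E)%E.
  move=> sf rf; have cf := smooth_continuous sf.
  pose v : vec := delta_mx ord0 (Ordinal hN).
  have v1 : dotv v v = 1 by rewrite dotv_delta mxE !eqxx.
  rewrite (gen_translE hRs hRp hk hV hN hmu x y sf rf v1).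
  rewrite -(radial_push_value hsg Qf cf rf v1) fineK//.
  have [B _ HB] := ball_bounded (Num.sqrt (dotv x x) + Num.sqrt (dotv y y)) cf.
  by apply: integrable_fin_num => //; exact: (conc_integrable cQ (RN_continuous cf) HB).
have sQ := conc_supp (@closed_cball R N _) cQ.
have kQ : compact (supp Q) by apply: (subclosed_compact _ (@compact_ball R N _) sQ); exact: supp_closed.
have [g1 [g2 [G1 G2 H12]]] := gt_len_hull hRs x y.
have shell : supp Q `<=` [set xi | enorm (x + y *m g1) <= enorm xi <= enorm (x + y *m g2)].
  have cE := @closed_shell R N (enorm (x + y *m g1)) (enorm (x + y *m g2)) _ (@continuous_enorm R N).
  apply: conc_supp => //.
  have cA := @closed_shell R N (enorm (x + y *m g1)) (enorm (x + y *m g2)) _ (@continuous_gt_len R N x y).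
  apply: (Qc [set z | enorm (x + y *m g1) <= gt_len x y z <= enorm (x + y *m g2)]).
  - by apply: supp_conc => // z /(hmu x).1 /H12.
  - exact: cE.
  - move=> z u /= zA u1; rewrite {2 3}/enorm dotv_scale2 u1 mulr1 sqrtr_sqr ger0_norm//.
    exact: sqrtr_ge0.
have shell0 : supp Q 0 -> G_orbit Rs x = G_orbit Rs (- y).
  move=> /shell /= /andP[h _]; apply: (G_orbit_opp hRs G1); apply: le_trans h _.
  by rewrite /enorm dotv0l sqrtr0.
exists Q; split=> //; split=> //; last by move=> z /shell /andP[h1 h2]; exists g1, g2.
move=> rho' k' r' H'.
have [r1 c1] := compact_supp_conc k'; have [r2 c2] := compact_supp_conc kQ.
(* Both measures have to be carried by one common ball before their moments can be compared. *)
have sub (a b : R) : cball a `<=` (cball (`|a| + `|b|) : set vec).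
  move=> z /= /le_trans; apply; rewrite -[a ^+ 2]real_normK ?num_real//.
  by rewrite lerXn2r ?nnegrE ?addr_ge0// lerDl.
have c1' := conc_subset (@closed_cball R N _) (@closed_cball R N _) (sub r1 r2) c1.
have := conc_subset (@closed_cball R N _) (@closed_cball R N _) (sub r2 r1) c2.
rewrite addrC => c2'.
apply: (radial_measure_unique hsg r' rQ c1' c2') => f sf rf.
by rewrite /Rintegral -Qv// -H'.
Qed.

End MainPositive.

Section MainZero.
Variables (R : realType).
Local Notation vec := 'rV[R]_0.
Local Notation RN := (RN R 0).
Variables (Rs : seq vec) (mu : vec -> probability RN R) (x y : vec).

(** The space is a single point: there is only one probability measure on it, [Vop] is the identity,
    and all distances vanish. This case is separate because the unit sphere is empty. *)
Lemma translation_measure_zero : exists rho, translation_measure Rs mu x y rho.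
Proof.
have e (a b : vec) : a = b by rewrite (thinmx0 a) (thinmx0 b).
have intE (P : probability RN R) (f : vec -> R) : (\int[P]_z (f z)%:E)%E = (f 0)%:E.
  rewrite (eq_integral (fun=> (f 0)%:E)); last by move=> z _; rewrite (e z 0).
  by rewrite integral_cst//= probability_setT mule1.
have VopE0 (f : vec -> R) : Vop mu f = f.
  by apply/funext => z; rewrite /Vop intE (e z 0).
exists (mu x); split; last by rewrite (e x (- y)).
split.
- have cS : closed (supp (mu x)) by exact: supp_closed.
  by apply: (subclosed_compact cS (@compact_ball R 0 1)) => z _; rewrite /= (e z 0) dotv0l expr1n.
- move=> O _ A _; congr (mu x _); apply/seteqP; split=> z /=; by rewrite (e (z *m O) z).
- move=> f sf rf; rewrite intE /gen_transl !VopE0; congr EFin.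
  rewrite (_ : Vinv mu f = f) ?(e (x + y) 0)//.
  rewrite /Vinv; case: xgetP => [g _ [_ <-]|/(_ f)]; first by rewrite VopE0.
  by move=> nf; exfalso; apply: nf; split=> //; exact: VopE0.
- move=> rho' _ _ _ A _.
  have [Az|nAz] := pselect (A 0).
    have -> : A = setT by apply/seteqP; split=> // z _; rewrite (e z 0).
    by apply: (etrans (probability_setT rho')); exact: esym (probability_setT (mu x)).
  have -> : A = set0 by rewrite -subset0 => z; rewrite (e z 0).
  by rewrite !measure0.
- move=> z _; exists 1%:M, 1%:M; split; [exact: rg_one|exact: rg_one| |].
    by rewrite (e (x + y *m 1%:M) z).
  by rewrite (e (x + y *m 1%:M) z).
Qed.

End MainZero.

Theorem mainTheorem9 (R : realType) (N : nat) (Rs Rp : seq 'rV[R]_N)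
  (k : 'rV[R]_N -> R) (V : ('rV[R]_N -> R) -> ('rV[R]_N -> R))
  (mu : 'rV[R]_N -> probability (RN R N) R) (x y : 'rV[R]_N) :
  root_system Rs -> positive_subsystem Rs Rp -> multiplicity Rs k ->
  poly_intertwiner Rp k V -> rosler_family Rs V mu ->
  exists rho : probability (RN R N) R,
    [/\ compact (supp rho), radial_measure rho,
        (forall f, smooth f -> radial_fun f ->
           (gen_transl mu f x y)%:E = (\int[rho]_z (f z)%:E)%E),
        (forall rho' : probability (RN R N) R,
           compact (supp rho') -> radial_measure rho' ->
           (forall f, smooth f -> radial_fun f ->
              (gen_transl mu f x y)%:E = (\int[rho']_z (f z)%:E)%E) ->
           forall A : set (RN R N), measurable A -> rho' A = rho A) &
        supp rho `<=` [set xi | exists g1 g2, [/\ refl_group Rs g1, refl_group Rs g2,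
              enorm (x + y *m g1) <= enorm xi & enorm xi <= enorm (x + y *m g2)]]] /\
        (supp rho 0 -> G_orbit Rs x = G_orbit Rs (- y)).
Proof.
move=> hRs hRp hk hV hmu; have [N0|N0] := posnP N.
  by subst N; exact: translation_measure_zero.
exact: (translation_measure_pos hRs hRp hk hV hmu x y N0).
Qed.
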